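(* (Anisotropic Reilly's identity.) If $\Omega\subset\mathbb{R}^{n+1}$ is a bounded open set with smooth boundary, $F$ is a smooth elliptic integrand on $\mathbb{S}^n$ and $u$ is the $F$-anisotropic torsion potential of $\Omega$, then $$\int_\Omega(\Delta_Fu)^2-\mathrm{tr}\big((\nabla(\nabla_Fu))^2\big)\,dx=\int_{\partial\Omega}H^F_\Omega\,F(\nabla u)^2\,F(\nu_\Omega)\,d\mathcal{H}^n .$$
   Context: Here $n\ge1$, $\mathcal{H}^n$ is $n$-dimensional Hausdorff measure and $\nu_\Omega$ is the outer unit normal to $\Omega$. A convex integrand is a function $F:\mathbb{S}^n\to(0,\infty)$ whose one-homogeneous extension to $\mathbb{R}^{n+1}$ (still denoted $F$) is convex. $F$ is a smooth elliptic integrand if moreover $F\in C^\infty(\mathbb{S}^n;(0,\infty))$ and there are constants $0<\lambda\le\Lambda<\infty$ such that $\lambda\,\mathrm{Id}\le\nabla^2F(\nu)\le\Lambda\,\mathrm{Id}$ on $\nu^\perp$ for every $\nu\in\mathbb{S}^n$ (derivatives of the one-homogeneous extension). Then $F^2/2\in C^{1,1}(\mathbb{R}^{n+1})\cap C^\infty(\mathbb{R}^{n+1}\setminus\{0\})$, with $\nabla(F^2/2)(0)=0$. The $F$-anisotropic torsion potential of $\Omega$ is the unique minimizer $u\in H^1_0(\Omega)$ of the strictly convex functional $\int_\Omega \frac{F^2(\nabla u)}{2}+u$; equivalently it is the distributional solution of $\Delta_Fu=1$ in $\Omega$, $u=0$ on $\partial\Omega$, where $\nabla_Fu=\nabla(F^2/2)(\nabla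 u)$ and $\Delta_Fu=\mathrm{div}(\nabla_Fu)$. By classical regularity, $u\in C^{1,\alpha}(\overline\Omega)\cap H^2(\Omega)$ for some $\alpha\in(0,1)$. The anisotropic mean curvature is $H^F_\Omega=\mathrm{div}^{\partial\Omega}(\nabla F\circ\nu_\Omega)=\mathrm{tr}(\nabla^2F(\nu_\Omega)\nabla\nu_\Omega)$ on $\partial\Omega$ ($\mathrm{div}^{\partial\Omega}$ tangential divergence, $\nabla\nu_\Omega$ second fundamental form with respect to $\nu_\Omega$). *)

(* Defs.v *)
From HB Require Import structures.
From mathcomp Require Import all_boot all_order all_algebra.
From mathcomp Require Import all_classical all_reals all_analysis.

Set Implicit Arguments.
Unset Strict Implicit.
Unset Printing Implicit Defensive.

Import Order.TTheory GRing.Theory Num.Theory.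
Import numFieldNormedType.Exports.

Local Open Scope classical_set_scope.
Local Open Scope ring_scope.

(* The library's norm on 'rV[R]_d is the sup norm: it induces the usual
   topology, differentiability and bounded sets, but everything metric below
   uses the Euclidean norm. *)
Section euclidean.
Context {R : realType} {d : nat}.
Local Notation E := 'rV[R]_d.

Definition dot (x y : E) : R := \sum_(i < d) x ord0 i * y ord0 i.

Definition enorm (x : E) : R := Num.sqrt (dot x x).

Definition partial (i : 'I_d) (f : E -> R) (x : E) : R :=
  'D_(delta_mx ord0 i) f x.

Definition grad (f : E -> R) (x : E) : E := \row_i partial i f x.

Definition hess (f : E -> R) (x : E) : 'M[R]_d :=
  \matrix_(i, j) partial i (partial j f) x.

(* Meant for open U. *)
Fixpoint Ck (k : nat) (U : set E) (f : E -> R) : Prop :=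
  match k with
  | 0 => forall x, U x -> {for x, continuous f}
  | k'.+1 => (forall x, U x -> differentiable f x) /\
             (forall i, Ck k' U (partial i f))
  end.

Definition smooth (U : set E) (f : E -> R) : Prop := forall k, Ck k U f.

Definition holder_on (alpha : R) (A : set E) (X : E -> E) : Prop :=
  exists C : R, forall x y, A x -> A y ->
    enorm (X x - X y) <= C * enorm (x - y) `^ alpha.

End euclidean.

(* T with the discrete sigma-algebra, so that covers in mu_ext are arbitrary. *)
Definition all_sets (T : Type) : Type := T.

Section all_sets.
Variable T : pointedType.
HB.instance Definition _ := Pointed.on (all_sets T).
HB.instance Definition _ := @isMeasurable.Build default_measure_display
  (all_sets T) setT I (fun _ _ => I) (fun _ _ => I).
End all_sets.

(* Outer measure generated by the gauge tau:
   inf of \sum_k tau (A k) over all countable covers (A k) of A. *)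
Definition method1 {R : realType} {T : pointedType} (tau : set T -> \bar R)
  (A : set T) : \bar R := mu_ext (tau : set (all_sets T) -> \bar R) A.

Section method1_theory.
Local Open Scope ereal_scope.
Context {R : realType} {T : pointedType} (tau : set T -> \bar R).
Hypothesis tau0 : tau set0 = 0.
Hypothesis tau_ge0 : forall A, 0 <= tau A.

Lemma method1_0 : method1 tau set0 = 0.
Proof. exact: (@mu_ext0 _ (all_sets T) R tau). Qed.

Lemma method1_ge0 A : 0 <= method1 tau A.
Proof. exact: (@mu_ext_ge0 _ (all_sets T) R tau). Qed.

Lemma le_method1 : {homo method1 tau : A B / A `<=` B >-> A <= B}.
Proof. exact: (@le_mu_ext _ (all_sets T) R tau). Qed.

Lemma method1_sigma_subadditive : sigma_subadditive (method1 tau).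
Proof. exact: (@mu_ext_sigma_subadditive _ (all_sets T) R tau). Qed.

End method1_theory.

(* The restriction of an outer measure to its Caratheodory sigma-algebra. *)
Definition caratheodory_measure {R : realType} {T : pointedType}
    (mu : {outer_measure set T -> \bar R}) :
    {measure set (caratheodory_type mu) -> \bar R} :=
  mu : set (caratheodory_type mu) -> \bar R.

Section lebesgue.
Local Open Scope ereal_scope.
Context {R : realType} (d : nat).
Local Notation E := 'rV[R]_d.

Definition box (a b : E) : set E :=
  [set x | forall i, (a ord0 i <= x ord0 i < b ord0 i)%R].

Definition box_gauge (A : set E) : \bar R :=
  if A == set0 then 0 else
  ereal_inf [set v | exists a b : E, [/\ forall i, (a ord0 i <= b ord0 i)%R,
    A = box a b & v = (\prod_(i < d) (b ord0 i - a ord0 i))%R%:E]].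

Lemma box_gauge0 : box_gauge set0 = 0.
Proof. by rewrite /box_gauge eqxx. Qed.

Lemma box_gauge_ge0 A : 0 <= box_gauge A.
Proof.
rewrite /box_gauge; case: ifP => // _.
apply: le_ereal_inf_tmp => _ [a [b [ab _ ->]]].
by rewrite lee_fin; apply: prodr_ge0 => i _; rewrite subr_ge0.
Qed.

Definition lebesgue_outer : set E -> \bar R := method1 box_gauge.

HB.instance Definition _ := isOuterMeasure.Build R E lebesgue_outer
  (method1_0 box_gauge0 box_gauge_ge0) (method1_ge0 box_gauge_ge0)
  (@le_method1 _ _ _) (method1_sigma_subadditive box_gauge_ge0).

Definition leb : {measure set (caratheodory_type lebesgue_outer) -> \bar R} :=
  caratheodory_measure lebesgue_outer.

End lebesgue.

Arguments leb {R} d.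

Section hausdorff.
Local Open Scope ereal_scope.
Context {R : realType} {d : nat} (s : nat).
Local Notation E := 'rV[R]_d.

Definition diam (A : set E) : \bar R :=
  ereal_sup [set r | exists x y, [/\ A x, A y & r = (enorm (x - y))%:E]].

(* Volume of the unit ball of R^s: with this factor the s-dimensional Hausdorff
   measure of R^s is Lebesgue measure. *)
Definition ball_volume : R :=
  fine (leb s [set x : 'rV[R]_s | (enorm x <= 1)%R]).

Definition hausdorff_gauge (delta : R) (A : set E) : \bar R :=
  if A == set0 then 0 else
  if diam A <= delta%:E then
    (ball_volume * (fine (diam A) / 2) ^+ s)%R%:E
  else +oo.

Lemma hausdorff_gauge0 delta : hausdorff_gauge delta set0 = 0.
Proof. by rewrite /hausdorff_gauge eqxx. Qed.

Lemma diam_ge0 A : A != set0 -> 0 <= diam A.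
Proof.
move=> /set0P[x Ax]; apply: le_ereal_sup_tmp; exists (enorm (x - x))%:E.
  by exists x, x.
by rewrite lee_fin sqrtr_ge0.
Qed.

Lemma hausdorff_gauge_ge0 delta A : 0 <= hausdorff_gauge delta A.
Proof.
rewrite /hausdorff_gauge; case: ifPn => // A0; case: ifP => // _.
rewrite lee_fin mulr_ge0 ?exprn_ge0 ?divr_ge0 ?fine_ge0 ?diam_ge0 //.
Qed.

Definition hausdorff_outer (A : set E) : \bar R :=
  ereal_sup [set method1 (hausdorff_gauge delta) A
            | delta in [set delta : R | (0 < delta)%R]].

Let approx_le delta A : (0 < delta)%R ->
  method1 (hausdorff_gauge delta) A <= hausdorff_outer A.
Proof. by move=> d0; apply: ereal_sup_ubound; exists delta. Qed.

Lemma hausdorff_outer_ge0 A : 0 <= hausdorff_outer A.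
Proof.
apply: le_trans (approx_le A ltr01).
exact: (method1_ge0 (hausdorff_gauge_ge0 1)).
Qed.

Lemma hausdorff_outer0 : hausdorff_outer set0 = 0.
Proof.
apply/eqP; rewrite eq_le hausdorff_outer_ge0 andbT.
apply: ge_ereal_sup => _ [delta _ <-].
by rewrite (method1_0 (hausdorff_gauge0 delta) (hausdorff_gauge_ge0 delta)).
Qed.

Lemma le_hausdorff_outer : {homo hausdorff_outer : A B / A `<=` B >-> A <= B}.
Proof.
move=> A B AB; apply: ge_ereal_sup => _ [delta d0 <-].
by apply: le_trans (approx_le B d0); exact: le_method1.
Qed.

Lemma hausdorff_outer_sigma_subadditive : sigma_subadditive hausdorff_outer.
Proof.
move=> F; apply: ge_ereal_sup => _ [delta d0 <-].
apply: le_trans (method1_sigma_subadditive (hausdorff_gauge_ge0 delta) F) _.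
apply: lee_nneseries => i *; last exact: approx_le.
exact: (method1_ge0 (hausdorff_gauge_ge0 delta)).
Qed.

HB.instance Definition _ := isOuterMeasure.Build R E hausdorff_outer
  hausdorff_outer0 hausdorff_outer_ge0 le_hausdorff_outer
  hausdorff_outer_sigma_subadditive.

Definition hausdorff :
    {measure set (caratheodory_type hausdorff_outer) -> \bar R} :=
  caratheodory_measure hausdorff_outer.

End hausdorff.

Arguments hausdorff {R} d s.

Section integrand.
Context {R : realType} {n : nat}.
Local Notation E := 'rV[R]_n.+1.

(* An integrand on the sphere is a function on E of which only the values at
   unit vectors are used. *)
Definition homext (F : E -> R) (x : E) : R :=
  enorm x * F ((enorm x)^-1 *: x).

Definition convex_integrand (F : E -> R) : Prop :=
  (forall nu, enorm nu = 1 -> 0 < F nu) /\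
  convex_function setT (homext F).

(* F is smooth on the sphere iff homext F is smooth away from the origin. *)
Definition smooth_elliptic_integrand (F : E -> R) : Prop :=
  [/\ convex_integrand F,
      smooth (~` [set 0]) (homext F) &
      exists l L : R, [/\ 0 < l, l <= L & forall nu tau : E,
        enorm nu = 1 -> dot nu tau = 0 ->
        l * dot tau tau <= dot (tau *m hess (homext F) nu) tau
                        <= L * dot tau tau]].

(* The field nabla_F u, given Du = nabla u. *)
Definition anisotropic_grad (F : E -> R) (Du : E -> E) (x : E) : E :=
  grad (fun p => homext F p ^+ 2 / 2) (Du x).

End integrand.

Section sobolev.
Context {R : realType} {d : nat}.
Local Notation E := 'rV[R]_d.
Implicit Types (Om : set E) (u : E -> R) (Du : E -> E).

Definition test_function Om (phi : E -> R) : Prop :=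
  smooth setT phi /\
  exists K : set E, [/\ compact K, K `<=` Om & forall x, ~ K x -> phi x = 0].

Definition loc_integrable Om (f : E -> R) : Prop :=
  forall K : set E, compact K -> K `<=` Om -> (leb d).-integrable K (EFin \o f).

Definition weak_partial Om (i : 'I_d) (f g : E -> R) : Prop :=
  [/\ loc_integrable Om f, loc_integrable Om g &
      forall phi, test_function Om phi ->
        \int[leb d]_(x in Om) (f x * partial i phi x) =
        - \int[leb d]_(x in Om) (g x * phi x)].

Definition weak_grad Om u Du : Prop :=
  forall i, weak_partial Om i u (fun x => Du x ord0 i).

(* (M x) i j is the i-th derivative of the j-th component of X. *)
Definition weak_jacobian Om (X : E -> E) (M : E -> 'M[R]_d) : Prop :=
  forall i j, weak_partial Om i (fun x => X x ord0 j) (fun x => M x i j).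

Definition L2 Om (f : E -> R) : Prop :=
  measurable_fun (Om : set (caratheodory_type (@lebesgue_outer R d))) f /\
  (leb d).-integrable Om (EFin \o (fun x => f x ^+ 2)).

(* u is in H^1(Om), with weak gradient Du; likewise for H^1_0 and H^2. *)
Definition sobolevH1 Om u Du : Prop :=
  [/\ L2 Om u, forall i, L2 Om (fun x => Du x ord0 i) & weak_grad Om u Du].

Definition sobolevH10 Om u Du : Prop :=
  sobolevH1 Om u Du /\
  exists phi : nat -> E -> R, (forall k, test_function Om (phi k)) /\
    (fun k => \int[leb d]_(x in Om) ((phi k x - u x) ^+ 2
      + enorm (grad (phi k) x - Du x) ^+ 2)%:E)%E @ \oo --> 0%E.

Definition sobolevH2 Om u Du : Prop :=
  sobolevH1 Om u Du /\ forall i, exists D2u, sobolevH1 Om (fun x => Du x ord0 i) D2u.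

End sobolev.

Section torsion.
Context {R : realType} {n : nat}.
Local Notation E := 'rV[R]_n.+1.

Definition torsion_energy (F : E -> R) (Om : set E) (u : E -> R)
  (Du : E -> E) : \bar R :=
  (\int[leb n.+1]_(x in Om) (homext F (Du x) ^+ 2 / 2 + u x)%:E)%E.

Definition torsion_potential (F : E -> R) (Om : set E) (u : E -> R)
  (Du : E -> E) : Prop :=
  sobolevH10 Om u Du /\
  forall v Dv, sobolevH10 Om v Dv ->
    (torsion_energy F Om u Du <= torsion_energy F Om v Dv)%E.

End torsion.

Section boundary.
Context {R : realType} {d : nat}.
Local Notation E := 'rV[R]_d.

Definition boundary (Om : set E) : set E := closure Om `\` Om^°.

Definition local_defining_function (Om : set E) (x : E) (U : set E)
    (phi : E -> R) : Prop :=
  [/\ open U /\ U x, smooth U phi, forall y, U y -> grad phi y != 0,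
      Om `&` U = [set y | phi y < 0] `&` U &
      boundary Om `&` U = [set y | phi y = 0] `&` U].

Definition smooth_boundary (Om : set E) : Prop :=
  forall x, boundary Om x -> exists U phi, local_defining_function Om x U phi.

Definition is_outer_normal (Om : set E) (x v : E) : Prop :=
  exists U phi, local_defining_function Om x U phi /\
    v = (enorm (grad phi x))^-1 *: grad phi x.

Definition outer_normal (Om : set E) (x : E) : E :=
  xget 0 [set v | is_outer_normal Om x v].

(* L represents (acting on row vectors on the right) the differential at x of
   the restriction of X to the boundary, extended by 0 in the normal
   direction. *)
Definition is_tangential_jacobian (Om : set E) (X : E -> E) (x : E)
    (L : 'M[R]_d) : Prop :=
  outer_normal Om x *m L = 0 /\
  forall e : R, 0 < e -> \forall y \near within (boundary Om) (nbhs x),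
    enorm (X y - X x - (y - x) *m L) <= e * enorm (y - x).

Definition tangential_div (Om : set E) (X : E -> E) (x : E) : R :=
  \tr (xget 0 [set L | is_tangential_jacobian Om X x L]).

End boundary.

Definition anisotropic_mean_curvature {R : realType} {n : nat}
    (F : 'rV[R]_n.+1 -> R) (Om : set 'rV[R]_n.+1) (x : 'rV[R]_n.+1) : R :=
  tangential_div Om (fun y => grad (homext F) (outer_normal Om y)) x.

(* Main.v *)
(** The vector field [X = ∇(F²/2)(Du)] equals [w N] on the boundary, where [N = ∇F(ν)] and
[w = F(Du)]: there [Du] is a nonnegative multiple of the outer normal [ν], because [u <= 0] vanishes
on the boundary, and this is tested against caps around exterior normal directions.  The quadratic
form [Q(A) = (tr A)² - tr (A²)] is a null Lagrangian, so the integral of [Q(DX)] only depends on the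
boundary values of [X] and may be computed with the extension [w N] instead, for which
[Q(D(w N)) = div (w² V)] with [V = N div N - (N·∇)N].  The divergence theorem and
[V·ν = F(ν) H] conclude.

The divergence theorem is localised by a partition of unity; near a boundary point the normal
derivative of a cutoff is integrated over thin collars, which straightening charts compare with
Hausdorff measure, normalised by the isodiametric inequality (a consequence of the
Hadwiger-Ohmann form of Brunn-Minkowski).  Weak derivatives are handled by mollification, seen as
the action of doubly stochastic kernels. *)
Require Import Defs.
From HB Require Import structures.
From mathcomp Require Import all_boot all_order all_algebra.
From mathcomp Require Import all_classical all_reals all_analysis.
From mathcomp Require Import measurable_realfun ring lra zify.
Set Implicit Arguments.
Unset Strict Implicit.
Unset Printing Implicit Defensive.
Import Order.TTheory GRing.Theory Num.Theory.
Import numFieldNormedType.Exports.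
Local Open Scope classical_set_scope.
Local Open Scope ring_scope.

(** Nothing is smooth enough for a direct computation: [Du] is only continuous up to the boundary,
    with square integrable weak derivatives, and the gradient of F²/2 is merely Lipschitz at the
    origin. The chain rule is therefore proved for smooth outer functions only, and [trunc], which
    erases the values near 0, serves twice: it removes the singularity at Du = 0, and it turns a
    function vanishing on the boundary into one of compact support, for which the null Lagrangian
    identity is the symmetry of second derivatives.

    The field wN must be weakly differentiable inside and known on the boundary. So N and a = ν/F(ν)
    are extended smoothly and w is the linear expression X·a; by Euler's relation it equals F(Du) on
    the boundary. Since Q(D(wN)) = div(w²V) with V smooth, the divergence theorem is required only
    for a continuous weakly differentiable function times a smooth field. It is proved as an
    inequality with an error [z] relative to the absolute flux, a form that survives localisation;
    the opposite field gives the converse. *)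

Notation Ritg mu D f := (mu.-integrable D (EFin \o f)) (only parsing).

Lemma half_lt (R : realFieldType) (r : R) (k : nat) : 0 < r -> r / k.+2%:R < r.
by move=> r0; rewrite ltr_pdivrMr // ltr_pMr // ltr1n. Qed.

Lemma frac_lt (R : realFieldType) (r : R) (m k : nat) : (m < k)%N -> 0 < r -> m%:R * (r / k%:R) < r.
by move=> mk r0; rewrite mulrCA gtr_pMr // ltr_pdivrMr ?mul1r ?ltr_nat // ltr0n (leq_ltn_trans _ mk).
Qed.

Lemma is_derive_continuous (R : realType) (f : R -> R) (t df : R) :
 is_derive t (1 : R) f df -> {for t, continuous f}.
by move=> h; apply: differentiable_continuous; apply/derivable1_diffP; case: h. Qed.

(** * Boxes, their covers and Lebesgue outer measure *)

Section rows.
Context {R : realType} {d : nat}.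

Definition rcons0 (t : R) (x : 'rV[R]_d) : 'rV[R]_d.+1 :=
 \row_j (if unlift ord0 j is Some i then x ord0 i else t).

Definition rtail (x : 'rV[R]_d.+1) : 'rV[R]_d := \row_i x ord0 (lift ord0 i).

Lemma rcons0_head t x : rcons0 t x ord0 ord0 = t.
by rewrite mxE unlift_none. Qed.

Lemma rcons0_lift t x i : rcons0 t x ord0 (lift ord0 i) = x ord0 i.
by rewrite mxE liftK. Qed.

Lemma rtail_cons t x : rtail (rcons0 t x) = x.
by apply/rowP => i; rewrite mxE rcons0_lift. Qed.

Lemma rcons0_eta (x : 'rV[R]_d.+1) : rcons0 (x ord0 ord0) (rtail x) = x.
apply/rowP => j; rewrite mxE; case: unliftP => [i ->|-> //].
by rewrite mxE.
Qed.

Lemma box_rcons0 (a b : 'rV[R]_d.+1) t x : box a b (rcons0 t x) <->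
 a ord0 ord0 <= t < b ord0 ord0 /\ box (rtail a) (rtail b) x.
split=> [h|[ht hx] j].
 split; first by have := h ord0; rewrite rcons0_head.
 by move=> i; have := h (lift ord0 i); rewrite rcons0_lift !mxE.
case: (unliftP ord0 j) => [i ->|->]; last by rewrite rcons0_head.
by rewrite rcons0_lift; have := hx i; rewrite !mxE.
Qed.

End rows.

Section volume.
Context {R : realType}.
Implicit Types d : nat.

Definition vol d (a b : 'rV[R]_d) : R := \prod_(i < d) (b ord0 i - a ord0 i).

Lemma vol_ge0 d (a b : 'rV[R]_d) : (forall i, a ord0 i <= b ord0 i) -> 0 <= vol a b.
by move=> ab; apply: prodr_ge0 => i; rewrite subr_ge0. Qed.

Lemma volS d (a b : 'rV[R]_d.+1) :
 vol a b = (b ord0 ord0 - a ord0 ord0) * vol (rtail a) (rtail b).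
by rewrite /vol big_ord_recl; congr (_ * _); apply: eq_bigr => i; rewrite !mxE. Qed.

(* Weights make the statement stable under slicing: fixing the first
  coordinate multiplies each weight by an indicator, and the estimate for the
  slices is then integrated over that coordinate. *)
Lemma vol_le_cover d (a b : 'rV[R]_d) (w : nat -> R) (l u : nat -> 'rV[R]_d) :
 (forall i, a ord0 i <= b ord0 i) -> (forall k, 0 <= w k) ->
 (forall k i, l k ord0 i <= u k ord0 i) ->
 (forall x, box a b x ->
   (1 <= \sum_(0 <= k <oo) (w k * \1_(box (l k) (u k)) x)%:E)%E) ->
 ((vol a b)%:E <= \sum_(0 <= k <oo) (w k * vol (l k) (u k))%:E)%E.
elim: d a b w l u => [|d IH] a b w l u ab w0 lu hc.
 rewrite /vol big_ord0.
 have hx : box a b (0 : 'rV[R]_0) by case.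
 apply: le_trans (hc _ hx) _; apply: lee_nneseries => [k _ _|k _].
  by rewrite lee_fin mulr_ge0.
 by rewrite big_ord0 lee_fin ler_wpM2l // indicE.
set a0 := a ord0 ord0; set b0 := b ord0 ord0.
pose I k := [set` `[l k ord0 ord0, u k ord0 ord0[%R].
pose V k := vol (rtail (l k)) (rtail (u k)).
have V0 k : 0 <= V k by apply: vol_ge0 => i; rewrite !mxE.
have slice t : (t \in `[a0, b0[)%R -> ((vol (rtail a) (rtail b))%:E <=
  \sum_(0 <= k <oo) (w k * \1_(I k) t * V k)%:E)%E.
 move=> ht; apply: IH => [i|k|k i|x hx]; rewrite ?mxE //.
  by rewrite mulr_ge0 //.
 have /hc : box a b (rcons0 t x) by apply/box_rcons0; split => //; move: ht; rewrite in_itv.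
 move=> /le_trans; apply; apply: lee_nneseries => [k _ _|k _].
  by rewrite lee_fin mulr_ge0.
 rewrite lee_fin -mulrA ler_wpM2l // !indicE.
 case: (boolP (_ \in box (l k) (u k))) => [|_]; last by rewrite mulr_ge0.
 rewrite inE => /box_rcons0 [h1 h2].
 by rewrite !mem_set // mulr1.
rewrite volS.
have -> : ((b0 - a0) * vol (rtail a) (rtail b))%:E =
  (\int[lebesgue_measure]_(t in [set` `[a0, b0[%R]) cst (vol (rtail a) (rtail b))%:E t)%E.
 rewrite integral_cst //= lebesgue_measure_itv lte_fin.
 case: ltP => h; first by rewrite mulrC.
 have -> : b0 = a0 by apply/eqP; rewrite eq_le h ab.
 by rewrite subrr mul0r mule0.
have mI k : measurable (I k : set (measurableTypeR R)) by exact: measurable_itv.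
have mf k : measurable_fun (setT : set (measurableTypeR R)) (EFin \o (fun t => w k * \1_(I k) t * V k)).
 apply/measurable_EFinP; apply: measurable_funM => //; apply: measurable_funM => //.
apply: (@le_trans _ _ (\int[lebesgue_measure]_(t in [set` `[a0, b0[%R])
  \sum_(0 <= k <oo) (w k * \1_(I k) t * V k)%:E)%E).
 apply: ge0_le_integral => //.
 - by move=> t _; apply: vol_ge0 => i; rewrite !mxE.
 - apply: (@ge0_emeasurable_sum _ _ _ _ _ predT) => [k t _ _|k _]; last exact: (measurable_funTS (mf k)).
  by rewrite lee_fin !mulr_ge0.
rewrite integral_nneseries //; last 2 first.
- by move=> k; exact: (measurable_funTS (mf k)).
- by move=> k t; rewrite lee_fin !mulr_ge0.
apply: lee_nneseries => [k _ _|k _].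
 by apply: integral_ge0 => t; rewrite lee_fin !mulr_ge0.
under eq_integral do rewrite mulrAC EFinM.
rewrite ge0_integralZl //; last 2 first.
- apply/measurable_EFinP; apply: measurable_funTS; exact: (@measurable_indic _ (measurableTypeR R) R setT _ (mI k)).
- by rewrite lee_fin mulr_ge0.
rewrite integral_indic //.
apply: (@le_trans _ _ ((w k * V k)%:E * lebesgue_measure (I k))%E).
 apply: lee_wpmul2l; first by rewrite lee_fin mulr_ge0.
 by apply: le_measure; rewrite ?inE //; exact: measurableI.
rewrite lebesgue_measure_itv volS -/(V k).
case: ltP => h; first by rewrite -EFinM -mulrA [V k * _]mulrC.
by rewrite mule0 lee_fin !mulr_ge0 // subr_ge0.
Qed.

End volume.

Section leb_theory.
Context {R : realType} {d : nat}.
Local Notation E := 'rV[R]_d.+1.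
Local Notation L := (@lebesgue_outer R d.+1).
Local Notation LT := (caratheodory_type L).

Lemma row_le_box_gauge (a b : E) : (forall i, a ord0 i <= b ord0 i) ->
 (box_gauge (box a b) <= (vol a b)%:E)%E.
move=> ab; rewrite /box_gauge; case: ifP => _; first by rewrite lee_fin vol_ge0.
by apply: ereal_inf_lbound; exists a, b.
Qed.

Lemma vol_box0 (a : E) : vol a a = 0.
by rewrite /vol big_ord_recl subrr mul0r. Qed.

(** A cover of finite total gauge consists of sets of finite gauge, and an infimum over no
    representation is infinite, so each of them is empty or a box. Half of [e] pays for the choice
    of the cover, the other half, split geometrically, for the endpoints chosen for each box. *)
Lemma leb_box_cover (A : set E) (e : R) : (L A < +oo)%E -> 0 < e ->
 exists l u : nat -> E, [/\ forall k i, l k ord0 i <= u k ord0 i,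
  A `<=` \bigcup_k box (l k) (u k) &
  (\sum_(0 <= k <oo) (vol (l k) (u k))%:E <= L A + e%:E)%E].
move=> Aoo e0.
have e20 : 0 < e / 2 by lra.
have Afin : L A \is a fin_num by rewrite ge0_fin_numE //; exact: outer_measure_ge0.
have [_ [B [_ AB <-]] hB0] := lb_ereal_inf_adherent e20 Afin.
have hB : (\sum_(0 <= k <oo) box_gauge (B k : set E) < L A + (e / 2)%:E)%E := hB0.
have gB k : (box_gauge (B k : set E) < +oo)%E.
 have h : (\sum_(0 <= k <oo) box_gauge (B k : set E) < +oo)%E.
  by apply: lt_trans hB _; rewrite -(fineK Afin) ltry.
 rewrite ltNge leye_eq; apply/negP => /eqP kB.
 move: h; rewrite (@nneseriesD1 _ _ k) //; last by move=> *; exact: box_gauge_ge0.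
 by rewrite kB addye // -ltNye (lt_le_trans ltNy0) // nneseries_ge0 // => *; exact: box_gauge_ge0.
have H k : exists p : E * E, [/\ forall i, p.1 ord0 i <= p.2 ord0 i,
  B k `<=` box p.1 p.2 &
  ((vol p.1 p.2)%:E <= box_gauge (B k : set E) + (e / 2 / (2 ^ k.+1)%:R)%:E)%E].
 have ek : 0 < e / 2 / (2 ^ k.+1)%:R by rewrite divr_gt0 // ltr0n.
 have := gB k; rewrite /box_gauge; case: eqP => [-> _|_ hk].
  by exists (0, 0); split=> //=; rewrite vol_box0 add0e ltW.
 set S := (X in ereal_inf X) in hk.
 have fS : ereal_inf S \is a fin_num.
  rewrite ge0_fin_numE //; apply: le_ereal_inf_tmp => _ [a [b [ab _ ->]]].
  by rewrite lee_fin vol_ge0.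
 have [_ [a [b [ab Bk ->]]] h] := lb_ereal_inf_adherent ek fS.
 by exists (a, b); split=> //=; [rewrite Bk|exact: ltW].
have [p hp] := choice H.
exists (fun k => (p k).1), (fun k => (p k).2); split.
- by move=> k; have [] := hp k.
- by move=> x /AB [k _ /= Bx]; exists k => //; have [_ + _] := hp k; exact.
apply: (@le_trans _ _ (\sum_(0 <= k <oo) (box_gauge (B k : set E) + (e / 2 / (2 ^ k.+1)%:R)%:E))%E).
 apply: lee_nneseries => [k _ _|k _]; last by have [] := hp k.
 by rewrite lee_fin vol_ge0; have [] := hp k.
apply: le_trans (epsilon_trick _ _ _) _ => //; [by move=> k; exact: box_gauge_ge0|exact: ltW|].
rewrite [in leRHS](splitr e) EFinD addeA; apply: leeD2r.
exact: ltW.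
Qed.

Lemma leb_le_cover (A : set E) (l u : nat -> E) :
 (forall k i, l k ord0 i <= u k ord0 i) -> A `<=` \bigcup_k box (l k) (u k) ->
 (L A <= \sum_(0 <= k <oo) (vol (l k) (u k))%:E)%E.
move=> lu Ac.
apply: (@le_trans _ _ (\sum_(0 <= k <oo) box_gauge (box (l k) (u k)))%E).
 by apply: ereal_inf_lbound; exists (fun k => box (l k) (u k)) => //.
apply: lee_nneseries => [k _ _|k _]; [exact: box_gauge_ge0|exact: row_le_box_gauge].
Qed.

Lemma leb_box_le (a b : E) : (forall i, a ord0 i <= b ord0 i) ->
 (L (box a b) <= (vol a b)%:E)%E.
move=> ab.
apply: le_trans (@leb_le_cover _ (fun k => if k is 0 then a else 0) (fun k => if k is 0 then b else 0) _ _) _.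
- by case.
- by exists 0%N.
rewrite (@nneseriesD1 _ _ 0%N) //=; last by case=> *; rewrite lee_fin vol_ge0.
rewrite eseries0 ?adde0 // => -[|k] //=.
by rewrite vol_box0.
Qed.

(** The lower bound is [vol_le_cover] with all weights equal to one, applied to a nearly optimal
    cover. *)
Lemma leb_box (a b : E) : (forall i, a ord0 i <= b ord0 i) ->
 L (box a b) = (vol a b)%:E.
move=> ab; apply/eqP; rewrite eq_le leb_box_le //=.
apply/lee_addgt0Pr => e e0.
have [|l [u [lu Ac hs]]] := @leb_box_cover (box a b) e _ e0.
 by apply: le_lt_trans (leb_box_le ab) _; rewrite ltry.
apply: le_trans hs.
under eq_eseriesr do rewrite -[X in X%:E]mul1r.
apply: vol_le_cover => // x /Ac [k _ hk].
rewrite (@nneseriesD1 _ _ k) //.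
rewrite mul1r indicE mem_set // -[leLHS]adde0 leeD2l //.
by apply: nneseries_ge0 => *.
Qed.

Definition rupd (x : E) (i : 'I_d.+1) (c : R) : E :=
 \row_j (if j == i then c else x ord0 j).

Lemma vol_split (a b : E) i m : vol a (rupd b i m) + vol (rupd a i m) b = vol a b.
rewrite /vol (bigD1 i) //= [X in _ + X](bigD1 i) //= [RHS](bigD1 i) //= !mxE eqxx.
have -> : \prod_(j < d.+1 | j != i) (rupd b i m ord0 j - a ord0 j) =
 \prod_(j < d.+1 | j != i) (b ord0 j - a ord0 j).
 by apply: eq_bigr => j /negbTE ji; rewrite mxE ji.
have -> : \prod_(j < d.+1 | j != i) (b ord0 j - rupd a i m ord0 j) =
 \prod_(j < d.+1 | j != i) (b ord0 j - a ord0 j).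
 by apply: eq_bigr => j /negbTE ji; rewrite mxE ji.
by ring.
Qed.

(** Each box of a nearly optimal cover of [X] is cut by the hyperplane into two boxes whose volumes
    add up, and the two families of halves cover the two parts of [X]. *)
Lemma halfspace_caratheodory (i : 'I_d.+1) (c : R) :
 L.-caratheodory [set x | x ord0 i < c].
apply: le_caratheodory_measurable => X.
have [XE|] := eqVneq (L X) +oo%E; first by rewrite [leRHS](XE : _ = _) leey.
rewrite -ltey => Xoo; apply/lee_addgt0Pr => e e0.
have [l [u [lu Xc hs]]] := leb_box_cover Xoo e0.
apply: le_trans hs.
(* Clamping [c] between the two endpoints keeps both halves ordered when the hyperplane misses the
   box; one of them is then degenerate. *)
pose m k := Num.max (l k ord0 i) (Num.min (u k ord0 i) c).
have lm k : l k ord0 i <= m k by rewrite le_max lexx.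
have mu k : m k <= u k ord0 i by rewrite ge_max lu ge_min lexx.
have h1 k j : l k ord0 j <= rupd (u k) i (m k) ord0 j.
 by rewrite mxE; case: eqP => [->|].
have h2 k j : rupd (l k) i (m k) ord0 j <= u k ord0 j.
 by rewrite mxE; case: eqP => [->|].
rewrite -(@eq_eseriesr _ (fun k => (vol (l k) (rupd (u k) i (m k)))%:E + (vol (rupd (l k) i (m k)) (u k))%:E)%E); last first.
 by move=> k; rewrite -EFinD vol_split.
rewrite nneseriesD; last first.
- by move=> k; rewrite lee_fin vol_ge0.
- by move=> k; rewrite lee_fin vol_ge0.
apply: leeD; apply: leb_le_cover => // x [/Xc [k _ hk] /= hx]; exists k => // j; rewrite mxE.
 case: eqP => [->|_]; last exact: hk.
 by have /andP[-> h] := hk i; rewrite lt_max lt_min h hx orbT.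
case: eqP => [->|_]; last exact: hk.
have := hk i; rewrite ge_max ge_min.
lra.
Qed.

Definition cube (p : R) (z : 'I_d.+1 -> int) : set E :=
 box (\row_i ((z i)%:~R * p)) (\row_i (((z i)%:~R + 1) * p)).

Definition grid (p : R) (x : E) : 'I_d.+1 -> int := fun i => Num.floor (x ord0 i / p).

Lemma cube_grid (p : R) (x : E) (z : 'I_d.+1 -> int) : 0 < p ->
 cube p z x <-> z = grid p x.
split.
 move=> h; apply/funext => i; have := h i; rewrite !mxE => /andP[h1 h2].
 by apply/esym/floor_def; rewrite intrD ler_pdivlMr // ltr_pdivrMr // h1.
move=> -> i; rewrite !mxE -ler_pdivlMr // -ltr_pdivrMr //.
by have := floor_itv (x ord0 i / p); rewrite intrD.
Qed.

Lemma cube_trivIset (p : R) : 0 < p -> trivIset [set: {ffun 'I_d.+1 -> int}] (fun z => cube p z).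
move=> p0; apply/trivIsetP => z w _ _ zw; rewrite -subset0 => x [].
move=> /(cube_grid _ _ p0) h1 /(cube_grid _ _ p0) h2.
by move/eqP: zw; apply; apply/ffunP => i; rewrite h1 h2.
Qed.

Lemma cube_dist (p : R) (z : 'I_d.+1 -> int) (x y : E) : 0 < p -> cube p z x -> cube p z y ->
 ball x p y.
move=> p0 hx hy; split=> // i j; rewrite (ord1 i) /ball /=.
have := hx j; have := hy j; rewrite !mxE ltr_norml.
by lra.
Qed.

Section halfspace_measurable.
Variable mu : {outer_measure set E -> \bar R}.
Hypothesis halfspaces : forall (i : 'I_d.+1) (c : R), mu.-caratheodory [set x | x ord0 i < c].
Local Notation MT := (caratheodory_type mu).

Lemma box_caratheodory (a b : E) : measurable (box a b : set MT).
have -> : box a b = \bigcap_(i in [set: 'I_d.+1])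
  ([set x : E | x ord0 i < b ord0 i] `&` ~` [set x | x ord0 i < a ord0 i]).
 apply/seteqP; split=> x.
  by move=> h i; have /andP[h1 h2] := h i; split=> //=; rewrite ltNge h1.
 by move=> h i; have [/= -> /negP] := h i I; rewrite -leNgt => ->.
apply: fin_bigcap_measurable => // i _.
apply: caratheodory_measurable_setI; first exact: halfspaces.
by apply: caratheodory_measurable_setC.
Qed.

(** An open set is the union of the grid cubes of side 1/(k+1) that it contains, a countable family.
    Only half-spaces are asked to be measurable, so that the argument serves Lebesgue and Hausdorff
    outer measures alike. *)
Lemma open_caratheodory (U : set E) : open U -> measurable (U : set MT).
move=> oU.
pose F (w : nat * {ffun 'I_d.+1 -> int}) : set MT :=
 if `[< cube w.1.+1%:R^-1 w.2 `<=` U >] then cube w.1.+1%:R^-1 w.2 else set0.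
have -> : U = \bigcup_w F w.
 apply/seteqP; split=> x; last first.
  by move=> [w _]; rewrite /F; case: asboolP => +; exact.
 move=> Ux; have /nbhs_ballP[r /= r0 hr] : nbhs x U by exact: open_nbhs_nbhs.
 have [k _ hk] := near_infty_natSinv_lt (PosNum r0).
 have k0 : (0 : R) < k.+1%:R^-1 by [].
 exists (k, [ffun i => grid k.+1%:R^-1 x i]) => //=.
 have hx : cube k.+1%:R^-1 [ffun i => grid k.+1%:R^-1 x i] x.
  by apply/cube_grid => //; apply/funext => i; rewrite ffunE.
 rewrite /F asboolT // => y hy; apply: hr.
 apply: le_ball (cube_dist k0 hx hy); apply: ltW; exact: (hk k (leqnn k)).
apply: countable_bigcupT_measurable => // w.
by rewrite /F; case: ifP => _; [exact: box_caratheodory|exact: measurable0].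
Qed.

End halfspace_measurable.

Lemma box_measurable (a b : E) : measurable (box a b : set LT).
by apply: box_caratheodory; exact: halfspace_caratheodory. Qed.

Lemma open_leb (U : set E) : open U -> measurable (U : set LT).
by apply: open_caratheodory; exact: halfspace_caratheodory. Qed.

End leb_theory.

(** * The Euclidean norm and the topology it induces *)

Section euclid.
Context {R : realType}.
Implicit Types d : nat.

Lemma dotC d (x y : 'rV[R]_d) : dot x y = dot y x.
by apply: eq_bigr => i; rewrite mulrC. Qed.

Lemma dotDl d (x y z : 'rV[R]_d) : dot (x + y) z = dot x z + dot y z.
by rewrite -big_split; apply: eq_bigr => i; rewrite mxE mulrDl. Qed.

Lemma dotDr d (x y z : 'rV[R]_d) : dot x (y + z) = dot x y + dot x z.
by rewrite dotC dotDl !(dotC x). Qed.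

Lemma dotZl d c (x y : 'rV[R]_d) : dot (c *: x) y = c * dot x y.
by rewrite mulr_sumr; apply: eq_bigr => i; rewrite mxE mulrA. Qed.

Lemma dotZr d c (x y : 'rV[R]_d) : dot x (c *: y) = c * dot x y.
by rewrite dotC dotZl dotC. Qed.

Lemma dotNl d (x y : 'rV[R]_d) : dot (- x) y = - dot x y.
by rewrite -scaleN1r dotZl mulN1r. Qed.

Lemma dotNr d (x y : 'rV[R]_d) : dot x (- y) = - dot x y.
by rewrite dotC dotNl dotC. Qed.

Lemma dot0l d (x : 'rV[R]_d) : dot 0 x = 0.
by rewrite -(scale0r x) dotZl mul0r. Qed.

Lemma dot_ge0 d (x : 'rV[R]_d) : 0 <= dot x x.
by apply: sumr_ge0 => i; rewrite sqr_ge0. Qed.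

Lemma enorm_ge0 d (x : 'rV[R]_d) : 0 <= enorm x. Proof. exact: sqrtr_ge0. Qed.

Lemma enorm_sqr d (x : 'rV[R]_d) : enorm x ^+ 2 = dot x x.
by rewrite sqr_sqrtr // dot_ge0. Qed.

Lemma coord_le_enorm d (x : 'rV[R]_d) i : `|x ord0 i| <= enorm x.
rewrite -sqrtr_sqr ler_wsqrtr // /dot (bigD1 i) //= lerDl.
by apply: sumr_ge0 => j; rewrite sqr_ge0.
Qed.

Lemma enorm_eq0 d (x : 'rV[R]_d) : (enorm x == 0) = (x == 0).
apply/eqP/eqP => [h|->]; last by rewrite /enorm dot0l sqrtr0.
apply/rowP => i; rewrite mxE; apply/eqP; rewrite -normr_le0 -h.
exact: coord_le_enorm.
Qed.

Lemma enorm0 d : enorm (0 : 'rV[R]_d) = 0.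
by apply/eqP; rewrite enorm_eq0. Qed.

Lemma enorm_gt0 d (x : 'rV[R]_d) : (0 < enorm x) = (x != 0).
by rewrite lt0r enorm_eq0 enorm_ge0 andbT. Qed.

Lemma enormZ d c (x : 'rV[R]_d) : enorm (c *: x) = `|c| * enorm x.
by rewrite /enorm dotZl dotZr mulrA sqrtrM ?sqr_ge0 // sqrtr_sqr. Qed.

Lemma enormN d (x : 'rV[R]_d) : enorm (- x) = enorm x.
by rewrite -scaleN1r enormZ normrN1 mul1r. Qed.

Lemma enormB d (x y : 'rV[R]_d) : enorm (x - y) = enorm (y - x).
by rewrite -enormN opprB. Qed.

Lemma dot_le_enorm d (x y : 'rV[R]_d) : dot x y <= enorm x * enorm y.
have [->|x0] := eqVneq x 0; first by rewrite dot0l enorm0 mul0r.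
have [->|y0] := eqVneq y 0; first by rewrite dotC dot0l enorm0 mulr0.
have a0 : 0 < enorm x by rewrite enorm_gt0.
have b0 : 0 < enorm y by rewrite enorm_gt0.
have := dot_ge0 (enorm y *: x - enorm x *: y).
rewrite !(dotDl, dotDr, dotNl, dotNr, dotZl, dotZr) -!enorm_sqr (dotC y x).
move: (enorm x) (enorm y) (dot x y) a0 b0 => a b c a0 b0 h.
have : 0 <= (a * b) * (2 * (a * b - c)) by nra.
by rewrite pmulr_rge0 ?mulr_gt0 // pmulr_rge0 // subr_ge0.
Qed.

Lemma norm_dot_le d (x y : 'rV[R]_d) : `|dot x y| <= enorm x * enorm y.
by rewrite ler_norml dot_le_enorm lerNl -dotNl (le_trans (dot_le_enorm _ _)) // enormN.
Qed.

Lemma ler_enormD d (x y : 'rV[R]_d) : enorm (x + y) <= enorm x + enorm y.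
rewrite -(@ler_pXn2r _ 2) ?nnegrE ?addr_ge0 ?enorm_ge0 //.
rewrite enorm_sqr !(dotDl, dotDr) sqrrD !enorm_sqr (dotC y x).
by have := dot_le_enorm x y; lra.
Qed.

Lemma ler_enorm_dist d (x y : 'rV[R]_d) : `|enorm x - enorm y| <= enorm (x - y).
have h a b : enorm a - enorm b <= enorm (a - b) :> R.
 by rewrite lerBlDr (le_trans _ (ler_enormD _ _)) // subrK.
by rewrite ler_norml h andbT lerNl opprB enormB.
Qed.

Lemma enorm_le_coord d (x : 'rV[R]_d) (r : R) :
 (forall i, `|x ord0 i| <= r) -> enorm x <= d%:R * r.
move=> h; rewrite -(@ler_pXn2r _ 2) ?nnegrE ?enorm_ge0 //; last first.
 case: d x h => [|d] x h; first by rewrite mul0r.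
 by rewrite mulr_ge0 // (le_trans _ (h ord0)).
rewrite enorm_sqr exprMn.
apply: (@le_trans _ _ (\sum_(i < d) r ^+ 2)).
 apply: ler_sum => i; rewrite -expr2 -real_normK ?num_real //.
 by rewrite ler_pXn2r // nnegrE (le_trans _ (h i)).
rewrite sumr_const card_ord -[leLHS]mulr_natl ler_wpM2r ?sqr_ge0 //.
by rewrite -natrX ler_nat; case: d {x h} => // d; rewrite leq_pmulr.
Qed.

Lemma ball_enorm d (x y : 'rV[R]_d) (r : R) : enorm (x - y) < r -> ball x r y.
move=> h; split=> [|i j]; first exact: le_lt_trans (enorm_ge0 _) h.
rewrite (ord1 i); apply: le_lt_trans h.
by rewrite (le_trans _ (coord_le_enorm _ j)) // !mxE.
Qed.

Lemma enorm_ball d (x y : 'rV[R]_d) (r : R) : ball x r y -> enorm (x - y) <= d%:R * r.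
by move=> [_ h]; apply: enorm_le_coord => i; rewrite !mxE; apply: ltW; exact: (h ord0 i). Qed.

Lemma nbhs_enormP d (x : 'rV[R]_d) (A : set 'rV[R]_d) :
 nbhs x A <-> exists2 r, 0 < r & forall y, enorm (y - x) < r -> A y.
split=> [/nbhs_ballP[r /= r0 hr]|[r r0 hr]].
 by exists r => // y h; apply: hr; apply: ball_enorm; rewrite enormB.
(* Dividing by [d.+1] instead of [d] covers dimension zero and makes the resulting Euclidean bound
   strict. *)
apply/nbhs_ballP; exists (r / d.+1%:R) => /=; first by rewrite divr_gt0.
move=> y /enorm_ball h; apply: hr; rewrite enormB (le_lt_trans h) //.
rewrite mulrA ltr_pdivrMr // mulrC ltr_pM2l // ltr_nat //.
Qed.

Lemma open_enorm d (x : 'rV[R]_d) U : open U -> U x ->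
 exists2 r, 0 < r & forall y, enorm (y - x) < r -> U y.
by move=> oU Ux; exact/nbhs_enormP/open_nbhs_nbhs. Qed.

Lemma cont_enormP d (f : 'rV[R]_d -> R) (x : 'rV[R]_d) :
 {for x, continuous f} <-> forall e, 0 < e -> exists2 r, 0 < r &
  forall y, enorm (y - x) < r -> `|f x - f y| < e.
have := @cvgrPdist_lt R R 'rV[R]_d (nbhs x).
split=> [/H h e e0|h]; first exact/nbhs_enormP/h.
by apply/H => e e0; apply/nbhs_enormP; exact: h.
Qed.

Lemma enorm_continuous d : continuous (@enorm R d).
move=> x; apply/cont_enormP => e; exists e => // y hy.
by rewrite (le_lt_trans (ler_enorm_dist _ _)) // enormB.
Qed.

End euclid.

(** * Scaling, translation and the volume of balls *)

Section scaling.
Context {R : realType} {d : nat}.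
Local Notation E := 'rV[R]_d.+1.
Local Notation L := (@lebesgue_outer R d.+1).
Local Notation LT := (caratheodory_type L).

Lemma leb_affine_le (v : E) (c : R) (A : set E) : 0 < c ->
 (L [set v + c *: x | x in A]%R <= (c ^+ d.+1)%:E * L A)%E.
move=> c0; have [->|] := eqVneq (L A) +oo%E.
 by rewrite gt0_muley ?leey // lte_fin exprn_gt0.
rewrite -ltey => Aoo; apply/lee_addgt0Pr => e e0.
have e0' : 0 < e / c ^+ d.+1 by rewrite divr_gt0 // exprn_gt0.
have [l [u [lu Ac hs]]] := leb_box_cover Aoo e0'.
apply: (@le_trans _ _ ((c ^+ d.+1)%:E * (L A + (e / c ^+ d.+1)%:E)))%E; last first.
 rewrite ge0_muleDr; [|exact: outer_measure_ge0|by rewrite lee_fin ltW].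
 by rewrite -EFinM mulrCA divff ?mulr1 // expf_neq0 // gt_eqF.
apply: le_trans (lee_wpmul2l _ hs); last by rewrite lee_fin exprn_ge0 // ltW.
rewrite -nneseriesZl; last by move=> *; rewrite lee_fin vol_ge0.
apply: le_trans (@leb_le_cover _ _ _ (fun k => v + c *: l k) (fun k => v + c *: u k) _ _) _.
- by move=> k i; rewrite !mxE lerD2l ler_pM2l.
- move=> _ [x /Ac [k _ hk] <-]; exists k => // i; rewrite !mxE.
 by rewrite lerD2l ltrD2l ler_pM2l // ltr_pM2l.
- apply: lee_nneseries => [k _ _|k _].
  by rewrite lee_fin vol_ge0 // => i; rewrite !mxE lerD2l ler_pM2l.
 rewrite /vol.
 rewrite (eq_bigr (fun i => c * (u k ord0 i - l k ord0 i))); last first.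
  by move=> i _; rewrite !mxE; ring.
 by rewrite big_split prodr_const card_ord.
Qed.

(** The reverse inequality is [leb_affine_le] for the inverse affine map. *)
Lemma leb_affine (v : E) (c : R) (A : set E) : 0 < c ->
 (L [set v + c *: x | x in A]%R = (c ^+ d.+1)%:E * L A)%E.
move=> c0; apply/eqP; rewrite eq_le leb_affine_le //=.
have ci0 : 0 < c^-1 by rewrite invr_gt0.
have := leb_affine_le (- (c^-1 *: v)) [set v + c *: x | x in A] ci0.
have -> : [set - (c^-1 *: v) + c^-1 *: x | x in [set v + c *: x | x in A]] = A.
 have K x : - (c^-1 *: v) + c^-1 *: (v + c *: x) = x.
  by rewrite scalerDr scalerA mulVf ?gt_eqF // scale1r addKr.
 apply/seteqP; split=> [_ [_ [x Ax <-] <-]|x Ax]; first by rewrite K.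
 by exists (v + c *: x) => //; exists x.
have cd0 : (0 <= (c ^+ d.+1)%:E)%E by rewrite lee_fin exprn_ge0 // ltW.
move=> /(lee_wpmul2l cd0)/le_trans; apply.
by rewrite muleA -EFinM -exprMn divff ?gt_eqF // expr1n mul1e.
Qed.

Lemma leb_translate (v : E) (A : set E) : L [set v + x | x in A] = L A.
rewrite -[RHS]mul1e -(expr1n _ d.+1) -(leb_affine v _ ltr01); congr L.
by apply: eq_imagel => x; rewrite scale1r.
Qed.

Lemma bounded_leb (A : set E) (r : R) : (forall x, A x -> enorm x <= r) -> (L A < +oo)%E.
move=> h.
have r0 : 0 <= Num.max r 0 by rewrite le_max lexx orbT.
apply: (@le_lt_trans _ _ (L (box (const_mx (- Num.max r 0)) (const_mx (Num.max r 0 + 1))))).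
 apply: le_outer_measure => x /h hx i; rewrite !mxE.
 have := coord_le_enorm x i; have : r <= Num.max r 0 by rewrite le_max lexx.
 by rewrite ler_norml; lra.
by rewrite leb_box ?ltry // => i; rewrite !mxE; lra.
Qed.

Definition eball (x : E) (r : R) : set E := [set y | enorm (y - x) <= r].

Lemma eball_closed x r : closed (eball x r).
have -> : eball x r = (fun y => enorm (y - x)) @^-1` [set t | t <= r] by [].
apply: closed_comp; last exact: closed_le.
move=> y _; apply/cont_enormP => e; exists e => // z hz.
rewrite (le_lt_trans (ler_enorm_dist _ _)) // enormB.
by have -> : z - x - (y - x) = z - y by rewrite opprB addrA subrK.
Qed.

Lemma eball_measurable x r : measurable (eball x r : set LT).
rewrite -[eball x r]setCK; apply: measurableC; apply: open_leb.
exact/closed_openC/eball_closed.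
Qed.

Local Notation om := (@ball_volume R d.+1).

Lemma eball_unit : L (eball 0 1) = om%:E.
rewrite /ball_volume.
have -> : [set x : E | enorm x <= 1] = eball 0 1.
 by apply/seteqP; split=> x; rewrite /eball /= subr0.
rewrite fineK // ge0_fin_numE; last exact: outer_measure_ge0.
by apply: (@bounded_leb _ 1) => x; rewrite /eball /= subr0.
Qed.

Lemma leb_eball x r : 0 < r -> L (eball x r) = (om * r ^+ d.+1)%:E.
move=> r0; rewrite mulrC EFinM -eball_unit -(leb_affine x _ r0); congr L.
apply/seteqP; split=> [y hy|_ [y hy <-]]; rewrite /eball /= ?subr0 in hy *.
 exists (r^-1 *: (y - x)); last by rewrite scalerA divff ?gt_eqF // scale1r addrC subrK.
 by rewrite subr0 enormZ gtr0_norm ?invr_gt0 // mulrC ler_pdivrMr // mul1r.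
by rewrite addrC addKr enormZ gtr0_norm // ger_pMr.
Qed.

Lemma ball_volume_gt0 : 0 < om.
rewrite -lte_fin -eball_unit.
apply: (@lt_le_trans _ _ (L (box 0 (const_mx d.+1%:R^-1)))).
 rewrite leb_box => [|i]; last by rewrite !mxE.
 by rewrite lte_fin prodr_gt0 // => i; rewrite !mxE.
apply: le_outer_measure => x hx; rewrite /eball /= subr0.
apply: le_trans (@enorm_le_coord _ _ _ d.+1%:R^-1 _) _; last by rewrite divff.
by move=> i; have := hx i; rewrite !mxE => /andP[h1 h2]; rewrite ger0_norm // ltW.
Qed.

End scaling.

(** * Brunn-Minkowski inequality for finite unions of boxes *)

Section brunn_minkowski.
Context {R : realType} {d : nat}.
Local Notation E := 'rV[R]_d.+1.
Local Notation L := (@lebesgue_outer R d.+1).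
Implicit Types (s t : seq (E * E)) (p q : E * E) (i : 'I_d.+1) (c : R).

Definition bpos p := [forall i, p.1 ord0 i < p.2 ord0 i].
(** For boxes, having disjoint interiors means being separated by a coordinate hyperplane; that
    hyperplane is where the list will be cut. *)
Definition bsep p q :=
 [exists i, (p.2 ord0 i <= q.1 ord0 i) || (q.2 ord0 i <= p.1 ord0 i)].
Definition bvol s : R := \sum_(p <- s) vol p.1 p.2.

Definition cutm p i c := Num.max (p.1 ord0 i) (Num.min (p.2 ord0 i) c).
Definition blo i c p := (p.1, rupd p.2 i (Num.min (p.2 ord0 i) c)).
Definition bup i c p := (rupd p.1 i (Num.max (p.1 ord0 i) c), p.2).
Definition lo i c s := [seq blo i c p | p <- s & p.1 ord0 i < c].
Definition up i c s := [seq bup i c p | p <- s & c < p.2 ord0 i].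

(** Here the boxes above the cut stay in the sum as degenerate ones, whereas [lo] drops them. The
    volume is the same, but in this form it is visibly continuous in [c], as the intermediate value
    theorem demands. *)
Definition lovol i c s := \sum_(p <- s) vol p.1 (rupd p.2 i (cutm p i c)).

Lemma bvol_gt0 s : all bpos s -> s != [::] -> 0 < bvol s.
have h p : bpos p -> 0 < vol p.1 p.2.
 by move=> /forallP hp; apply: prodr_gt0 => i; rewrite subr_gt0.
case: s => // p s /andP[hp hs]; rewrite /bvol big_cons ltr_pwDl ?h //.
by rewrite big_seq sumr_ge0 // => q /(allP hs)/h/ltW.
Qed.

Lemma rupd_same (x : E) i : rupd x i (x ord0 i) = x.
by apply/rowP => j; rewrite mxE; case: eqP => [->|]. Qed.

Lemma vol_rupdr (a b : E) i c : vol a (rupd b i c) =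
 (c - a ord0 i) * \prod_(j < d.+1 | j != i) (b ord0 j - a ord0 j).
rewrite /vol (bigD1 i) //= mxE eqxx; congr (_ * _).
by apply: eq_bigr => j /negbTE ji; rewrite mxE ji.
Qed.

Lemma vol_rupdl (a b : E) i c : vol (rupd a i c) b =
 (b ord0 i - c) * \prod_(j < d.+1 | j != i) (b ord0 j - a ord0 j).
rewrite /vol (bigD1 i) //= mxE eqxx; congr (_ * _).
by apply: eq_bigr => j /negbTE ji; rewrite mxE ji.
Qed.

Lemma lovolE i c s : all bpos s -> bvol (lo i c s) = lovol i c s.
move=> hs; rewrite /bvol big_map big_filter big_mkcond.
rewrite big_seq [RHS]big_seq; apply: eq_bigr => p /(allP hs) /forallP hp.
rewrite !vol_rupdr /cutm; case: ltP => h.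
 by rewrite max_r // le_min (ltW h) ltW.
by rewrite max_l ?subrr ?mul0r // ge_min h orbT.
Qed.

Lemma lovol_up i c s : all bpos s -> lovol i c s + bvol (up i c s) = bvol s.
move=> hs; rewrite /bvol big_map big_filter [X in _ + X]big_mkcond -big_split.
rewrite big_seq [RHS]big_seq; apply: eq_bigr => p /(allP hs) /forallP hp.
rewrite -(vol_split p.1 p.2 i (cutm p i c)).
rewrite !vol_rupdl /cutm; case: ltP => h.
 by [].
by rewrite max_r ?ltW // subrr mul0r.
Qed.

Lemma all_lo i c s : all bpos s -> all bpos (lo i c s).
move=> hs; rewrite all_map; apply/allP => p; rewrite mem_filter => /andP[pc /(allP hs)/forallP hp].
apply/forallP => j; rewrite mxE; case: eqP => [->|_] //.
by rewrite lt_min hp.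
Qed.

Lemma all_up i c s : all bpos s -> all bpos (up i c s).
move=> hs; rewrite all_map; apply/allP => p; rewrite mem_filter => /andP[pc /(allP hs)/forallP hp].
apply/forallP => j; rewrite mxE; case: eqP => [->|_] //.
by rewrite gt_max hp.
Qed.

Lemma sub_bsep p q p' q' : bsep p q ->
 (forall i, p'.2 ord0 i <= p.2 ord0 i) -> (forall i, q'.2 ord0 i <= q.2 ord0 i) ->
 (forall i, p.1 ord0 i <= p'.1 ord0 i) -> (forall i, q.1 ord0 i <= q'.1 ord0 i) ->
 bsep p' q'.
move=> /existsP[i h] h1 h2 h3 h4; apply/existsP; exists i.
case/orP: h => h; apply/orP; [left|right].
 by rewrite (le_trans (h1 i)) // (le_trans h).
by rewrite (le_trans (h2 i)) // (le_trans h).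
Qed.

Lemma pairwise_lo i c s : pairwise bsep s -> pairwise bsep (lo i c s).
move=> hs; rewrite pairwise_map; apply: (@sub_pairwise _ bsep); last exact: pairwise_filter.
move=> p q h; apply: sub_bsep h _ _ _ _ => j //=; rewrite mxE; case: eqP => [->|_] //;
 by rewrite ge_min lexx.
Qed.

Lemma pairwise_up i c s : pairwise bsep s -> pairwise bsep (up i c s).
move=> hs; rewrite pairwise_map; apply: (@sub_pairwise _ bsep); last exact: pairwise_filter.
move=> p q h; apply: sub_bsep h _ _ _ _ => j //=; rewrite mxE; case: eqP => [->|_] //;
 by rewrite le_max lexx.
Qed.

Lemma size_filter_lt (T : eqType) (a : pred T) (s : seq T) x :
 x \in s -> ~~ a x -> (size (seq.filter a s) < size s)%N.
move=> xs ax; rewrite size_filter ltn_neqAle count_size andbT -all_count.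
by apply/allPn; exists x.
Qed.

Lemma lovol_continuous i s : continuous (fun c => lovol i c s).
elim: s => [|p s IH].
 have -> : (fun c => lovol i c [::]) = 0 by apply/funext => c; rewrite /lovol big_nil.
 exact: cst_continuous.
have -> : (fun c => lovol i c (p :: s)) = (fun c => (cutm p i c - p.1 ord0 i) *
  \prod_(j < d.+1 | j != i) (p.2 ord0 j - p.1 ord0 j) + lovol i c s).
 by apply/funext => c; rewrite /lovol big_cons vol_rupdr.
move=> c; apply: cvgD; last exact: IH.
apply: cvgMr_tmp; apply: cvgB; last exact: cvg_cst.
apply: (@continuous_max _ _ (fun=> p.1 ord0 i) (fun c => Num.min (p.2 ord0 i) c)).
 exact: cst_continuous.
apply: (@continuous_min _ _ (fun=> p.2 ord0 i) id); [exact: cst_continuous|exact: cvg_id].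
Qed.

Lemma lovol_ivt i s v : all bpos s -> 0 <= v <= bvol s -> exists c, lovol i c s = v.
move=> hs /andP[v0 vs].
pose lb := \sum_(p <- s) (- `|p.1 ord0 i|) .
pose ub := \sum_(p <- s) `|p.2 ord0 i|.
have hl p : p \in s -> lb <= p.1 ord0 i.
 move=> ps; rewrite /lb (big_rem p) //= (@le_trans _ _ (- `|p.1 ord0 i|)) //.
  rewrite gerDl; apply: sumr_le0 => q; rewrite //.
 by rewrite lerNl -normrN ler_norm.
have hu p : p \in s -> p.2 ord0 i <= ub.
 move=> ps; rewrite /ub (big_rem p) //= (@le_trans _ _ (`|p.2 ord0 i|)) ?ler_norm //.
 by rewrite lerDl; apply: sumr_ge0.
have h0 : lovol i lb s = 0.
 rewrite /lovol big_seq big1 // => p ps; rewrite vol_rupdr /cutm max_l ?subrr ?mul0r //.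
 by rewrite ge_min hl ?orbT.
have h1 : lovol i ub s = bvol s.
 rewrite /lovol big_seq [RHS]big_seq; apply: eq_bigr => p ps.
 have /forallP/(_ i)/ltW hp := allP hs _ ps.
 by rewrite /cutm (min_l (hu _ ps)) max_r // rupd_same.
have lu : lb <= ub.
 rewrite (@le_trans _ _ 0) //; first by apply: sumr_le0 => q.
 by apply: sumr_ge0.
have b0 := le_trans v0 vs.
have [||c _ <-] := @IVT R (fun c => lovol i c s) lb ub v lu; last by exists c.
 exact/continuous_subspaceT/lovol_continuous.
by rewrite h0 h1 (min_l b0) (max_r b0) v0.
Qed.

Lemma box_sum_lo i c c' p q :
 box (p.1 + q.1) ((blo i c p).2 + (blo i c' q).2) `<=`
 box (p.1 + q.1) (p.2 + q.2) `&` [set x | x ord0 i < c + c'].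
move=> x h; split=> [j|/=].
 have /andP[-> /=] := h j; rewrite !mxE => /lt_le_trans; apply.
 by case: eqP => [->|_] //; apply: lerD; rewrite ge_min lexx.
have /andP[_] := h i; rewrite !mxE eqxx => /lt_le_trans; apply.
by apply: lerD; rewrite ge_min lexx orbT.
Qed.

Lemma box_sum_up i c c' p q :
 box ((bup i c p).1 + (bup i c' q).1) (p.2 + q.2) `<=`
 box (p.1 + q.1) (p.2 + q.2) `&` ~` [set x | x ord0 i < c + c'].
move=> x h; split=> [j|/=].
 have /andP[h1 ->] := h j; rewrite andbT; apply: le_trans h1; rewrite !mxE.
 by case: eqP => [->|_] //; apply: lerD; rewrite le_max lexx.
apply/negP; rewrite -leNgt; have /andP[+ _] := h i; rewrite !mxE eqxx; apply: le_trans.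
by apply: lerD; rewrite le_max lexx orbT.
Qed.

(* Multiplicative Brunn-Minkowski, by the Hadwiger-Ohmann cutting argument. *)
Lemma hadwiger_ohmann n s t (C : set E) (c : R) : (size s + size t <= n)%N ->
 s != [::] -> t != [::] -> all bpos s -> all bpos t ->
 pairwise bsep s -> pairwise bsep t -> (L C <= c%:E)%E ->
 (forall p q, p \in s -> q \in t -> box (p.1 + q.1) (p.2 + q.2) `<=` C) ->
 4 ^+ d.+1 * bvol s * bvol t <= c ^+ 2.
elim: n s t C c => [|n IH] s t C c.
 by case: s => // p s; rewrite addSn.
(* A list with at least two boxes is cut along a hyperplane separating two of them, so that both
   pieces are strictly shorter; the other list is cut by a parallel hyperplane at the height that
   splits its volume in the same ratio [th]. The sums of the lower pieces and of the upper pieces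
   lie on opposite sides of the hyperplane at height [k + k']. *)
have step s1 s2 C1 c1 : (size s1 + size s2 <= n.+1)%N -> (1 < size s1)%N ->
 s1 != [::] -> s2 != [::] -> all bpos s1 -> all bpos s2 ->
 pairwise bsep s1 -> pairwise bsep s2 -> (L C1 <= c1%:E)%E ->
 (forall p q, p \in s1 -> q \in s2 -> box (p.1 + q.1) (p.2 + q.2) `<=` C1) ->
 4 ^+ d.+1 * bvol s1 * bvol s2 <= c1 ^+ 2.
- move=> hn s11 s1n s2n ps1 ps2 ss1 ss2 hL hC.
 have [i [k [[a as1 ak] [b bs1 kb]]]] : exists i k,
   (exists2 a, a \in s1 & a.2 ord0 i <= k) /\ (exists2 b, b \in s1 & k <= b.1 ord0 i).
  case: s1 s11 ss1 {hn s1n ps1 hC} => [|p [|q s1]] //= _ /andP[/andP[+ _] _].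
  move=> /existsP[i /orP[h|h]].
   exists i, (p.2 ord0 i); split; [exists p|exists q] => //; rewrite !inE eqxx ?orbT //.
  exists i, (q.2 ord0 i); split; [exists q|exists p] => //; rewrite !inE eqxx ?orbT //.
 have aa : a.1 ord0 i < a.2 ord0 i by have /forallP := allP ps1 _ as1.
 have bb : b.1 ord0 i < b.2 ord0 i by have /forallP := allP ps1 _ bs1.
 have lo_n : lo i k s1 != [::].
  apply/eqP => h; have : blo i k a \in lo i k s1.
   by apply: map_f; rewrite mem_filter as1 (lt_le_trans aa).
  by rewrite h.
 have up_n : up i k s1 != [::].
  apply/eqP => h; have : bup i k b \in up i k s1.
   by apply: map_f; rewrite mem_filter bs1 (le_lt_trans kb).
  by rewrite h.
 have lo_s : (size (lo i k s1) < size s1)%N.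
  by rewrite size_map; apply: size_filter_lt bs1 _; rewrite -leNgt.
 have up_s : (size (up i k s1) < size s1)%N.
  by rewrite size_map; apply: size_filter_lt as1 _; rewrite -leNgt.
 have A0 := bvol_gt0 ps1 s1n; have B0 := bvol_gt0 ps2 s2n.
 have Al := bvol_gt0 (all_lo i k ps1) lo_n.
 have Au := bvol_gt0 (all_up i k ps1) up_n.
 have eA : bvol (lo i k s1) + bvol (up i k s1) = bvol s1 by rewrite lovolE // lovol_up.
 set th := bvol (lo i k s1) / bvol s1.
 have th0 : 0 < th by rewrite divr_gt0.
 have th1 : th < 1 by rewrite ltr_pdivrMr // mul1r -eA ltrDl.
 have [|k' hk'] := @lovol_ivt i s2 (th * bvol s2) ps2.
  by rewrite mulr_ge0 ?(ltW th0) ?(ltW B0) //= ger_pMl // ltW.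
 have eBl : bvol (lo i k' s2) = th * bvol s2 by rewrite lovolE.
 have eBu : bvol (up i k' s2) = (1 - th) * bvol s2.
  by have := @lovol_up i k' s2 ps2; rewrite hk'; lra.
 have eAl : bvol (lo i k s1) = th * bvol s1 by rewrite /th divfK // gt_eqF.
 have eAu : bvol (up i k s1) = (1 - th) * bvol s1 by move: eA; rewrite eAl; lra.
 have lo2n : lo i k' s2 != [::].
  by apply/eqP => h; move: eBl; rewrite h /bvol big_nil => /esym/eqP; rewrite gt_eqF // mulr_gt0.
 have up2n : up i k' s2 != [::].
  apply/eqP => h; move: eBu; rewrite h /bvol big_nil => /esym/eqP.
  by rewrite gt_eqF // mulr_gt0 // subr_gt0.
 set H : set E := [set x | x ord0 i < k + k'].
 have eL : (L C1 = L (C1 `&` H) + L (C1 `&` ~` H))%E.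
  exact: (halfspace_caratheodory i (k + k') C1).
 have f1 : L (C1 `&` H) \is a fin_num.
  rewrite ge0_fin_numE ?outer_measure_ge0 //.
  by apply: le_lt_trans (ltry c1); apply: le_trans hL; exact: le_outer_measure.
 have f2 : L (C1 `&` ~` H) \is a fin_num.
  rewrite ge0_fin_numE ?outer_measure_ge0 //.
  by apply: le_lt_trans (ltry c1); apply: le_trans hL; exact: le_outer_measure.
 set c2 := fine (L (C1 `&` H)); set c3 := fine (L (C1 `&` ~` H)).
 have c20 : 0 <= c2 by rewrite fine_ge0 // outer_measure_ge0.
 have c30 : 0 <= c3 by rewrite fine_ge0 // outer_measure_ge0.
 have c23 : c2 + c3 <= c1 by rewrite -lee_fin EFinD !fineK // -eL.
 have h2 : 4 ^+ d.+1 * bvol (lo i k s1) * bvol (lo i k' s2) <= c2 ^+ 2.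
  apply: (IH _ _ (C1 `&` H)); rewrite ?all_lo ?pairwise_lo ?fineK //.
   rewrite -ltnS; apply: leq_trans hn; rewrite -addSn leq_add // size_map size_filter count_size //.
  move=> _ _ /mapP[p pp ->] /mapP[q qq ->] x hx0; have [hx Hx] := @box_sum_lo i k k' p q x hx0; split => //.
  by move: pp qq; rewrite !mem_filter => /andP[_ /hC h] /andP[_ /h]; exact.
 have h3 : 4 ^+ d.+1 * bvol (up i k s1) * bvol (up i k' s2) <= c3 ^+ 2.
  apply: (IH _ _ (C1 `&` ~` H)); rewrite ?all_up ?pairwise_up ?fineK //.
   rewrite -ltnS; apply: leq_trans hn; rewrite -addSn leq_add // size_map size_filter count_size //.
  move=> _ _ /mapP[p pp ->] /mapP[q qq ->] x hx0; have [hx Hx] := @box_sum_up i k k' p q x hx0; split => //.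
  by move: pp qq; rewrite !mem_filter => /andP[_ /hC h] /andP[_ /h]; exact.
 move: h2 h3; rewrite eAl eAu eBl eBu.
 (* Because the ratios agree, the induction hypotheses bound [th * sqrt K] and [(1 - th) * sqrt K]
    by [c2] and [c3], and these add up without loss to [sqrt K <= c1]. *)
 set K := 4 ^+ d.+1 * bvol s1 * bvol s2.
 have K0 : 0 <= K by rewrite !mulr_ge0 // ltW.
 have -> : 4 ^+ d.+1 * (th * bvol s1) * (th * bvol s2) = (th * Num.sqrt K) ^+ 2.
  by rewrite exprMn sqr_sqrtr // /K; ring.
 have -> : 4 ^+ d.+1 * ((1 - th) * bvol s1) * ((1 - th) * bvol s2) = ((1 - th) * Num.sqrt K) ^+ 2.
  by rewrite exprMn sqr_sqrtr // /K; ring.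
 have S0 := sqrtr_ge0 K.
 have t0 := ltW th0; have t1 : 0 <= 1 - th by rewrite subr_ge0 ltW.
 have p1 := mulr_ge0 t0 S0; have p2 := mulr_ge0 t1 S0.
 rewrite !ler_pXn2r ?nnegrE // => g1 g2.
 have c10 : 0 <= c1 by lra.
 by rewrite -(sqr_sqrtr K0) ler_pXn2r //; lra.
case: (ltnP 1 (size s)) => [ls|ls]; first by move=> *; apply: (step s t C c).
case: (ltnP 1 (size t)) => [lt1|lt1].
 move=> h1 h2 h3 h4 h5 h6 h7 h8 h9; rewrite mulrAC; apply: (step t s C c) => //.
  by rewrite addnC.
 by move=> p q pt qs; rewrite [p.1 + _]addrC [p.2 + _]addrC; exact: h9.
case: s ls => [|p [|]] //= _; case: t lt1 => [|q [|]] //= _ _ _ _.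
rewrite /bvol !big_seq1 !andbT => /forallP hp /forallP hq _ _ hL hC.
have hpq i : (p.1 + q.1) ord0 i <= (p.2 + q.2) ord0 i.
 by rewrite !mxE; apply: lerD; apply: ltW.
have : (vol (p.1 + q.1) (p.2 + q.2) <= c).
 rewrite -lee_fin -leb_box //; apply: le_trans hL; apply: le_outer_measure.
 by apply: hC; rewrite inE.
move=> hv; apply: (@le_trans _ _ (vol (p.1 + q.1) (p.2 + q.2) ^+ 2)); last first.
 by rewrite ler_pXn2r // nnegrE ?(le_trans _ hv) // vol_ge0.
rewrite -prodrXl -[X in _ ^+ X]card_ord -prodr_const -!big_split /=.
apply: ler_prod => i _; rewrite !mxE.
have := hp i; have := hq i.
move: (p.1 ord0 i) (p.2 ord0 i) (q.1 ord0 i) (q.2 ord0 i) => x y z w h1 h2.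
(* One box against one box: in each coordinate this is the arithmetic-geometric mean inequality for
   the two side lengths. *)
have -> : (y + w - (x + z)) ^+ 2 = 4 * (y - x) * (w - z) + (y - x - (w - z)) ^+ 2 by ring.
by rewrite lerDl sqr_ge0 !mulr_ge0 // subr_ge0 ltW.
Qed.

End brunn_minkowski.

(** * Hausdorff measure of full dimension is Lebesgue measure *)

Section gauge.
Context {R : realType} {d : nat} (s : nat).
Local Notation E := 'rV[R]_d.
Local Notation om := (@ball_volume R s).

Lemma ball_volume_ge0 : 0 <= om.
by rewrite fine_ge0. Qed.

Lemma hausdorff_gauge_le (delta D : R) (A : set E) : 0 <= D -> D <= delta ->
 (forall x y, A x -> A y -> enorm (x - y) <= D) ->
 (hausdorff_gauge s delta A <= (om * (D / 2) ^+ s)%:E)%E.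
move=> D0 Dd hA; rewrite /hausdorff_gauge; case: ifPn => [_|A0].
 by rewrite lee_fin mulr_ge0 ?ball_volume_ge0 // exprn_ge0 // divr_ge0.
have dD : (diam A <= D%:E)%E.
 by apply: ge_ereal_sup => _ [x [y [Ax Ay ->]]]; rewrite lee_fin hA.
have fd : diam A \is a fin_num.
 by rewrite ge0_fin_numE ?diam_ge0 // (le_lt_trans dD) // ltry.
have f0 : 0 <= fine (diam A) by rewrite fine_ge0 // diam_ge0.
have hd : (diam A <= delta%:E)%E by rewrite (le_trans dD).
rewrite hd lee_fin ler_wpM2l ?ball_volume_ge0 // lerXn2r ?nnegrE ?divr_ge0 //.
by rewrite ler_pM2r // -lee_fin fineK.
Qed.

Lemma hausdorff_gauge_fin (delta : R) (A : set E) : (hausdorff_gauge s delta A < +oo)%E ->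
 A = set0 \/ exists D, [/\ 0 <= D, D <= delta,
  (forall x y, A x -> A y -> enorm (x - y) <= D) &
  hausdorff_gauge s delta A = (om * (D / 2) ^+ s)%:E].
rewrite /hausdorff_gauge; case: eqP => [->|/eqP A0]; first by left.
case: ifP => // hd; right.
have : diam A \is a fin_num.
 by rewrite ge0_fin_numE ?diam_ge0 // (le_lt_trans hd) // ltry.
exists (fine (diam A)); split => //.
- by rewrite fine_ge0 // diam_ge0.
- by rewrite -lee_fin fineK.
- move=> x y Ax Ay; rewrite -lee_fin fineK //; apply: ereal_sup_ubound.
 by exists x, y.
Qed.

Lemma method1_le_cover (tau : set E -> \bar R) (A : set E) (B : nat -> set E) :
 A `<=` \bigcup_k B k -> (method1 tau A <= \sum_(0 <= k <oo) tau (B k))%E.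
by move=> AB; apply: ereal_inf_lbound; exists B => //. Qed.

Lemma le_method1_cover (tau : set E -> \bar R) (A : set E) c :
 (forall B : nat -> set E, A `<=` \bigcup_k B k -> (c <= \sum_(0 <= k <oo) tau (B k))%E) ->
 (c <= method1 tau A)%E.
by move=> h; apply: le_ereal_inf_tmp => _ [B [_ AB] <-]; exact: h. Qed.

End gauge.

(** A cover of [A] at scale [delta / c] is mapped to a cover of the image at scale [delta]. Its
    members are first intersected with [A], because [f] is controlled only there. *)
Lemma hausdorff_lipschitz (R : realType) (m k s : nat) (f : 'rV[R]_m -> 'rV[R]_k)
  (A : set 'rV[R]_m) (c : R) : 0 < c ->
 (forall x y, A x -> A y -> enorm (f x - f y) <= c * enorm (x - y)) ->
 (hausdorff_outer s (f @` A) <= (c ^+ s)%:E * hausdorff_outer s A)%E.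
move=> c0 hf; apply: ge_ereal_sup => _ [delta /= d0 <-].
have dc0 : 0 < delta / c by rewrite divr_gt0.
apply: (@le_trans _ _ ((c ^+ s)%:E * method1 (hausdorff_gauge s (delta / c)) A)%E); last first.
 apply: lee_wpmul2l; first by rewrite lee_fin exprn_ge0 // ltW.
 by apply: ereal_sup_ubound; exists (delta / c).
have cs0 : 0 < c ^+ s by rewrite exprn_gt0.
rewrite -lee_pdivrMl //; apply: le_method1_cover => B AB.
rewrite lee_pdivrMl // -nneseriesZl => [|*]; last exact: hausdorff_gauge_ge0.
apply: le_trans (method1_le_cover _ (B := fun j => f @` (B j `&` A)) _) _.
 by move=> _ [x Ax <-]; have [j _ Bx] := AB _ Ax; exists j => //; exists x.
apply: lee_nneseries => [j _ _|j _]; first exact: hausdorff_gauge_ge0.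
have [->|] := eqVneq (hausdorff_gauge s (delta / c) (B j)) +oo%E.
 by rewrite gt0_muley // leey.
rewrite -ltey => /hausdorff_gauge_fin [->|[D [D0 Dd hD ->]]].
 by rewrite set0I image_set0 hausdorff_gauge0 mule_ge0 ?hausdorff_gauge_ge0 // ltW.
apply: le_trans (@hausdorff_gauge_le _ _ _ _ (c * D) _ _ _ _) _.
- by rewrite mulr_ge0 // ltW.
- by rewrite mulrC -ler_pdivlMr.
- move=> _ _ [x [Bx Ax] <-] [y [By Ay] <-]; rewrite (le_trans (hf _ _ Ax Ay)) //.
 by rewrite ler_pM2l // hD.
- by rewrite -mulrA exprMn mulrCA.
Qed.

(** The way in which the mesh [p] of a grid is sent to zero in an estimate whose error depends
    continuously on [p]. *)
Lemma le_at_right0 (R : realType) (a q : R) (f : R -> R) : 0 < q -> {for 0, continuous f} ->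
 (forall p, 0 < p -> p < q -> a <= f p) -> a <= f 0.
move=> q0 cf h; rewrite leNgt; apply/negP => fa.
have /nbhs_ballP[r /= r0 hr] : nbhs (0 : R) [set p | f p < a] by exact: (cvgr_lt _ cf).
set p := Num.min r q / 2.
have p0 : 0 < p by rewrite divr_gt0 // lt_min r0.
have pm : p < Num.min r q by rewrite ltr_pdivrMr // ltr_pMr ?ltr1n // lt_min r0.
have /andP[pr pq] : (p < r) && (p < q) by rewrite -lt_min.
have /hr /= : ball (0 : R) r p by rewrite /ball /= sub0r normrN gtr0_norm.
by rewrite ltNge h.
Qed.

Lemma prod_continuous (R : realType) (I : Type) (r : seq I) (f : I -> R -> R) :
 (forall i, continuous (f i)) -> continuous (fun x => \prod_(i <- r) f i x).
move=> cf; elim: r => [|i r IH].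
 have -> : (fun x => \prod_(i <- [::]) f i x) = 1 by apply/funext => x; rewrite big_nil.
 exact: cst_continuous.
have -> : (fun x => \prod_(j <- i :: r) f j x) = (fun x => f i x * \prod_(j <- r) f j x).
 by apply/funext => x; rewrite big_cons.
by move=> x; apply: cvgM; [exact: cf|exact: IH].
Qed.

Lemma outer_bigsetU (R : realType) (T : Type) (mu : {outer_measure set T -> \bar R})
  (I : Type) (s : seq I) (Q : pred I) (F : I -> set T) :
 (mu (\big[setU/set0]_(i <- s | Q i) F i) <= \sum_(i <- s | Q i) mu (F i))%E.
elim: s => [|i s IH]; first by rewrite !big_nil outer_measure0.
rewrite !big_cons; case: ifP => //.
by rewrite (le_trans (outer_measureU2 _ _ _)) // leeD2l.
Qed.

Lemma bigsetU_fin_sup (T : Type) (I : finType) (Q : pred I) (F : I -> set T) i : Q i ->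
 F i `<=` \big[setU/set0]_(j | Q j) F j.
by rewrite -bigcup_seq_cond; exists i => //=; rewrite mem_index_enum. Qed.

Section grid.
Context {R : realType} {d : nat}.
Local Notation E := 'rV[R]_d.+1.
Local Notation L := (@lebesgue_outer R d.+1).
Local Notation LT := (caratheodory_type L).
Local Notation Z := {ffun 'I_d.+1 -> int}.

Definition gcells (p : R) (A : set E) : set Z := [set z | cube p z `&` A !=set0].

Lemma gcells_finite (p r : R) (A : set E) : 0 < p -> (forall x, A x -> enorm x <= r) ->
 finite_set (gcells p A).
move=> p0 hA.
pose N := (Num.trunc (`|r| / p)).+2.
pose g (k : {ffun 'I_d.+1 -> 'I_(N + N)}) : Z := [ffun i => (k i)%:Z - N%:Z].
apply: (@sub_finite_set _ _ (g @` [set: {ffun 'I_d.+1 -> 'I_(N + N)}])); last first.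
 by apply: finite_image.
move=> z [x [zx /hA hx]].
have hz i : (- N%:Z <= z i < N%:Z)%R.
 have := zx i; rewrite !mxE => /andP[h1 h2].
 have xi : `|x ord0 i| < (N%:R - 1) * p.
  apply: (@le_lt_trans _ _ `|r|).
   by rewrite (le_trans (coord_le_enorm _ _)) // (le_trans hx) // ler_norm.
  rewrite -ltr_pdivrMr // -natr1 addrK.
  by apply: Num.Theory.real_truncnS_gt; exact: num_real.
 move: xi; rewrite ltr_norml => /andP[h3 h4].
 have : (z i)%:~R < N%:R :> R.
  by rewrite -(ltr_pM2r p0) (le_lt_trans h1) // (lt_trans h4) // ltr_pM2r // gtrDl.
 have h6 : - N%:R < (z i)%:~R :> R.
  by rewrite -(ltr_pM2r p0); lra.
 by rewrite ltW // -(@ltr_int R).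
have hk i : (absz (z i + N%:Z)%R < N + N)%N.
 by have := hz i; lia.
exists [ffun i => Ordinal (hk i)] => //; apply/ffunP => i; rewrite !ffunE /=.
by have := hz i; lia.
Qed.

Definition gseq (p : R) (A : set E) : seq Z := finmap.enum_fset (fset_set (gcells p A)).

Lemma gseq_uniq p A : uniq (gseq p A). Proof. exact: finmap.fset_uniq. Qed.

Lemma mem_gseq (p r : R) (A : set E) z : 0 < p -> (forall x, A x -> enorm x <= r) ->
 (z \in gseq p A) <-> gcells p A z.
move=> p0 hA; split=> [|h].
 by rewrite in_fset_set ?inE; last exact: gcells_finite hA.
by rewrite in_fset_set ?inE; last exact: gcells_finite hA.
Qed.

Definition gpoint (p : R) (z : Z) : E := \row_i ((z i)%:~R * p).

Lemma cubeE (p : R) (z : Z) : cube p z = box (gpoint p z) (gpoint p z + const_mx p).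
congr box; apply/rowP => i; rewrite !mxE; ring.
Qed.

Lemma gpoint_vol (p : R) (z : Z) : vol (gpoint p z) (gpoint p z + const_mx p) = p ^+ d.+1.
rewrite /vol (eq_bigr (fun=> p)) ?prodr_const ?card_ord // => i.
by rewrite !mxE addrAC subrr add0r.
Qed.

Lemma leb_le_gseq (p r : R) (A : set E) : 0 < p -> (forall x, A x -> enorm x <= r) ->
 (L A <= ((size (gseq p A))%:R * p ^+ d.+1)%:E)%E.
move=> p0 hA.
apply: (@le_trans _ _ (L (\big[setU/set0]_(z <- gseq p A) cube p z))).
 apply: le_outer_measure => x; rewrite -bigcup_seq.
 exists [ffun i => grid p x i] => /=.
  apply/(mem_gseq _ p0 hA); exists x; split => //.
  by apply/cube_grid => //; apply/funext => i; rewrite ffunE.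
 by apply/cube_grid => //; apply/funext => i; rewrite ffunE.
elim: (gseq p A) => [|z s IH]; first by rewrite big_nil outer_measure0 mul0r.
rewrite big_cons (le_trans (outer_measureU2 _ _ _)) //= mulrSr mulrDl mul1r addrC EFinD.
apply: leeD => //; rewrite cubeE leb_box ?gpoint_vol // => i.
by rewrite !mxE lerDl ltW.
Qed.

Lemma gseq_le_leb (p r : R) (A B : set E) : 0 < p -> (forall x, A x -> enorm x <= r) ->
 (forall z, gcells p A z -> cube p z `<=` B) ->
 (((size (gseq p A))%:R * p ^+ d.+1)%:E <= L B)%E.
move=> p0 hA hB.
have hs z : z \in gseq p A -> cube p z `<=` B by move=> /(mem_gseq _ p0 hA)/hB.
apply: (@le_trans _ _ (leb d.+1 (\big[setU/set0]_(z <- gseq p A) (cube p z : set LT)))); last first.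
 apply: (@le_outer_measure _ _ L); rewrite -bigcup_seq => x [z /= /hs]; exact.
rewrite /gseq measure_fbigsetU => [|z _|]; last 2 first.
- exact: box_measurable.
- exact: (sub_trivIset _ (cube_trivIset p0)).
rewrite (eq_bigr (fun=> (p ^+ d.+1)%:E)); last first.
 move=> z; rewrite /= cubeE leb_box ?gpoint_vol // => i.
 by rewrite !mxE lerDl ltW.
elim: (finmap.enum_fset _) => [|z s IH]; first by rewrite mul0r sume_ge0 // => *; rewrite lee_fin exprn_ge0 // ltW.
by rewrite big_cons mulrSr mulrDl mul1r addrC EFinD leeD.
Qed.

End grid.

Section isodiametric.
Context {R : realType} {d : nat}.
Local Notation E := 'rV[R]_d.+1.
Local Notation L := (@lebesgue_outer R d.+1).
Local Notation om := (@ball_volume R d.+1).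

Lemma affine_expr_continuous (c a b x : R) (m : nat) :
 {for x, continuous (fun p => c * (a + b * p) ^+ m)}.
apply: cvgMl_tmp; apply: (@continuous_comp _ _ _ (fun p => a + b * p) (fun t => t ^+ m)).
 by apply: cvgD; [exact: cvg_cst|apply: cvgMl_tmp; exact: cvg_id].
exact: exprn_continuous.
Qed.

(** Brunn-Minkowski is applied to [A] and its reflection, both replaced by the grid cubes that meet
    them. The sum of the two is the difference set of [A], contained in a ball of radius [D] up to
    the mesh; hence [4 ^ m * |A|^2] is at most the square of the volume of that ball. *)
Lemma isodiametric (A : set E) (D : R) : 0 <= D ->
 (forall x y, A x -> A y -> enorm (x - y) <= D) ->
 (L A <= (om * (D / 2) ^+ d.+1)%:E)%E.
move=> D0 hD.
have [->|/set0P[x0 Ax0]] := eqVneq A set0.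
 by rewrite outer_measure0 lee_fin mulr_ge0 ?ball_volume_ge0 // exprn_ge0 // divr_ge0.
have hA x : A x -> enorm x <= enorm x0 + D.
 by move=> Ax; rewrite -lerBlDl (le_trans _ (hD _ _ Ax Ax0)) // (le_trans (ler_norm _)) // ler_enorm_dist.
have fA : L A \is a fin_num.
 by rewrite ge0_fin_numE ?outer_measure_ge0 // (bounded_leb hA).
rewrite -(fineK fA) lee_fin.
have -> : D / 2 = D / 2 + d.+1%:R * 0 by lra.
apply: (@le_at_right0 _ _ 1 (fun p => om * (D / 2 + d.+1%:R * p) ^+ d.+1)) => [||p p0 _] //.
 exact: affine_expr_continuous.
rewrite -lee_fin (fineK fA); apply: le_trans (leb_le_gseq p0 hA) _; rewrite lee_fin.
set N := size _.
pose S := [seq (gpoint p z, gpoint p z + const_mx p) | z <- gseq p A].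
pose T := [seq (- (gpoint p z + const_mx p), - gpoint p z) | z <- gseq p A].
have vS : bvol S = N%:R * p ^+ d.+1.
 rewrite /bvol big_map (eq_bigr (fun=> p ^+ d.+1)) => [|z _]; last by rewrite gpoint_vol.
 by rewrite big_const_seq iter_addr_0 mulr_natl.
have vT : bvol T = N%:R * p ^+ d.+1.
 rewrite /bvol big_map (eq_bigr (fun=> p ^+ d.+1)) => [|z _].
  by rewrite big_const_seq iter_addr_0 mulr_natl.
 rewrite -(gpoint_vol p z); apply: eq_bigr => i _; rewrite !mxE; ring.
have gA : gseq p A != [::].
 apply/eqP => h; have /(mem_gseq _ p0 hA) : gcells p A [ffun i => grid p x0 i].
  exists x0; split => //.
  by apply/cube_grid => //; apply/funext => i; rewrite ffunE.
 by rewrite h.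
have pS : pairwise (fun z w : {ffun 'I_d.+1 -> int} => [exists i, z i != w i]) (gseq p A).
 have := gseq_uniq p A; rewrite uniq_pairwise; apply: sub_pairwise => z w /=.
 apply: contra => /forallP h; apply/eqP/ffunP => i.
 exact/eqP/h.
have sepz (a b : int) : a != b -> (a%:~R * p + p <= b%:~R * p) || (b%:~R * p + p <= a%:~R * p).
 have e (u v : int) : (u%:~R * p + p <= v%:~R * p) = (u + 1 <= v).
  by rewrite -{2}(mul1r p) -mulrDl ler_pM2r // -(intrD R u 1) ler_int.
 rewrite !e => ab; lia.
(* A point in the sum of a cube and a reflected cube differs from a difference of two points of [A]
   by at most [2 * p] in each coordinate, hence by at most [2 * d.+1 * p] in norm. *)
set c := om * (D + 2 * d.+1%:R * p) ^+ d.+1.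
have r0 : 0 < D + 2 * d.+1%:R * p by rewrite ltr_wpDl // !mulr_gt0.
have : 4 ^+ d.+1 * bvol S * bvol T <= c ^+ 2.
 apply: (@hadwiger_ohmann _ _ (size S + size T) S T (eball 0 (D + 2 * d.+1%:R * p))) => //.
 - by rewrite /S; case: (gseq p A) gA.
 - by rewrite /T; case: (gseq p A) gA.
 - by rewrite all_map; apply/allP => z _; apply/forallP => i; rewrite !mxE ltrDl.
 - by rewrite all_map; apply/allP => z _; apply/forallP => i; rewrite !mxE ltrN2 ltrDl.
 - rewrite pairwise_map; apply: sub_pairwise pS => z w /= /existsP[i /sepz h].
  by apply/existsP; exists i; rewrite !mxE.
 - rewrite pairwise_map; apply: sub_pairwise pS => z w /= /existsP[i /sepz h].
  by apply/existsP; exists i; rewrite !mxE !lerN2 orbC.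
 - by rewrite leb_eball.
 move=> _ _ /mapP[z /(mem_gseq _ p0 hA)[a [za Aa]] ->] /mapP[w /(mem_gseq _ p0 hA)[b [wb Ab]] ->].
 move=> x hx; rewrite /eball /= subr0.
 have -> : x = (a - b) + (x - (a - b)) by rewrite addrC subrK.
 apply: le_trans (ler_enormD _ _) _; apply: lerD; first exact: hD.
 rewrite [2 * _]mulrC -mulrA; apply: enorm_le_coord => i.
 have := hx i; have := za i; have := wb i; rewrite !mxE /= ler_norml => /andP[h1 h2] /andP[h3 h4] /andP[h5 h6].
 lra.
rewrite vS vT.
have -> : 4 ^+ d.+1 * (N%:R * p ^+ d.+1) * (N%:R * p ^+ d.+1) = (2 ^+ d.+1 * (N%:R * p ^+ d.+1)) ^+ 2.
 have -> : 4 ^+ d.+1 = (2 ^+ d.+1) ^+ 2 :> R.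
  by have -> : (4 : R) = 2 * 2 by [rewrite -natrM]; rewrite exprMn.
 by ring.
have c0 : 0 <= c by rewrite mulr_ge0 ?ball_volume_ge0 // exprn_ge0 // ltW.
rewrite ler_pXn2r ?nnegrE //; last by rewrite !mulr_ge0 ?exprn_ge0 // ltW.
rewrite -ler_pdivlMl // => /le_trans; apply.
rewrite mulrCA -exprVn -exprMn.
by have -> : 2^-1 * (D + 2 * d.+1%:R * p) = D / 2 + d.+1%:R * p by field.
Qed.

(** The isodiametric inequality bounds the Lebesgue measure of every covering set by its gauge,
    whatever the scale; scale one is as good as any. *)
Lemma leb_le_hausdorff (A : set E) : (L A <= hausdorff_outer d.+1 A)%E.
apply: (@le_trans _ _ (method1 (hausdorff_gauge d.+1 1) A)); last first.
 by apply: ereal_sup_ubound; exists 1; rewrite /=.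
apply: le_method1_cover => B AB.
apply: le_trans (le_trans (le_outer_measure L _ _ AB) (outer_measure_sigma_subadditive L B)) _.
apply: lee_nneseries => [k _ _|k _]; first exact: outer_measure_ge0.
have [->|] := eqVneq (hausdorff_gauge d.+1 1 (B k)) +oo%E; first by rewrite leey.
rewrite -ltey => /hausdorff_gauge_fin [->|[D [D0 _ hD ->]]]; last exact: isodiametric.
by rewrite outer_measure0 hausdorff_gauge0.
Qed.

End isodiametric.

Section premeasure.
Context {R : realType} {d : nat} (s : nat) (delta : R).
Local Notation E := 'rV[R]_d.

Definition hdelta (A : set E) : \bar R := method1 (hausdorff_gauge s delta) A.

HB.instance Definition _ := isOuterMeasure.Build R E hdelta
 (method1_0 (hausdorff_gauge0 s delta) (hausdorff_gauge_ge0 s delta))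
 (method1_ge0 (hausdorff_gauge_ge0 s delta))
 (@le_method1 _ _ _) (method1_sigma_subadditive (hausdorff_gauge_ge0 s delta)).

Lemma hdelta_le_gauge A : (hdelta A <= hausdorff_gauge s delta A)%E.
apply: le_trans (@method1_le_cover _ _ _ A (fun k => if k is 0 then A else set0) _) _.
 by exists 0.
rewrite (@nneseriesD1 _ _ 0%N) //=; last by move=> *; exact: hausdorff_gauge_ge0.
by rewrite eseries0 ?adde0 // => -[|k] //=; rewrite hausdorff_gauge0.
Qed.

End premeasure.

Section filling.
Context {R : realType} {d : nat}.
Local Notation E := 'rV[R]_d.+1.
Local Notation L := (@lebesgue_outer R d.+1).
Local Notation om := (@ball_volume R d.+1).
Variable delta : R.
Hypothesis delta0 : 0 < delta.
Local Notation M := (@hdelta R d.+1 d.+1 delta).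
Local Notation m := d.+1.

Let cub (a : E) (h : R) : set E := box a (a + const_mx h).
Let h0 := delta / m%:R.
(** The proportion of a cube that its inscribed ball occupies. *)
Let beta := om / 2 ^+ m.

Let P (C : R) := forall a h, 0 < h -> h <= h0 -> (M (cub a h) <= (C * h ^+ m)%:E)%E.

Let m0 : (0 : R) < m%:R. Proof. by []. Qed.
Let h00 : 0 < h0. Proof. by rewrite divr_gt0. Qed.

Let cub_dist a h x y : cub a h x -> cub a h y -> enorm (x - y) <= m%:R * h.
move=> hx hy; apply: enorm_le_coord => i; have := hx i; have := hy i.
by rewrite !mxE ler_norml => /andP[h3 h4]; lra.
Qed.

Let leb_cub a h : 0 <= h -> L (cub a h) = (h ^+ m)%:E.
move=> hh; rewrite leb_box => [|i]; last by rewrite !mxE lerDl.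
by rewrite /vol (eq_bigr (fun=> h)) ?prodr_const ?card_ord // => i; rewrite !mxE addrAC subrr add0r.
Qed.

Let P_crude : P (om * (m%:R / 2) ^+ m).
move=> a h hh hh0; apply: le_trans (hdelta_le_gauge _ _ _) _.
apply: le_trans (@hausdorff_gauge_le _ _ _ _ (m%:R * h) _ _ _ _) _.
- by rewrite mulr_ge0 // ltW.
- by move: hh0; rewrite ler_pdivlMr // mulrC.
- by exact: cub_dist.
- by rewrite -mulrA -exprMn mulrAC.
Qed.

Let beta_gt0 : 0 < beta. Proof. by rewrite divr_gt0 ?ball_volume_gt0. Qed.

Let beta_le1 : beta <= 1.
have -> : (1 : R) = 1 * (1 + 1 * 0) ^+ m by rewrite mulr0 addr0 expr1n mulr1.
apply: (@le_at_right0 _ _ 1 (fun p => 1 * (1 + 1 * p) ^+ m)) => [||p p0 _] //.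
 exact: affine_expr_continuous.
have -> : beta = om * (2^-1) ^+ m by rewrite exprVn.
rewrite -lee_fin -(@leb_eball _ _ 0) // mul1r mul1r.
have q0 : 0 <= 1 + p by lra.
rewrite -(leb_cub (const_mx (- 2^-1)) q0).
apply: le_outer_measure => x; rewrite /= => hx i.
have := le_trans (coord_le_enorm _ i) hx; rewrite !mxE ler_norml => /andP[h1 h2].
lra.
Qed.

(** A self-improvement that stands in for a Vitali covering. The gauge of the ball inscribed in a
    cube is exactly its volume, the fraction [beta]; the rest of the cube is covered by small
    subcubes, each charged at the known rate [C]. The map [C -> beta + C * (1 - beta)] has 1 as its
    only fixed point. *)
Let P_step C e : 0 <= C -> P C -> 0 < e -> P (beta + C * (1 - beta) + e).
move=> C0 PC e0 a h hh hh0.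
pose e' := e / (C + 1).
have e'0 : 0 < e' by rewrite divr_gt0 // ltr_wpDl.
have /nbhs_ballP[r /= r0 hr] : nbhs (0 : R) [set q | beta - e' < om * (2^-1 + (-1) * q) ^+ m].
 apply: (cvgr_gt _ (@affine_expr_continuous R om 2^-1 (-1) 0 m)).
 by rewrite mulr0 addr0 exprVn -/beta gtrBl.
pose r' := Num.min r 2^-1.
have r'0 : 0 < r' by rewrite lt_min r0 invr_gt0 /=.
pose N := (Num.trunc (m%:R / r')).+1.
have N0 : (0 : R) < N%:R by rewrite ltr0n.
have Nr : m%:R / N%:R < r'.
 rewrite ltr_pdivrMr // -ltr_pdivrMl // mulrC.
 by apply: Num.Theory.real_truncnS_gt; exact: num_real.
have /andP[Nr1 Nr2] : (m%:R / N%:R < r) && (m%:R / N%:R < 2^-1 :> R) by rewrite -lt_min.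
pose k := h / N%:R.
have k0 : 0 < k by rewrite divr_gt0.
have kh0 : k <= h0.
 by rewrite (le_trans _ hh0) // ler_pdivrMr // ler_peMr ?ler1n // ltW.
pose cc := a + const_mx (h / 2).
pose B := eball cc (h / 2).
pose sc (z : {ffun 'I_m -> 'I_N}) := cub (a + \row_i ((z i)%:R * k)) k.
pose inB z := `[< sc z `<=` B >].
have locate x : cub a h x -> exists z, sc z x.
 move=> hx.
 have hz i : (Num.trunc ((x ord0 i - a ord0 i) / k) < N)%N /\
   ((Num.trunc ((x ord0 i - a ord0 i) / k))%:R * k <= x ord0 i - a ord0 i <
   ((Num.trunc ((x ord0 i - a ord0 i) / k))%:R + 1) * k).
  have := hx i; rewrite !mxE => /andP[h1 h2].
  have t0 : 0 <= (x ord0 i - a ord0 i) / k by rewrite divr_ge0 ?subr_ge0 // ltW.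
  have /andP[g1 g2] := Num.Theory.truncn_itv t0.
  split; last by rewrite -ler_pdivlMr // -ltr_pdivrMr // g1 natr1.
  rewrite -(ltr_nat R) (le_lt_trans g1) // ltr_pdivrMr // /k mulrC divfK ?gt_eqF //.
  by rewrite ltrBlDl.
 exists [ffun i => Ordinal (hz i).1] => i; rewrite !mxE !ffunE /=.
 by have [_ /andP[g1 g2]] := hz i; apply/andP; split; lra.
have covQ : cub a h `<=` B `|` \big[setU/set0]_(z | ~~ inB z) sc z.
 move=> x /locate[z hz]; have [zB|zB] := boolP (inB z).
  by left; move/asboolP: zB; exact.
 by right; apply: (@bigsetU_fin_sup _ _ (fun z => ~~ inB z) sc z _ x hz).
have EN : k ^+ m * N%:R ^+ m = h ^+ m by rewrite -exprMn divfK // gt_eqF.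
have rB : h / 2 - m%:R * k = h * (2^-1 + (-1) * (m%:R / N%:R)) by rewrite /k; field; rewrite gt_eqF.
have rB0 : 0 < h / 2 - m%:R * k by rewrite rB mulr_gt0 // mulN1r subr_gt0.
(* The subcubes have diameter at most [m * k], so all those meeting the ball of radius
   [h / 2 - m * k] lie inside [B]; they therefore fill at least that smaller ball. *)
have inn : om * (h / 2 - m%:R * k) ^+ m <= #|[pred z | inB z]|%:R * k ^+ m.
 rewrite -lee_fin -(leb_eball cc rB0).
 apply: (@le_trans _ _ (L (\big[setU/set0]_(z | inB z) sc z))).
  apply: le_outer_measure => x; rewrite /eball /= => hx.
  have /locate[z hz] : cub a h x.
   move=> i; have := le_trans (coord_le_enorm _ i) hx; rewrite !mxE ler_norml => /andP[g1 g2].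
   by have mk : 0 < m%:R * k; [rewrite mulr_gt0|apply/andP; split; lra].
  apply: (@bigsetU_fin_sup _ _ inB sc z _ x hz); apply/asboolP => y hy; rewrite /B /eball /=.
  have -> : y - cc = (y - x) + (x - cc) by rewrite addrA subrK.
  rewrite (le_trans (ler_enormD _ _)) // -lerBrDr (le_trans (cub_dist hy hz)) //.
  by rewrite lerBrDr -lerBrDl.
 apply: le_trans (outer_bigsetU _ _ _ _) _.
 rewrite (eq_bigr (fun=> (k ^+ m)%:E)) => [|z _]; last by apply: leb_cub; exact: ltW.
 by rewrite sumEFin sumr_const mulr_natl.
apply: (@le_trans _ _ (M B + \sum_(z | ~~ inB z) M (sc z))%E).
 apply: le_trans (le_outer_measure M _ _ covQ) _.
 apply: le_trans (outer_measureU2 _ _ _) _; apply: leeD2l; exact: outer_bigsetU.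
have MB : (M B <= (beta * h ^+ m)%:E)%E.
 apply: le_trans (hdelta_le_gauge _ _ _) _.
 apply: le_trans (@hausdorff_gauge_le _ _ _ _ h _ _ _ _) _.
 - exact: ltW.
 - by rewrite (le_trans hh0) // ler_pdivrMr // ler_peMr ?ler1n // ltW.
 - move=> x y; rewrite /B /eball /= => hx hy.
  have -> : x - y = (x - cc) - (y - cc) by rewrite opprB addrA subrK.
  rewrite (le_trans (ler_enormD _ _)) // enormN (splitr h) lerD //.
 - by rewrite exprMn exprVn mulrA mulrAC.
have Mz : (\sum_(z | ~~ inB z) M (sc z) <= (#|[pred z | ~~ inB z]|%:R * (C * k ^+ m))%:E)%E.
 apply: (@le_trans _ _ (\sum_(z | ~~ inB z) (C * k ^+ m)%:E)%E).
  by apply: lee_sum => z _; exact: PC.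
 by rewrite sumEFin sumr_const mulr_natl.
apply: le_trans (leeD MB Mz) _; rewrite lee_fin.
have Ecard : #|[pred z | ~~ inB z]|%:R = N%:R ^+ m - #|[pred z | inB z]|%:R :> R.
 have := cardC [pred z | inB z]; rewrite card_ffun !card_ord => h1.
 by rewrite -natrX -h1 natrD addrAC subrr add0r.
have hr1 : beta - e' < om * (2^-1 + -1 * (m%:R / N%:R)) ^+ m.
 apply: hr; rewrite /ball /= sub0r normrN ger0_norm //.
have inn2 : (beta - e') * h ^+ m <= #|[pred z | inB z]|%:R * k ^+ m.
 apply: le_trans inn; rewrite rB exprMn mulrCA [leRHS]mulrC ler_wpM2r ?exprn_ge0 // ltW //.
rewrite Ecard.
have -> : (N%:R ^+ m - #|[pred z | inB z]|%:R) * (C * k ^+ m) =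
  C * (h ^+ m - #|[pred z | inB z]|%:R * k ^+ m) by rewrite -EN; ring.
have Ce : C * e' <= e.
 rewrite mulrA ler_pdivrMr ?ltr_wpDl // mulrC mulrDr mulr1 lerDl ltW //.
have hm0 : 0 <= h ^+ m by rewrite exprn_ge0 // ltW.
have := ler_wpM2l C0 inn2; have := ler_wpM2r hm0 Ce.
lra.
Qed.

Let P_1 t : 0 < t -> P (1 + t).
move=> t0; pose S := [set C | 0 <= C /\ P C].
have S0 : S (om * (m%:R / 2) ^+ m).
 by split; [rewrite mulr_ge0 ?ball_volume_ge0 // exprn_ge0 // divr_ge0 // ltW|exact: P_crude].
have hS : has_inf S by split; [exists (om * (m%:R / 2) ^+ m)|exists 0 => x []].
have b0 := beta_gt0.
(* Improving a nearly optimal constant cannot beat the infimum; letting [e] vanish leaves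
   [inf S * beta <= beta]. *)
have key e : 0 < e -> inf S * beta <= beta + 2 * e.
 move=> e0; have [C [C0 PC] Ce] := inf_adherent e0 hS.
 have : inf S <= beta + C * (1 - beta) + e.
  apply: ge_inf; first by case: hS.
  split; last exact: P_step.
  have : 0 <= C * (1 - beta) by apply: mulr_ge0 => //; rewrite subr_ge0.
  lra.
 have : (C - (inf S + e)) * (1 - beta) <= 0.
  by rewrite mulr_le0_ge0 ?subr_ge0 // subr_le0 ltW.
 nra.
have i1 : inf S <= 1.
 rewrite -(ler_pM2r b0); apply/ler_addgt0Pr => e e0.
 have e20 : 0 < e / 2 by lra.
 by have := key _ e20; lra.
have [C [C0 PC] Ct] := inf_adherent t0 hS.
move=> a h hh hh0; apply: le_trans (PC a h hh hh0) _.
by rewrite lee_fin ler_wpM2r ?exprn_ge0 ?ltW // (lt_le_trans Ct) // lerD2r.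
Qed.

Let hdelta_cub a h : 0 < h -> h <= h0 -> (M (cub a h) <= (h ^+ m)%:E)%E.
move=> hh hh0; have hm : 0 < h ^+ m by rewrite exprn_gt0.
apply/lee_addgt0Pr => e e0.
have e1 : 0 < e / h ^+ m by rewrite divr_gt0.
apply: le_trans (P_1 e1 a hh hh0) _.
by rewrite mulrDl mul1r divfK // gt_eqF.
Qed.

(** From cubes to boxes: the grid cubes that meet a box lie in the box enlarged by the mesh [p],
    whose volume is continuous in [p]. From boxes to sets: a nearly optimal cover. *)
Lemma hdelta_le_leb (A : set E) : (M A <= L A)%E.
have [->|] := eqVneq (L A) +oo%E; first by rewrite leey.
rewrite -ltey => Aoo; apply/lee_addgt0Pr => e e0.
have [l [u [lu Ac hs]]] := leb_box_cover Aoo e0.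
apply: le_trans hs; apply: le_trans (le_outer_measure M _ _ Ac) _.
apply: le_trans (outer_measure_sigma_subadditive M _) _.
apply: lee_nneseries => [k _ _|k _]; first exact: outer_measure_ge0.
move: (l k) (u k) (lu k) => a b ab {l u lu Ac A Aoo}.
have [r hr] : exists r, forall x, box a b x -> enorm x <= r.
 exists (m%:R * \sum_i (`|a ord0 i| + `|b ord0 i|)) => x hx; apply: enorm_le_coord => i.
 rewrite (bigD1 i) //= (@le_trans _ _ (`|a ord0 i| + `|b ord0 i|)) //; last first.
  by rewrite lerDl sumr_ge0 => *.
 have /andP[h1 h2] := hx i; rewrite ler_norml; apply/andP; split.
  have := ler_norm (- a ord0 i); rewrite normrN; have := normr_ge0 (b ord0 i); lra.
 have := ler_norm (b ord0 i); have := normr_ge0 (a ord0 i); lra.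
pose f (p : R) := \prod_(i < m) (b ord0 i - a ord0 i + 2 * p).
have H p : 0 < p -> p < h0 -> (M (box a b) <= (f p)%:E)%E.
 move=> p0 ph.
 apply: (@le_trans _ _ (L (box (a - const_mx p) (b + const_mx p)))); last first.
  rewrite leb_box => [|i]; last by rewrite !mxE; have := ab i; lra.
  by apply: ler_prod => i; rewrite !mxE; have := ab i; lra.
 apply: le_trans (gseq_le_leb p0 hr _); last first.
  move=> z [x [zx hx]] y zy i; have := hx i; have := zx i; have := zy i; rewrite !mxE.
  lra.
 apply: (@le_trans _ _ (M (\big[setU/set0]_(z <- gseq p (box a b)) cube p z))).
  apply: le_outer_measure => x; rewrite -bigcup_seq.
  exists [ffun i => grid p x i] => /=.
   apply/(mem_gseq _ p0 hr); exists x; split => //.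
   by apply/cube_grid => //; apply/funext => i; rewrite ffunE.
  by apply/cube_grid => //; apply/funext => i; rewrite ffunE.
 apply: le_trans (outer_bigsetU _ _ _ _) _.
 apply: (@le_trans _ _ (\sum_(z <- gseq p (box a b)) (p ^+ m)%:E)%E).
  by apply: lee_sum => z _; rewrite cubeE; apply: hdelta_cub => //; exact: ltW.
 by rewrite sumEFin big_const_seq iter_addr_0 mulr_natl.
have fM : M (box a b) \is a fin_num.
 rewrite ge0_fin_numE ?outer_measure_ge0 //.
 have h20 : 0 < h0 / 2 by rewrite divr_gt0.
 by apply: le_lt_trans (H _ h20 _) (ltry _); rewrite half_lt.
have -> : vol a b = f 0 by rewrite /f; apply: eq_bigr => i; rewrite mulr0 addr0.
apply: (@le_trans _ _ (fine (M (box a b)))%:E); first by rewrite fineK.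
apply: (@le_at_right0 _ _ h0) => //.
 apply: prod_continuous => i x; apply: cvgD; first exact: cvg_cst.
 by apply: cvgMl_tmp.
by move=> p p0 ph; rewrite -lee_fin fineK // H.
Qed.

End filling.

Lemma hausdorff_leb (R : realType) (d : nat) (A : set 'rV[R]_d.+1) :
 hausdorff_outer d.+1 A = lebesgue_outer A.
apply/eqP; rewrite eq_le leb_le_hausdorff andbT.
by apply: ge_ereal_sup => _ [delta d0 <-]; exact: hdelta_le_leb.
Qed.

(** * Relative continuity and the measurable sets of Hausdorff measure *)

Section contin_on.
Context {R : realType} {d : nat}.
Local Notation E := 'rV[R]_d.+1.

(** Continuity of the restriction to [D]. The outer normal has a meaning on the boundary only, and
    [Du] on the closure of the domain only, so values elsewhere must not enter. *)
Definition contin_on (D : set E) (f : E -> R) := forall x, D x -> forall e, 0 < e ->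
 exists2 r, 0 < r & forall y, D y -> enorm (y - x) < r -> `|f y - f x| < e.

Lemma contin_on_measurable (mu : {outer_measure set E -> \bar R}) (D : set E) (f : E -> R) :
 (forall (i : 'I_d.+1) (c : R), mu.-caratheodory [set x | x ord0 i < c]) ->
 contin_on D f -> measurable_fun (D : set (caratheodory_type mu)) f.
move=> hmu cf mD; apply: (measurability _ (RGenOInfty.measurableE R)) => //.
move=> _ [_ [c ->] <-].
pose U := [set y : E | exists x r, [/\ enorm (y - x) < r &
  forall z, D z -> enorm (z - x) < r -> c < f z]].
have -> : D `&` f @^-1` `]c, +oo[%classic = D `&` U.
 apply/seteqP; split=> x [Dx /=]; rewrite ?in_itv /= ?andbT.
  move=> cx; split => //; have e0 : 0 < f x - c by rewrite subr_gt0.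
  have [r r0 hr] := cf _ Dx _ e0; exists x, r; rewrite subrr enorm0; split => // z Dz.
  by have := hr _ Dz; rewrite ltr_norml; lra.
 by move=> [y [r [xy h]]]; split => //=; exact: h.
apply: measurableI => //; apply: open_caratheodory => //.
rewrite openE => y [x [r [yx h]]]; apply/nbhs_enormP; exists (r - enorm (y - x)).
 lra.
move=> z; exists x, r.
have -> : z - x = (z - y) + (y - x) by rewrite addrA subrK.
by rewrite (le_lt_trans (ler_enormD _ _)) // -ltrBrDr.
Qed.

End contin_on.

Section metric.
Context {R : realType} {d : nat} (s : nat).
Local Notation E := 'rV[R]_d.+1.
Local Notation H := (@hausdorff_outer R d.+1 s).
Variable g : E -> R.
Hypothesis g_lip : forall x y, g x - g y <= enorm (x - y).

Lemma hdelta_anti (A : set E) (a b : R) : a <= b -> (hdelta s b A <= hdelta s a A)%E.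
move=> ab; apply: le_method1_cover => B AB; apply: le_trans (method1_le_cover _ AB) _.
apply: lee_nneseries => [k _ _|k _]; first exact: hausdorff_gauge_ge0.
have [->|] := eqVneq (hausdorff_gauge s a (B k)) +oo%E; first by rewrite leey.
rewrite -ltey => /hausdorff_gauge_fin[->|[D [D0 Da hD ->]]].
 by rewrite !hausdorff_gauge0.
by apply: hausdorff_gauge_le => //; exact: le_trans ab.
Qed.

(** At a scale below the gap [a - b] no set of a cover can meet both [A] and [B], so the cover
    splits into a cover of each. *)
Lemma hausdorff_separated (A B : set E) (a b : R) : b < a ->
 (forall x, A x -> a <= g x) -> (forall x, B x -> g x <= b) ->
 (H A + H B <= H (A `|` B))%E.
move=> ba gA gB.
have sep delta : 0 < delta -> delta < a - b ->
  (hdelta s delta A + hdelta s delta B <= hdelta s delta (A `|` B))%E.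
 move=> d0 dab; apply: le_method1_cover => C ABC.
 pose F (X : set E) k := if `[< C k `&` X !=set0 >] then C k else set0.
 have cF X : X `<=` A `|` B -> X `<=` \bigcup_k F X k.
  move=> XAB x Xx; have [k _ Cx] := ABC _ (XAB _ Xx); exists k => //.
  by rewrite /F asboolT //; exists x.
 have h1 := method1_le_cover (hausdorff_gauge s delta) (cF A (@subsetUl _ A B)).
 have h2 := method1_le_cover (hausdorff_gauge s delta) (cF B (@subsetUr _ A B)).
 apply: le_trans (leeD h1 h2) _.
 rewrite -nneseriesD; [|by move=> *; exact: hausdorff_gauge_ge0|by move=> *; exact: hausdorff_gauge_ge0].
 apply: lee_nneseries => [k _ _|k _]; first by rewrite adde_ge0 // hausdorff_gauge_ge0.
 have g0 := hausdorff_gauge_ge0 s.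
 rewrite /F; case: asboolP => [[x [Cx Ax]]|_]; case: asboolP => [[y [Cy By]]|_];
  rewrite ?hausdorff_gauge0 ?adde0 ?add0e //.
 have [->|] := eqVneq (hausdorff_gauge s delta (C k)) +oo%E; first by rewrite leey.
 rewrite -ltey => /hausdorff_gauge_fin[C0|[D [D0 Da hD _]]]; first by move: Cx; rewrite C0.
 by exfalso; have := hD _ _ Cx Cy; have := g_lip x y; have := gA _ Ax; have := gB _ By; lra.
have [fU|] := eqVneq (H (A `|` B)) +oo%E; first by rewrite [leRHS](fU : _ = _) leey.
rewrite -ltey => fU.
have fA : H A \is a fin_num.
 by rewrite ge0_fin_numE ?outer_measure_ge0 // (le_lt_trans _ fU) // le_outer_measure.
have fB : H B \is a fin_num.
 by rewrite ge0_fin_numE ?outer_measure_ge0 // (le_lt_trans _ fU) // le_outer_measure.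
apply/lee_addgt0Pr => e e0.
have e20 : 0 < e / 2 by lra.
have [_ [d1 /= d10 <-] h1] := ub_ereal_sup_adherent e20 fA.
have [_ [d2 /= d20 <-] h2] := ub_ereal_sup_adherent e20 fB.
pose d3 := Num.min (Num.min d1 d2) ((a - b) / 2).
have d3ab : d3 < a - b by rewrite gt_min; lra.
have d30 : 0 < d3 by rewrite !lt_min; lra.
have d31 : d3 <= d1 by rewrite !ge_min lexx.
have d32 : d3 <= d2 by rewrite !ge_min lexx orbT.
have h3 : (hdelta s d3 (A `|` B) <= H (A `|` B))%E by apply: ereal_sup_ubound; exists d3.
have k1 := lt_le_trans h1 (hdelta_anti A d31).
have k2 := lt_le_trans h2 (hdelta_anti B d32).
apply: le_trans (leeD2r _ h3); apply: le_trans (leeD2r _ (sep _ d30 d3ab)).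
rewrite (splitr e) EFinD addeACA.
by apply: leeD; rewrite -leeBlDr // ltW.
Qed.

Let r (k : nat) : R := k.+1%:R^-1.
Let r_dec j k : (j < k)%N -> r k < r j.
by rewrite ltf_pV2 ?posrE // ltr_nat. Qed.

(** Carathéodory's criterion for metric outer measures. The part of [X] outside the set is exhausted
    by the sets [A n], at positive distance from it, and what is left over is a tail of thin shells
    whose measures form a convergent series. *)
Lemma hausdorff_caratheodory : H.-caratheodory [set x | g x <= 0].
apply: le_caratheodory_measurable => X.
have [XE|] := eqVneq (H X) +oo%E; first by rewrite [leRHS](XE : _ = _) leey.
rewrite -ltey => Xoo.
pose A k := X `&` [set x | r k <= g x].
pose S k := X `&` [set x | r k.+1 <= g x < r k].
(* Consecutive shells touch, but shells of equal parity are separated; hence the sums over even and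
   over odd indices are each bounded by the measure of [X]. *)
have sums b N : (\sum_(0 <= j < N) H (S (2 * j + b)%N) <= H X)%E.
 have : (\sum_(0 <= j < N) H (S (2 * j + b)%N) <= H (A (2 * N + b).-1))%E.
  elim: N => [|N IH]; first by rewrite big_geq // outer_measure_ge0.
  have -> : (2 * N.+1 + b).-1 = (2 * N + b).+1 by lia.
  rewrite big_nat_recr //=.
  case: N IH => [|N] IH.
   rewrite big_geq // add0e; apply: le_outer_measure => x [Xx /andP[h _]]; split => //.
  apply: le_trans (leeD2r _ IH) _.
  apply: le_trans (@hausdorff_separated _ _ (r (2 * N.+1 + b).-1) (r (2 * N.+1 + b)) _ _ _) _.
  - by apply: r_dec.
  - by move=> x [].
  - by move=> x [_ /andP[_ /ltW]].
  apply: le_outer_measure => x [[Xx h]|[Xx /andP[h _]]]; split => //.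
  by apply: le_trans h; apply/ltW/r_dec.
 by move=> /le_trans; apply; apply: le_outer_measure => x [].
have evenodd N : (\sum_(0 <= k < 2 * N) H (S k) =
  \sum_(0 <= j < N) H (S (2 * j + 0)%N) + \sum_(0 <= j < N) H (S (2 * j + 1)%N))%E.
 rewrite -big_split; elim: N => [|N IH]; first by rewrite !big_geq.
 have -> : (2 * N.+1 = (2 * N).+2)%N by lia.
 by rewrite !big_nat_recr //= addn0 addn1 IH addeA.
have tot : (\sum_(0 <= k <oo) H (S k) < +oo)%E.
 apply: (@le_lt_trans _ _ (H X + H X)); last by rewrite lte_add_pinfty.
 apply: lime_le; first by apply: is_cvg_nneseries => *; exact: outer_measure_ge0.
 near=> N.
 apply: (@le_trans _ _ (\sum_(0 <= k < 2 * N) H (S k))%E).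
  have NN : (N <= 2 * N)%N by lia.
  rewrite [leRHS](@big_cat_nat _ _ _ N) //= leeDl //; apply: sume_ge0 => *; exact: outer_measure_ge0.
 apply: le_trans (leeD (sums 0%N N) (sums 1%N N)).
 by rewrite evenodd.
have tail : (\sum_(n <= k <oo) H (S k))%E @[n --> \oo] --> 0%E.
 by apply: nneseries_tail_cvg => // *; exact: outer_measure_ge0.
pose S0 := [set x | g x <= 0].
have main n : (H (X `&` S0) + H (X `&` ~` S0)
  <= H X + \sum_(n <= k <oo) H (S k))%E.
 apply: (@le_trans _ _ (H (X `&` S0) + (H (A n) + \sum_(n <= k <oo) H (S k)))%E).
  apply: leeD2l; apply: (@le_trans _ _ (H (A n `|` \bigcup_(k >= n) S k))).
   apply: le_outer_measure => x [Xx /= /negP]; rewrite -ltNge => gx.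
   have [h|h] := leP (r n) (g x); first by left.
   right; have [k kx] : exists k, r k <= g x.
    have [k _ hk] := near_infty_natSinv_lt (PosNum gx).
    by exists k; apply/ltW/(hk k (leqnn k)).
   have r_anti i j : (i <= j)%N -> r j <= r i.
    by rewrite leq_eqVlt => /orP[/eqP -> //|/r_dec/ltW].
   elim: k kx => [|k IH] kx; first by move: (lt_le_trans h (r_anti _ _ (leq0n n))); rewrite ltNge kx.
   have [/IH //|kx2] := leP (r k) (g x).
   exists k => //=; last by split => //=; rewrite kx.
   rewrite leqNgt; apply/negP => kn.
   by move: (lt_le_trans h (r_anti _ _ kn)); rewrite ltNge kx.
  apply: le_trans (outer_measureU2 _ _ _) _; apply: leeD2l.
  have -> : [set k | (n <= k)%N] = ~` `I_n by apply/seteqP; split => k; [move=> h /=; apply/negP; rewrite -leqNgt|move/negP; rewrite -leqNgt].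
  exact: outer_measure_sigma_subadditive_tail.
 rewrite addeA; apply: leeD2r.
 rewrite addeC; apply: le_trans (@hausdorff_separated _ _ (r n) 0 _ _ _) _.
 - by rewrite /r.
 - by move=> x [].
 - by move=> x [].
 by apply: le_outer_measure => x [[]|[]].
have cv : (fun n => H X + \sum_(n <= k <oo) H (S k))%E @ \oo --> (H X + 0)%E.
 apply: cvgeD => //; [|exact: cvg_cst].
 by apply: fin_num_adde_defl.
rewrite -[leRHS]adde0; apply: (cvge_to_ge cv); apply: nearW => n.
Unshelve. all: by end_near. Qed.

End metric.

Lemma hausdorff_halfspace (R : realType) (d s : nat) (i : 'I_d.+1) (c : R) :
 (@hausdorff_outer R d.+1 s).-caratheodory [set x : 'rV[R]_d.+1 | x ord0 i < c].
have -> : [set x : 'rV[R]_d.+1 | x ord0 i < c] = ~` [set x : 'rV[R]_d.+1 | c - x ord0 i <= 0].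
 by apply/seteqP; split => x /=; rewrite subr_le0 => h; [apply/negP; rewrite -ltNge|rewrite ltNge; exact/negP].
apply: caratheodory_measurable_setC; apply: hausdorff_caratheodory => x y.
have := coord_le_enorm (y - x) i; rewrite enormB !mxE ler_norml; lra.
Qed.

(** * Differential calculus in several variables *)

Section fdiff.
Context {R : realType} {d : nat}.
Local Notation E := 'rV[R]_d.
Implicit Types (f : E -> R) (x G : E).

(** Differentiability at [x] with gradient [G], in the Euclidean norm. It is the form in which
    remainders are estimated; [diff_fdiff] and [fdiff_diff] translate it to and from the
    differential for the sup norm. *)
Definition fdiff f x G := forall e, 0 < e -> exists2 r, 0 < r &
 forall y, enorm (y - x) < r -> `|f y - f x - dot G (y - x)| <= e * enorm (y - x).

Lemma normr_le_enorm x : `|x| <= enorm x.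
rewrite [leLHS]/Num.Def.normr /= mx_normrE; apply: bigmax_le => [|[i j] _ /=].
 exact: enorm_ge0.
by rewrite (ord1 i) coord_le_enorm.
Qed.

Lemma coord_le_normr x i : `|x ord0 i| <= `|x|.
by rewrite [leRHS]/Num.Def.normr /= mx_normrE; exact: (le_bigmax _ _ (ord0, i)). Qed.

Lemma enorm_le_normr x : enorm x <= d%:R * `|x|.
by apply: enorm_le_coord => i; exact: coord_le_normr. Qed.

Lemma diff_grad f x (h : E) : differentiable f x -> 'd f x h = dot (grad f x) h.
move=> df; rewrite {1}(row_sum_delta h) linear_sum; apply: eq_bigr => i.
by rewrite linearZ mxE /partial deriveE // mulrC.
Qed.

Lemma diff_fdiff f x : differentiable f x -> fdiff f x (grad f x).
move=> df e e0; have /eqaddoP h := diff_locally df.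
have e1 : 0 < e by [].
have /nbhs_enormP[r r0 hr] := h _ e1.
exists r => // y yx; have := hr (y - x); rewrite subr0 => /(_ yx).
rewrite -[X in X <= _ -> _]/(`|f (y - x + x) - (f x + 'd f x (y - x))|) subrK diff_grad //.
rewrite opprD addrA => /le_trans; apply.
by rewrite ler_wpM2l ?normr_le_enorm // ltW.
Qed.

Definition dotl G := fun h : E => dot G h : R^o.

Fact dotl_is_linear G : linear (dotl G).
by move=> a u v; rewrite /dotl dotDr dotZr. Qed.
HB.instance Definition _ G := GRing.isLinear.Build R E R^o _ (dotl G) (dotl_is_linear G).

Lemma dot_continuous G : continuous (fun h : E => dot G h).
move=> x; apply/cont_enormP => e.
have : 0 < enorm G + 1 by rewrite ltr_wpDl ?enorm_ge0.
exists (e / (enorm G + 1)) => [|y]; first by rewrite divr_gt0.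
rewrite ltr_pdivlMr // => h; rewrite -[dot G x - _]opprB normrN.
have -> : dot G y - dot G x = dot G (y - x) by rewrite dotDr dotNr.
apply: le_lt_trans (norm_dot_le _ _) _; apply: le_lt_trans h.
by rewrite mulrC ler_wpM2l ?enorm_ge0 // lerDl.
Qed.

Lemma fdiff_diff f x G : fdiff f x G -> differentiable f x /\ grad f x = G.
move=> h.
have cd : continuous (dotl G : E -> R^o) by exact: dot_continuous.
have loc : f \o shift x = cst (f x) + (dotl G : E -> R) +o_ (0 : E) id.
 apply/eqaddoP => e e0.
 have ed : 0 < e / d.+1%:R by rewrite divr_gt0.
 have [r r0 hr] := h _ ed; apply/nbhs_enormP; exists r => // y; rewrite subr0 => yr.
 have := hr (y + x); rewrite addrK => /(_ yr).
 rewrite opprD addrA => /le_trans; apply.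
 apply: (@le_trans _ _ (e / d.+1%:R * (d%:R * `|y|))).
  by rewrite ler_wpM2l ?enorm_le_normr // ltW.
 rewrite -mulrA; apply: ler_wpM2l; first exact: ltW.
 by rewrite mulrA ler_piMl // mulrC ler_pdivrMr // mul1r ler_nat.
have dE : 'd f x = (dotl G : E -> R) :> (E -> R) by exact: diff_unique.
have : differentiable f x by apply/diff_locallyP; rewrite dE.
split=> //; apply/rowP => i; rewrite mxE /partial deriveE // dE /dotl /dot.
rewrite (bigD1 i) //= !mxE !eqxx mulr1 big1 ?addr0 // => j ji.
by rewrite !mxE (negbTE ji) mulr0.
Qed.

Lemma fdiff_ext f g x G r : 0 < r -> (forall y, enorm (y - x) < r -> f y = g y) ->
 fdiff f x G -> fdiff g x G.
move=> r0 fg h e e0; have [s s0 hs] := h e e0.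
exists (Num.min r s) => [|y]; first by rewrite lt_min r0.
rewrite lt_min => /andP[yr ys]; rewrite -!fg ?hs // subrr enorm0 //.
Qed.

Lemma partialD f g x i : differentiable f x -> differentiable g x ->
 partial i (f \+ g) x = partial i f x + partial i g x.
by move=> df dg; rewrite /partial deriveD //; exact: diff_derivable. Qed.

Lemma partialM f g x i : differentiable f x -> differentiable g x ->
 partial i (f \* g) x = f x * partial i g x + g x * partial i f x.
by move=> df dg; rewrite /partial deriveM //; exact: diff_derivable. Qed.

Lemma partial_cst (c : R) x i : partial i (cst c) x = 0.
exact: derive_cst. Qed.

Lemma fdiff_coord x j : fdiff (fun y => y ord0 j) x (delta_mx ord0 j).
exists 1 => // y.
have -> : dot (delta_mx ord0 j) (y - x) = y ord0 j - x ord0 j.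
 rewrite /dot (bigD1 j) //= !mxE !eqxx mul1r big1 ?addr0 // => k kj.
 by rewrite !mxE (negbTE kj) mul0r.
by rewrite subrr normr0 mulr_ge0 ?enorm_ge0 // ltW.
Qed.

Lemma partial_coord j x i : partial i (fun y => y ord0 j) x = (i == j)%:R.
have [_ /rowP/(_ i)] := fdiff_diff (fdiff_coord x j).
by rewrite !mxE.
Qed.

Lemma partial_near f g x i : (\near x, f x = g x) -> partial i f x = partial i g x.
exact: near_eq_derive. Qed.

Lemma differentiable_near f g x : (\near x, f x = g x) -> differentiable f x -> differentiable g x.
move=> /nbhs_enormP[r r0 hr] /diff_fdiff /(fdiff_ext r0 hr).
by move=> /fdiff_diff[].
Qed.

Lemma differentiable_comp1 (h : R -> R) f x (dh : R) : is_derive (f x) 1 h dh ->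
 differentiable f x -> differentiable (h \o f) x.
move=> [hd _] df; apply: differentiable_comp => //; exact/derivable1_diffP.
Qed.

Lemma partial_comp1 (h : R -> R) f x i (dh : R) : is_derive (f x) 1 h dh -> differentiable f x ->
 differentiable (h \o f) x /\ partial i (h \o f) x = dh * partial i f x.
move=> [hd <-] df; have dh' : differentiable h (f x) by apply/derivable1_diffP.
have dc := differentiable_comp df dh'.
rewrite /partial (deriveE _ dc) (deriveE _ df) diff_comp //=.
by rewrite (diff1E dh') derive1E [LHS]mulrC.
Qed.

End fdiff.

Lemma differentiable_row (R : realType) (m d : nat) (f : 'rV[R]_d -> 'rV[R]_m) x :
 (forall j, differentiable (fun y => f y ord0 j) x) -> differentiable f x.
move=> df.
have -> : f = \sum_(j < m) (fun y => f y ord0 j *: delta_mx ord0 j).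
 apply/funext => y; rewrite fct_sumE {1}(row_sum_delta (f y)).
 by [].
by apply: differentiable_sum => j; apply: differentiableZl.
Qed.

Lemma partial_comp (R : realType) (m d : nat) (f : 'rV[R]_d -> 'rV[R]_m) (g : 'rV[R]_m -> R) x i :
 (forall j, differentiable (fun y => f y ord0 j) x) -> differentiable g (f x) ->
 differentiable (g \o f) x /\
 partial i (g \o f) x = \sum_(j < m) partial j g (f x) * partial i (fun y => f y ord0 j) x.
move=> df; have dF := differentiable_row df; split; first exact: differentiable_comp.
rewrite /partial deriveE; last exact: differentiable_comp.
rewrite diff_comp //= -(deriveE _ dF) derive_mx; last exact: diff_derivable.
rewrite diff_grad //; apply: eq_bigr => j.
by rewrite !mxE.
Qed.

Section Ck.
Context {R : realType} {d : nat}.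
Local Notation E := 'rV[R]_d.
Implicit Types (f g : E -> R) (U V : set E).

Lemma Ck_S k U f : Ck k.+1 U f -> Ck k U f.
elim: k f => [|k IH] f [df hf]; first by move=> x /df /differentiable_continuous.
by split=> // i; exact: (IH _ (hf i)).
Qed.

Lemma Ck_sub k U V f : V `<=` U -> Ck k U f -> Ck k V f.
move=> VU; elim: k f => [|k IH] f; first by move=> h x /VU /h.
by move=> [h1 h2]; split => [x Vx|i]; [exact/h1/VU|exact: (IH _ (h2 i))].
Qed.

Lemma Ck_ext k U f g : open U -> (forall x, U x -> f x = g x) -> Ck k U f -> Ck k U g.
move=> oU; have nearU x : U x -> nbhs x U by move=> Ux; exact: open_nbhs_nbhs.
elim: k f g => [|k IH] f g fg.
 move=> h x Ux; apply/cont_enormP => e e0.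
 have [r r0 hr] := (cont_enormP f x).1 (h x Ux) e e0.
 have [s s0 hs] := (nbhs_enormP x U).1 (nearU _ Ux).
 exists (Num.min r s) => [|y]; first by rewrite lt_min r0.
 by rewrite lt_min => /andP[yr ys]; rewrite -!fg ?hr //; exact: hs.
have near_fg x : U x -> \near x, f x = g x.
 by move=> /nearU; apply: filterS => y /fg.
move=> [h1 h2]; split=> [x Ux|i].
 exact: (differentiable_near (near_fg _ Ux) (h1 _ Ux)).
by apply: IH (h2 i) => x Ux; exact: partial_near (near_fg _ Ux).
Qed.

Lemma Ck_cst k U c : Ck k U (cst c).
elim: k c => [|k IH] c; first by move=> x _; exact: cst_continuous.
split=> [x _|i]; first exact: differentiable_cst.
have -> : partial i (cst c) = 0 :> (E -> R) by apply/funext => x; rewrite partial_cst.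
exact: IH.
Qed.

Lemma Ck_coord k U j : Ck k U (fun y : E => y ord0 j).
have df (x : E) : differentiable (fun y : E => y ord0 j) x := (fdiff_diff (fdiff_coord x j)).1.
case: k => [|k]; first by move=> x _; exact: differentiable_continuous.
split=> [x _|i]; first exact: df.
have -> : partial i (fun y => y ord0 j) = cst (i == j)%:R :> (E -> R).
 by apply/funext => x; rewrite partial_coord.
exact: Ck_cst.
Qed.

Lemma Ck_D k U f g : open U -> Ck k U f -> Ck k U g -> Ck k U (f \+ g).
move=> oU; elim: k f g => [|k IH] f g; first by move=> h1 h2 x Ux; apply: (@continuousD _ _ _ f g x (h1 x Ux) (h2 x Ux)).
move=> [h1 h2] [h3 h4]; split=> [x Ux|i]; first by apply: differentiableD; [exact: h1|exact: h3].
apply: Ck_ext (IH _ _ (h2 i) (h4 i)) => // x Ux.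
by rewrite partialD; [|exact: h1|exact: h3].
Qed.

Lemma Ck_M k U f g : open U -> Ck k U f -> Ck k U g -> Ck k U (f \* g).
move=> oU; elim: k f g => [|k IH] f g; first by move=> h1 h2 x Ux; apply: (@continuousM _ _ f g x (h1 x Ux) (h2 x Ux)).
move=> cf cg; have [h1 h2] := cf; have [h3 h4] := cg.
split=> [x Ux|i]; first by apply: differentiableM; [exact: h1|exact: h3].
have := Ck_D oU (IH _ _ (Ck_S cf) (h4 i)) (IH _ _ (Ck_S cg) (h2 i)).
apply: Ck_ext => // x Ux.
by rewrite partialM; [|exact: h1|exact: h3].
Qed.

Lemma Ck_sum k U (I : Type) (r : seq I) (F : I -> E -> R) : open U ->
 (forall i, Ck k U (F i)) -> Ck k U (fun x => \sum_(i <- r) F i x).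
move=> oU h; elim: r => [|i r IH].
 apply: Ck_ext (Ck_cst k U 0) => // x; by rewrite big_nil.
by apply: Ck_ext (Ck_D oU (h i) IH) => // x; rewrite big_cons.
Qed.

Lemma Ck_V k U f : open U -> (forall x, U x -> f x != 0) -> Ck k U f ->
 Ck k U (fun x => (f x)^-1).
move=> oU f0; elim: k f f0 => [|k IH] f f0.
 by move=> h x Ux; apply: (@continuousV _ _ f x (f0 x Ux) (h x Ux)).
move=> cf; have [h1 h2] := cf.
have hd x : U x -> is_derive (f x) 1 GRing.inv (- (f x) ^- 2).
 move=> Ux; apply: DeriveDef; first by apply: derivableV => //; exact: f0.
 by rewrite deriveV ?derive_id ?f0 // [_ *: 1]mulr1.
split=> [x Ux|i]; first exact: (differentiable_comp1 (hd x Ux) (h1 x Ux)).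
have cI := IH f f0 (Ck_S cf).
have := Ck_M oU (Ck_M oU (Ck_cst k U (-1)) (Ck_M oU cI cI)) (h2 i).
apply: Ck_ext => // x Ux; have [_] := partial_comp1 i (hd x Ux) (h1 x Ux).
by rewrite /= mulN1r -expr2 exprVn.
Qed.

End Ck.

Lemma Ck_comp (R : realType) (m d k : nat) (U : set 'rV[R]_d) (V : set 'rV[R]_m)
  (f : 'rV[R]_d -> 'rV[R]_m) (g : 'rV[R]_m -> R) :
 open U -> (forall x, U x -> V (f x)) ->
 (forall j, Ck k U (fun y => f y ord0 j)) -> Ck k V g -> Ck k U (g \o f).
move=> oU UV; elim: k g => [|k IH] g cf.
 move=> cg x Ux; have := cg _ (UV _ Ux).
 apply: (@continuous_comp _ _ _ f g) => //.
 move=> A /nbhs_enormP[r r0 hr].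
 have rm : 0 < r / m.+1%:R by rewrite divr_gt0.
 have H : \forall y \near x, forall j, `|f x ord0 j - f y ord0 j| < r / m.+1%:R.
  apply: (@filter_forall _ _ (fun (j : 'I_m) (y : 'rV[R]_d) => `|f x ord0 j - f y ord0 j| < r / m.+1%:R) (nbhs x) (nbhs_filter x)) => j; apply/nbhs_enormP.
  exact: ((cont_enormP (fun y => f y ord0 j) x).1 (cf j x Ux) _ rm).
 apply: filterS H => y hy; apply: hr; apply: (@le_lt_trans _ _ (m%:R * (r / m.+1%:R))).
  by apply: enorm_le_coord => j; rewrite !mxE distrC ltW.
 by rewrite frac_lt.
move=> [h1 h2]; have df x j : U x -> differentiable (fun y => f y ord0 j) x by move=> /(cf j).1.
split=> [x Ux|i].
 exact: differentiable_comp (differentiable_row (fun j => df x j Ux)) (h1 _ (UV _ Ux)).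
have := Ck_sum (index_enum _) oU (fun j => Ck_M oU (IH _ (fun j => Ck_S (cf j)) (h2 j)) ((cf j).2 i)).
apply: Ck_ext => // x Ux.
by have [_ ->] := @partial_comp _ _ _ f g x i (fun j => df x j Ux) (h1 _ (UV _ Ux)).
Qed.

Section mvt.
Context {R : realType} {d : nat}.
Local Notation E := 'rV[R]_d.
Implicit Types (f g : E -> R) (U V : set E).

Lemma is_derive_line f (x v : E) (t : R) : differentiable f (x + t *: v) ->
 is_derive t 1 (fun s => f (x + s *: v)) (dot (grad f (x + t *: v)) v).
move=> df; pose ga (s : R) : E := x + s *: v.
have dg : is_derive t 1 ga v.
 have H : is_derive t 1 (fun s : R => s *: v) v.
  apply: DeriveDef; first exact/derivable1_diffP.
  by rewrite deriveE // diff_val scale1r.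
 by have := is_deriveD (is_derive_cst x t 1) H; rewrite add0r.
have dgd : differentiable ga t by [].
have dc := differentiable_comp dgd df.
apply: DeriveDef; first exact/derivable1_diffP.
rewrite deriveE // diff_comp //= -(deriveE _ dgd) (derive_val (is_derive := dg)).
exact: diff_grad.
Qed.

Lemma mvt_line f (x v : E) : (forall t, 0 <= t <= 1 -> differentiable f (x + t *: v)) ->
 exists2 t, 0 < t < 1 & f (x + v) - f x = dot (grad f (x + t *: v)) v.
move=> df.
have [||t] := @MVT R (fun s => f (x + s *: v)) (fun t => dot (grad f (x + t *: v)) v) 0 1 ltr01.
- move=> t; rewrite in_itv => /andP[t0 t1]; apply: is_derive_line; apply: df.
 by rewrite !ltW.
- apply: derivable_within_continuous => t; rewrite /= => ht.
 by case: (is_derive_line (df _ ht)).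
by rewrite scale1r scale0r addr0 subr0 mulr1 => h; exists t.
Qed.

Lemma enorm_ball_convex (x0 x y : E) r t : 0 <= t <= 1 -> enorm (x - x0) < r -> enorm (y - x0) < r ->
 enorm (x + t *: (y - x) - x0) < r.
move=> /andP[t0 t1] hx hy.
have -> : x + t *: (y - x) - x0 = (1 - t) *: (x - x0) + t *: (y - x0).
 by apply/rowP => i; rewrite !mxE; ring.
apply: le_lt_trans (ler_enormD _ _) _; rewrite !enormZ !ger0_norm ?subr_ge0 //.
have [->|tn0] := eqVneq t 0; first by rewrite subr0 mul1r mul0r addr0.
have tp : 0 < t by lra.
have : 0 <= (1 - t) * (r - enorm (x - x0)) by rewrite mulr_ge0 // subr_ge0 // ltW.
have : 0 < t * (r - enorm (y - x0)) by rewrite mulr_gt0 // subr_gt0.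
lra.
Qed.

Lemma enorm_grad_continuous U f x0 e : Ck 1 U f -> U x0 -> 0 < e ->
 exists2 r, 0 < r & forall x, enorm (x - x0) < r -> U x -> enorm (grad f x - grad f x0) < e.
move=> [_ cf] Ux e0.
have m0 : (0 : R) < d.+1%:R by [].
have em : 0 < e / d.+1%:R by rewrite divr_gt0.
have : nbhs x0 [set y | forall j, `|partial j f x0 - partial j f y| < e / d.+1%:R].
 apply: (@filter_forall _ _ (fun (j : 'I_d) (y : E) => `|partial j f x0 - partial j f y| < e / d.+1%:R)
  (nbhs x0) (nbhs_filter x0)) => j; apply/nbhs_enormP.
 exact: ((cont_enormP (partial j f) x0).1 (cf j x0 Ux) _ em).
move=> /nbhs_enormP[r r0 hr]; exists r => // x /hr hx _.
apply: (@le_lt_trans _ _ (d%:R * (e / d.+1%:R))).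
 by apply: enorm_le_coord => j; rewrite !mxE distrC ltW.
by rewrite frac_lt.
Qed.

(** The remainder is uniform in both points, not only around [x0]. This is what makes the boundary
    charts bi-Lipschitz with a constant close to one. *)
Lemma strict_diff U f x0 e : open U -> Ck 1 U f -> U x0 -> 0 < e ->
 exists2 r, 0 < r & forall x y, enorm (x - x0) < r -> enorm (y - x0) < r ->
  `|f y - f x - dot (grad f x0) (y - x)| <= e * enorm (y - x).
move=> oU cf Ux0 e0; have [r r0 hr] := enorm_grad_continuous cf Ux0 e0.
have [s s0 hs] := open_enorm oU Ux0.
exists (Num.min r s) => [|x y]; first by rewrite lt_min r0.
move=> hx hy; have hxy t : 0 <= t <= 1 -> enorm (x + t *: (y - x) - x0) < Num.min r s.
 by move=> ht; exact: enorm_ball_convex.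
have [t|t /andP[t0 t1]] := @mvt_line f x (y - x).
 by move=> /hxy; rewrite lt_min => /andP[_ /hs]; exact: cf.1.
rewrite [x + (y - x)]addrC subrK => ->; rewrite -dotNl -dotDl.
apply: le_trans (norm_dot_le _ _) _; apply: ler_wpM2r; first exact: enorm_ge0.
have : 0 <= t <= 1 by lra.
by move=> /hxy; rewrite lt_min => /andP[/hr h /hs/h/ltW].
Qed.

(** The second difference of [f] over a small square of side [h] is symmetric in the two directions,
    and two uses of the mean value theorem write it as [h ^ 2] times a value of the mixed derivative
    near [x], in either order. *)
Lemma schwarz U f x (i0 j0 : 'I_d) : open U -> Ck 2 U f -> U x ->
 partial i0 (partial j0 f) x = partial j0 (partial i0 f) x.
move=> oU c2 Ux.
have key i j e : 0 < e -> exists2 r, 0 < r & forall h, 0 < h -> h < r -> exists c,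
  `|c - partial j (partial i f) x| < e /\
  f (x + h *: delta_mx ord0 i + h *: delta_mx ord0 j) - f (x + h *: delta_mx ord0 i)
   - (f (x + h *: delta_mx ord0 j) - f x) = h ^+ 2 * c.
 move=> e0; pose ei : E := delta_mx ord0 i; pose ej : E := delta_mx ord0 j.
 have cont := (c2.2 i).2 j.
 have [r r0 hr] := (cont_enormP _ x).1 (cont x Ux) e e0.
 have [s s0 hs] := open_enorm oU Ux.
 have ne (k : 'I_d) : enorm (delta_mx ord0 k : E) <= d%:R.
  rewrite -[leRHS]mulr1; apply: enorm_le_coord => l; rewrite mxE /=.
  by case: (l == k); rewrite ?normr1 ?normr0.
 have m0 : (0 : R) < d%:R by rewrite ltr0n (leq_ltn_trans (leq0n i) (ltn_ord i)).
 pose q := Num.min r s / (2 * d%:R).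
 have q0 : 0 < q by rewrite divr_gt0 ?mulr_gt0 // lt_min r0.
 exists q => // h h0 hq.
 have close a b : 0 <= a <= 1 -> 0 <= b <= 1 ->
   enorm (x + (a * h) *: ei + (b * h) *: ej - x) < Num.min r s.
  move=> /andP[a0 a1] /andP[b0 b1]; rewrite addrAC [x + _]addrC addrK.
  apply: le_lt_trans (ler_enormD _ _) _; rewrite !enormZ.
  have ha : `|a * h| <= h by rewrite ger0_norm ?mulr_ge0 ?ger_pMl // ltW.
  have hb : `|b * h| <= h by rewrite ger0_norm ?mulr_ge0 ?ger_pMl // ltW.
  have := ler_pM (normr_ge0 _) (enorm_ge0 _) ha (ne i).
  have := ler_pM (normr_ge0 _) (enorm_ge0 _) hb (ne j).
  move: hq; rewrite ltr_pdivlMr ?mulr_gt0 //; lra.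
 have inU a b : 0 <= a <= 1 -> 0 <= b <= 1 -> U (x + (a * h) *: ei + (b * h) *: ej).
  by move=> ha hb; apply: hs; have := close a b ha hb; rewrite lt_min => /andP[].
 have z01 : 0 <= (0 : R) <= 1 by lra.
 have o01 : 0 <= (1 : R) <= 1 by lra.
 pose p y := f (y + h *: ej) - f y.
 have gd (k : E -> R) y v : differentiable k y -> 'D_v k y = dot (grad k y) v.
  by move=> dk; rewrite deriveE // diff_grad.
 have dsh y : U (y + h *: ej) -> differentiable (fun z => f (z + h *: ej)) y /\
   grad (fun z => f (z + h *: ej)) y = grad f (y + h *: ej).
  move=> Uy; apply: fdiff_diff => e1 e10.
  have [r1 r10 h1] := diff_fdiff (c2.1 _ Uy) e10.
  exists r1 => // z; have := h1 (z + h *: ej).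
  have -> : z + h *: ej - (y + h *: ej) = z - y by rewrite opprD addrACA subrr addr0.
  exact.
 have U1 t : 0 <= t <= 1 -> U (x + t *: (h *: ei)).
  by move=> ht; have := inU t 0 ht z01; rewrite mul0r scale0r addr0 scalerA.
 have U2 t : 0 <= t <= 1 -> U (x + t *: (h *: ei) + h *: ej).
  by move=> ht; have := inU t 1 ht o01; rewrite mul1r scalerA.
 have dp t : 0 <= t <= 1 -> differentiable p (x + t *: (h *: ei)).
  move=> ht; apply: differentiableB; first exact: (dsh _ (U2 _ ht)).1.
  exact: c2.1 (U1 _ ht).
 have [t /andP[t0 t1] Et] := mvt_line dp.
 have ht : 0 <= t <= 1 by lra.
 have Ep : dot (grad p (x + t *: (h *: ei))) (h *: ei) =
   h * (partial i f (x + t *: (h *: ei) + h *: ej) - partial i f (x + t *: (h *: ei))).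
  rewrite dotZr -gd; last exact: dp.
  have [d1 g1] := dsh _ (U2 _ ht); have d2 := c2.1 _ (U1 _ ht).
  have A1 : 'D_ei (fun z => f (z + h *: ej)) (x + t *: (h *: ei)) =
    partial i f (x + t *: (h *: ei) + h *: ej).
   by rewrite (gd _ _ _ d1) g1 -(gd _ _ _ (c2.1 _ (U2 _ ht))).
  rewrite -[in RHS]A1 (deriveB (diff_derivable d1) (diff_derivable d2)) //.
 have [s1 hs1 Es] := @mvt_line (partial i f) (x + t *: (h *: ei)) (h *: ej)
  (fun b hb => (c2.2 i).1 _ (eq_ind _ U (inU t b ht hb) _ (esym (f_equal2 (fun a b => x + a + b) (scalerA t h ei) (scalerA b h ej))))).
 have hs1' : 0 <= s1 <= 1 by case/andP: hs1 => *; rewrite !ltW.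
 exists (partial j (partial i f) (x + t *: (h *: ei) + s1 *: (h *: ej))); split.
  rewrite distrC; apply: hr; have := close t s1 ht hs1'; rewrite !scalerA lt_min => /andP[h1 _] //.
 rewrite Et Ep Es dotZr -mulrA.
 by rewrite -gd //; apply: (c2.2 i).1; have := inU t s1 ht hs1'; rewrite !scalerA.
apply/eqP; rewrite -subr_eq0 -normr_le0; apply/ler_addgt0Pr => e e0; rewrite add0r.
have e20 : 0 < e / 2 by lra.
have [r1 r10 h1] := key i0 j0 _ e20; have [r2 r20 h2] := key j0 i0 _ e20.
pose h := Num.min r1 r2 / 2.
have h0 : 0 < h by rewrite divr_gt0 // lt_min r10.
have hm : h < Num.min r1 r2 by rewrite ltr_pdivrMr // ltr_pMr ?ltr1n // lt_min r10.
have /andP[hr1 hr2] : (h < r1) && (h < r2) by rewrite -lt_min.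
have [c [hc Ec]] := h1 h h0 hr1; have [c' [hc' Ec']] := h2 h h0 hr2.
have cc : c = c'.
 have h20 : h ^+ 2 != 0 by rewrite expf_neq0 // gt_eqF.
 apply: (mulfI h20); rewrite -Ec -Ec'.
 rewrite [x + _ + _]addrAC; ring.
rewrite -cc in hc'; apply: ltW.
have -> : partial i0 (partial j0 f) x - partial j0 (partial i0 f) x =
  (c - partial j0 (partial i0 f) x) - (c - partial i0 (partial j0 f) x).
 by rewrite opprB [RHS]addrC addrA subrK.
apply: le_lt_trans (ler_normB _ _) _; rewrite (splitr e); exact: ltrD hc'.
Qed.

Lemma Ck_union k U V f : Ck k U f -> Ck k V f -> Ck k (U `|` V) f.
elim: k f => [|k IH] f; first by move=> h1 h2 x [/h1|/h2].
move=> [h1 h2] [h3 h4]; split=> [x [/h1|/h3] //|i]; exact: (IH _ (h2 i) (h4 i)).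
Qed.

Fixpoint ck1 (n : nat) (h : R -> R) : Prop :=
 if n is n'.+1 then exists2 h' : R -> R, (forall t : R, is_derive t (1 : R) h (h' t)) & ck1 n' h'
 else continuous h.

Lemma Ck_comp1 k U f (h : R -> R) : open U -> ck1 k h -> Ck k U f -> Ck k U (h \o f).
move=> oU; elim: k h => [|k IH] h.
 by move=> ch cf x Ux; apply: (@continuous_comp _ _ _ f h); [exact: cf|exact: ch].
move=> [h' dh ck] cf; split=> [x Ux|i]; first exact: (differentiable_comp1 (dh _) (cf.1 _ Ux)).
apply: Ck_ext (Ck_M oU (IH _ ck (Ck_S cf)) (cf.2 i)) => // x Ux.
by have [_ ->] := partial_comp1 i (dh (f x)) (cf.1 _ Ux).
Qed.

End mvt.

(** * Smooth functions that vanish on a half-line, and smooth steps *)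

Section flat.
Context {R : realType}.

(** The powers of 1/t make the family stable under differentiation up to linear combinations, so all
    its members are smooth by one induction. *)
Definition flat (k : nat) (t : R) : R := if 0 < t then t^-1 ^+ k * expR (- t^-1) else 0.

Lemma flat_ge0 k t : 0 <= flat k t.
rewrite /flat; case: ifP => // t0; rewrite mulr_ge0 // exprn_ge0 // invr_ge0 ltW //.
Qed.

Lemma flat0_gt0 t : 0 < t -> 0 < flat 0 t.
by move=> t0; rewrite /flat t0 mul1r expR_gt0. Qed.

Lemma flat_le0 k t : t <= 0 -> flat k t = 0.
by rewrite /flat leNgt; case: ifP. Qed.

(** One term of the exponential series, [y ^ (k+2) / (k+2)! <= exp y] at [y = 1/t], absorbs the
    negative power and leaves a factor [t ^ 2]; the derivative at the origin is then zero. *)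
Lemma flat_quadratic k t : `|flat k t| <= k.+2`!%:R * t ^+ 2.
rewrite /flat; case: ifP => t0; last by rewrite normr0 mulr_ge0 ?sqr_ge0.
set y := t^-1; have y0 : 0 < y by rewrite invr_gt0.
rewrite ger0_norm ?mulr_ge0 ?exprn_ge0 ?(ltW y0) // expRN.
have h : y ^+ k.+2 / k.+2`!%:R <= expR y.
 by apply: le_trans (expR_ge1Dxn k.+1 (ltW y0)); rewrite lerDr.
have h2 : t ^+ 2 * y ^+ 2 = 1 by rewrite -exprMn divff ?expr1n // gt_eqF.
rewrite ler_pdivrMr ?expR_gt0 //.
apply: (@le_trans _ _ (k.+2`!%:R * t ^+ 2 * (y ^+ k.+2 / k.+2`!%:R))); last first.
 by rewrite ler_wpM2l // mulr_ge0 ?sqr_ge0.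
rewrite le_eqVlt; apply/orP; left; apply/eqP.
have -> : y ^+ k.+2 = y ^+ k * y ^+ 2 by rewrite -exprD addn2.
transitivity (y ^+ k * (t ^+ 2 * y ^+ 2) * (k.+2`!%:R / k.+2`!%:R)); last by ring.
by rewrite h2 divff ?mulr1.
Qed.

Lemma is_derive_quadratic (h : R -> R) (C : R) :
 (forall t, `|h t| <= C * t ^+ 2) -> is_derive (0 : R) (1 : R) h 0.
move=> hC; have h0 : h 0 = 0.
 by apply/eqP; rewrite -normr_le0 (le_trans (hC 0)) // expr0n mulr0.
have C0 : 0 <= C by have := hC 1; rewrite expr1n mulr1; exact: le_trans.
have cv : (fun u : R => u^-1 *: (h (u *: (1 : R) + 0) - h 0)) @ 0^' --> (0 : R).
 apply/cvgrPdist_lt => e e0; have C1 : 0 < C + 1 by lra.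
 have ec : 0 < e / (C + 1) by rewrite divr_gt0.
 near=> u; have u0 : u != 0 by near: u; exact: nbhs_dnbhs_neq.
 rewrite h0 subr0 addr0 sub0r normrN normrM normfV [u *: 1]mulr1.
 rewrite mulrC ltr_pdivrMr ?normr_gt0 //; apply: le_lt_trans (hC u) _.
 rewrite -real_normK ?num_real // mulrA ltr_pM2r ?normr_gt0 //.
 apply: (@le_lt_trans _ _ ((C + 1) * `|u|)); first by rewrite ler_wpM2r // lerDl.
 rewrite mulrC -ltr_pdivlMr //.
 by near: u; apply: dnbhs0_lt.
by apply: DeriveDef; [apply/cvg_ex; exists 0|exact: cvg_lim].
Unshelve. all: by end_near. Qed.

Lemma is_derive_flat k (t : R) :
 is_derive t (1 : R) (flat k) (flat k.+2 t - k%:R * flat k.+1 t).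
have [t0|t0|->] := ltgtP t 0.
- rewrite !(flat_le0 _ (ltW t0)) mulr0 subr0.
 apply: (near_eq_is_derive (f := cst 0)).
 near=> u; rewrite flat_le0 //; near: u; exact: lt_le_nbhsl.
- have tn : t != 0 by lra.
 have dV : is_derive t (1 : R) (fun u => u^-1) (- t ^- 2).
  apply: DeriveDef; first exact: derivableV.
  by rewrite deriveV ?derive_id // [_ *: 1]mulr1.
 have dX : is_derive t (1 : R) (fun u => u^-1 ^+ k) (k%:R * t^-1 ^+ k.-1 * (- t ^- 2)).
  have dP : is_derive t^-1 (1 : R) (fun u : R => u ^+ k) (k%:R * t^-1 ^+ k.-1).
   apply: DeriveDef; first exact: exprn_derivable.
   by rewrite -derive1E; exact: exp_derive1.
  exact: is_derive1_comp.
 have dE : is_derive t (1 : R) (fun u => expR (- u^-1)) (expR (- t^-1) * t ^- 2).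
  have dN : is_derive t (1 : R) (fun u : R => - u^-1) (t ^- 2).
   by have := is_deriveN dV; rewrite opprK.
  exact: (@is_derive1_comp R expR (fun u => - u^-1) t _ _ (is_derive_expR _) dN).
 have : is_derive t (1 : R) (fun u => u^-1 ^+ k * expR (- u^-1)) (flat k.+2 t - k%:R * flat k.+1 t).
  apply: (is_derive_eq (is_deriveM dX dE)).
  rewrite /flat t0 /GRing.scale /=; rewrite -exprVn.
  case: k {dX dE} => [|k]; first by rewrite !expr0; ring.
  by rewrite !exprS; ring.
 apply: near_eq_is_derive; near=> u; rewrite /flat (_ : 0 < u) //.
 by near: u; exact: lt_nbhsr.
- rewrite !flat_le0 // mulr0 subr0; exact: is_derive_quadratic (flat_quadratic k).
Unshelve. all: by end_near. Qed.

Lemma ck1_continuous n (h : R -> R) : ck1 n h -> continuous h.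
case: n => // n [h' dh _] t; apply: differentiable_continuous; apply/derivable1_diffP.
by [].
Qed.

Lemma ck1_lin n (a : R) (g h : R -> R) : ck1 n g -> ck1 n h -> ck1 n (fun t => g t + a * h t).
elim: n g h => [|n IH] g h.
 by move=> cg ch t; apply: cvgD; [exact: cg|apply: cvgMl_tmp; exact: ch].
move=> [g' dg cg] [h' dh ch]; exists (fun t => g' t + a * h' t); last exact: IH.
move=> t; apply: is_deriveD.
Qed.

Lemma ck1_flat n k : ck1 n (flat k).
elim: n k => [|n IH] k.
 move=> t; apply: differentiable_continuous; apply/derivable1_diffP.
 by case: (is_derive_flat k t).
exists (fun t => flat k.+2 t + (- k%:R) * flat k.+1 t); last exact: ck1_lin.
by move=> t; have := is_derive_flat; rewrite mulNr.
Qed.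

Definition step (t : R) : R := flat 0 t / (flat 0 t + flat 0 (1 - t)).

Lemma step_den t : 0 < flat 0 t + flat 0 (1 - t).
have [t0|t0] := ltP 0 t; first by rewrite ltr_pwDl ?flat0_gt0 ?flat_ge0.
by rewrite ltr_wpDl ?flat_ge0 // flat0_gt0 // subr_gt0 (le_lt_trans t0).
Qed.

Lemma step_le0 t : t <= 0 -> step t = 0.
by move=> t0; rewrite /step flat_le0 // mul0r. Qed.

Lemma step_ge1 t : 1 <= t -> step t = 1.
move=> t1; have := step_den t; rewrite /step (flat_le0 0 (_ : 1 - t <= 0)) ?subr_le0 // addr0 => h.
by rewrite divff // gt_eqF.
Qed.

Lemma step_itv t : 0 <= step t <= 1.
have h := step_den t; rewrite divr_ge0 ?flat_ge0 ?(ltW h) //= ler_pdivrMr // mul1r lerDl.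
exact: flat_ge0.
Qed.

Definition dstep (t : R) : R :=
 (flat 2 t * flat 0 (1 - t) + flat 0 t * flat 2 (1 - t)) / (flat 0 t + flat 0 (1 - t)) ^+ 2.

Lemma dstep_ge0 t : 0 <= dstep t.
by rewrite divr_ge0 ?sqr_ge0 // addr_ge0 // mulr_ge0 ?flat_ge0. Qed.

Lemma is_derive_step (t : R) : is_derive t (1 : R) step (dstep t).
have d1 : is_derive t (1 : R) (flat 0) (flat 2 t).
 by have := is_derive_flat 0 t; rewrite mul0r subr0.
have d2 : is_derive t (1 : R) (fun u => flat 0 (1 - u)) (- flat 2 (1 - t)).
 have dB : is_derive t (1 : R) (fun u : R => 1 - u) (-1).
  by have := is_deriveB (is_derive_cst (1 : R) t 1) (is_derive_id t 1); rewrite sub0r.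
 have := @is_derive1_comp R (flat 0) (fun u => 1 - u) t _ _ (is_derive_flat 0 (1 - t)) dB.
 by rewrite mul0r subr0 mulrN1.
have d3 := is_deriveD d1 d2; have n0 : flat 0 t + flat 0 (1 - t) != 0 by rewrite gt_eqF ?step_den.
have dV : is_derive t (1 : R) (fun u => (flat 0 u + flat 0 (1 - u))^-1)
  (- (flat 0 t + flat 0 (1 - t)) ^- 2 * (flat 2 t - flat 2 (1 - t))).
 apply: DeriveDef; first by apply: derivableV => //.
 by rewrite deriveV // (@derive_val _ _ _ _ _ _ _ d3).
apply: (is_derive_eq (is_deriveM d1 dV)).
rewrite /dstep /GRing.scale /=; move: n0.
move: (flat 0 t) (flat 0 (1 - t)) (flat 2 t) (flat 2 (1 - t)) => a b a' b' n0.
by field.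
Qed.

Lemma dstep_continuous : continuous dstep.
have cf k : continuous (flat k) := (ck1_flat 0 k).
have cg k : continuous (fun t : R => flat k (1 - t)).
 move=> t; apply: (@continuous_comp R R R (fun t : R => 1 - t) (flat k)); last exact: cf.
 by apply: cvgB; [exact: cvg_cst|exact: cvg_id].
move=> t; apply: cvgM.
 by apply: cvgD; apply: cvgM; [exact: cf|exact: cg|exact: cf|exact: cg].
have cd : {for t, continuous (fun t : R => flat 0 t + flat 0 (1 - t))}.
 by apply: cvgD; [exact: cf|exact: cg].
apply: cvgV; first by rewrite expf_neq0 // gt_eqF ?step_den.
by apply: (@continuous_comp R R R (fun t : R => flat 0 t + flat 0 (1 - t)) (fun u : R => u ^+ 2)) => //; exact: exprn_continuous.
Qed.

Lemma Ck_step (d k : nat) (U : set 'rV[R]_d) (f : 'rV[R]_d -> R) : open U ->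
 Ck k U f -> Ck k U (step \o f).
move=> oU cf; have c1 : Ck k U (flat 0 \o f) by apply: Ck_comp1 => //; exact: ck1_flat.
have c2 : Ck k U (flat 0 \o (fun x => 1 - f x)).
 apply: Ck_comp1 => //; first exact: ck1_flat.
 by apply: Ck_ext (Ck_D oU (Ck_cst k U 1) (Ck_M oU (Ck_cst k U (-1)) cf)) => // x; rewrite /= mulN1r.
apply: (Ck_M oU c1 (Ck_V oU _ (Ck_D oU c1 c2))) => x.
by rewrite gt_eqF ?step_den.
Qed.

End flat.

(** * Real-valued integrals: domination, products and limits *)

Section real_integrals.
Context {disp} {T : measurableType disp} {R : realType} (mu : {measure set T -> \bar R}).
Variables (D : set T) (mD : measurable D).
Implicit Types f g h : T -> R.

Lemma itg_meas f : Ritg mu D f -> measurable_fun D f.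
by case/integrableP => /measurable_EFinP. Qed.

Lemma itg_le f g : measurable_fun D f -> (forall x, D x -> `|f x| <= g x) ->
 Ritg mu D g -> Ritg mu D f.
move=> mf fg; apply: le_integrable => //; first exact/measurable_EFinP.
by move=> x Dx; rewrite lee_fin (le_trans (fg x Dx)) // ler_norm.
Qed.

Lemma itgMb f g (C : R) : Ritg mu D f -> measurable_fun D g ->
 (forall x, D x -> `|g x| <= C) -> Ritg mu D (fun x => f x * g x).
move=> intf mg gC; have mf := itg_meas intf.
apply: (@itg_le _ (fun x => C * `|f x|)); first exact: measurable_funM.
 by move=> x Dx; rewrite normrM mulrC ler_wpM2r ?gC.
have : Ritg mu D (fun x => `|f x|) by exact: (integrable_norm intf).
by move=> /(integrableZl mD C).
Qed.

Lemma itgD f g : Ritg mu D f -> Ritg mu D g ->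
 Ritg mu D (fun x => f x + g x).
by move=> iF ig; exact: (integrableD mD iF ig). Qed.

Lemma itgB f g : Ritg mu D f -> Ritg mu D g ->
 Ritg mu D (fun x => f x - g x).
by move=> iF ig; exact: (integrableB mD iF ig). Qed.

Lemma itgZ f (c : R) : Ritg mu D f ->
 Ritg mu D (fun x => c * f x).
by move=> iF; exact: (integrableZl mD c iF). Qed.

Lemma itg_norm f : Ritg mu D f ->
 Ritg mu D (fun x => `|f x|).
by move=> iF; exact: (integrable_norm iF). Qed.

Lemma itgM f g : measurable_fun D f -> measurable_fun D g ->
 Ritg mu D (fun x => f x ^+ 2) ->
 Ritg mu D (fun x => g x ^+ 2) ->
 Ritg mu D (fun x => f x * g x).
move=> mf mg if2 ig2; apply: (@itg_le _ (fun x => f x ^+ 2 + g x ^+ 2)).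
- exact: measurable_funM.
- move=> x _; rewrite normrM -[f x ^+ 2]real_normK ?num_real // -[g x ^+ 2]real_normK ?num_real //.
 have := sqr_ge0 (`|f x| - `|g x|); rewrite sqrrB => h.
 have h1 : 0 <= `|f x| ^+ 2 by exact: sqr_ge0. have h2 : 0 <= `|g x| ^+ 2 by exact: sqr_ge0.
 have h3 : 0 <= `|f x| * `|g x| by exact: mulr_ge0.
 rewrite mulr2n in h; lra.
- exact: itgD.
Qed.

Lemma integrable_sqr_add f g : measurable_fun D f -> measurable_fun D g ->
 Ritg mu D (fun x => f x ^+ 2) ->
 Ritg mu D (fun x => g x ^+ 2) ->
 Ritg mu D (fun x => (f x + g x) ^+ 2).
move=> mf mg if2 ig2.
apply: (@itg_le _ (fun x => 2 * f x ^+ 2 + 2 * g x ^+ 2)).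
- by apply: measurable_funX; exact: measurable_funD.
- move=> x; rewrite ger0_norm ?sqr_ge0 //; have := sqr_ge0 (f x - g x).
 lra.
- by apply: itgD; exact: itgZ.
Qed.

Lemma Rdominated (f_ : nat -> T -> R) f g : (forall n, measurable_fun D (f_ n)) ->
 (forall x, D x -> (f_ ^~ x) @ \oo --> f x) ->
 Ritg mu D g -> (forall n x, D x -> `|f_ n x| <= g x) ->
 [/\ Ritg mu D f,
   (fun n => \int[mu]_(x in D) `|f_ n x - f x|) @ \oo --> 0 &
   (fun n => \int[mu]_(x in D) f_ n x) @ \oo --> \int[mu]_(x in D) f x].
move=> mf_ cf ig fg.
have mf : measurable_fun D f by apply: (measurable_fun_cvg mf_).
have ce : {ae mu, forall x, D x -> (fun n => (f_ n x)%:E) @ \oo --> (f x)%:E}.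
 by apply: aeW => x Dx; apply: cvg_EFin; [exact: nearW|exact: cf].
have le : {ae mu, forall x n, D x -> (`|(f_ n x)%:E| <= (g x)%:E)%E}.
 by apply: aeW => x n Dx; rewrite lee_fin fg.
have [h1 h2 h3] := dominated_convergence mD (fun n => (measurable_EFinP _ _).2 (mf_ n))
 ((measurable_EFinP _ _).2 mf) ce ig le.
split=> //.
 apply: fine_cvg; move: h2; rewrite /= => h2; exact: h2.
apply: fine_cvg; rewrite fineK; last exact: integrable_fin_num.
exact: h3.
Qed.

Lemma Rintegral_abs_eq0 f : Ritg mu D f -> \int[mu]_(x in D) `|f x| = 0 ->
 {ae mu, forall x, D x -> f x = 0}.
move=> iF f0; have mf := itg_meas iF.
have : (\int[mu]_(x in D) `|(f x)%:E| = 0)%E.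
 have fin : (\int[mu]_(x in D) `|(f x)%:E|)%E \is a fin_num.
  exact: (integrable_fin_num mD (itg_norm iF)).
 by rewrite -(fineK fin); congr (_%:E).
move=> /(ae_eq_integral_abs mu mD ((measurable_EFinP _ _).2 mf)).
by apply: filterS => x h /h [].
Qed.

Lemma ae_eq_Rintegral f g : measurable_fun D f -> measurable_fun D g ->
 {ae mu, forall x, D x -> f x = g x} -> \int[mu]_(x in D) f x = \int[mu]_(x in D) g x.
move=> mf mg fg; congr fine; apply: ae_eq_integral => //.
- exact/measurable_EFinP.
- exact/measurable_EFinP.
- by apply: filterS fg => x h Dx; rewrite h.
Qed.

Lemma Rintegral_sum (I : Type) (s : seq I) (F : I -> T -> R) :
 (forall i, Ritg mu D (F i)) ->
 Ritg mu D (fun x => \sum_(i <- s) F i x) /\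
 \int[mu]_(x in D) (\sum_(i <- s) F i x) = \sum_(i <- s) \int[mu]_(x in D) F i x.
move=> iF; elim: s => [|i s [IH1 IH2]].
 under eq_fun do rewrite big_nil; rewrite big_nil Rintegral_cst // mul0r; split=> //.
 exact: integrable0.
under eq_fun do rewrite big_cons; rewrite big_cons -IH2 -RintegralD //; split=> //.
exact: itgD.
Qed.

(** The difference of the integrals splits into [a_ k - a], small in L¹, against the bounded [b_ k],
    and into [a * (b_ k - b)], handled by dominated convergence. *)
Lemma Rintegral_prod_lim (a : T -> R) (a_ b_ : nat -> T -> R) (b : T -> R) (C : R) :
 (forall k, Ritg mu D (a_ k)) -> Ritg mu D a ->
 (forall e : R, 0 < e -> exists N, forall k, (N <= k)%N -> \int[mu]_(x in D) `|a_ k x - a x| <= e) ->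
 (forall k, measurable_fun D (b_ k)) -> (forall k x, D x -> `|b_ k x| <= C) ->
 (forall x, D x -> (b_ ^~ x) @ \oo --> b x) ->
 Ritg mu D (fun x => a x * b x) /\
 (fun k => \int[mu]_(x in D) (a_ k x * b_ k x)) @ \oo --> \int[mu]_(x in D) (a x * b x).
move=> ia_ ia ca mb_ bC cb.
have ma := itg_meas ia.
have iab k : Ritg mu D (fun x => a x * b_ k x) by exact: itgMb (bC k).
have iaC : Ritg mu D (fun x => C * `|a x|).
 by apply: itgZ => //; exact: itg_norm.
have [i1 _ c1] := @Rdominated (fun k x => a x * b_ k x) (fun x => a x * b x) _
 (fun k => measurable_funM ma (mb_ k)) (fun x Dx => cvgMr (cb x Dx)) iaC
 (fun k x Dx => ltac:(by rewrite normrM mulrC ler_wpM2r // bC)).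
split=> //; apply/cvgrPdist_le => e e0.
have e2 : 0 < e / 2 by lra.
have C1 : 0 < `|C| + 1 by [].
have [N hN] := ca _ (divr_gt0 e2 C1).
move/cvgrPdist_le/(_ _ e2) : c1 => [N' _ hN'].
exists (maxn N N') => // k /=; rewrite geq_max => /andP[Nk Nk'].
have := hN' k Nk'; rewrite /= => h1; have h2 := hN k Nk.
have iD : Ritg mu D (fun x => a_ k x - a x) by exact: itgB.
have iDb : Ritg mu D (fun x => (a_ k x - a x) * b_ k x) by exact: itgMb (bC k).
have -> : \int[mu]_(x in D) (a_ k x * b_ k x) = \int[mu]_(x in D) (a x * b_ k x) +
  \int[mu]_(x in D) ((a_ k x - a x) * b_ k x).
 by rewrite -RintegralD //; apply: eq_Rintegral => x _; ring.
rewrite opprD addrA; apply: le_trans (ler_normB _ _) _; rewrite (splitr e); apply: lerD => //.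
apply: le_trans (le_normr_Rintegral mD iDb) _.
apply: (@le_trans _ _ (\int[mu]_(x in D) (`|C| * `|a_ k x - a x|))).
 apply: le_Rintegral => //; first exact: itg_norm.
  by apply: itgZ => //; exact: itg_norm.
 move=> x Dx; rewrite normrM mulrC ler_wpM2r //; exact: le_trans (bC k x Dx) (ler_norm _).
rewrite RintegralZl //; last exact: itg_norm.
apply: le_trans (ler_wpM2l (normr_ge0 C) h2) _.
by rewrite mulrCA ger_pMr // ler_pdivrMr // mul1r lerDl.
Qed.

Lemma itg_ind (A : set T) : measurable A -> (mu A < +oo)%E ->
 Ritg mu setT (\1_A : T -> R).
move=> mA Afin; apply/integrableP; split; first by apply/measurable_EFinP.
under eq_integral => x do rewrite /= ger0_norm //.
by rewrite integral_indic // setIT.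
Qed.

(* The arithmetic-geometric mean replaces the Cauchy-Schwarz inequality. *)
Lemma young (t a b : R) : 0 < t -> `|a * b| <= t * a ^+ 2 + t^-1 * b ^+ 2.
move=> t0; rewrite normrM -[a ^+ 2]real_normK ?num_real // -[b ^+ 2]real_normK ?num_real //.
have := mulr_ge0 (normr_ge0 a) (normr_ge0 b); move: `|a| `|b| => x y.
have : 0 <= t^-1 * (t * x - y) ^+ 2 by rewrite mulr_ge0 ?sqr_ge0 // ltW ?invr_gt0.
have -> : t^-1 * (t * x - y) ^+ 2 = t * x ^+ 2 + t^-1 * y ^+ 2 - 2 * (x * y).
 by field; exact: lt0r_neq0.
lra.
Qed.

Lemma integral_young t f g : 0 < t -> measurable_fun D f -> measurable_fun D g ->
 Ritg mu D (fun x => f x ^+ 2) -> Ritg mu D (fun x => g x ^+ 2) ->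
 `|\int[mu]_(x in D) (f x * g x)| <= t * \int[mu]_(x in D) f x ^+ 2 + t^-1 * \int[mu]_(x in D) g x ^+ 2.
move=> t0 mf mg if2 ig2; have ifg := itgM mf mg if2 ig2.
apply: le_trans (le_normr_Rintegral mD ifg) _.
rewrite -!RintegralZl // -RintegralD //; try exact: itgZ.
apply: le_Rintegral => //; [exact: itg_norm|by apply: itgD; exact: itgZ|].
by move=> x _; exact: young.
Qed.

End real_integrals.

(** * Doubly stochastic kernels and approximate identities *)

Section markov_kernel.
Context {disp} {T : measurableType disp} {R : realType} (mu : {sigma_finite_measure set T -> \bar R}).
Implicit Types (K : T * T -> R) (f g h : T -> R).
Local Notation itg f := (mu.-integrable setT (EFin \o f)).

(** Normalisation in [y] makes [Kop] an average and yields Jensen's inequality; normalisation in [x]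
    makes it preserve integrals, hence contract L¹. The bound on [K] makes the products with
    integrable functions integrable. *)
Definition doubly_stochastic K := [/\ measurable_fun setT K, (forall p, 0 <= K p),
 (exists C, forall p, K p <= C), (forall x, (\int[mu]_y (K (x, y))%:E = 1)%E) &
 (forall y, (\int[mu]_x (K (x, y))%:E = 1)%E)].

Definition Kop K f x := \int[mu]_y (f y * K (x, y)).

Variables (K : T * T -> R) (dsK : doubly_stochastic K).

Let mK : measurable_fun setT K. Proof. by case: dsK. Qed.
Let K0 p : 0 <= K p. Proof. by case: dsK. Qed.
Let m1 x : measurable_fun setT (fun y => K (x, y)).
exact: (measurableT_comp mK (measurable_pair1 x)). Qed.
Let m2 y : measurable_fun setT (fun x => K (x, y)).
exact: (measurableT_comp mK (measurable_pair2 y)). Qed.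
Lemma K_integrable x : itg (fun y => K (x, y)).
apply/integrableP; split; first exact/measurable_EFinP.
have [_ _ _ h _] := dsK; under eq_integral => y do rewrite /= ger0_norm //.
by rewrite h ltry.
Qed.

Lemma Kop_itg f x : itg f -> itg (fun y => f y * K (x, y)).
have [_ _ [C hC] _ _] := dsK => intf; apply: (@itgMb _ _ _ mu setT measurableT f _ C) => //.
by move=> y; rewrite ger0_norm.
Qed.

Lemma Kop_le f g x : itg f -> itg g -> (forall y, f y <= g y) -> Kop K f x <= Kop K g x.
move=> intf ig fg; apply: le_Rintegral => //; try exact: Kop_itg.
by move=> y; rewrite ler_wpM2r.
Qed.

Lemma Kop_cst (c : R) x : Kop K (fun=> c) x = c.
rewrite /Kop RintegralZl //; last exact: K_integrable.
have [_ _ _ h _] := dsK; by rewrite /Rintegral h mulr1.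
Qed.

Lemma Kop_add f g x : itg f -> itg g -> Kop K (fun y => f y + g y) x = Kop K f x + Kop K g x.
move=> intf ig; rewrite -RintegralD //; try exact: Kop_itg.
by apply: eq_Rintegral => y; rewrite mulrDl.
Qed.

Lemma Kop_scale (c : R) f x : itg f -> Kop K (fun y => c * f y) x = c * Kop K f x.
move=> intf; rewrite -RintegralZl //; last exact: Kop_itg.
by apply: eq_Rintegral => y; rewrite mulrA.
Qed.

Lemma Kop_sub f g x : itg f -> itg g -> Kop K (fun y => f y - g y) x = Kop K f x - Kop K g x.
move=> intf ig; rewrite -RintegralB //; try exact: Kop_itg.
by apply: eq_Rintegral => y; rewrite mulrBl.
Qed.

Lemma Kop_int f : itg f -> itg (Kop K f) /\ \int[mu]_x Kop K f x = \int[mu]_x f x.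
move=> intf; have mf := itg_meas intf.
pose F (p : T * T) : \bar R := (f p.2 * K p)%:E.
have mF : measurable_fun setT F.
 apply/measurable_EFinP; apply: measurable_funM => //.
 exact: (measurableT_comp mf measurable_snd).
have [_ _ _ _ h2] := dsK.
have iF : (mu \x mu)%E.-integrable setT F.
 apply/integrable21ltyP => //; case/integrableP: intf => _; apply: le_lt_trans.
 apply: ge0_le_integral => //.
 - by move=> y _; exact: integral_ge0.
 - apply: (@measurable_fun_fubini_tonelli_G _ _ _ _ _ mu (fun p => `|F p|%E)).
  + exact: measurableT_comp.
  + by [].
 - by apply: measurableT_comp => //; exact/measurable_EFinP.
 - move=> y; rewrite (_ : (fun x => _) = (fun x => `|f y|%:E * (K (x, y))%:E)%E); last first.
   by apply/funext => x; rewrite /= normrM (ger0_norm (K0 _)).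
  rewrite ge0_integralZl //; last by move=> x; rewrite lee_fin.
   by rewrite h2 mule1.
  exact/measurable_EFinP.
have eF x : fubini_F mu F x = (Kop K f x)%:E.
 by rewrite fineK //; apply: (integrable_fin_num measurableT); exact: Kop_itg.
have : itg (Kop K f).
 have := integrable_fubini_F iF; rewrite (_ : fubini_F mu F = EFin \o Kop K f) //.
 exact/funext.
split=> //; congr fine; under eq_integral do rewrite -eF.
rewrite (Fubini iF); apply: eq_integral => y.
under eq_integral => x do rewrite /F /= EFinM.
rewrite integralZl //; first by rewrite h2 mule1.
apply/integrableP; split; first exact/measurable_EFinP.
by under eq_integral => x do rewrite /= ger0_norm //; rewrite h2 ltry.
Qed.

Lemma Kop_norm f x : itg f -> `|Kop K f x| <= Kop K (fun y => `|f y|) x.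
move=> intf; apply: le_trans (le_normr_Rintegral measurableT (Kop_itg x intf)) _.
by rewrite le_eqVlt; apply/orP; left; apply/eqP/eq_Rintegral => y; rewrite normrM (ger0_norm (K0 _)).
Qed.

Lemma Kop_contract f : itg f -> \int[mu]_x `|Kop K f x| <= \int[mu]_x `|f x|.
move=> intf; have ia := itg_norm intf.
rewrite -(Kop_int ia).2; apply: le_Rintegral => //.
- by apply: itg_norm => //; exact: (Kop_int intf).1.
- exact: (Kop_int ia).1.
- by move=> x _; exact: Kop_norm.
Qed.

Lemma Kop_bilinear f g (t : R) : 0 < t -> itg f -> measurable_fun setT g ->
 itg (fun x => f x ^+ 2) -> itg (fun x => g x ^+ 2) ->
 itg (fun x => Kop K f x * g x) /\
 \int[mu]_x `|Kop K f x * g x| <= t * \int[mu]_x f x ^+ 2 + t^-1 * \int[mu]_x g x ^+ 2.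
move=> t0 intf mg if2 ig2.
have [ik ek] := Kop_int if2; have [ikf _] := Kop_int intf.
(* Jensen's inequality for the square: the average of [(m - f y) ^ 2] is nonnegative, where [m] is
   the average of [f] itself. *)
have sq x : Kop K f x ^+ 2 <= Kop K (fun y => f y ^+ 2) x.
 set m := Kop K f x.
 have : Kop K (fun y => 2 * m * f y - f y ^+ 2) x <= m ^+ 2.
  rewrite -(Kop_cst (m ^+ 2) x) /Kop; apply: le_Rintegral => //.
  - by apply: Kop_itg; apply: itgB => //; exact: itgZ.
  - by apply: (itgZ measurableT (m ^+ 2) (K_integrable x)).
  - move=> y _; rewrite ler_wpM2r //; have := sqr_ge0 (m - f y); rewrite sqrrB mulr2n; lra.
 rewrite Kop_sub //; last exact: itgZ.
 by rewrite Kop_scale // -/m expr2; lra.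
have bd x : `|Kop K f x * g x| <= t * Kop K (fun y => f y ^+ 2) x + t^-1 * g x ^+ 2.
 apply: (@le_trans _ _ (t * Kop K f x ^+ 2 + t^-1 * g x ^+ 2)); last by rewrite lerD2r ler_pM2l.
 exact: young.
have im : itg (fun x => t * Kop K (fun y => f y ^+ 2) x + t^-1 * g x ^+ 2).
 by apply: itgD => //; exact: itgZ.
have mk : measurable_fun setT (fun x => Kop K f x * g x).
 by apply: measurable_funM => //; exact: itg_meas ikf.
have ii : itg (fun x => Kop K f x * g x) by apply: itg_le mk (fun x _ => bd x) im.
split=> //; rewrite -ek -!RintegralZl // -RintegralD //; try exact: itgZ.
by apply: le_Rintegral => //; exact: itg_norm.
Qed.

End markov_kernel.

Section approximate_identity.
Context {disp} {T : measurableType disp} {R : realType} (mu : {sigma_finite_measure set T -> \bar R}).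
Implicit Types (f g h : T -> R).
Local Notation itg f := (mu.-integrable setT (EFin \o f)).
Variables (K : nat -> T * T -> R) (dsK : forall k, doubly_stochastic mu (K k)).
Variables (opn : set T -> Prop).
Hypothesis opn_measurable : forall U, opn U -> measurable U.
Hypothesis opn_local : forall U x, opn U -> U x ->
 exists N, forall k, (N <= k)%N -> forall y, ~ U y -> K k (x, y) = 0.
Hypothesis opn_regular : forall A (e : R), measurable A -> (mu A < +oo)%E -> 0 < e ->
 exists U, [/\ opn U, A `<=` U & (mu (U `\` A) <= e%:E)%E].

(** A class closed under sums, multiples and L¹ limits; convergence thus spreads from indicators of
    members of [opn] to measurable sets of finite measure, to simple functions and to all integrable
    functions. *)
Definition approximable f := itg f /\
 forall e : R, 0 < e -> exists N, forall k, (N <= k)%N ->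
  \int[mu]_x `|Kop mu (K k) f x - f x| <= e.

Let Kint k f := @Kop_int _ _ _ mu (K k) (dsK k) f.

Let idiff k f : itg f -> itg (fun x => Kop mu (K k) f x - f x).
by move=> i1; apply: itgB => //; exact: (Kint k i1).1. Qed.

Lemma approximable_add f g : approximable f -> approximable g -> approximable (fun x => f x + g x).
move=> [if_ af] [ig ag]; split; first exact: itgD.
move=> e e0; have e2 : 0 < e / 2 by rewrite divr_gt0.
have [N1 h1] := af _ e2; have [N2 h2] := ag _ e2.
exists (maxn N1 N2) => k; rewrite geq_max => /andP[k1 k2].
have i1 := itg_norm (idiff k if_); have i2 := itg_norm (idiff k ig).
apply: (@le_trans _ _ (e / 2 + e / 2)); last by rewrite -splitr.
apply: le_trans (lerD (h1 k k1) (h2 k k2)); rewrite -RintegralD //.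
apply: le_Rintegral => //; last first.
- by move=> x _; rewrite (Kop_add (dsK k)) // opprD addrACA ler_normD.
- exact: itgD.
- by apply: itg_norm; apply: idiff; exact: itgD.
Qed.

Lemma approximable_scale (c : R) f : approximable f -> approximable (fun x => c * f x).
move=> [if_ af]; split; first exact: itgZ.
move=> e e0; have c0 : 0 < `|c| + 1 by apply: ltr_wpDl.
have [N h] := af (e / (`|c| + 1)) (divr_gt0 e0 c0).
exists N => k /h {}h; have i1 := itg_norm (idiff k if_).
apply: (@le_trans _ _ (`|c| * \int[mu]_x `|Kop mu (K k) f x - f x|)).
 rewrite -RintegralZl // le_eqVlt; apply/orP; left; apply/eqP/eq_Rintegral => x _.
 by rewrite (Kop_scale (dsK k)) // -mulrBr normrM.
apply: le_trans (ler_wpM2l (normr_ge0 c) h) _.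
by rewrite mulrCA ger_pMr // ler_pdivrMr // mul1r lerDl.
Qed.

Lemma approximable0 : approximable (fun=> 0).
have : itg (fun=> 0) by exact: integrable0.
split=> //; exists 0%N => k; under eq_Rintegral => x do rewrite (Kop_cst (dsK k)) subrr normr0.
by rewrite Rintegral_cst // mul0r ltW.
Qed.

(** The kernels contract L¹, so an approximation error is counted at most twice, uniformly in
    [k]. *)
Lemma approximable_lim f : itg f ->
 (forall e : R, 0 < e -> exists2 g, approximable g & \int[mu]_x `|f x - g x| <= e) ->
 approximable f.
move=> if_ H; split=> // e e0; have e3 : 0 < e / 3 by rewrite divr_gt0.
have [g [ig ag] fg] := H _ e3; have [N h] := ag _ e3.
exists N => k /h {}h; have ifg := itgB measurableT if_ ig.
have i1 := itg_norm (Kint k ifg).1; have i2 := itg_norm (idiff k ig).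
have i3 := itg_norm ifg.
apply: (@le_trans _ _ (\int[mu]_x (`|Kop mu (K k) (fun y => f y - g y) x| +
  `|Kop mu (K k) g x - g x| + `|f x - g x|))).
 apply: le_Rintegral => //; first by apply: itg_norm; exact: idiff.
  by apply: itgD => //; exact: itgD.
 move=> x _; rewrite (Kop_sub (dsK k)) //.
 set a := Kop _ _ f x; set b := Kop _ _ g x.
 have -> : a - f x = (a - b) + (b - g x) - (f x - g x) by ring.
 by rewrite (le_trans (ler_normB _ _)) // lerD2r ler_normD.
rewrite RintegralD //; last exact: itgD.
rewrite RintegralD //; have := Kop_contract (dsK k) ifg.
move=> h2; lra.
Qed.

(** The kernel preserves the integral of the indicator, so what leaks out of [U] equals what is lost
    inside, and the L¹ distance is twice the integral of the loss [F]. The loss tends to zero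
    pointwise, because near a point of [U] the kernel does not see the complement. *)
Lemma approximable_open U : opn U -> (mu U < +oo)%E -> approximable (\1_U : T -> R).
move=> oU Ufin; have mU := opn_measurable oU.
have iU : itg (\1_U : T -> R) by exact: itg_ind.
split=> // e e0.
have m1 : measurable_fun setT (\1_U : T -> R) by exact: measurable_indic.
have q01 k x : 0 <= Kop mu (K k) (\1_U : T -> R) x <= 1.
 have i1 : itg (fun=> 0 : R) by exact: integrable0.
 apply/andP; split.
  rewrite -(Kop_cst (dsK k) 0 x); by apply: (Kop_le (dsK k)) => // y; rewrite indicE.
 rewrite -[leRHS](Kop_cst (dsK k) 1 x) /Kop; apply: le_Rintegral => //.
 - exact: (Kop_itg (dsK k)).
 - by under eq_fun do rewrite mul1r; exact: K_integrable (dsK k) x.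
 - move=> y _; case: (dsK k) => _ K0 _ _ _; by rewrite ler_wpM2r // indicE; case: (y \in U).
pose F k x : R := (\1_U x) * (1 - Kop mu (K k) (\1_U : T -> R) x).
have mF k : measurable_fun setT (F k).
 apply: measurable_funM => //; apply: measurable_funB => //.
 exact: (itg_meas (Kint k iU).1).
have cF x : setT x -> (F ^~ x) @ \oo --> (0 : R).
 move=> _; have [xU|xU] := pselect (U x); last first.
  by rewrite /F indicE memNset //; under eq_fun do rewrite mul0r; exact: cvg_cst.
 have [N hN] := opn_local oU xU.
 apply: cvg_near_cst; exists N => // k /= Nk; apply/eqP.
 rewrite /F -[X in _ * (X - _)](Kop_cst (dsK k) 1 x) (_ : Kop mu _ \1_U x = Kop mu (K k) (fun=> 1) x) ?subrr ?mulr0 //.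
 apply: eq_Rintegral => y _; have [yU|yU] := pselect (U y).
  by rewrite indicE mem_set.
 by rewrite (hN k Nk y yU) !mulr0.
have bF k x : setT x -> `|F k x| <= (\1_U x : R).
 move=> _; rewrite /F; have /andP[q0 q1] := q01 k x.
 rewrite normrM ger0_norm ?indicE // ger0_norm ?subr_ge0 //.
 by rewrite ler_piMr // lerBlDr lerDl.
have [_ _ H] := Rdominated measurableT mF cF iU bF.
rewrite Rintegral_cst // mul0r in H.
have e2 : 0 < e / 2 by rewrite divr_gt0.
move/cvgrPdist_le/(_ _ e2) : H => [N _ hN]; exists N => k Nk.
have iF : itg (F k) by apply: itg_le (mF k) (bF k) iU.
have -> : \int[mu]_x `|Kop mu (K k) \1_U x - \1_U x| =
  \int[mu]_x ((Kop mu (K k) \1_U x - \1_U x) + 2 * F k x).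
 apply: eq_Rintegral => x _; rewrite /F; have /andP[q0 q1] := q01 k x; rewrite indicE.
 case: (x \in U); first by rewrite ler0_norm ?subr_le0 //=; ring.
 by rewrite /= subr0 ger0_norm // mul0r mulr0 addr0.
rewrite RintegralD //; first last.
- exact: itgZ.
- exact: idiff.
rewrite RintegralB //; last exact: (Kint k iU).1.
rewrite (Kint k iU).2 subrr add0r RintegralZl //.
have := hN k Nk; rewrite /= sub0r normrN => /(le_trans (ler_norm _)); lra.
Qed.

Lemma approximable_set A : measurable A -> (mu A < +oo)%E -> approximable (\1_A : T -> R).
move=> mA Afin; have iA : itg (\1_A : T -> R) by exact: itg_ind.
apply: approximable_lim => // e e0; have [U [oU AU UA]] := opn_regular mA Afin e0.
have mU := opn_measurable oU; have mUA : measurable (U `\` A) by exact: measurableD.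
have Ufin : (mu U < +oo)%E.
 rewrite -(setDUK AU) (le_lt_trans (measureU2 mu mA mUA)) //.
 by rewrite lte_add_pinfty // (le_lt_trans UA) // ltry.
exists (\1_U : T -> R); first exact: approximable_open.
have -> : \int[mu]_x `|(\1_A x : R) - \1_U x| = \int[mu]_x (\1_(U `\` A) x : R).
 apply: eq_Rintegral => x _; rewrite !indicE in_setD.
 have := AU x; case: (asboolP (A x)) => xA; case: (asboolP (U x)) => xU h.
 - by rewrite !mem_set // subrr normr0.
 - by case: xU; exact: h.
 - by rewrite memNset // mem_set //= sub0r normrN normr1.
 - by rewrite !memNset // subrr normr0.
rewrite /Rintegral integral_indic // setIT -lee_fin fineK // ge0_fin_numE //.
by rewrite (le_lt_trans UA) // ltry.
Qed.

Import HBSimple.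

Lemma approximable_integrable f : itg f -> approximable f.
move=> if_; apply: approximable_lim => // e e0.
have [g_ [ig _ cg]] := approximation_sfun_integrable measurableT if_.
move: cg => /fine_cvgP[[N1 _ h1]] /cvgrPdist_le /(_ _ e0) [N2 _ h2].
pose m := maxn N1 N2; exists (g_ m); last first.
 have := h2 m (leq_maxr _ _); rewrite /= sub0r normrN; exact/le_trans/ler_norm.
(* Only nonzero values of a simple function need a level set of finite measure; the zero level,
   possibly of infinite measure, contributes nothing to the sum. *)
have fin (y : R) : y != 0 -> (mu (g_ m @^-1` [set y]) < +oo)%E.
 move=> y0; have mS : measurable (g_ m @^-1` [set y]) by exact: measurable_sfunP.
 have iy := itg_norm (ig m).
 have : (\int[mu]_x ((`|y| * \1_(g_ m @^-1` [set y]) x)%:E) < +oo)%E.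
  case/integrableP: iy => _; apply: le_lt_trans; apply: ge0_le_integral => //.
  - by apply/measurable_EFinP; apply: measurable_funM => //; exact: measurable_indic.
  - by apply: measurableT_comp => //; apply/measurable_EFinP; apply: measurableT_comp.
  - move=> x _; rewrite /= normr_id lee_fin indicE; case: (asboolP (g_ m x = y)) => xy.
    by rewrite mem_set // mulr1 xy.
   by rewrite memNset // mulr0.
 under eq_integral do rewrite EFinM.
 rewrite ge0_integralZl //; first last.
  by apply/measurable_EFinP; exact: measurable_indic.
 rewrite integral_indic // setIT.
 have ny : (0 < `|y|%:E :> \bar R)%E by rewrite lte_fin normr_gt0.
 suff H (v : \bar R) : (0 <= v)%E -> (`|y|%:E * v < +oo)%E -> (v < +oo)%E.
  by apply: H; exact: measure_ge0.
 by case: v => [r _ _|_|//]; [exact: ltry|rewrite gt0_muley].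
have -> : (g_ m : T -> R) = fun x : T => \sum_(y <- finmap.enum_fset (fset_set (range (g_ m)))) (y * \1_(g_ m @^-1` [set y]) x)%R.
 by apply/funext => x; rewrite [LHS]fimfunE fsbig_finite.
move: (finmap.enum_fset _) => s0; elim: s0 => [|y s IH].
 by under eq_fun do rewrite big_nil; exact: approximable0.
under eq_fun do rewrite big_cons; apply: approximable_add => //.
have [->|y0] := eqVneq y 0.
 by under eq_fun do rewrite mul0r; exact: approximable0.
by apply: approximable_scale; apply: approximable_set; [exact: measurable_sfunP|exact: fin].
Qed.

(** The test function [g] is split at height [n]. Its bounded part [gb] is paired with L¹
    convergence; its tail [gt], small in L², is controlled uniformly in [k] by [Kop_bilinear]. *)
Lemma Kop_weak f g : itg f -> itg (fun x => f x ^+ 2) -> itg (fun x => g x ^+ 2) ->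
 measurable_fun setT g -> forall e : R, 0 < e -> exists N, forall k, (N <= k)%N ->
 `|\int[mu]_x (Kop mu (K k) f x * g x) - \int[mu]_x (f x * g x)| <= e.
move=> if_ if2 ig2 mg e e0; have mf := itg_meas if_.
pose A := \int[mu]_x f x ^+ 2; have A0 : 0 <= A by apply: Rintegral_ge0 => x _; exact: sqr_ge0.
(* Each of the two tail terms costs [t * A] and [t^-1] times the squared norm of the tail, both made
   at most [e / 6]; with [e / 3] for the bounded part the total is [e]. *)
pose t := e / (6 * (A + 1)); have A1 : 0 < A + 1 by apply: ltr_wpDl.
have t0 : 0 < t by rewrite divr_gt0 // mulr_gt0.
have tA : t * A <= e / 6.
 rewrite /t invfM mulrA -[leRHS]mulr1 -mulrA ler_wpM2l ?divr_ge0 // ?(ltW e0) //.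
 by rewrite mulrC ler_pdivrMr // mul1r lerDl.
pose B n := [set x | `|g x| <= n%:R].
have mB n : measurable (B n).
 have mng : measurable_fun setT (fun x => `|g x|) by exact: measurableT_comp.
 have -> : B n = setT `&` (fun x => `|g x|) @^-1` `]-oo, n%:R].
  by rewrite setTI; apply/seteqP; split=> x; rewrite /B /= in_itv.
 by apply: mng => //; exact: measurable_itv.
pose gb n x := g x * \1_(B n) x; pose gt n x := g x - gb n x.
have mgb n : measurable_fun setT (gb n).
 by apply: measurable_funM => //; exact: measurable_indic.
have mgt n : measurable_fun setT (gt n) by exact: measurable_funB.
have gt2 n x : `|gt n x ^+ 2| <= g x ^+ 2.
 rewrite ger0_norm ?sqr_ge0 // /gt /gb indicE; case: (x \in B n); first by rewrite mulr1 subrr expr0n sqr_ge0.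
 by rewrite mulr0 subr0.
have c0 x : setT x -> (fun n => gt n x ^+ 2) @ \oo --> (0 : R).
 move=> _; have [N hN] : exists N : nat, `|g x| <= N%:R.
  by exists (Num.trunc `|g x|).+1; apply: ltW; apply: Num.Theory.real_truncnS_gt; exact: num_real.
 apply: cvg_near_cst; exists N => // n /= Nn.
 rewrite /gt /gb indicE mem_set ?mulr1 ?subrr ?expr0n //.
 by rewrite /B /= (le_trans hN) // ler_nat.
have [_ _] := @Rdominated _ _ _ mu setT measurableT (fun n x => gt n x ^+ 2) (fun=> 0) (fun x => g x ^+ 2)
 (fun n => measurable_funX 2%N (mgt n)) c0 ig2 (fun n x _ => gt2 n x).
rewrite Rintegral_cst // mul0r => H.
have te : 0 < t * (e / 6) by apply: mulr_gt0 => //; exact: divr_gt0.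
move/cvgrPdist_le/(_ _ te) : H => [n _ hn].
have {hn} : \int[mu]_x gt n x ^+ 2 <= t * (e / 6).
 by have := hn n (leqnn n); rewrite /= sub0r normrN => /(le_trans (ler_norm _)).
move=> hn.
have tn : t^-1 * \int[mu]_x gt n x ^+ 2 <= e / 6.
 by rewrite mulrC ler_pdivrMr // mulrC.
have igt : itg (fun x => gt n x ^+ 2).
 by apply: itg_le (measurable_funX 2%N (mgt n)) (fun x _ => gt2 n x) ig2.
have n1 : 0 < (n.+1%:R : R) by rewrite ltr0n.
have e3 : 0 < e / 3 / n.+1%:R by rewrite !divr_gt0.
have [_ /(_ _ e3) [N hN]] := approximable_integrable if_.
exists N => k Nk.
have [ikt bkt] := Kop_bilinear (dsK k) t0 if_ (mgt n) if2 igt.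
have ifg := itgM measurableT mf mg if2 ig2.
have ift := itgM measurableT mf (mgt n) if2 igt.
have gbn x : setT x -> `|gb n x| <= n.+1%:R.
 move=> _; rewrite /gb indicE; case: (asboolP (B n x)) => h.
  by rewrite mem_set // mulr1 (le_trans h) // ler_nat.
 by rewrite memNset // mulr0 normr0 ltW.
have idb : itg (fun x => (Kop mu (K k) f x - f x) * gb n x).
 by apply: itgMb gbn => //; exact: idiff.
have [ikg _] := Kop_bilinear (dsK k) t0 if_ mg if2 ig2.
rewrite -RintegralB //.
have -> : \int[mu]_x (Kop mu (K k) f x * g x - f x * g x) =
 \int[mu]_x (((Kop mu (K k) f x - f x) * gb n x + Kop mu (K k) f x * gt n x) - f x * gt n x).
 by apply: eq_Rintegral => x _; rewrite /gt; ring.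
rewrite RintegralB //; last exact: itgD.
rewrite RintegralD //.
have h1 : `|\int[mu]_x ((Kop mu (K k) f x - f x) * gb n x)| <= e / 3.
 apply: le_trans (le_normr_Rintegral measurableT idb) _.
 apply: (@le_trans _ _ (\int[mu]_x (n.+1%:R * `|Kop mu (K k) f x - f x|))).
  apply: le_Rintegral => //.
  - exact: itg_norm.
  - by apply: itgZ => //; apply: itg_norm; exact: idiff.
  - by move=> x _; rewrite normrM mulrC ler_wpM2r // gbn.
 rewrite RintegralZl //; last by apply: itg_norm; exact: idiff.
 by rewrite mulrC -ler_pdivlMr // hN.
have h2 := le_trans (le_normr_Rintegral measurableT ikt) bkt.
have h3 := integral_young measurableT t0 mf (mgt n) if2 igt; rewrite -/A in h3.
rewrite -/A in h2.
apply: le_trans (ler_normB _ _) _; apply: le_trans (lerD (ler_normD _ _) (lexx _)) _.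
lra.
Qed.

End approximate_identity.

(** * Integration on Euclidean space and functions of bounded support *)

Section euclidean_integral.
Context {R : realType} {d : nat}.
Local Notation E := 'rV[R]_d.+1.
Local Notation L := (@lebesgue_outer R d.+1).
Local Notation LT := (caratheodory_type L).
Local Notation mu := (@leb R d.+1).
Local Notation Z := {ffun 'I_d.+1 -> int}.

Lemma lebE (A : set E) : mu A = L A. Proof. by []. Qed.

Lemma leb_sigma_finite : sigma_finite [set: LT] mu.
exists (fun k => box (const_mx (- k%:R)) (const_mx k%:R)).
 apply/seteqP; split=> // x; pose N := (Num.trunc (enorm (x : E))).+1.
 have hN : enorm (x : E) < N%:R by apply: Num.Theory.real_truncnS_gt; exact: num_real.
 exists N => // i; rewrite !mxE; have := le_lt_trans (coord_le_enorm (x : E) i) hN.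
 by rewrite ltr_norml => /andP[/ltW -> ->].
move=> k; split; first exact: box_measurable.
rewrite lebE leb_box ?ltry // => i; rewrite !mxE.
by have : (0 : R) <= k%:R by []; lra.
Qed.

(** The same measure, equipped with the sigma-finiteness that Fubini's theorem asks for. *)
Definition lebs : {sigma_finite_measure set LT -> \bar R} :=
 HB.pack (Measure.sort mu) (Measure.class mu) (@Measure_isSigmaFinite.Build _ LT R (Measure.sort mu) leb_sigma_finite).

Lemma cont_meas (D : set E) (f : E -> R) : contin_on D f ->
 measurable_fun (D : set LT) f.
by apply: contin_on_measurable; exact: halfspace_caratheodory. Qed.

Lemma cont_contin (D : set E) (f : E -> R) : continuous f -> contin_on D f.
move=> cf x _ e e0; have [r r0 hr] := (cont_enormP f x).1 (cf x) e e0.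
by exists r => // y _ /hr; rewrite distrC.
Qed.

Lemma integrable_bounded (D : set E) (f : E -> R) (C : R) :
 measurable (D : set LT) -> (L D < +oo)%E -> measurable_fun (D : set LT) f ->
 (forall x, D x -> `|f x| <= C) -> Ritg mu D f.
move=> mD Dfin mf hC; apply: measurable_bounded_integrable => //.
exists C; split; first exact: num_real.
by move=> M CM x Dx /=; rewrite (le_trans (hC _ Dx)) // ltW.
Qed.

(** The outer measure is invariant under translation, so Carathéodory's condition for a set carries
    over to its translates. *)
Lemma translate_measurable (v : E) : measurable_fun [set: LT] (fun x : LT => (v + x : E) : LT).
move=> _ A mA; rewrite setTI.
have -> : (fun x : LT => (v + x : E) : LT) @^-1` A = [set - v + x | x in (A : set E)].
 apply/seteqP; split=> [x Ax|_ [x Ax <-]] /=; last by rewrite addrA subrr add0r.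
 by exists (v + x) => //; rewrite addrA addNr add0r.
pose P := [set - v + x | x in (A : set E)].
suff H X : (L X = L (X `&` P) + L (X `&` ~` P))%E by exact: H.
rewrite -(leb_translate v X) -(leb_translate v (X `&` P)) -(leb_translate v (X `&` ~` P)).
rewrite (mA [set v + x | x in X]); congr (L _ + L _)%E; apply/seteqP; split.
- move=> _ [[x Xx <-] Ax]; exists x => //; split => //; exists (v + x) => //.
 by rewrite addrA addNr add0r.
- move=> _ [x [Xx [y Ay yx]] <-]; split; first by exists x.
 by rewrite -yx addrA subrr add0r.
- move=> _ [[x Xx <-] Ax]; exists x => //; split => // -[y Ay xy]; apply: Ax.
 by rewrite -xy addrA subrr add0r.
- move=> _ [x [Xx nx] <-]; split; first by exists x.
 by move=> Ax; apply: nx; exists (v + x) => //; rewrite addrA addNr add0r.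
Qed.

Lemma leb_preimage_translate (v : E) (A : set E) :
 L ((fun x => v + x) @^-1` A) = L A.
rewrite -(leb_translate v ((fun x => v + x) @^-1` A)); congr L.
apply/seteqP; split=> [_ [x Ax <-] //|x Ax]; exists (- v + x) => /=; rewrite addrA subrr add0r //.
Qed.

Lemma Rintegral_translate (v : E) (f : E -> R) : Ritg mu setT f ->
 Ritg mu setT (fun x => f (v + x)) /\
 \int[mu]_x f (v + x) = \int[mu]_x f x.
move=> intf; have mt := translate_measurable v.
have mf : measurable_fun [set: LT] (EFin \o f) by case/integrableP: intf.
have eqm A : measurable (A : set LT) -> A `<=` setT ->
  pushforward mu (fun x : LT => (v + x : E) : LT) A = mu A.
 by move=> _ _; exact: leb_preimage_translate.
have intg : Ritg mu setT (fun x => f (v + x)).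
 apply/integrableP; split; first exact: (measurableT_comp mf mt).
 case/integrableP: intf => _; rewrite -(eq_measure_integral _ eqm) ge0_integral_pushforward //.
 exact: measurableT_comp.
rewrite /Rintegral -[in RHS](eq_measure_integral _ eqm) integral_pushforward //.
Qed.

(** Measurability is meant in the product sigma-algebra: [W] is the union of the countably many
    products of two grid cubes that it contains. *)
Lemma prod_open_measurable (W : set (E * E)) :
 (forall p, W p -> exists2 r, 0 < r & forall q : E * E,
   enorm (q.1 - p.1) < r -> enorm (q.2 - p.2) < r -> W q) ->
 measurable (W : set (LT * LT)).
move=> oW.
pose F (w : nat * (Z * Z)) : set (LT * LT) :=
 if `[< cube w.1.+1%:R^-1 w.2.1 `*` cube w.1.+1%:R^-1 w.2.2 `<=` W >]
 then cube w.1.+1%:R^-1 w.2.1 `*` cube w.1.+1%:R^-1 w.2.2 else set0.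
have -> : W = \bigcup_w F w.
 apply/seteqP; split=> [p Wp|p [w _]]; last by rewrite /F; case: asboolP => +; exact.
 have [r r0 hr] := oW _ Wp.
 have rd0 : 0 < r / d.+2%:R by rewrite divr_gt0.
 have [k _ hk] := near_infty_natSinv_lt (PosNum rd0).
 have kr : k.+1%:R^-1 < r / d.+2%:R by exact: (hk k (leqnn k)).
 have k0 : (0 : R) < k.+1%:R^-1 by [].
 have inc (x : E) : cube k.+1%:R^-1 [ffun i => grid k.+1%:R^-1 x i] x.
  by apply/cube_grid => //; apply/funext => i; rewrite ffunE.
 have close (x y : E) : cube k.+1%:R^-1 [ffun i => grid k.+1%:R^-1 x i] y -> enorm (y - x) < r.
  move=> hy; rewrite enormB; apply: le_lt_trans (enorm_ball (cube_dist k0 (inc x) hy)) _.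
  apply: (@le_lt_trans _ _ (d.+1%:R * (r / d.+2%:R))); first by rewrite ler_wpM2l // ltW.
  by rewrite frac_lt.
 have sub : cube k.+1%:R^-1 [ffun i => grid k.+1%:R^-1 p.1 i] `*`
   cube k.+1%:R^-1 [ffun i => grid k.+1%:R^-1 p.2 i] `<=` W.
  by move=> q [h1 h2]; apply: hr; exact: close.
 exists (k, ([ffun i => grid k.+1%:R^-1 p.1 i], [ffun i => grid k.+1%:R^-1 p.2 i])) => //.
 by rewrite /F (asboolT sub); split; exact: inc.
apply: countable_bigcupT_measurable => // w; rewrite /F; case: ifP => _; last exact: measurable0.
by apply: measurableX; exact: box_measurable.
Qed.

Lemma kernel_measurable (k : E -> R) : continuous k ->
 measurable_fun [set: LT * LT] (fun p => k ((p.2 : E) - (p.1 : E))).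
move=> ck; apply: (measurability _ (RGenOInfty.measurableE R)) => //.
move=> _ [_ [c ->] <-]; apply: prod_open_measurable => -[x y] /=.
rewrite in_itv /= => cxy.
have e0 : 0 < k (y - x) - c by lra.
have [r r0 hr] := (cont_enormP k (y - x)).1 (ck _) _ e0.
exists (r / 2) => [|[x' y'] /= hx hy]; first by rewrite divr_gt0.
rewrite in_itv /=; have := hr (y' - x').
have -> : y' - x' - (y - x) = (y' - y) - (x' - x) by apply/rowP => i; rewrite !mxE; ring.
have : enorm (y' - y - (x' - x)) < r.
 by apply: le_lt_trans (ler_enormD _ _) _; rewrite enormN (splitr r) ltrD.
by rewrite ltr_norml; lra.
Qed.

Section compact_support.
Implicit Types (f g : E -> R) (x y h : E) (U Om K : set E).

Lemma eball_compact x r : compact (eball x r).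
apply: bounded_closed_compact; last exact: eball_closed.
exists (enorm x + r); split; first exact: num_real.
move=> M hM y yr; apply: le_trans (normr_le_enorm y) _; apply: le_trans (ltW hM).
by rewrite -{1}(subrK x y) addrC (le_trans (ler_enormD _ _)) // lerD2l.
Qed.

Lemma compact_enorm_bounded K : compact K -> exists2 r, 0 < r & forall x, K x -> enorm x <= r.
move=> /compact_bounded [M [_ hM]]; exists (d.+1%:R * (`|M| + 1)).
 by [].
move=> x Kx; apply: le_trans (enorm_le_normr x) _; rewrite ler_wpM2l //.
by apply: hM => //; rewrite ltr_pwDr // ler_norm.
Qed.

Lemma continuous_bounded_on K f : compact K -> (forall x, K x -> {for x, continuous f}) ->
 exists2 C, 0 < C & forall x, K x -> `|f x| <= C.
move=> cK cf; have cfK : {within K, continuous f}.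
 by apply: continuous_in_subspaceT => x /set_mem; exact: cf.
have [M [_ hM]] := compact_bounded (continuous_compact cfK cK).
exists (`|M| + 1); first by rewrite ltr_wpDl.
by move=> x Kx; apply: (hM _ _ (f x)); [rewrite ltr_pwDr // ler_norm|exists x].
Qed.

Lemma smooth_partial U f i : smooth U f -> smooth U (partial i f).
by move=> sf k; have [_] := sf k.+1; apply. Qed.

Lemma smooth_diff U f x : smooth U f -> U x -> differentiable f x.
by move=> sf; have [+ _] := sf 1%N; apply. Qed.

Lemma smooth_for U f x : smooth U f -> U x -> {for x, continuous f}.
by move=> sf; by have := sf 0%N; apply. Qed.

Lemma smooth_continuous f : smooth setT f -> continuous f.
by move=> sf x; by have := sf 0%N; apply. Qed.

Lemma smooth_contin_on D f : smooth setT f -> contin_on D f.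
by move=> sf; apply: cont_contin; exact: smooth_continuous. Qed.

Lemma smooth_measurable (D : set LT) f : smooth setT f -> measurable_fun D f.
by move=> sf; apply: cont_meas; exact: smooth_contin_on. Qed.

Definition bump_function g := smooth setT g /\ exists r, forall x, r < enorm x -> g x = 0.

Lemma outside_partial g r i : (forall x, r < enorm x -> g x = 0) ->
 forall x, r < enorm x -> partial i g x = 0.
move=> g0 x rx; rewrite (@partial_near _ _ g (cst 0)) ?partial_cst //.
apply/nbhs_enormP; exists (enorm x - r); first by rewrite subr_gt0.
move=> y yx; apply: g0; have := ler_enorm_dist x y; rewrite enormB => h.
have := le_lt_trans (le_trans (ler_norm _) h) yx; lra.
Qed.

Lemma bump_partial g i : bump_function g -> bump_function (partial i g).
by move=> [sg [r g0]]; split; [exact: smooth_partial|exists r; exact: outside_partial].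
Qed.

Lemma bump_bounded g : bump_function g -> exists2 C, 0 < C & forall x, `|g x| <= C.
move=> [sg [r g0]].
have [C C0 hC] := continuous_bounded_on (@eball_compact 0 r) (fun x _ => smooth_continuous sg (x := x)).
exists C => // x; have [xr|xr] := leP (enorm x) r; first by apply: hC; rewrite /eball /= subr0.
by rewrite g0 // normr0 ltW.
Qed.

Lemma bump_grad_bounded g : bump_function g -> exists2 C, 0 < C & forall x, enorm (grad g x) <= C.
move=> bg; have H (i : 'I_d.+1) : {C | 0 < C & forall x, `|partial i g x| <= C}.
 by have [C C0 hC] := cid2 (bump_bounded (bump_partial i bg)); exists C.
pose C := \sum_i s2val (H i); have Ci i : s2val (H i) <= C.
 by rewrite /C (bigD1 i) //= lerDl sumr_ge0 // => j; rewrite ltW // (s2valP (H j)).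
exists (d.+1%:R * C).
 by rewrite mulr_gt0 // (lt_le_trans (s2valP (H ord0))).
move=> x; apply: enorm_le_coord => i; rewrite mxE.
exact: le_trans (s2valP' (H i) x) (Ci i).
Qed.

Lemma bump_lipschitz g : bump_function g -> exists2 C, 0 < C & forall x h, `|g (x + h) - g x| <= C * enorm h.
move=> bg; have [C C0 hC] := bump_grad_bounded bg; exists C => // x h.
have [t _ ->] := @mvt_line R d.+1 g x h (fun t _ => smooth_diff bg.1 (I : setT (x + t *: h))).
by rewrite (le_trans (norm_dot_le _ _)) // ler_wpM2r // enorm_ge0.
Qed.

Lemma bump_quadratic g : bump_function g -> exists2 C, 0 < C &
 forall x h, `|g (x + h) - g x - dot (grad g x) h| <= C * enorm h ^+ 2.
move=> bg; have H (i : 'I_d.+1) : {C | 0 < C & forall x h, `|partial i g (x + h) - partial i g x| <= C * enorm h}.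
 by have [C C0 hC] := cid2 (bump_lipschitz (bump_partial i bg)); exists C.
pose C := \sum_i s2val (H i); have Ci i : s2val (H i) <= C.
 by rewrite /C (bigD1 i) //= lerDl sumr_ge0 // => j; rewrite ltW // (s2valP (H j)).
exists (d.+1%:R * C).
 by rewrite mulr_gt0 // (lt_le_trans (s2valP (H ord0))).
move=> x h.
have [t /andP[t0 t1] ->] := @mvt_line R d.+1 g x h (fun t _ => smooth_diff bg.1 (I : setT (x + t *: h))).
rewrite -dotNl -dotDl (le_trans (norm_dot_le _ _)) // mulrA ler_wpM2r ?enorm_ge0 //.
rewrite -mulrA; apply: enorm_le_coord => i; rewrite !mxE.
apply: le_trans (s2valP' (H i) _ _) _; rewrite enormZ gtr0_norm //.
apply: ler_pM => //; first by rewrite ltW // (s2valP (H i)).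
 by rewrite mulr_ge0 ?enorm_ge0 // ltW.
by rewrite ler_piMl ?enorm_ge0 // ltW.
Qed.

Lemma bump_itg g : bump_function g -> Ritg mu setT g.
move=> bg; have [C C0 hC] := bump_bounded bg; have [sg [r g0]] := bg.
have mB := eball_measurable (0 : E) r.
have fB : (mu (eball (0 : E) r) < +oo)%E.
 by apply: (@bounded_leb _ _ _ r) => x; rewrite /eball /= subr0.
apply: (@itg_le _ _ _ mu setT measurableT g (fun x => C * \1_(eball (0 : E) r) x)).
- by exact: smooth_measurable.
- move=> x _; rewrite indicE; case: (asboolP (eball 0 r x)) => h.
  by rewrite mem_set // mulr1.
 rewrite memNset // mulr0 g0 ?normr0 // ltNge; apply/negP => hx; apply: h.
 by rewrite /eball /= subr0.
- by apply: itgZ => //; exact: itg_ind.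
Qed.

(** A consequence of translation invariance: the increment of [g] along a step of length [t] has
    integral zero, and it differs from [t] times the partial derivative by at most [C * t ^ 2] on a
    fixed ball. Dividing by [t] leaves an arbitrarily small bound. *)
Lemma integral_partial g i : bump_function g -> \int[mu]_x partial i g x = 0.
move=> bg; have [C C0 hC] := bump_quadratic bg; have [sg [r g0]] := bg.
have ig := bump_itg bg; have ip := bump_itg (bump_partial i bg).
pose r1 := `|r| + 1; pose B := eball (0 : E) r1.
have mB : measurable (B : set LT) by exact: eball_measurable.
have fB : (mu B < +oo)%E.
 by apply: (@bounded_leb _ _ _ r1) => x; rewrite /B /eball /= subr0.
have iB := itg_ind mB fB.
pose V := \int[mu]_x (\1_B x : R); have V0 : 0 <= V by apply: Rintegral_ge0 => x.
have key t : 0 < t -> t <= 1 -> t * `|\int[mu]_x partial i g x| <= (C * V) * t ^+ 2.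
 move=> t0 t1; pose v := t *: (delta_mx ord0 i : E).
 have ev : enorm v = t.
  rewrite enormZ gtr0_norm // -[RHS]mulr1; congr (_ * _).
  rewrite /enorm /dot (bigD1 i) //= big1 => [|j /negbTE ji]; last by rewrite !mxE ji mulr0.
  by rewrite !mxE !eqxx mulr1 addr0 sqrtr1.
 have [iv ev2] := Rintegral_translate v ig.
 have dv x : dot (grad g x) v = t * partial i g x.
  rewrite /dot (bigD1 i) //= big1 => [|j /negbTE ji]; last by rewrite !mxE ji !mulr0.
  by rewrite !mxE !eqxx addr0 mulr1 mulrC.
 have itp := itgZ measurableT t ip.
 have iD := itgB measurableT iv ig.
 have eD : \int[mu]_x (g (v + x) - g x) = 0 by rewrite RintegralB // ev2 subrr.
 have iD2 := itgB measurableT iD itp.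
 have : `|\int[mu]_x (g (v + x) - g x - t * partial i g x)| <= (C * V) * t ^+ 2.
  apply: le_trans (le_normr_Rintegral measurableT iD2) _.
  have -> : C * V * t ^+ 2 = \int[mu]_x (C * t ^+ 2 * \1_B x).
   by rewrite RintegralZl // mulrAC.
  apply: le_Rintegral => //; first exact: itg_norm.
   exact: itgZ.
  move=> x _; rewrite indicE; case: (asboolP (B x)) => h.
   by rewrite mem_set // mulr1 -dv addrC [v + x]addrC -ev addrC.
  have xr : r1 < enorm x by rewrite ltNge; apply/negP => hx; apply: h; rewrite /B /eball /= subr0.
  have rr : r <= `|r| by exact: ler_norm.
  rewrite memNset // mulr0 g0; last first.
   have := ler_enormD (v + x) (- v); rewrite addrAC subrr add0r enormN ev => h2.
   rewrite /r1 in xr; lra.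
  rewrite g0; last by rewrite /r1 in xr; lra.
  rewrite (@outside_partial g r) //; last by rewrite /r1 in xr; lra.
  by rewrite mulr0 !subr0 normr0.
 by rewrite RintegralB // eD sub0r normrN RintegralZl // normrM gtr0_norm.
apply/eqP; rewrite -normr_le0 leNgt; apply/negP => q0.
set q := `|_| in key q0.
have CV1 : 0 < C * V + 1 by rewrite ltr_wpDl // mulr_ge0 // ltW.
pose t := Num.min 1 (q / (C * V + 1) / 2).
have t0 : 0 < t by rewrite lt_min ltr01 !divr_gt0.
have : t <= 1 by rewrite ge_min lexx.
have := key t; rewrite mulrCA ler_pM2l // => h.
have : t * (C * V + 1) <= q / 2.
 by rewrite -ler_pdivlMr // mulrAC ge_min lexx orbT.
lra.
Qed.

Lemma bumpM g (h : E -> R) : bump_function g -> smooth setT h -> bump_function (fun x => g x * h x).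
move=> [sg [r g0]] sh; split=> [k|]; first exact: (Ck_M openT (sg k) (sh k)).
by exists r => x /g0 ->; rewrite mul0r.
Qed.

(** The argument is [y - x] and not [x - y]: the value at [x] is literally the pairing of [f] with a
    translate of [g], which can be a test function. This is why a sign appears in [conv_smooth]. *)
Definition conv f g x := \int[mu]_y (f y * g (y - x)).

Lemma bump_shift_measurable g x : bump_function g ->
 measurable_fun [set: LT] (fun y : LT => g ((y : E) - x)).
move=> [sg _]; have cg := smooth_continuous sg.
apply: cont_meas => y _ e e0; have [r r0 hr] := (cont_enormP g (y - x)).1 (cg _) e e0.
exists r => // z _ zy; rewrite distrC; apply: hr.
by have -> : z - x - (y - x) = z - y by apply/rowP => i; rewrite !mxE; ring.
Qed.

Lemma conv_integrable f g x : Ritg mu setT f -> bump_function g ->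
 Ritg mu setT (fun y => f y * g (y - x)).
move=> intf bg; have [C _ hC] := bump_bounded bg.
exact: (itgMb (C := C) measurableT intf (bump_shift_measurable x bg) (fun y _ => hC _)).
Qed.

Lemma conv_fdiff f g x : Ritg mu setT f -> bump_function g ->
 fdiff (conv f g) x (\row_i - conv f (partial i g) x).
move=> intf bg e e0; have [C C0 hC] := bump_quadratic bg.
pose A := \int[mu]_y `|f y|; have A0 : 0 <= A by exact: Rintegral_ge0.
have : 0 < C * A + 1 by rewrite ltr_wpDl // mulr_ge0 // ltW.
exists (e / (C * A + 1)); first by rewrite divr_gt0.
move=> z zx; pose v := z - x.
have iz := conv_integrable z intf bg; have ix := conv_integrable x intf bg.
have ip i := conv_integrable x intf (bump_partial i bg).
have [ii es] := Rintegral_sum measurableT (index_enum 'I_d.+1)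
 (fun i => itgZ measurableT (v ord0 i) (ip i)).
have -> : dot (\row_i - conv f (partial i g) x) (z - x) =
  - \int[mu]_y (\sum_i v ord0 i * (f y * partial i g (y - x))).
 rewrite es -sumrN; apply: eq_bigr => i.
 by rewrite mxE RintegralZl // mulNr mulrC.
rewrite opprK -RintegralB // -RintegralD //; last exact: itgB.
set G := fun => _.
have GE y : G y = f y * (g (y - x - v) - g (y - x) - dot (grad g (y - x)) (- v)).
 have -> : y - x - v = y - z by rewrite opprB addrA subrK.
 rewrite dotNr opprK mulrDr mulrBr; congr (_ + _); rewrite mulr_sumr.
 by apply: eq_bigr => i; rewrite [grad _ _ _ _]mxE mulrC -mulrA.
have iG : Ritg mu setT G.
 by apply: itgD => //; exact: itgB.
apply: le_trans (le_normr_Rintegral measurableT iG) _.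
apply: (@le_trans _ _ (\int[mu]_y (C * enorm v ^+ 2 * `|f y|))).
 apply: le_Rintegral => //; first exact: itg_norm.
  by apply: itgZ => //; exact: itg_norm.
 by move=> y; rewrite GE normrM mulrC ler_wpM2r // -(enormN v).
rewrite RintegralZl //; last exact: itg_norm.
rewrite mulrA mulrAC ler_wpM2r ?enorm_ge0 // mulrAC.
move: zx; rewrite ltr_pdivlMr // => /ltW; apply: le_trans.
by rewrite mulrC ler_wpM2l ?enorm_ge0 // lerDl.
Qed.

Lemma conv_smooth f g : Ritg mu setT f -> bump_function g ->
 smooth setT (conv f g) /\ forall i x, partial i (conv f g) x = - conv f (partial i g) x.
move=> intf; have pE (h : E -> R) i x : bump_function h -> partial i (conv f h) x = - conv f (partial i h) x.
 move=> bh; have [_ gE] := fdiff_diff (conv_fdiff x intf bh).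
 by have := congr1 (fun G : E => G ord0 i) gE; rewrite !mxE.
move=> bg; split; last by move=> i x; exact: pE.
move=> k; elim: k g bg => [|k IH] g bg.
 move=> x _; apply: differentiable_continuous.
 exact: (fdiff_diff (conv_fdiff x intf bg)).1.
split=> [x _|i]; first exact: (fdiff_diff (conv_fdiff x intf bg)).1.
apply: (@Ck_ext _ _ k setT (cst (-1) \* conv f (partial i g)) _ openT).
 by move=> x; rewrite pE // /= mulN1r.
by apply: Ck_M; [exact: openT|exact: Ck_cst|exact: IH (bump_partial i bg)].
Qed.

End compact_support.

(** * Mollifiers, and exhaustion of an open set from inside *)

Section mollifier.
Local Notation lebs := (@lebs).
Implicit Types (f g : E -> R) (x y z : E) (U Om K : set E).

Definition rad (k : nat) : R := k.+1%:R^-1.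

Lemma rad_gt0 k : 0 < rad k. Proof. by rewrite invr_gt0. Qed.

Lemma rad_small (e : R) : 0 < e -> exists N, forall k, (N <= k)%N -> rad k < e.
by move=> e0; have [N _ hN] := near_infty_natSinv_lt (PosNum e0); exists N => k; exact: hN. Qed.

Definition mollf (r : R) : E -> R := flat 0 \o (fun z => r ^+ 2 - dot z z).

Lemma smooth_dot : smooth setT (fun z : E => dot z z).
move=> k; apply: (@Ck_sum _ _ k setT _ _ (fun i z => z ord0 i * z ord0 i) openT) => i.
by apply: Ck_M; [exact: openT|exact: Ck_coord|exact: Ck_coord].
Qed.

Lemma bump_mollf r : 0 < r -> bump_function (mollf r).
move=> r0; split=> [k|].
 apply: (Ck_comp1 openT (ck1_flat k 0)).
 apply: (@Ck_ext _ _ k setT (cst (r ^+ 2) \+ (cst (-1) \* (fun z : E => dot z z))) _ openT).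
  by move=> x /=; rewrite mulN1r.
 by apply: (Ck_D openT (Ck_cst _ _ _)); apply: (Ck_M openT (Ck_cst _ _ _)); exact: smooth_dot.
exists r => x rx; rewrite /mollf /= flat_le0 // subr_le0 -enorm_sqr lerXn2r ?nnegrE ?(ltW rx) ?(ltW r0) //.
exact: enorm_ge0.
Qed.

Lemma mollf_ge0 r z : 0 <= mollf r z. Proof. exact: flat_ge0. Qed.

Definition mass r := \int[mu]_x mollf r x.

Lemma mass_gt0 r : 0 < r -> 0 < mass r.
move=> r0; rewrite lt_neqAle Rintegral_ge0 ?andbT; last by move=> x _; exact: mollf_ge0.
apply/eqP => m0; have bm := bump_mollf r0; have im := bump_itg bm.
have : \int[mu]_x `|mollf r x| = 0.
 by rewrite m0; apply: eq_Rintegral => x; rewrite ger0_norm // mollf_ge0.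
move=> /(Rintegral_abs_eq0 measurableT im) [N [mN N0 subN]].
have : (L (eball (0 : E) (r / 2)) <= L N)%E.
 apply: le_outer_measure => x; rewrite /eball /= subr0 => xr; apply: subN => /= /(_ I).
 apply/eqP; rewrite gt_eqF // /mollf /=; apply: flat0_gt0; rewrite subr_gt0 -enorm_sqr.
 by rewrite ltrXn2r ?nnegrE ?enorm_ge0 // (le_lt_trans xr) // half_lt.
rewrite leb_eball ?divr_gt0 //; have -> : L N = 0%E by exact: N0.
rewrite lee_fin leNgt mulr_gt0 //; first exact: ball_volume_gt0.
by rewrite exprn_gt0 // divr_gt0.
Qed.

Definition eta k (z : E) : R := mollf (rad k) z * (mass (rad k))^-1.

Lemma bump_eta k : bump_function (eta k).
by apply: bumpM; [exact: bump_mollf (rad_gt0 k)|move=> l; exact: Ck_cst]. Qed.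

Lemma eta_ge0 k z : 0 <= eta k z.
by rewrite mulr_ge0 ?mollf_ge0 // invr_ge0 ltW // mass_gt0 // rad_gt0. Qed.

Lemma eta_outside k z : rad k <= enorm z -> eta k z = 0.
move=> rz; rewrite /eta /mollf /= flat_le0 ?mul0r // subr_le0 -enorm_sqr lerXn2r ?nnegrE ?enorm_ge0 //.
by rewrite ltW // rad_gt0.
Qed.

Lemma eta_even k z : eta k (- z) = eta k z.
by rewrite /eta /mollf /= dotNl dotNr opprK. Qed.

Lemma int_eta k : \int[mu]_x eta k x = 1.
rewrite RintegralZr //; first by rewrite divff // gt_eqF // mass_gt0 // rad_gt0.
exact: bump_itg (bump_mollf (rad_gt0 k)).
Qed.

Lemma int_eta_shift k x : Ritg mu setT (fun y => eta k (y - x)) /\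
 \int[mu]_y eta k (y - x) = 1.
have [i1 i2] := Rintegral_translate (- x) (bump_itg (bump_eta k)).
have e y : - x + y = y - x by rewrite addrC.
split; first by move: i1; under eq_fun do rewrite e.
by rewrite -(int_eta k) -i2; apply: eq_Rintegral => y; rewrite e.
Qed.

Definition eta_kernel k (p : LT * LT) : R := eta k ((p.2 : E) - (p.1 : E)).

(** The mollifier is even, so normalisation in one variable gives it in the other. *)
Lemma eta_stochastic k : doubly_stochastic lebs (eta_kernel k).
have h x : (\int[mu]_y (eta k (y - x))%:E = 1)%E.
 have [i1 i2] := int_eta_shift k x.
 have fin := integrable_fin_num measurableT i1.
 by rewrite -(fineK fin); congr (_%:E).
split.
- apply: kernel_measurable; exact: smooth_continuous (bump_eta k).1.
- by move=> p; exact: eta_ge0.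
- have [C _ hC] := bump_bounded (bump_eta k); exists C => p; exact: le_trans (ler_norm _) (hC _).
- exact: h.
- move=> y; rewrite -[RHS](h y); apply: eq_integral => x.
 by rewrite -eta_even opprB.
Qed.

Lemma eta_local U x : open U -> U x -> exists N, forall k, (N <= k)%N ->
 forall y, ~ U y -> eta k (y - x) = 0.
move=> oU Ux; have [r r0 hr] := open_enorm oU Ux.
have [N hN] := rad_small r0; exists N => k /hN kr y nUy; apply: eta_outside.
by rewrite leNgt; apply/negP => h; apply: nUy; apply: hr; exact: lt_trans kr.
Qed.

(** The half-open boxes of a nearly optimal cover are pushed out slightly on their closed sides, at
    a geometric cost, and become open. *)
Lemma leb_outer_regular (A : set E) (e : R) : measurable (A : set LT) -> (L A < +oo)%E -> 0 < e ->
 exists U, [/\ open U, A `<=` U & (L (U `\` A) <= e%:E)%E].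
move=> mA Afin e0; have e2 : 0 < e / 2 by lra.
have [l [u [lu cov sumv]]] := leb_box_cover Afin e2.
have H k : {t : R | 0 < t & vol (l k - const_mx t) (u k) <= vol (l k) (u k) + (e / 2) / 2 ^+ k.+1}.
 apply: cid2; pose f (t : R) := \prod_(i < d.+1) (u k ord0 i - l k ord0 i + t).
 have cf : continuous f.
  apply: prod_continuous => i t; by apply: cvgD; [exact: cvg_cst|exact: cvg_id].
 have ek : 0 < (e / 2) / 2 ^+ k.+1 by rewrite divr_gt0.
 have /cvgrPdist_le/(_ _ ek)/nbhs_ballP[t /= t0 ht] := cf 0.
 exists (t / 2); first by rewrite divr_gt0.
 have : `|f 0 - f (t / 2)| <= e / 2 / 2 ^+ k.+1.
  apply: ht; rewrite /ball /= sub0r normrN gtr0_norm ?divr_gt0 //.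
  lra.
 have -> : f 0 = vol (l k) (u k) by apply: eq_bigr => i; rewrite addr0.
 have -> : f (t / 2) = vol (l k - const_mx (t / 2)) (u k).
  by apply: eq_bigr => i; rewrite !mxE opprB addrA addrAC.
 by rewrite distrC => /(le_trans (ler_norm _)); lra.
pose t k := s2val (H k); have t0 k : 0 < t k := s2valP (H k).
have tv k := s2valP' (H k).
pose B k := [set x : 'rV[R]_d.+1 | forall i, l k ord0 i - t k < x ord0 i < u k ord0 i].
pose U := \bigcup_k B k.
have oU : open U.
 apply: bigcup_open => k _; rewrite openE => x Bx; apply/nbhs_enormP.
 pose m := \big[Num.min/1]_(i < d.+1) Num.min (x ord0 i - (l k ord0 i - t k)) (u k ord0 i - x ord0 i).
 exists m.
  rewrite /m; elim/big_ind : _ => [|a b a0 b0|i _]; rewrite ?ltr01 // lt_min.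
   lra.
  by rewrite !subr_gt0.
 move=> y ym i; have := le_lt_trans (coord_le_enorm (y - x) i) ym.
 have : m <= Num.min (x ord0 i - (l k ord0 i - t k)) (u k ord0 i - x ord0 i).
  by rewrite /m (bigD1 i) //= ge_min lexx.
 rewrite le_min !mxE => /andP[h1 h2] h3; have := lt_le_trans h3 h1; have := lt_le_trans h3 h2.
 by rewrite !ltr_norml => /andP[? ?]; lra.
have AU : A `<=` U.
 move=> x /cov [k _ bx]; exists k => // i; have /andP[h1 h2] := bx i.
 by rewrite (lt_le_trans _ h1) // ltrBlDr ltrDl.
have LU : (L U <= L A + e%:E)%E.
 apply: le_trans (@leb_le_cover _ _ U (fun k => l k - const_mx (t k)) u _ _) _.
 - by move=> k i; rewrite !mxE lerBlDr (le_trans (lu k i)) // lerDl ltW.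
 - move=> x [k _ Bx]; exists k => // i; have /andP[h1 h2] := Bx i.
  by rewrite !mxE ltW.
 - apply: (@le_trans _ _ (\sum_(0 <= k <oo) ((vol (l k) (u k))%:E + ((e / 2) / 2 ^+ k.+1)%:E))%E).
   apply: lee_nneseries => [k _ _|k _].
    by rewrite lee_fin vol_ge0 // => i; rewrite !mxE lerBlDr (le_trans (lu k i)) // lerDl ltW.
   by exact: tv.
  have := epsilon_trick xpredT (fun k => (vol_ge0 (lu k) : (0 <= (vol (l k) (u k))%:E)%E)) (ltW e2).
  under eq_eseriesr do rewrite natrX; move=> /le_trans; apply.
  apply: le_trans (leeD sumv (lexx _)) _.
  by rewrite -addeA -EFinD -splitr.
exists U; have mU : measurable (U : set LT) by exact: open_leb.
have : (mu (U `\` A) = mu U - mu (U `&` A))%E.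
 by apply: measureD => //; exact: (le_lt_trans LU (lte_add_pinfty Afin (ltry _))).
rewrite (setIidr AU) !lebE => ->; rewrite leeBlDl //.
by rewrite ge0_fin_numE //; exact: outer_measure_ge0.
Qed.

Lemma conv_eta_int k f : Ritg mu setT f ->
 Ritg mu setT (conv f (eta k)).
by move=> iF; exact: (Kop_int (eta_stochastic k) iF).1. Qed.

Lemma conv_eta_L1 f (e : R) : Ritg mu setT f -> 0 < e ->
 exists N, forall k, (N <= k)%N -> \int[mu]_x `|conv f (eta k) x - f x| <= e.
move=> iF.
exact: (approximable_integrable eta_stochastic (opn := fun U : set LT => open (U : set E))
 (fun U => @open_leb R d U) eta_local leb_outer_regular iF).2.
Qed.

Lemma conv_eta_weak f g (e : R) : Ritg mu setT f ->
 Ritg mu setT (fun x => f x ^+ 2) ->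
 Ritg mu setT (fun x => g x ^+ 2) ->
 measurable_fun (setT : set LT) g -> 0 < e -> exists N, forall k, (N <= k)%N ->
 `|\int[mu]_x (conv f (eta k) x * g x) - \int[mu]_x (f x * g x)| <= e.
move=> i1 i2 i3 mg e0.
exact: (Kop_weak eta_stochastic (opn := fun U : set LT => open (U : set E))
 (fun U => @open_leb R d U) eta_local leb_outer_regular i1 i2 i3 mg e0).
Qed.

Lemma conv_eta_near k f x (c e : R) : Ritg mu setT f ->
 (forall y, enorm (y - x) < rad k -> `|f y - c| <= e) -> `|conv f (eta k) x - c| <= e.
move=> iF fe; have [i1 e1] := int_eta_shift k x.
have i2 := conv_integrable x iF (bump_eta k).
have i3 := itgZ measurableT c i1.
have i4 := itgB measurableT i2 i3.
have -> : conv f (eta k) x - c = \int[mu]_y (f y * eta k (y - x) - c * eta k (y - x)).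
 by rewrite RintegralB // RintegralZl // e1 mulr1.
apply: le_trans (le_normr_Rintegral measurableT i4) _.
rewrite -[e]mulr1 -e1 -RintegralZl //; apply: le_Rintegral => //.
- exact: itg_norm.
- exact: itgZ.
- move=> y; rewrite -mulrBl normrM (ger0_norm (eta_ge0 _ _)).
 have [h|h] := ltP (enorm (y - x)) (rad k); first by rewrite ler_wpM2r ?eta_ge0 ?fe.
 by rewrite eta_outside // !mulr0.
Qed.

Lemma conv_eta_bound k f x (C : R) : Ritg mu setT f ->
 (forall y, `|f y| <= C) -> `|conv f (eta k) x| <= C.
move=> iF fC; rewrite -[conv _ _ _]subr0; apply: conv_eta_near => // y.
by rewrite subr0.
Qed.

End mollifier.

Section inner.
Implicit Types (x y z : E) (U Om K : set E).

(** The points at distance at least [r] from the complement. For bounded open [Om] these are compact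
    sets exhausting it, and mollification at scale below [r] is legitimate on them. *)
Definition inner Om (r : R) : set E := [set y | forall z, ~ Om z -> r <= enorm (y - z)].

Lemma inner_sub Om r : 0 < r -> inner Om r `<=` Om.
move=> r0 y iy; apply: contrapT => /iy; rewrite subrr enorm0 leNgt; exact/negP/negPn.
Qed.

Lemma inner_anti Om r s : r <= s -> inner Om s `<=` inner Om r.
by move=> rs y iy z /iy; exact: le_trans. Qed.

Lemma inner_shift Om r s x y : inner Om (r + s) x -> enorm (y - x) <= s -> inner Om r y.
move=> ix yx z /ix h; have := ler_enormD (x - y) (y - z).
rewrite addrA subrK => h2; rewrite enormB in yx; lra.
Qed.

Lemma inner_closed Om r : closed (inner Om r).
rewrite -[inner _ _]setCK; apply: open_closedC; rewrite openE => x /existsNP[z] /not_implyP[nz].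
move/negP; rewrite -ltNge => h; apply/nbhs_enormP; exists (r - enorm (x - z)); first by rewrite subr_gt0.
move=> y yx iy; have := iy z nz; have := ler_enormD (y - x) (x - z); rewrite addrA subrK.
lra.
Qed.

Lemma inner_compact Om r : bounded_set Om -> 0 < r -> compact (inner Om r).
move=> bO r0; apply: bounded_closed_compact; last exact: inner_closed.
by case: bO => M [rM hM]; exists M; split=> // r' /hM h y /(inner_sub r0); exact: h.
Qed.

Lemma compact_inner Om K : open Om -> compact K -> K `<=` Om ->
 exists2 r, 0 < r & K `<=` inner Om r.
move=> oO /compact_near_coveringP cK KO.
have : \forall k \near \oo, K `<=` inner Om (rad k : R).
 apply: (cK nat \oo (fun k x => inner Om (rad k) x)) => x /KO Ox.
 have [r r0 hr] := open_enorm oO Ox.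
 have r2 : 0 < r / 2 by lra.
 have [N hN] := rad_small r2.
 exists ([set y | enorm (y - x) < r / 2], [set k | (N <= k)%N]).
  by split; [apply/nbhs_enormP; exists (r / 2)|exists N].
 move=> [y k] /= [yx /hN kr] z nz; rewrite leNgt; apply/negP => yz; apply: nz; apply: hr.
 have := ler_enormD (z - y) (y - x); rewrite addrA subrK (enormB z y); lra.
by move=> [N _ hN]; exists (rad N); [exact: rad_gt0|exact: hN (leqnn N)].
Qed.

End inner.

End euclidean_integral.

(** * Operations on relatively continuous functions and bounded sets *)

Lemma rtail_lip_continuous {R : realType} {m k : nat} (f : 'rV[R]_m -> 'rV[R]_k) :
 (forall x y, enorm (f x - f y) <= enorm (x - y)) -> continuous f.
move=> lf x A /nbhs_enormP[r r0 hr]; apply/nbhs_enormP; exists r => // y yx.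
by apply: hr; exact: le_lt_trans.
Qed.

Lemma contin_on_cst {R : realType} {m : nat} (D : set 'rV[R]_m.+1) (a : R) : contin_on D (fun=> a).
by move=> x _ e e0; exists (1 : R) => // y _ _; rewrite subrr normr0. Qed.

Lemma closed_level {R : realType} {m : nat} (D : set 'rV[R]_m.+1) (f : 'rV[R]_m.+1 -> R) t :
 closed D -> contin_on D f -> closed [set x | D x /\ t <= f x].
move=> cD cf; set K := [set x | _]; rewrite -[K]setCK; apply: open_closedC; rewrite openE => x nK.
apply/nbhs_enormP; have [Dx|nDx] := pselect (D x); last first.
 have /nbhs_enormP[r r0 hr] : nbhs x (~` D) by apply: open_nbhs_nbhs; split=> //; exact: closed_openC.
 by exists r => // y /hr ny [].
have fx : f x < t by rewrite ltNge; apply/negP => h; apply: nK.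
have q0 : 0 < t - f x by rewrite subr_gt0.
have [r r0 hr] := cf x Dx _ q0; exists r => // y yx [Dy]; apply/negP; rewrite -ltNge.
have := le_lt_trans (ler_norm _) (hr y Dy yx); lra.
Qed.

Lemma bounded_eball {R : realType} {m : nat} (A : set 'rV[R]_m.+1) : bounded_set A ->
 exists2 M, 0 < M & A `<=` eball 0 M.
move=> [M [_ hM]]; exists (m.+1%:R * (`|M| + 1)); first by rewrite //.
move=> x Ax; rewrite /eball /= subr0; apply: le_trans (enorm_le_normr x) _; rewrite ler_wpM2l //.
by apply: hM => //; rewrite ltr_pwDr // ler_norm.
Qed.

Lemma closure_compact {R : realType} {m : nat} (A : set 'rV[R]_m.+1) : bounded_set A -> compact (closure A).
move=> /bounded_eball[M _ AM]; apply: (subclosed_compact (@closed_closure _ A) (@eball_compact R m 0 M)).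
by rewrite [X in _ `<=` X](closure_id _).1; [exact: closure_subset|exact: eball_closed].
Qed.

Lemma restrict_integrable {R : realType} {disp} {T : measurableType disp} (nu : {measure set T -> \bar R}) (A : set T) (f : T -> R) (B : R) :
 measurable A -> (nu A < +oo)%E -> measurable_fun setT (f \_ A) -> (forall x, `|f x| <= B) ->
 Ritg nu setT (f \_ A).
move=> mA fA mf fB; apply: (@itg_le _ _ _ nu setT measurableT _ (fun x => B * \1_A x)) => //.
- move=> x _; rewrite indicE /patch; case: ifP => _; first by rewrite mulr1.
 by rewrite mulr0 normr0.
- by apply: itgZ => //; exact: itg_ind.
Qed.

Section contin_on_theory.
Context {R : realType} {d : nat}.
Local Notation E := 'rV[R]_d.+1.
Implicit Types (f g : E -> R) (x y z : E) (D : set E).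

Lemma finite_radius (I : finType) (P : I -> R -> Prop) :
 (forall i r s, s <= r -> P i r -> P i s) -> (forall i, exists2 r, 0 < r & P i r) ->
 exists2 r, 0 < r & forall i, P i r.
move=> Pa H; pose r i := s2val (cid2 (H i)); have r0 i : 0 < r i := s2valP (cid2 (H i)).
have Pr i : P i (r i) := s2valP' (cid2 (H i)).
exists (\big[Num.min/1]_i r i) => [|i].
 by elim/big_ind : _ => // a b a0; rewrite lt_min a0.
by apply: Pa (Pr i); rewrite (bigD1 i) //= ge_min lexx.
Qed.

Lemma contin_on_row m (f : E -> 'rV[R]_m) D x e : (forall j, contin_on D (fun y => f y ord0 j)) ->
 D x -> 0 < e -> exists2 r, 0 < r & forall y, D y -> enorm (y - x) < r -> enorm (f y - f x) < e.
move=> cf Dx e0; have e1 : 0 < e / m.+1%:R by rewrite divr_gt0.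
have [r r0 hr] := @finite_radius 'I_m (fun j r => forall y, D y -> enorm (y - x) < r ->
 `|f y ord0 j - f x ord0 j| < e / m.+1%:R)
 (fun j r s sr H y Dy yx => H y Dy (lt_le_trans yx sr)) (fun j => cf j x Dx _ e1).
exists r => // y Dy yx; apply: (@le_lt_trans _ _ (m%:R * (e / m.+1%:R))).
 by apply: enorm_le_coord => j; rewrite !mxE ltW // hr.
by rewrite frac_lt.
Qed.

Lemma contin_on_comp m (f : E -> 'rV[R]_m) (g : 'rV[R]_m -> R) D :
 (forall j, contin_on D (fun y => f y ord0 j)) -> (forall x, D x -> {for f x, continuous g}) ->
 contin_on D (g \o f).
move=> cf cg x Dx e e0; have [r r0 hr] := (cont_enormP g (f x)).1 (cg x Dx) e e0.
have [s s0 hs] := contin_on_row cf Dx r0.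
by exists s => // y Dy yx; rewrite distrC; apply: hr; exact: hs.
Qed.

Lemma contin_on_comp1 f (h : R -> R) D : contin_on D f -> continuous h -> contin_on D (h \o f).
move=> cf ch x Dx e e0; have /cvgrPdist_lt/(_ e e0)/nbhs_ballP[r /= r0 hr] := ch (f x).
have [s s0 hs] := cf x Dx r r0; exists s => // y Dy yx; rewrite distrC; apply: hr.
by rewrite /ball /= distrC; exact: hs.
Qed.

Lemma contin_on_sub D D' f : D' `<=` D -> contin_on D f -> contin_on D' f.
move=> DD cf x Dx e e0; have [r r0 hr] := cf x (DD _ Dx) e e0.
by exists r => // y /DD; exact: hr.
Qed.

Lemma contin_onD D f g : contin_on D f -> contin_on D g -> contin_on D (fun x => f x + g x).
move=> cf cg x Dx e e0; have e2 : 0 < e / 2 by rewrite divr_gt0.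
have [r r0 hr] := cf x Dx _ e2; have [s s0 hs] := cg x Dx _ e2.
exists (Num.min r s); first by rewrite lt_min r0.
move=> y Dy; rewrite lt_min => /andP[h1 h2]; rewrite opprD addrACA (le_lt_trans (ler_normD _ _)) //.
by rewrite (splitr e) ltrD ?hr ?hs.
Qed.

Lemma contin_onM D f g : contin_on D f -> contin_on D g -> contin_on D (fun x => f x * g x).
move=> cf cg.
pose F (x : E) : 'rV[R]_2 := \row_j (if j == ord0 then f x else g x).
pose G (p : 'rV[R]_2) := p ord0 ord0 * p ord0 (lift ord0 ord0).
have GF x : (G \o F) x = f x * g x by rewrite /G /= !mxE.
have cF j : contin_on D (fun y => F y ord0 j).
 have [->|j0] := eqVneq j ord0.
  by have -> : (fun y => F y ord0 ord0) = f by apply/funext => y; rewrite mxE.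
 by have -> : (fun y => F y ord0 j) = g by apply/funext => y; rewrite mxE (negbTE j0).
have cG : continuous G.
 by apply: smooth_continuous => k; apply: Ck_M; [exact: openT|exact: Ck_coord|exact: Ck_coord].
have -> : (fun x => f x * g x) = G \o F by apply/funext => x.
by apply: contin_on_comp => // x _; exact: cG.
Qed.

End contin_on_theory.

(** * Weak derivatives and their chain rule *)

Section weak_derivative.
Context {R : realType} {d : nat}.
Local Notation E := 'rV[R]_d.+1.
Local Notation L := (@lebesgue_outer R d.+1).
Local Notation LT := (caratheodory_type (@lebesgue_outer R d.+1)).
Local Notation mu := (@leb R d.+1).
Variables (Om : set E) (oO : open Om) (bO : bounded_set Om).
Implicit Types (f g h phi : E -> R) (x y z : E) (i : 'I_d.+1).

Lemma Om_measurable : measurable (Om : set LT).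
exact: open_leb. Qed.
Let mO := Om_measurable.

Lemma bounded_fin : (L Om < +oo)%E.
have [M [_ hM]] := bO; apply: (@bounded_leb _ _ _ (d.+1%:R * (`|M| + 1))) => x Ox.
by apply: le_trans (enorm_le_normr x) _; rewrite ler_wpM2l //; apply: hM => //; rewrite ltr_pwDr // ler_norm.
Qed.

Lemma test_bump phi : test_function Om phi -> bump_function phi.
move=> [sp [K [cK KO p0]]]; split=> //; have [r _ hr] := compact_enorm_bounded cK.
by exists r => x rx; apply: p0 => /hr; rewrite leNgt rx.
Qed.

Lemma test_outside phi x : test_function Om phi -> ~ Om x -> phi x = 0.
by move=> [sp [K [cK KO p0]]] nO; apply: p0 => /KO. Qed.

Lemma outside_partial_closed g (K : set E) i x : closed K -> (forall y, ~ K y -> g y = 0) ->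
 ~ K x -> partial i g x = 0.
move=> clK g0 nK; rewrite (@partial_near _ _ g (cst 0)) ?partial_cst //.
have : nbhs x (~` K) by apply: open_nbhs_nbhs; split=> //; exact: closed_openC.
by apply: filterS => y; exact: g0.
Qed.

Lemma test_partial phi i : test_function Om phi -> test_function Om (partial i phi).
move=> [sp [K [cK KO p0]]]; split; first exact: smooth_partial.
exists K; split=> // x; apply: outside_partial_closed => //.
apply: compact_closed => //.
Qed.

Lemma testM phi (a : E -> R) : test_function Om phi -> smooth setT a ->
 test_function Om (fun x => phi x * a x).
move=> [sp [K [cK KO p0]]] sa; split; first by move=> k; exact: (Ck_M openT (sp k) (sa k)).
by exists K; split=> // x /p0 ->; rewrite mul0r.
Qed.

Lemma Rintegral_supp (A : set E) (h : E -> R) : (forall x, ~ A x -> h x = 0) ->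
 \int[mu]_(x in A) h x = \int[mu]_x h x.
move=> h0; rewrite Rintegral_mkcond; apply: eq_Rintegral => x; rewrite /patch.
by case: ifPn => // /negP; rewrite in_setE => /h0.
Qed.

Lemma restrict_int (A : set E) (h : E -> R) : measurable (A : set LT) ->
 Ritg mu A h <-> Ritg mu setT (h \_ A).
by move=> mA; rewrite (integrable_mkcond _ mA) restrict_EFin. Qed.

(** In contrast to [weak_partial], both functions are integrable on the whole of [Om], which keeps
    sums, products with smooth functions and dominated limits inside the notion. *)
Definition wder i f g := [/\ Ritg mu Om f, Ritg mu Om g &
 forall phi, test_function Om phi ->
  \int[mu]_(x in Om) (f x * partial i phi x) = - \int[mu]_(x in Om) (g x * phi x)].

Lemma test_itgM f phi : Ritg mu Om f -> test_function Om phi ->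
 Ritg mu Om (fun x => f x * phi x).
move=> iF tp; have bp := test_bump tp; have [C _ hC] := bump_bounded bp.
apply: (@itgMb _ _ _ mu Om mO f phi C) => //.
exact: smooth_measurable bp.1.
Qed.

Lemma smooth_bounded_Om a : smooth setT a -> exists2 C, 0 < C & forall x, Om x -> `|a x| <= C.
move=> sa; have [M [_ hM]] := bO.
have [C C0 hC] := continuous_bounded_on (@eball_compact R d 0 (d.+1%:R * (`|M| + 1)))
 (fun x _ => smooth_continuous sa (x := x)).
exists C => // x Ox; apply: hC; rewrite /eball /= subr0.
by apply: le_trans (enorm_le_normr x) _; rewrite ler_wpM2l //; apply: hM => //; rewrite ltr_pwDr // ler_norm.
Qed.

Lemma smooth_itgM f a : Ritg mu Om f -> smooth setT a ->
 Ritg mu Om (fun x => f x * a x).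
move=> iF sa; have [C _ hC] := smooth_bounded_Om sa.
apply: (@itgMb _ _ _ mu Om mO f a C) => //.
exact: smooth_measurable.
Qed.

Lemma wderD i f g f' g' : wder i f g -> wder i f' g' ->
 wder i (fun x => f x + f' x) (fun x => g x + g' x).
move=> [a1 a2 a3] [b1 b2 b3]; split; try exact: itgD.
move=> phi tp; under eq_Rintegral do rewrite mulrDl.
rewrite RintegralD //; try exact: test_itgM (test_partial i tp).
rewrite a3 // b3 // -opprD -RintegralD //; try exact: test_itgM.
by congr (- _); apply: eq_Rintegral => x; rewrite mulrDl.
Qed.

Lemma wder0 i : wder i (fun=> 0) (fun=> 0).
have : Ritg mu Om (fun=> 0 : R) by exact: integrable0.
split=> // tp; under eq_Rintegral do rewrite mul0r.
under [in RHS]eq_Rintegral do rewrite mul0r.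
by rewrite Rintegral_cst // mul0r oppr0.
Qed.

Lemma wder_sum i (I : Type) (s : seq I) (F G : I -> E -> R) : (forall k, wder i (F k) (G k)) ->
 wder i (fun x => \sum_(k <- s) F k x) (fun x => \sum_(k <- s) G k x).
move=> H; elim: s => [|k s IH].
 under eq_fun do rewrite big_nil; under [X in wder _ _ X]eq_fun do rewrite big_nil; exact: wder0.
under eq_fun do rewrite big_cons; under [X in wder _ _ X]eq_fun do rewrite big_cons.
exact: wderD.
Qed.

Lemma wderM i f g a : wder i f g -> smooth setT a ->
 wder i (fun x => f x * a x) (fun x => f x * partial i a x + g x * a x).
move=> [a1 a2 a3] sa; have := smooth_partial i sa.
split; first exact: smooth_itgM.
 by apply: itgD => //; exact: smooth_itgM.
move=> phi tp; have tpa := testM tp sa.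
have := a3 _ tpa.
have pE x : partial i (fun y => phi y * a y) x = phi x * partial i a x + a x * partial i phi x.
 apply: partialM; first exact: smooth_diff (test_bump tp).1 I.
 exact: smooth_diff.
under eq_Rintegral do rewrite pE mulrDr mulrA mulrA.
have i1 : Ritg mu Om (fun x => f x * phi x * partial i a x).
 by apply: smooth_itgM => //; exact: test_itgM.
have i2 : Ritg mu Om (fun x => f x * a x * partial i phi x).
 apply: test_itgM (test_partial i tp); exact: smooth_itgM.
have i3 : Ritg mu Om (fun x => g x * a x * phi x).
 apply: test_itgM tp; exact: smooth_itgM.
rewrite RintegralD // => /eqP; rewrite addrC -subr_eq0 opprK -addrA addr_eq0 => /eqP ->.
congr (- _); rewrite -RintegralD //; last first.
 exact: test_itgM.
by apply: eq_Rintegral => x _; ring.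
Qed.

Lemma partial_shift g i x y : smooth setT g ->
 partial i (fun y => g (y - x)) y = partial i g (y - x).
move=> sg; have dg := diff_fdiff (smooth_diff sg (I : setT (y - x))).
have sh : fdiff (fun y => g (y - x)) y (grad g (y - x)).
 move=> e e0; have [r r0 hr] := dg e e0; exists r => // z.
 have e1 : z - x - (y - x) = z - y by apply/rowP => k; rewrite !mxE; ring.
 by have := hr (z - x); rewrite e1; apply.
have := congr1 (fun G : E => G ord0 i) (fdiff_diff sh).2.
by rewrite !mxE.
Qed.

Lemma smooth_shift g x : smooth setT g -> smooth setT (fun y => g (y - x)).
move=> sg k; apply: (@Ck_comp R d.+1 d.+1 k setT setT (fun y => y - x) g openT) => // j.
apply: (@Ck_ext _ _ k setT ((fun y : E => y ord0 j) \+ cst (- x ord0 j)) _ openT).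
 by move=> y; rewrite !mxE.
by apply: Ck_D; [exact: openT|exact: Ck_coord|exact: Ck_cst].
Qed.

Lemma eta_test k r x : inner Om r x -> rad k < r -> test_function Om (fun y => eta k (y - x)).
move=> ix kr; split; first exact: smooth_shift (bump_eta k).1.
exists (eball x (rad k)); split; first exact: eball_compact.
 move=> y yx; apply: contrapT => /ix; rewrite enormB leNgt; apply/negP/negPn.
 exact: le_lt_trans kr.
move=> y yx; apply: eta_outside; rewrite leNgt; apply/negP => h; apply: yx; exact: ltW.
Qed.

(** At a point farther than [rad k] from the complement the translated mollifier is itself a test
    function, and the defining identity applies to it. *)
Lemma conv_partial_inner i f g k r x : wder i f g -> inner Om r x -> rad k < r ->
 partial i (conv (f \_ Om) (eta k)) x = conv (g \_ Om) (eta k) x.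
move=> [a1 a2 a3] ix kr; have tt := eta_test ix kr.
have mk (u v : E -> R) : conv (u \_ Om) v x = \int[mu]_(y in Om) (u y * v (y - x)).
 rewrite Rintegral_mkcond; apply: eq_Rintegral => y; rewrite /patch.
 by case: ifP => //; rewrite mul0r.
have iF := (restrict_int f mO).1 a1.
rewrite (conv_smooth iF (bump_eta k)).2 !mk.
under eq_Rintegral do rewrite -(partial_shift i x _ (bump_eta k).1).
by rewrite a3 // opprK.
Qed.

Lemma conv_eta_cvg f x : contin_on Om f -> Ritg mu Om f -> Om x ->
 (fun k => conv (f \_ Om) (eta k) x) @ \oo --> f x.
move=> cf iF Ox; apply/cvgrPdist_le => e e0; have [r r0 hr] := cf x Ox e e0.
have [s s0 hs] := open_enorm oO Ox.
have rs0 : 0 < Num.min r s by rewrite lt_min r0.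
have [N hN] := rad_small rs0; exists N => // k /hN kr; rewrite distrC.
apply: conv_eta_near; first exact: (restrict_int f mO).1.
move=> y yx; have := lt_trans yx kr; rewrite lt_min => /andP[h1 h2].
rewrite /patch mem_set; last exact: hs.
by rewrite ltW // hr //; exact: hs.
Qed.

(** The components of [f] are mollified, the smooth chain rule is integrated by parts on an inner
    set [D] that carries the test function, and the mesh is sent to zero. Continuity of [f] gives
    pointwise convergence of the values, L¹ convergence of the mollified derivatives the rest. *)
Lemma wder_comp m (f : E -> 'rV[R]_m.+1) (g : 'I_m.+1 -> E -> R) i (G : 'rV[R]_m.+1 -> R) (C : R) :
 0 <= C -> smooth setT G -> (forall j, wder i (fun x => f x ord0 j) (g j)) ->
 (forall j, contin_on Om (fun x => f x ord0 j)) -> (forall x j, Om x -> `|f x ord0 j| <= C) ->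
 wder i (G \o f) (fun x => \sum_(j < m.+1) g j x * partial j G (f x)).
move=> C0 sG wf cf fC.
have ifj j : Ritg mu setT ((fun x => f x ord0 j) \_ Om).
 by have [a1 _ _] := wf j; exact: (restrict_int _ mO).1 a1.
have igj j : Ritg mu setT (g j \_ Om).
 by have [_ a2 _] := wf j; exact: (restrict_int _ mO).1 a2.
have cGf (H : 'rV[R]_m.+1 -> R) : smooth setT H -> contin_on Om (H \o f).
 by move=> sH; apply: contin_on_comp => // x _; exact: smooth_continuous.
have HC (H : 'rV[R]_m.+1 -> R) : smooth setT H -> exists2 B, 0 < B & forall p : 'rV[R]_m.+1, (forall j, `|p ord0 j| <= C) -> `|H p| <= B.
 move=> sH; have [B B0 hB] := continuous_bounded_on (@eball_compact R m 0 (m.+1%:R * C))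
  (fun (x : 'rV[R]_m.+1) _ => smooth_continuous sH (x := x)).
 by exists B => // p pC; apply: hB; rewrite /eball /= subr0; exact: enorm_le_coord.
have int1 (H : 'rV[R]_m.+1 -> R) : smooth setT H -> Ritg mu Om (H \o f).
 move=> sH; have [B B0 hB] := HC H sH; apply: (@integrable_bounded _ _ _ _ B) => //.
 - exact: bounded_fin.
 - by apply: cont_meas; exact: cGf.
 - by move=> x Ox; apply: hB => j; exact: fC.
have int2 j : Ritg mu Om (fun x => g j x * partial j G (f x)).
 have [B B0 hB] := HC _ (smooth_partial j sG).
 apply: (@itgMb _ _ _ mu Om mO (g j) (fun x => partial j G (f x)) B).
 - by case: (wf j).
 - by apply: cont_meas; exact: cGf (smooth_partial j sG).
 - by move=> x Ox; apply: hB => l; exact: fC.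
split; first exact: int1.
 exact: (Rintegral_sum mO (index_enum 'I_m.+1) int2).1.
move=> phi tp; have bp := test_bump tp; have [sp [K [cK KO p0]]] := tp.
have [r r0 Kr] := compact_inner oO cK KO.
pose D := inner Om r; have mD : measurable (D : set LT).
 by rewrite -[D]setCK; apply: measurableC; apply: open_leb; apply: closed_openC; exact: inner_closed.
have DO : D `<=` Om by exact: inner_sub.
have phiD x : ~ D x -> phi x = 0 by move=> nD; apply: p0 => /Kr.
have dphiD x : ~ D x -> partial i phi x = 0.
 by apply: outside_partial_closed => //; exact: inner_closed.
have [N hN] := rad_small r0.
pose F k (x : E) : 'rV[R]_m.+1 := \row_j conv ((fun x => f x ord0 j) \_ Om) (eta (N + k)%N) x.
have sF k j : smooth setT (fun x => F k x ord0 j).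
 move=> l; apply: (@Ck_ext _ _ l setT (conv ((fun x => f x ord0 j) \_ Om) (eta (N + k)%N)) _ openT).
  by move=> x _; rewrite mxE.
 exact: (conv_smooth (ifj j) (bump_eta (N + k)%N)).1.
have cF j x : D x -> (fun k => F k x ord0 j) @ \oo --> f x ord0 j.
 move=> Dx; have [a1 _ _] := wf j; apply/cvgrPdist_le => e e0.
 have /cvgrPdist_le/(_ e e0)[N' _ h] := conv_eta_cvg (cf j) a1 (DO x Dx).
 by exists N' => // k /= k'; rewrite mxE; apply: h; exact: leq_trans (leq_addl _ _).
(* Averages respect the bound [C], so [G] and its derivatives are evaluated on a fixed bounded set
   along the whole sequence. *)
have FC k x j : `|F k x ord0 j| <= C.
 rewrite mxE; apply: conv_eta_bound => // y; rewrite /patch; case: ifP => [/set_mem Oy|_]; first exact: fC.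
 by rewrite normr0.
have sGF (H : 'rV[R]_m.+1 -> R) k : smooth setT H -> smooth setT (H \o F k).
 by move=> sH l; apply: (@Ck_comp R m.+1 d.+1 l setT setT (F k) H openT) => // j; exact: sF.
have cGF (H : 'rV[R]_m.+1 -> R) x : smooth setT H -> D x -> (fun k => H (F k x)) @ \oo --> H (f x).
 move=> sH Dx; apply/cvgrPdist_lt => e e0.
 have [q q0 hq] := (cont_enormP H (f x)).1 (smooth_continuous sH (x := _)) e e0.
 have q1 : 0 < q / m.+2%:R by rewrite divr_gt0.
 have : \forall k \near \oo, forall j, `|f x ord0 j - F k x ord0 j| < q / m.+2%:R.
  by apply: filter_forall => j; exact: ((cvgrPdist_lt _ _).1 (cF j x Dx)).
 apply: filterS => k hk; apply: hq; apply: (@le_lt_trans _ _ (m.+1%:R * (q / m.+2%:R))).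
  by apply: enorm_le_coord => j; rewrite !mxE distrC; have := hk j; rewrite mxE => /ltW.
 by rewrite frac_lt.
pose h j k x := conv (g j \_ Om) (eta (N + k)%N) x * (partial j G (F k x) * phi x).
pose hl j x := g j x * (partial j G (f x) * phi x).
(* The product of [phi] and [G (F k)] is smooth of bounded support, so its derivative integrates to
   zero; on [D] the derivative of a mollified component is the mollified weak derivative. *)
have ibp k : \int[mu]_(x in D) (partial i phi x * G (F k x)) =
  - \sum_(j < m.+1) \int[mu]_(x in D) h j k x.
 have bj j : bump_function (fun x => phi x * partial j G (F k x)) by apply: bumpM => //; exact: sGF (smooth_partial j sG).
 have ij j : Ritg mu setT (h j k).
  have [B _ hB] := bump_bounded (bj j).
  apply: (@itgMb _ _ _ mu setT measurableT _ _ B); first exact: conv_eta_int.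
   apply: cont_meas; apply: cont_contin.
   by under eq_fun do rewrite mulrC; exact: smooth_continuous (bj j).1.
  by move=> x _; rewrite mulrC hB.
 have b0 := integral_partial i (bumpM bp (sGF G k sG)).
 have [i1 e1] := Rintegral_sum measurableT (index_enum 'I_m.+1) ij.
 rewrite Rintegral_supp; last by move=> x /dphiD ->; rewrite mul0r.
 have eD j : \int[mu]_(x in D) h j k x =
   \int[mu]_x h j k x.
  by apply: Rintegral_supp => x /phiD; rewrite /h => ->; rewrite !mulr0.
 under eq_bigr do rewrite eD.
 rewrite -e1; apply/eqP; rewrite -addr_eq0 -RintegralD //; last first.
  by apply: bump_itg; apply: bumpM; [exact: bump_partial|exact: sGF].
 apply/eqP; rewrite -[RHS]b0; apply: eq_Rintegral => x _.
 rewrite (@partialM _ _ phi (G \o F k)); first last.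
 - exact: smooth_diff (sGF G k sG) I.
 - exact: smooth_diff sp I.
 rewrite (@partial_comp _ _ _ (F k) G x i _ _).2; first last.
 - exact: smooth_diff sG I.
 - by move=> j; exact: smooth_diff (sF k j) I.
 rewrite addrC [G _ * _]mulrC; congr (_ + _); rewrite mulr_sumr; apply: eq_bigr => j _; rewrite /h.
 case: (pselect (D x)) => Dx; last by rewrite phiD // mulr0 mulr0 mul0r.
 have -> : partial i (fun y => F k y ord0 j) x = conv (g j \_ Om) (eta (N + k)%N) x.
  rewrite -(conv_partial_inner (wf j) Dx (hN _ (leq_addr k N))).
  by congr partial; apply/funext => y; rewrite mxE.
 by rewrite mulrA mulrC; congr (_ * _); rewrite mulrC.
have [B0' B00 hB0] := HC G sG.
have ip : Ritg mu D (partial i phi).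
 by apply: (integrableS measurableT mD (@subsetT _ D)); exact: bump_itg (bump_partial i bp).
have cst0 (a : E -> R) : forall e : R, 0 < e -> exists N, forall k, (N <= k)%N -> \int[mu]_(x in D) `|a x - a x| <= e.
 move=> e e0; exists 0%N => k _; under eq_Rintegral do rewrite subrr normr0.
 by rewrite Rintegral_cst // mul0r ltW.
have [_ lim1] := @Rintegral_prod_lim _ _ _ mu D mD (partial i phi) (fun=> partial i phi) (fun k x => G (F k x))
 (fun x => G (f x)) B0' (fun=> ip) ip
 (cst0 _)
 (fun k => measurable_funTS (cont_meas (cont_contin (smooth_continuous (sGF G k sG)))))
 (fun k x _ => hB0 _ (FC k x)) (fun x Dx => cGF G x sG Dx).
have lim2 j : (fun k => \int[mu]_(x in D) h j k x) @ \oo -->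
  \int[mu]_(x in D) hl j x.
 have [B B_ hB] := HC _ (smooth_partial j sG); have [P _ hP] := bump_bounded bp.
 have ig : Ritg mu D (g j).
  by apply: (integrableS mO mD DO); case: (wf j).
 have icv k : Ritg mu setT (conv (g j \_ Om) (eta k)) by exact: conv_eta_int.
 apply: (@Rintegral_prod_lim _ _ _ mu D mD (g j) (fun k => conv (g j \_ Om) (eta (N + k)%N))
  (fun k x => partial j G (F k x) * phi x) _ (B * P) _ ig _ _ _ _).2.
 - by move=> k; apply: (integrableS measurableT mD (@subsetT _ D)).
 - move=> e e0; have [N' hN'] := conv_eta_L1 (igj j) e0; exists N' => k kN.
  apply: le_trans (hN' (N + k)%N (leq_trans kN (leq_addl _ _))).
  have iD := itg_norm (itgB measurableT (icv (N + k)%N) (igj j)).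
  rewrite Rintegral_mkcond; apply: le_Rintegral => //.
   apply: (restrict_int _ mD).1; apply: (@eq_integrable _ _ _ mu D mD (EFin \o (fun x => `|conv (g j \_ Om) (eta (N + k)) x - (g j \_ Om) x|))).
    by move=> x /set_mem Dx; rewrite /= /patch mem_set //; exact: DO.
   by apply: (integrableS measurableT mD (@subsetT _ D)).
  move=> x _; have [Dx|nDx] := pselect (D x); last by rewrite [leLHS]/patch (memNset nDx); exact: normr_ge0.
  by rewrite /patch (mem_set Dx) (mem_set (DO _ Dx)).
 - move=> k; apply: measurable_funTS; apply: cont_meas; apply: cont_contin.
  apply: (@smooth_continuous _ _ ((partial j G \o F k) \* phi)) => l.
  exact: (Ck_M openT (sGF _ k (smooth_partial j sG) l) (sp l)).
 - move=> k x _; rewrite normrM ler_pM ?hP ?hB //; exact: FC.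
 - by move=> x Dx; apply: cvgMl; exact: cGF (smooth_partial j sG) Dx.
have lim3 : (fun k => - \sum_(j < m.+1) \int[mu]_(x in D) h j k x)
  @ \oo --> - \sum_(j < m.+1) \int[mu]_(x in D) hl j x.
 apply: cvgN; elim: (index_enum _) => [|j s IH].
  by under eq_fun do rewrite big_nil; rewrite big_nil; exact: cvg_cst.
 by under eq_fun do rewrite big_cons; rewrite big_cons; apply: cvgD.
have E1 : \int[mu]_(x in D) (partial i phi x * G (f x)) =
  - \sum_(j < m.+1) \int[mu]_(x in D) hl j x.
 by move: lim1; under eq_fun do rewrite ibp; move=> lim1; exact: (cvg_unique (@norm_hausdorff _ _) lim1 lim3).
have toD (v : E -> R) : (forall x, ~ D x -> v x = 0) -> \int[mu]_(x in Om) v x = \int[mu]_(x in D) v x.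
 move=> h0; rewrite [RHS]Rintegral_supp // Rintegral_supp // => x nO; apply: h0 => /DO; exact: nO.
rewrite toD; last by move=> x /dphiD ->; rewrite mulr0.
under eq_Rintegral do rewrite mulrC.
rewrite E1 toD; last by move=> x /phiD ->; rewrite mulr0.
have ijD j : Ritg mu D (hl j).
 rewrite /hl; under eq_fun do rewrite mulrA; apply: (integrableS mO mD DO); exact: test_itgM tp.
rewrite -(Rintegral_sum mD (index_enum 'I_m.+1) ijD).2; congr (- _); apply: eq_Rintegral => x _.
by rewrite mulr_suml; apply: eq_bigr => j _; rewrite /hl mulrA.
Qed.

End weak_derivative.

(** * Smooth truncation of small values *)

Section truncation.
Context {R : realType}.
Implicit Types (e t : R).

(** For positive [e] this vanishes when [|t| <= e] and is the identity once [t ^ 2 >= 2 * e ^ 2].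
    Small values are erased exactly while the function stays smooth. *)
Definition trunc e t : R := t * step (t ^+ 2 / e ^+ 2 - 1).

Definition dtrunc e t : R :=
 step (t ^+ 2 / e ^+ 2 - 1) + 2 * (t ^+ 2 / e ^+ 2) * dstep (t ^+ 2 / e ^+ 2 - 1).

Lemma dstep_le0 t : t <= 0 -> dstep t = 0.
by move=> t0; rewrite /dstep !(flat_le0 _ t0) !mul0r addr0 mul0r. Qed.

Lemma dstep_ge1 t : 1 <= t -> dstep t = 0.
by move=> t1; rewrite /dstep !(flat_le0 _ (_ : 1 - t <= 0)) ?subr_le0 // !mulr0 addr0 mul0r.
Qed.

Lemma dstep_bounded : exists2 M : R, 0 < M & forall t, dstep t <= M.
have [c _ hc] := @EVT_max R dstep 0 1 ler01 (continuous_subspaceT dstep_continuous).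
exists (dstep c + 1); first by rewrite ltr_wpDl // dstep_ge0.
move=> t; have [t0|t0] := leP t 0; first by rewrite dstep_le0 // addr_ge0 // dstep_ge0.
have [t1|t1] := leP 1 t; first by rewrite dstep_ge1 // addr_ge0 // dstep_ge0.
by rewrite (le_trans (hc t _)) ?lerDl // in_itv /= !ltW.
Qed.

Lemma is_derive_trunc e (t : R) : is_derive t (1 : R) (trunc e) (dtrunc e t).
have ds : is_derive t (1 : R) (fun u : R => u ^+ 2 / e ^+ 2 - 1) (2 * t / e ^+ 2).
 have d1 : is_derive t (1 : R) (fun u : R => u * u) (t + t).
  apply: (is_derive_eq (is_deriveM (is_derive_id t 1) (is_derive_id t 1))).
  by rewrite /GRing.scale /= !mulr1.
 have d2 : is_derive t (1 : R) (fun u : R => e ^- 2 * (u * u)) (e ^- 2 * (t + t)).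
  exact: (is_derive_eq (is_deriveZ (e ^- 2) d1)).
 have d3 := is_deriveD d2 (is_derive_cst (-1 : R) t 1).
 have -> : (fun u : R => u ^+ 2 / e ^+ 2 - 1) = (fun u : R => e ^- 2 * (u * u)) + (-1).
  by apply/funext => u; rewrite mulrC.
 by apply: (is_derive_eq d3); ring.
have dc := @is_derive1_comp R step (fun u : R => u ^+ 2 / e ^+ 2 - 1) t _ _ (is_derive_step _) ds.
apply: (is_derive_eq (is_deriveM (is_derive_id t 1) dc)).
rewrite /GRing.scale /= /dtrunc.
ring.
Qed.

Lemma trunc_small e t : 0 < e -> `|t| <= e -> t ^+ 2 / e ^+ 2 - 1 <= 0.
move=> e0 te; rewrite subr_le0 ler_pdivrMr ?exprn_gt0 // mul1r -[t ^+ 2]real_normK ?num_real //.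
by rewrite lerXn2r ?nnegrE // ltW.
Qed.

Lemma trunc0 e t : 0 < e -> `|t| <= e -> trunc e t = 0.
by move=> e0 /(trunc_small e0) h; rewrite /trunc step_le0 // mulr0. Qed.

Lemma dtrunc0 e t : 0 < e -> `|t| <= e -> dtrunc e t = 0.
by move=> e0 /(trunc_small e0) h; rewrite /dtrunc step_le0 // dstep_le0 // mulr0 addr0. Qed.

Lemma trunc_le e t : `|trunc e t| <= `|t|.
have /andP[s0 s1] := step_itv (t ^+ 2 / e ^+ 2 - 1).
by rewrite normrM ler_piMr // ger0_norm.
Qed.

(** The bound does not depend on [e]: the factor [dstep] is supported where [t ^ 2 / e ^ 2] is
    between 1 and 2, so the growing factor in front of it never exceeds 4. *)
Lemma dtrunc_bounded : exists2 B : R, 0 < B & forall e t, `|dtrunc e t| <= B.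
have [M M0 hM] := dstep_bounded; exists (1 + 4 * M) => [|e t].
 lra.
have /andP[s0 s1] := step_itv (t ^+ 2 / e ^+ 2 - 1).
have a0 : 0 <= t ^+ 2 / e ^+ 2 by rewrite divr_ge0 ?sqr_ge0.
rewrite /dtrunc; move: a0 s0 s1; set a := t ^+ 2 / _ => a0 s0 s1.
rewrite ger0_norm; last by rewrite addr_ge0 // mulr_ge0 ?dstep_ge0 // mulr_ge0.
apply: lerD => //; have [a2|a2] := leP 2 a.
 by rewrite dstep_ge1 ?mulr0; [rewrite mulr_ge0 // ltW|lra].
by apply: ler_pM; [rewrite mulr_ge0|exact: dstep_ge0|lra|exact: hM].
Qed.

Lemma rad_large t : t != 0 -> exists N, forall k, (N <= k)%N -> 1 <= t ^+ 2 / (rad k : R) ^+ 2 - 1.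
move=> t0; have q0 : 0 < `|t| / 2 by rewrite divr_gt0 ?normr_gt0.
have [N hN] := rad_small q0; exists N => k /hN kt; have r0 : 0 < (rad k : R) := rad_gt0 k.
have h : 2 * rad k <= `|t| by lra.
rewrite lerBrDr ler_pdivlMr ?exprn_gt0 // -[t ^+ 2]real_normK ?num_real //.
have : (2 * rad k) ^+ 2 <= `|t| ^+ 2 by rewrite lerXn2r ?nnegrE ?mulr_ge0 // ltW.
have : 0 <= (rad k : R) ^+ 2 by exact: sqr_ge0.
lra.
Qed.

Lemma trunc_cvg t : (fun k => trunc (rad k) t) @ \oo --> t.
have [->|t0] := eqVneq t 0.
 by rewrite /trunc; under eq_fun do rewrite mul0r; exact: cvg_cst.
have [N hN] := rad_large t0; apply: cvg_near_cst; exists N => // k /hN h.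
by rewrite /trunc step_ge1 // mulr1.
Qed.

Lemma dtrunc_cvg t : (fun k => dtrunc (rad k) t) @ \oo --> ((t != 0)%:R : R).
have [->|t0] := eqVneq.
 apply: cvg_near_cst; exists 0%N => // k; rewrite dtrunc0 ?normr0 ?rad_gt0 //.
 by rewrite ltW // rad_gt0.
have [N hN] := rad_large t0; apply: cvg_near_cst; exists N => // k /hN h.
by rewrite /dtrunc step_ge1 // dstep_ge1 // mulr0 addr0.
Qed.

Lemma dtrunc_continuous e : continuous (dtrunc e).
have cs : continuous (fun t : R => t ^+ 2 / e ^+ 2 - 1).
 move=> t; apply: cvgB; last exact: cvg_cst.
 by apply: cvgMl; exact: exprn_continuous.
move=> t; apply: cvgD.
 apply: (@continuous_comp R R R (fun t : R => t ^+ 2 / e ^+ 2 - 1) step); first exact: cs.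
 apply: differentiable_continuous; apply/derivable1_diffP.
 by case: (is_derive_step (t ^+ 2 / e ^+ 2 - 1)).
apply: cvgM; last first.
 apply: (@continuous_comp R R R (fun t : R => t ^+ 2 / e ^+ 2 - 1) dstep); first exact: cs.
 exact: dstep_continuous.
apply: cvgMr; apply: cvgMl; exact: exprn_continuous.
Qed.

Lemma trunc_continuous e : continuous (trunc e).
move=> t; apply: differentiable_continuous; apply/derivable1_diffP.
by case: (is_derive_trunc e t).
Qed.

Lemma Ck_trunc (d k : nat) (U : set 'rV[R]_d) (f : 'rV[R]_d -> R) e : open U ->
 Ck k U f -> Ck k U (trunc e \o f).
move=> oU cf.
apply: (@Ck_ext _ _ k U (f \* (step \o ((cst (e ^- 2) \* (f \* f)) \+ cst (-1)))) _ oU).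
 by move=> x; rewrite /= [e ^- 2 * _]mulrC.
apply: Ck_M => //; apply: Ck_step => //; apply: Ck_D => //; last exact: Ck_cst.
by apply: Ck_M => //; [exact: Ck_cst|exact: Ck_M].
Qed.

End truncation.

(** * Uniqueness of weak derivatives and the null Lagrangian identity *)

Section weak_uniqueness.
Context {R : realType} {d : nat}.
Local Notation E := 'rV[R]_d.+1.
Local Notation L := (@lebesgue_outer R d.+1).
Local Notation LT := (caratheodory_type (@lebesgue_outer R d.+1)).
Local Notation mu := (@leb R d.+1).
Variables (Om : set E) (oO : open Om) (bO : bounded_set Om).
Implicit Types (f g h phi : E -> R) (x y z : E).
Let mO := Om_measurable oO.

Lemma closed_leb (K : set E) : closed K -> measurable (K : set LT).
by move=> cK; rewrite -[K]setCK; apply: measurableC; apply: open_leb; exact: closed_openC.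
Qed.

Lemma compact_leb_measurable (K : set E) : compact K -> measurable (K : set LT).
by move=> cK; apply: closed_leb; apply: compact_closed => //; exact: norm_hausdorff. Qed.

(** On an inner set every mollification of [h] is a pairing with a test function, hence zero, and it
    converges to [h] in L¹. Countably many inner sets exhaust [Om]. *)
Lemma weak_unique h : loc_integrable Om h ->
 (forall phi, test_function Om phi -> \int[mu]_(x in Om) (h x * phi x) = 0) ->
 {ae mu, forall x, Om x -> h x = 0}.
move=> lh h0.
have H m : {ae mu, forall x, inner Om (rad m) x -> h x = 0}.
 pose r := rad m / 2 : R; have r0 : 0 < r by rewrite divr_gt0 // rad_gt0.
 have rr : rad m = r + r :> R by rewrite -splitr.
 pose B := inner Om r; pose D := inner Om (rad m).
 have mB : measurable (B : set LT) by apply: closed_leb; exact: inner_closed.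
 have mD : measurable (D : set LT) by apply: closed_leb; exact: inner_closed.
 have DB : D `<=` B by apply: inner_anti; rewrite rr lerDl ltW.
 have iB : Ritg mu B h by apply: lh; [exact: inner_compact|exact: inner_sub].
 have iD : Ritg mu D h by exact: (integrableS mB mD DB iB).
 have ih := (restrict_int _ mB).1 iB.
 apply: (Rintegral_abs_eq0 mD iD); apply/eqP; rewrite eq_le Rintegral_ge0 ?andbT //.
 apply/ler_addgt0Pr => e e0; rewrite add0r.
 have [N hN] := conv_eta_L1 ih e0; have [N' hN'] := rad_small r0.
 pose k := maxn N N'; apply: le_trans (hN k (leq_maxl _ _)).
 have c0 x : D x -> conv (h \_ B) (eta k) x = 0.
  move=> Dx; have kr : rad k < r := hN' k (leq_maxr _ _).
  have tt : test_function Om (fun y => eta k (y - x)).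
   by apply: (eta_test Dx); rewrite rr ltr_wpDl // ltW.
  rewrite -(h0 _ tt) Rintegral_mkcond; apply: eq_Rintegral => y; rewrite /patch.
  have [yx|yx] := ltP (enorm (y - x)) (rad k); last by rewrite eta_outside // !mulr0 if_same.
  have By : B y by apply: (@inner_shift _ _ _ _ r x); [rewrite -rr|rewrite ltW // (lt_trans yx)].
  by rewrite !mem_set //; exact: inner_sub By.
 have ic := itg_norm (itgB measurableT (conv_eta_int k ih) ih).
 rewrite Rintegral_mkcond; apply: le_Rintegral => //.
  by apply: (restrict_int _ mD).1; exact: itg_norm.
 move=> x _; have [Dx|nDx] := pselect (D x); last by rewrite [leLHS]/patch (memNset nDx); exact: normr_ge0.
 by rewrite c0 // sub0r normrN /patch (mem_set Dx) (mem_set (DB _ Dx)).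
apply: filterS (ae_foralln H) => x hx Ox.
have c1 : compact [set x] by exact: compact_set1.
have [r r0 hr] := compact_inner oO c1 (fun y (yx : y = x) => eq_ind_r Om Ox yx).
have [N hN] := rad_small r0; apply: (hx N); apply: (@inner_anti _ _ _ (rad N) r); last exact: hr.
by rewrite ltW // hN.
Qed.

Lemma wder_ae i f g g' : wder Om i f g -> weak_partial Om i f g' ->
 {ae mu, forall x, Om x -> g' x = g x}.
move=> [a1 a2 a3] [b1 b2 b3].
have ga : loc_integrable Om (fun x => g' x - g x).
 move=> K cK KO; have mK : measurable (K : set LT).
  by apply: closed_leb; apply: compact_closed => //.
 by apply: itgB => //; [exact: b2|exact: (integrableS mO mK KO a2)].
have h : forall phi, test_function Om phi -> \int[mu]_(x in Om) ((g' x - g x) * phi x) = 0.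
 move=> phi tp; have [sp [K [cK KO p0]]] := tp.
 have mK : measurable (K : set LT).
  by apply: closed_leb; apply: compact_closed => //.
 have toK (u : E -> R) : \int[mu]_(x in Om) (u x * phi x) = \int[mu]_(x in K) (u x * phi x).
  rewrite [RHS]Rintegral_supp; last by move=> x /p0 ->; rewrite mulr0.
  by rewrite Rintegral_supp // => x nO; rewrite p0 ?mulr0 // => /KO.
 have [C _ hC] := bump_bounded (test_bump tp).
 have mp : measurable_fun (K : set LT) phi.
  by exact: smooth_measurable.
 have i1 : Ritg mu K (fun x => g' x * phi x).
  by apply: (@itgMb _ _ _ mu K mK g' phi C) => //; exact: b2.
 have i2 : Ritg mu K (fun x => g x * phi x).
  by apply: (@itgMb _ _ _ mu K mK g phi C) => //; exact: (integrableS mO mK KO a2).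
 rewrite toK; under eq_Rintegral do rewrite mulrBl.
 rewrite RintegralB // -!toK; have := a3 _ tp; rewrite b3 // => /eqP.
 lra.
have [N [mN N0 sub]] := weak_unique ga h; exists N; split=> // x nx; apply: sub => hx.
by apply: nx => Ox; apply/eqP; rewrite -subr_eq0; apply/eqP; exact: hx.
Qed.

(** The derivatives of the truncations converge dominatedly to [g] times the indicator of [f != 0].
    Here [g] need only be a formal derivative, correct after truncation; this is how the nonsmooth
    flow at the origin is treated. *)
Lemma wder_trunc i f g : contin_on Om f -> Ritg mu Om f ->
 Ritg mu Om g ->
 (forall k, wder Om i (trunc (rad k) \o f) (fun x => dtrunc (rad k) (f x) * g x)) ->
 wder Om i f (fun x => (f x != 0)%:R * g x).
move=> cf iF ig.
have [B B0 hB] := @dtrunc_bounded R.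
have mdt k : measurable_fun (Om : set LT) (fun x => dtrunc (rad k) (f x)).
 by apply: cont_meas; exact: contin_on_comp1 (@dtrunc_continuous R _).
have mg := itg_meas ig.
have iBg : Ritg mu Om (fun x => B * `|g x|).
 by apply: itgZ => //; exact: itg_norm.
have [il _ _] := @Rdominated _ _ _ mu Om mO (fun k x => dtrunc (rad k) (f x) * g x)
 (fun x => (f x != 0)%:R * g x) _ (fun k => measurable_funM (mdt k) mg)
 (fun x _ => ltac:(apply: cvgMl; exact: dtrunc_cvg)) iBg
 (fun k x _ => ltac:(by rewrite normrM ler_wpM2r)).
split=> // phi tp; have bp := test_bump tp; have [P P0 hP] := bump_bounded bp.
have bdp := bump_partial i bp; have [Q Q0 hQ] := bump_bounded bdp.
have mp : measurable_fun (Om : set LT) phi.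
 by exact: smooth_measurable bp.1.
have mdp : measurable_fun (Om : set LT) (partial i phi).
 by exact: smooth_measurable bdp.1.
have iQ : Ritg mu Om (fun x => Q * `|f x|).
 by apply: itgZ => //; exact: itg_norm.
have iP : Ritg mu Om (fun x => P * (B * `|g x|)) by exact: itgZ.
have mt k : measurable_fun (Om : set LT) (fun x => trunc (rad k) (f x)).
 by apply: cont_meas; exact: contin_on_comp1 (@trunc_continuous R _).
have [_ _ l1] := @Rdominated _ _ _ mu Om mO (fun k x => trunc (rad k) (f x) * partial i phi x)
 (fun x => f x * partial i phi x) _ (fun k => measurable_funM (mt k) mdp)
 (fun x _ => ltac:(apply: cvgMl; exact: trunc_cvg)) iQ
 (fun k x _ => ltac:(by rewrite normrM mulrC ler_pM // trunc_le)).
have [_ _ l2] := @Rdominated _ _ _ mu Om mO (fun k x => dtrunc (rad k) (f x) * g x * phi x)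
 (fun x => (f x != 0)%:R * g x * phi x) _ (fun k => measurable_funM (measurable_funM (mdt k) mg) mp)
 (fun x _ => ltac:(apply: cvgMl; apply: cvgMl; exact: dtrunc_cvg)) iP
 (fun k x _ => ltac:(by rewrite normrM mulrC ler_pM // normrM ler_wpM2r)).
have eqk k : \int[mu]_(x in Om) (trunc (rad k) (f x) * partial i phi x) =
  - \int[mu]_(x in Om) (dtrunc (rad k) (f x) * g x * phi x).
 by have [_ _] := H k; apply.
move: l1; under eq_fun do rewrite eqk; move=> l1.
exact: (cvg_unique (@norm_hausdorff _ _) l1 (cvgN l2)).
Qed.

Lemma wder_trunc_comp i f g (C e : R) : contin_on Om f -> (forall x, Om x -> `|f x| <= C) -> 0 <= C ->
 wder Om i f g -> wder Om i (trunc e \o f) (fun x => dtrunc e (f x) * g x).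
move=> cf fC C0 wf; pose F (x : E) : 'rV[R]_1 := \row_j f x.
pose G := trunc e \o (fun p : 'rV[R]_1 => p ord0 ord0).
have sG : smooth setT G by move=> k; apply: Ck_trunc; [exact: openT|exact: Ck_coord].
have Fj (j : 'I_1) : (fun x => F x ord0 j) = f by apply/funext => x; rewrite mxE.
have := @wder_comp R d Om oO bO 0 F (fun=> g) i G C C0 sG.
have dG p : partial ord0 G p = dtrunc e (p ord0 ord0).
 have [_ ->] := @partial_comp1 R 1 (trunc e) (fun p : 'rV[R]_1 => p ord0 ord0) p ord0 _ (is_derive_trunc e _)
   (fdiff_diff (fdiff_coord p ord0)).1.
 by rewrite partial_coord mulr1.
have -> : (fun x => \sum_(j < 1) g x * partial j G (F x)) = fun x => dtrunc e (f x) * g x.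
 by apply/funext => x; rewrite big_ord1 dG mxE mulrC.
have -> : G \o F = trunc e \o f by apply/funext => x; rewrite /G /= mxE.
apply=> [j|j|x j Ox]; rewrite ?Fj //; by rewrite mxE fC.
Qed.

Lemma sq_restrict (h : E -> R) : (fun x => (h \_ Om) x ^+ 2) = (fun x => h x ^+ 2) \_ Om.
by apply/funext => x; rewrite /patch; case: ifP => //; rewrite expr0n. Qed.

Definition sqint (h : E -> R) := measurable_fun (Om : set LT) h /\
 Ritg mu Om (fun x => h x ^+ 2).

(* For a smooth [Z] both sides equal [- \int Y * partial i (partial j Z)]. *)
Lemma curl_compact (Z Y : E -> R) (gz gy : 'I_d.+1 -> E -> R) K i j : compact K -> K `<=` Om ->
 (forall x, ~ K x -> Z x = 0) -> (forall p x, ~ K x -> gz p x = 0) ->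
 (forall p, wder Om p Z (gz p)) -> (forall p, sqint (gz p)) ->
 (forall p, wder Om p Y (gy p)) -> (forall p, sqint (gy p)) ->
 \int[mu]_(x in Om) (gz i x * gy j x) = \int[mu]_(x in Om) (gz j x * gy i x).
move=> cK KO Z0 gz0 wZ sZ wY sY.
have [r r0 Kr] := compact_inner oO cK KO; have r2 : 0 < r / 2 by rewrite divr_gt0.
have [N hN] := rad_small r2.
pose Zk k := conv (Z \_ Om) (eta k).
have iZ : Ritg mu setT (Z \_ Om).
 by have [a1 _ _] := wZ ord0; exact: (restrict_int _ mO).1.
have igz p : Ritg mu setT (gz p \_ Om).
 by have [_ a2 _] := wZ p; exact: (restrict_int _ mO).1.
have sZk k : smooth setT (Zk k) := (conv_smooth iZ (bump_eta k)).1.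
have far (u : E -> R) k x : (forall y, ~ K y -> u y = 0) -> (N <= k)%N -> ~ inner Om (r / 2) x ->
  conv (u \_ Om) (eta k) x = 0.
 move=> u0 /hN kr nx; rewrite /conv; under eq_Rintegral => y _.
  rewrite (_ : _ * _ = 0); first over.
  have [yx|yx] := ltP (enorm (y - x)) (rad k); last by rewrite eta_outside // mulr0.
  rewrite /patch; case: ifP => _; last by rewrite mul0r.
  rewrite u0 ?mul0r // => /Kr Ky; apply: nx; apply: (@inner_shift _ _ _ _ (r / 2) y).
   by rewrite -splitr.
  by rewrite enormB ltW // (lt_trans yx).
 by rewrite Rintegral_cst // mul0r.
have tZk k : (N <= k)%N -> test_function Om (Zk k).
 move=> Nk; split; first exact: sZk.
 exists (inner Om (r / 2)); split; [exact: inner_compact|exact: inner_sub|].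
 by move=> x; exact: far.
have pZk k p x : (N <= k)%N -> partial p (Zk k) x = conv (gz p \_ Om) (eta k) x.
 move=> Nk; have [ix|nx] := pselect (inner Om (r / 2) x).
  exact: (conv_partial_inner oO (wZ p) ix (hN _ Nk)).
 rewrite far //; last exact: gz0.
 apply: (@outside_partial_closed _ _ (Zk k) (inner Om (r / 2))) => //; first exact: inner_closed.
 by move=> y; exact: far.
have sym k : (N <= k)%N -> \int[mu]_(x in Om) (conv (gz i \_ Om) (eta k) x * gy j x) =
  \int[mu]_(x in Om) (conv (gz j \_ Om) (eta k) x * gy i x).
 move=> Nk; have tk := tZk k Nk.
 have half p q : \int[mu]_(x in Om) (conv (gz p \_ Om) (eta k) x * gy q x) =
   - \int[mu]_(x in Om) (Y x * partial q (partial p (Zk k)) x).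
  have [_ _ ->] := wY q; last exact: test_partial.
  by rewrite opprK; apply: eq_Rintegral => x; rewrite pZk // mulrC.
 have eY : (fun x => Y x * partial j (partial i (Zk k)) x) = (fun x => Y x * partial i (partial j (Zk k)) x).
  by apply/funext => x; rewrite (@schwarz R _ setT (Zk k) x j i openT (sZk k 2%N) I).
 apply: (etrans (half i j)); apply: (etrans _ (esym (half j i))).
 exact: (congr1 (fun F : E -> R => - \int[mu]_(x in Om) F x) eY).
have lim p q (e : R) : 0 < e -> exists N, forall k, (N <= k)%N ->
  `|\int[mu]_(x in Om) (conv (gz p \_ Om) (eta k) x * gy q x) - \int[mu]_(x in Om) (gz p x * gy q x)| <= e.
 move=> e0; have [mz z2] := sZ p; have [my y2] := sY q.
 have h1 : Ritg mu setT (fun x => (gz p \_ Om) x ^+ 2).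
  by rewrite sq_restrict; exact: (restrict_int _ mO).1.
 have h2 : Ritg mu setT (fun x => (gy q \_ Om) x ^+ 2).
  by rewrite sq_restrict; exact: (restrict_int _ mO).1.
 have h3 : measurable_fun (setT : set LT) (gy q \_ Om).
  by apply/(measurable_restrict _ mO) => //; rewrite setTI.
 have [N' hN'] := conv_eta_weak (igz p) h1 h2 h3 e0; exists N' => k /hN'.
 have -> : \int[mu]_(x in Om) (conv (gz p \_ Om) (eta k) x * gy q x) =
   \int[mu]_x (conv (gz p \_ Om) (eta k) x * (gy q \_ Om) x).
  rewrite Rintegral_mkcond; apply: eq_Rintegral => x; rewrite /patch; case: ifP => //; by rewrite mulr0.
 have -> : \int[mu]_(x in Om) (gz p x * gy q x) = \int[mu]_x ((gz p \_ Om) x * (gy q \_ Om) x).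
  rewrite Rintegral_mkcond; apply: eq_Rintegral => x; rewrite /patch; case: ifP => //; by rewrite mulr0.
 by [].
apply/eqP; rewrite -subr_eq0 -normr_le0; apply/ler_addgt0Pr => e e0; rewrite add0r.
have e2 : 0 < e / 2 by lra.
have [N1 h1] := lim i j _ e2; have [N2 h2] := lim j i _ e2.
pose k := maxn N (maxn N1 N2).
have /h1 {}h1 : (N1 <= k)%N by rewrite !leq_max leqnn !orbT.
have /h2 {}h2 : (N2 <= k)%N by rewrite !leq_max leqnn !orbT.
have Nk : (N <= k)%N by rewrite leq_max leqnn.
rewrite sym // distrC in h1; rewrite (splitr e); apply: le_trans (lerD h1 h2).
by apply: le_trans (ler_normD _ _); rewrite addrA subrK.
Qed.

(** Truncation reduces the claim to [curl_compact]: as [Z] is continuous up to the boundary and zero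
    there, the set where [|Z| >= rad k] is a compact subset of [Om]. *)
Lemma curl_vanishing (Z Y : E -> R) (gz gy : 'I_d.+1 -> E -> R) (C : R) i j :
 contin_on (closure Om) Z -> (forall x, Om x -> `|Z x| <= C) -> 0 <= C ->
 (forall x, closure Om x -> ~ Om x -> Z x = 0) ->
 (forall p, wder Om p Z (gz p)) -> (forall p, sqint (gz p)) ->
 (forall p, wder Om p Y (gy p)) -> (forall p, sqint (gy p)) ->
 \int[mu]_(x in Om) (gz i x * gy j x) = \int[mu]_(x in Om) (gz j x * gy i x).
move=> cZ ZC C0 Z0 wZ sZ wY sY.
have cZO : contin_on Om Z by apply: contin_on_sub cZ; exact: subset_closure.
have iZ : Ritg mu Om Z by case: (wZ ord0).
(* The limit of the truncated derivatives keeps only the set where [Z] is nonzero; nothing is lost,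
   because by uniqueness a weak derivative vanishes almost everywhere on the zero set. *)
have nz p : {ae mu, forall x, Om x -> gz p x = (Z x != 0)%:R * gz p x}.
 have [a1 a2 a3] := wZ p.
 have w2 := wder_trunc cZO iZ a2 (fun k => wder_trunc_comp (rad k) cZO ZC C0 (wZ p)).
 apply: (wder_ae w2); split=> // K cK KO.
  by apply: (integrableS mO _ KO a1); exact: compact_leb_measurable.
 by apply: (integrableS mO _ KO a2); exact: compact_leb_measurable.
have [B B0 hB] := @dtrunc_bounded R.
pose g k p := (fun x => dtrunc (rad k) (Z x) * gz p x) \_ Om.
have mdt k : measurable_fun (Om : set LT) (fun x => dtrunc (rad k) (Z x)).
 by apply: cont_meas; exact: contin_on_comp1 (@dtrunc_continuous R _).
have sym k : \int[mu]_(x in Om) (g k i x * gy j x) = \int[mu]_(x in Om) (g k j x * gy i x).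
 pose K := [set x : 'rV[R]_d.+1 | closure Om x /\ rad k <= `|Z x|].
 have KO : K `<=` Om.
  move=> x [cx Zx]; apply: contrapT => /(Z0 x cx) z0; move: Zx; rewrite z0 normr0.
  by rewrite leNgt rad_gt0.
 have cK : compact K.
  apply: (subclosed_compact _ (closure_compact bO)); last by move=> x [].
  apply: closed_level; first exact: closed_closure.
  by apply: (contin_on_comp1 (h := Num.norm)) cZ _ => x; exact: norm_continuous.
 have wg p : wder Om p ((trunc (rad k) \o Z) \_ Om) (g k p).
  have [b1 b2 b3] := wder_trunc_comp (rad k) cZO ZC C0 (wZ p).
  have e1 (u : E -> R) : {in (Om : set LT), (EFin \o u) =1 (EFin \o (u \_ Om))}.
   by move=> x xO; rewrite /= /patch xO.
  split.
  - exact: (@eq_integrable _ _ _ mu Om mO _ _ (e1 _) b1).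
  - exact: (@eq_integrable _ _ _ mu Om mO _ _ (e1 _) b2).
  - move=> phi /b3 b3p; rewrite -[LHS](_ : \int[mu]_(x in Om) ((trunc (rad k) \o Z) x * partial p phi x) = _); last first.
    by apply: eq_Rintegral => x xO; rewrite /patch xO.
   rewrite b3p; congr (- _); apply: eq_Rintegral => x xO; by rewrite /g /patch xO.
 have sg p : sqint (g k p).
  have [mz z2] := sZ p; have m1 : measurable_fun (Om : set LT) (g k p).
   by apply: eq_measurable_fun (measurable_funM (mdt k) mz) => x xO; rewrite /g /patch xO.
  split=> //; apply: (@itg_le _ _ _ mu Om mO _ (fun x => B ^+ 2 * gz p x ^+ 2)).
  - exact: measurable_funX.
  - move=> x Ox; rewrite /g /patch mem_set // exprMn normrM !normrX -[gz p x ^+ 2]real_normK ?num_real //.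
   by rewrite ler_wpM2r // lerXn2r ?nnegrE // ltW.
  - exact: itgZ.
 apply: (@curl_compact _ Y (g k) gy K i j cK KO _ _ wg sg wY sY).
  move=> x nK; rewrite /patch; case: ifP => // /set_mem Ox; rewrite /= trunc0 ?rad_gt0 //.
  by rewrite leNgt; apply/negP => h; apply: nK; split; [exact: subset_closure|exact: ltW].
 move=> p x nK; rewrite /g /patch; case: ifP => // /set_mem Ox; rewrite dtrunc0 ?mul0r ?rad_gt0 //.
 by rewrite leNgt; apply/negP => h; apply: nK; split; [exact: subset_closure|exact: ltW].
have lim p q : (fun k => \int[mu]_(x in Om) (g k p x * gy q x)) @ \oo --> \int[mu]_(x in Om) (gz p x * gy q x).
 have [mz z2] := sZ p; have [my y2] := sY q.
 have ipq := itgM mO mz my z2 y2.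
 have iB : Ritg mu Om (fun x => B * `|gz p x * gy q x|).
  by apply: itgZ => //; exact: itg_norm.
 have gE k x : Om x -> g k p x = dtrunc (rad k) (Z x) * gz p x.
  by move=> Ox; rewrite /g /patch mem_set.
 have ek k : \int[mu]_(x in Om) (g k p x * gy q x) = \int[mu]_(x in Om) (dtrunc (rad k) (Z x) * (gz p x * gy q x)).
  by apply: eq_Rintegral => x /set_mem Ox; rewrite gE // mulrA.
 under eq_fun do rewrite ek.
 have [_ _ l] := @Rdominated _ _ _ mu Om mO (fun k x => dtrunc (rad k) (Z x) * (gz p x * gy q x))
  (fun x => (Z x != 0)%:R * (gz p x * gy q x)) _ (fun k => measurable_funM (mdt k) (measurable_funM mz my))
  (fun x _ => ltac:(apply: cvgMl; exact: dtrunc_cvg)) iB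
  (fun k x _ => ltac:(by rewrite normrM ler_wpM2r)).
 rewrite (_ : \int[mu]_(x in Om) (gz p x * gy q x) = \int[mu]_(x in Om) ((Z x != 0)%:R * (gz p x * gy q x))) //.
 apply: ae_eq_Rintegral; first exact: mO.
 - exact: measurable_funM.
 - apply: measurable_fun_cvg (fun k => measurable_funM (mdt k) (measurable_funM mz my)) _.
  by move=> x _; apply: cvgMl; exact: dtrunc_cvg.
 - have [N [mN N0 sub]] := nz p; exists N; split=> // x nx; apply: sub => hx.
  by apply: nx => Ox; rewrite mulrA -(hx Ox).
have l1 := lim i j; move: l1; under eq_fun do rewrite sym.
move=> l1; exact: (cvg_unique (@norm_hausdorff _ _) l1 (lim j i)).
Qed.

End weak_uniqueness.

Lemma patch_measurable {disp} {T : measurableType disp} {R : realType} (D : set T) (f : T -> R) :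
 measurable D -> measurable_fun D f -> measurable_fun setT (f \_ D).
by move=> mD mf; apply/(measurable_restrict f mD) => //; rewrite setTI. Qed.

Lemma row_ext {R : realType} {m : nat} (x y : 'rV[R]_m) : (forall i, x ord0 i = y ord0 i) -> x = y.
by move=> h; apply/rowP => i; exact: h. Qed.

Lemma rowB {R : realType} {m : nat} (x y : 'rV[R]_m) i : (x - y) ord0 i = x ord0 i - y ord0 i.
by rewrite !mxE. Qed.

Lemma rowD {R : realType} {m : nat} (x y : 'rV[R]_m) i : (x + y) ord0 i = x ord0 i + y ord0 i.
by rewrite mxE. Qed.

Lemma rowZ {R : realType} {m : nat} (x : 'rV[R]_m) c i : (c *: x) ord0 i = c * x ord0 i.
by rewrite mxE. Qed.

Lemma Rle_of_ele {R : realType} {d1 d2} {T1 : measurableType d1} {T2 : measurableType d2}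
 (mu : {measure set T1 -> \bar R}) (nu : {measure set T2 -> \bar R}) (f : T1 -> R) (g : T2 -> R) (c : R) :
 Ritg mu setT f -> Ritg nu setT g ->
 (\int[mu]_x (f x)%:E <= c%:E * \int[nu]_x (g x)%:E)%E -> \int[mu]_x f x <= c * \int[nu]_x g x.
move=> iF ig; have f1 := integrable_fin_num measurableT iF; have f2 := integrable_fin_num measurableT ig.
by rewrite -(fineK f1) -(fineK f2).
Qed.

Lemma integrable_sqr_mulb {disp} {T : measurableType disp} {R : realType} (mu : {measure set T -> \bar R})
 (D : set T) (mD : measurable D) (f g : T -> R) (C : R) : Ritg mu D (fun x => f x ^+ 2) ->
 measurable_fun D g -> (forall x, D x -> `|g x| <= C) -> Ritg mu D (fun x => (f x * g x) ^+ 2).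
move=> iF mg gC; have -> : (fun x => (f x * g x) ^+ 2) = fun x => f x ^+ 2 * g x ^+ 2.
 by apply/funext => x; rewrite exprMn.
apply: (itgMb mD iF (C := C ^+ 2)).
 by exact: measurable_funM.
move=> x Dx; rewrite normrX lerXn2r //; exact: le_trans (gC x Dx).
Qed.

(** * Layer-cake comparison, uniform continuity, meshes and finite covers *)

Section layers.
Context {R : realType}.

Lemma count_ge (v s : R) (M : nat) : 0 < s -> v <= s * M%:R -> v <= s + s * \sum_(j < M) ((j.+1%:R * s <= v)%R)%:R.
move=> s0; elim: M => [|M IH] vM; first by rewrite big_ord0 mulr0 addr0 (le_trans vM) // mulr0 ltW.
rewrite big_ord_recr /=; have [h2|h2] := leP v (s * M%:R).
 by rewrite mulrDr addrA (le_trans (IH h2)) // lerDl mulr_ge0 // ltW.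
have -> : \sum_(j < M) ((j.+1%:R * s <= v)%R)%:R = M%:R :> R.
 rewrite -[M in RHS]card_ord -sumr_const; apply: eq_bigr => j _.
 by rewrite (_ : (_ <= _) = true) // (le_trans _ (ltW h2)) // mulrC ler_wpM2l ?(ltW s0) // ler_nat.
by rewrite (le_trans vM) // -natr1 !mulrDr mulr1 addrC addrA lerDl mulr_ge0 // ltW.
Qed.

Lemma count_le (v s : R) (M : nat) : 0 < s -> 0 <= v -> s * \sum_(j < M) ((j.+1%:R * s <= v)%R)%:R <= v.
move=> s0 v0; elim: M => [|M IH]; first by rewrite big_ord0 mulr0.
rewrite big_ord_recr /=; have [h|h] := leP (M.+1%:R * s) v; last by rewrite addr0.
apply: le_trans h; rewrite mulrC ler_wpM2r ?(ltW s0) // -natr1 lerD //.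
rewrite -[M in leRHS]card_ord -sumr_const; apply: ler_sum => j _; by case: (_ <= v).
Qed.

Lemma indic_level {T : Type} (f : T -> R) t y : \1_([set x | t <= f x]) y = ((t <= f y)%R)%:R :> R.
by rewrite indicE; case: (boolP (t <= f y)) => h; [rewrite mem_set|rewrite memNset //; exact/negP].
Qed.

Lemma level_measurable {disp} {T : measurableType disp} (f : T -> R) t :
 measurable_fun setT f -> measurable [set x | t <= f x].
move=> mf; have -> : [set x | t <= f x] = setT `&` f @^-1` `[t, +oo[.
 by rewrite setTI; apply/seteqP; split=> x; rewrite /= in_itv /= andbT.
by apply: mf => //; exact: measurable_itv.
Qed.

Lemma integral_levels {disp} {T : measurableType disp} (mu : {measure set T -> \bar R}) M (A : 'I_M -> set T) (s : R) :
 0 <= s -> (forall j, measurable (A j)) -> measurable_fun setT (fun x => s * \sum_(j < M) \1_(A j) x) /\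
 (\int[mu]_x (s * \sum_(j < M) \1_(A j) x)%:E = \sum_(j < M) s%:E * mu (A j))%E.
move=> s0 mA; split.
 by apply: measurable_funM => //; apply: measurable_sum => j; exact: measurable_indic.
under eq_integral do rewrite mulr_sumr -sumEFin.
rewrite ge0_integral_sum //; first last.
- by move=> j x _; rewrite lee_fin mulr_ge0 // indicE.
- by move=> j; apply/measurable_EFinP; apply: measurable_funM => //; exact: measurable_indic.
apply: eq_bigr => j _.
under eq_integral do rewrite EFinM; rewrite ge0_integralZl //; first by rewrite integral_indic // setIT.
by apply/measurable_EFinP; exact: measurable_indic.
Qed.

(** A layer-cake formula discretised with step [s]: a comparison of superlevel sets under two
    unrelated measures becomes a comparison of integrals. It lets integrals over collars and over
    the boundary be compared through set estimates alone. *)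
Lemma layer_le {disp1} {T1 : measurableType disp1} {disp2} {T2 : measurableType disp2}
  (mu : {measure set T1 -> \bar R}) (nu : {measure set T2 -> \bar R})
  (f : T1 -> R) (g : T2 -> R) (D : set T1) (c C : R) :
 measurable_fun setT f -> measurable_fun setT g -> measurable D -> (mu D < +oo)%E ->
 (forall x, 0 <= f x <= C) -> (forall x, ~ D x -> f x = 0) -> (forall y, 0 <= g y) -> 0 <= c ->
 (forall t : R, 0 < t -> (mu [set x | (t <= f x)%R] <= c%:E * nu [set y | (t <= g y)%R])%E) ->
 (\int[mu]_x (f x)%:E <= c%:E * \int[nu]_y (g y)%:E)%E.
move=> mf mg mD Dfin f0 fD g0 c0 H; apply/lee_addgt0Pr => e e0.
have D1 : 0 < fine (mu D) + 1 by rewrite ltr_wpDl // fine_ge0.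
pose s := e / (fine (mu D) + 1); have s0 : 0 < s by rewrite divr_gt0.
pose M := (Num.trunc (C / s)).+1.
have CM : C <= s * M%:R.
 by rewrite mulrC -ler_pdivrMr // ltW //; apply: Num.Theory.real_truncnS_gt; exact: num_real.
(* The lowest layer is replaced by all of [D]. It pays for the rounding of [f] up to a multiple of
   [s], and [s] was chosen so that this costs at most [e]. *)
pose A j := if j is k.+1 then [set x | k.+1%:R * s <= f x] else D.
have mA (j : 'I_M.+1) : measurable (A j) by case: j => -[|j] //= _; exact: level_measurable.
have [mfA iA] := integral_levels mu (ltW s0) mA.
have [mgB iB] := @integral_levels _ _ nu M (fun j => [set y | j.+1%:R * s <= g y]) _ (ltW s0)
 (fun j => level_measurable _ mg).
have pt x : f x <= s * \sum_(j < M.+1) \1_(A j) x.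
 have /andP[f1 f2] := f0 x; have [Dx|nDx] := pselect (D x); last first.
  by rewrite fD // mulr_ge0 ?(ltW s0) // sumr_ge0 // => j _; rewrite indicE.
 rewrite big_ord_recl mulrDr; have -> : \1_(A (@ord0 M)) x = 1 :> R by rewrite indicE mem_set.
 under eq_bigr do rewrite lift0 /A indic_level.
 by rewrite mulr1; exact: count_ge s0 (le_trans f2 CM).
have pg y : s * \sum_(j < M) \1_([set x | j.+1%:R * s <= g x]) y <= g y.
 by under eq_bigr do rewrite indic_level; exact: count_le M s0 (g0 y).
apply: (@le_trans _ _ (\int[mu]_x (s * \sum_(j < M.+1) \1_(A j) x)%:E)%E).
 apply: ge0_le_integral => //; try exact/measurable_EFinP.
  by move=> x _; rewrite lee_fin; case/andP: (f0 x).
 by move=> x _; rewrite lee_fin pt.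
rewrite iA big_ord_recl addeC; apply: leeD; last first.
 rewrite -[mu _]fineK ?ge0_fin_numE // -EFinM lee_fin /s mulrAC ler_pdivrMr //.
 by rewrite ler_wpM2l ?(ltW e0) // lerDl.
apply: (@le_trans _ _ (c%:E * \sum_(j < M) s%:E * nu [set x | (j.+1%:R * s <= g x)%R])%E).
 rewrite ge0_sume_distrr; last by move=> j _; rewrite mule_ge0 // lee_fin ltW.
 apply: lee_sum => j _; rewrite muleCA lee_wpmul2l ?lee_fin ?(ltW s0) // lift0.
 by apply: H; rewrite mulr_gt0.
rewrite lee_wpmul2l ?lee_fin // -iB; apply: ge0_le_integral => //; try exact/measurable_EFinP.
 by move=> x _; rewrite lee_fin mulr_ge0 ?(ltW s0) //; apply: sumr_ge0 => j _; rewrite indicE.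
by move=> x _; rewrite lee_fin pg.
Qed.

End layers.

Section uniform_continuity.
Context {R : realType} {d : nat}.
Local Notation E := 'rV[R]_d.+1.

Lemma contin_on_uniform (K : set E) (f : E -> R) e : compact K -> contin_on K f -> 0 < e ->
 exists2 r, 0 < r & forall x y, K x -> K y -> enorm (y - x) < r -> `|f y - f x| < e.
move=> /compact_near_coveringP cK cf e0; have e2 : 0 < e / 2 by rewrite divr_gt0.
have : \forall k \near \oo, K `<=` [set x | K x -> forall y, K y -> enorm (y - x) < (rad k : R) -> `|f y - f x| < e].
 apply: (cK nat \oo (fun k x => K x -> forall y, K y -> enorm (y - x) < (rad k : R) -> `|f y - f x| < e)) => x Kx.
 have [r r0 hr] := cf x Kx _ e2; have r2 : 0 < r / 2 by rewrite divr_gt0.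
 have [N hN] := rad_small r2.
 exists ([set y | enorm (y - x) < r / 2], [set k | (N <= k)%N]).
  by split; [apply/nbhs_enormP; exists (r / 2)|exists N].
 move=> [z k] /= [zx /hN kr] Kz y Ky yz.
 have h1 := hr z Kz; have h2 := hr y Ky; have := ler_enormD (y - z) (z - x).
 rewrite addrA subrK => h3.
 have {}h1 : `|f z - f x| < e / 2 by apply: h1; lra.
 have {}h2 : `|f y - f x| < e / 2 by apply: h2; lra.
 have -> : f y - f z = (f y - f x) - (f z - f x) by ring.
 by rewrite (le_lt_trans (ler_normB _ _)) // (splitr e) ltrD.
move=> [N _ hN]; exists (rad N); first exact: rad_gt0.
by move=> x y Kx Ky yx; exact: (hN N (leqnn N) x Kx Kx y Ky yx).
Qed.

(** The inverse of an expanding map is Lipschitz on the image. *)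
Lemma hausdorff_expand (m k s : nat) (f : 'rV[R]_m.+1 -> 'rV[R]_k) (A : set 'rV[R]_m.+1) (c : R) : 0 < c ->
 (forall x y, A x -> A y -> c * enorm (x - y) <= enorm (f x - f y)) ->
 (hausdorff_outer s A <= (c^-1 ^+ s)%:E * hausdorff_outer s (f @` A))%E.
move=> c0 fA; pose g (y : 'rV[R]_k) : 'rV[R]_m.+1 := xget 0 [set x | A x /\ f x = y].
have gf x : A x -> g (f x) = x.
 move=> Ax; rewrite /g; case: xgetP => [z _ [Az fz]|/(_ x)]; last by case.
 apply/eqP; rewrite -subr_eq0 -enorm_eq0 eq_le enorm_ge0 andbT.
 by have := fA z x Az Ax; rewrite fz subrr enorm0 pmulr_rle0.
have gA : g @` (f @` A) = A.
 apply/seteqP; split=> [_ [_ [x Ax <-] <-]|x Ax]; first by rewrite gf.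
 by exists (f x); [exists x|exact: gf].
rewrite -[X in (hausdorff_outer s X <= _)%E]gA; apply: hausdorff_lipschitz; first by rewrite invr_gt0.
move=> _ _ [x Ax <-] [y Ay <-]; rewrite !gf // mulrC ler_pdivlMr // mulrC; exact: fA.
Qed.

End uniform_continuity.

Section mesh.
Context {R : realType}.
Implicit Types (t : R).

(** The derivative of [step (2 * u - 1)], a bump of integral one. The profile is zero up to 1/2, so
    that a field multiplied by the corresponding cutoff is supported at a positive distance from the
    boundary. *)
Definition kstep (t : R) : R := 2 * dstep (2 * t - 1).

Lemma kstep_ge0 t : 0 <= kstep t. Proof. by rewrite mulr_ge0 // dstep_ge0. Qed.

Lemma kstep_out t : t <= 0 \/ 1 <= t -> kstep t = 0.
by case=> h; [rewrite /kstep dstep_le0 ?mulr0|rewrite /kstep dstep_ge1 ?mulr0] => //; lra.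
Qed.

Lemma kstep_bounded : exists2 B : R, 0 < B & forall t, kstep t <= B.
have [M M0 hM] := @dstep_bounded R; exists (2 * M); first by rewrite mulr_gt0.
by move=> t; rewrite ler_pM2l.
Qed.

Lemma kstep_continuous : continuous kstep.
move=> t; apply: cvgMr.
apply: (@continuous_comp R R R (fun t : R => 2 * t - 1) dstep); last exact: dstep_continuous.
by apply: cvgB; [apply: cvgMr; exact: cvg_id|exact: cvg_cst].
Qed.

Lemma is_derive_kstep t : is_derive t (1 : R) (fun u : R => step (2 * u - 1)) (kstep t).
have d1 : is_derive t (1 : R) (fun u : R => 2 * u) 2.
 by apply: (is_derive_eq (is_deriveZ (2 : R) (is_derive_id t 1))); rewrite /GRing.scale /= mulr1.
have d2 : is_derive t (1 : R) (fun u : R => 2 * u - 1) 2.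
 by apply: (is_derive_eq (is_deriveB d1 (is_derive_cst (1 : R) t 1))); rewrite subr0.
have := @is_derive1_comp R step (fun u : R => 2 * u - 1) t _ _ (is_derive_step _) d2.
by rewrite mulrC.
Qed.

Lemma enorm_row1 (t : R) : enorm (const_mx t : 'rV[R]_1) = `|t|.
by rewrite /enorm /dot big_ord1 !mxE sqrtr_sqr. Qed.

(** The sample points come from the mean value theorem, so the Riemann sum telescopes to exactly
    one. Later a collar is sliced along this mesh and no one-dimensional integral or coarea formula
    is needed. *)
Lemma kstep_mesh (z : R) : 0 < z -> exists M : nat, exists xi : nat -> R,
 [/\ (0 < M)%N, \sum_(l < M) kstep (xi l) / M%:R = 1 &
  forall (l : nat) t, l%:R / M%:R < t -> t <= l.+1%:R / M%:R -> (l < M)%N -> `|kstep t - kstep (xi l)| <= z].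
move=> z0; pose K := eball (0 : 'rV[R]_1) 1.
have cf : contin_on K (kstep \o (fun p : 'rV[R]_1 => p ord0 ord0)).
 apply: contin_on_comp1 kstep_continuous => p _ e e0; exists e => // q _ /= qp.
 by have := coord_le_enorm (q - p) ord0; rewrite !mxE => /le_lt_trans; apply.
have [q q0 hq] := contin_on_uniform (@eball_compact R 0 0 1) cf z0.
have [N hN] := rad_small q0; pose M := N.+1; have M0 : (0 : R) < M%:R by rewrite ltr0n.
have Mq : M%:R^-1 < q by exact: hN (leqnn N).
have close t u : 0 <= t <= 1 -> 0 <= u <= 1 -> `|t - u| <= M%:R^-1 -> `|kstep t - kstep u| <= z.
 move=> /andP[t0 t1] /andP[u0 u1] tu.
 have := hq (const_mx u) (const_mx t); rewrite /K /eball /= !subr0 !enorm_row1 !mxE (ger0_norm t0) (ger0_norm u0).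
 move=> /(_ u1 t1); rewrite (_ : const_mx t - const_mx u = const_mx (t - u)); last by apply/rowP => i; rewrite !mxE.
 by rewrite enorm_row1 => /(_ (le_lt_trans tu Mq)) /ltW.
have cS : continuous (fun u : R => step (2 * u - 1)).
 move=> x; apply: differentiable_continuous; apply/derivable1_diffP.
 by case: (is_derive_kstep x).
have H (l : nat) : {c : R | l%:R / M%:R < c < l.+1%:R / M%:R &
  step (2 * (l.+1%:R / M%:R) - 1) - step (2 * (l%:R / M%:R) - 1) = kstep c * M%:R^-1}.
 apply: cid2.
 have ab : l%:R / M%:R < l.+1%:R / M%:R :> R by rewrite ltr_pM2r ?invr_gt0 // ltr_nat.
 have [c] := @MVT R (fun u : R => step (2 * u - 1)) kstep _ _ ab (fun x _ => is_derive_kstep x)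
  (continuous_subspaceT cS).
 rewrite in_itv /= => cI ->; exists c => //.
 by rewrite -mulrBl -natr1 addrAC subrr add0r mul1r.
exists M, (fun l => s2val (H l)); split=> //.
 have h (l : nat) : kstep (s2val (H l)) / M%:R = step (2 * (l.+1%:R / M%:R) - 1) - step (2 * (l%:R / M%:R) - 1).
  exact: esym (s2valP' (H l)).
 under eq_bigr do rewrite h.
 rewrite -(big_mkord xpredT (fun l : nat => step (2 * (l.+1%:R / M%:R) - 1) - step (2 * (l%:R / M%:R) - 1))).
 rewrite (telescope_sumr (fun l : nat => step (2 * (l%:R / M%:R) - 1))) // divff ?gt_eqF // step_ge1; last lra.
 by rewrite mul0r mulr0 step_le0 ?subr0 //; lra.
move=> l t t0 t1 lM; have /andP[x0 x1] := s2valP (H l).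
have l0 : 0 <= l%:R / M%:R :> R by rewrite divr_ge0.
have l1 : l.+1%:R / M%:R <= 1 :> R by rewrite ler_pdivrMr // mul1r ler_nat.
have step1 : l.+1%:R / M%:R = l%:R / M%:R + M%:R^-1 :> R by rewrite -natr1 mulrDl mul1r.
apply: close; [by apply/andP; split; lra|by apply/andP; split; lra|].
by rewrite ler_norml; apply/andP; split; lra.
Qed.

Lemma mesh_cell (M : nat) t : (0 < M)%N -> 0 < t -> t <= 1 ->
 exists2 l : nat, (l < M)%N & l%:R / M%:R < t <= l.+1%:R / M%:R.
move=> M0 t0 t1; have Mr : (0 : R) < M%:R by rewrite ltr0n.
have ex : exists l : nat, t <= l.+1%:R / M%:R.
 by exists M.-1; rewrite prednK // divff ?gt_eqF.
have [l tl lmin] := ex_minnP ex.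
have lM : (l < M)%N by have := lmin M.-1; rewrite prednK // divff ?gt_eqF // => /(_ t1); rewrite -ltnS prednK.
exists l => //; rewrite tl andbT; case: l lmin {tl lM} => [|l] lmin; first by rewrite mul0r.
by rewrite ltNge; apply/negP => /lmin; rewrite ltnn.
Qed.

Lemma mesh_cell_uniq (M l l' : nat) t : (0 < M)%N -> l%:R / M%:R < t <= l.+1%:R / M%:R ->
 l'%:R / M%:R < t <= l'.+1%:R / M%:R -> l = l'.
move=> M0; have Mr : (0 : R) < M%:R by rewrite ltr0n.
have key (a b : nat) : a%:R / M%:R < t -> t <= b.+1%:R / M%:R -> (a <= b)%N.
 by move=> h1 h2; have := lt_le_trans h1 h2; rewrite ltr_pM2r ?invr_gt0 // ltr_nat.
by move=> /andP[h1 h2] /andP[h3 h4]; apply/eqP; rewrite eqn_leq !key.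
Qed.

End mesh.

Section compact_balls.
Context {R : realType} {m : nat}.
Local Notation E := 'rV[R]_m.+1.

Lemma open_ball_enorm (x : E) (r : R) : open [set y : 'rV[R]_m.+1 | enorm (y - x) < r].
rewrite openE => y yx; apply/nbhs_enormP; exists (r - enorm (y - x)); first by rewrite subr_gt0.
move=> z /=; have := ler_enormD (z - y) (y - x); rewrite addrA subrK; lra.
Qed.

Lemma open_far_enorm (x : E) (r : R) : open [set y : 'rV[R]_m.+1 | r < enorm (y - x)].
rewrite openE => y yx; apply/nbhs_enormP; exists (enorm (y - x) - r); first by rewrite subr_gt0.
move=> u /=; have := ler_enormD (y - u) (u - x); rewrite addrA subrK enormB; lra.
Qed.

(** Only the balls of half radius are required to cover. This leaves room for cutoffs equal to one
    on the half ball and zero outside the ball. *)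
Lemma compact_balls (K : set E) (P : E -> R -> Prop) : compact K ->
 (forall x, K x -> exists2 r, 0 < r & P x r) ->
 exists s : seq (E * R), (forall p, p \in s -> 0 < p.2 /\ P p.1 p.2) /\
  forall x, K x -> exists2 p, p \in s & enorm (x - p.1) < p.2 / 2.
rewrite compact_cover => cK H.
have H' x : exists r, K x -> 0 < r /\ P x r.
 by have [/H[r r0 Pr]|nK] := pselect (K x); [exists r|exists 0].
pose r x := sval (cid (H' x)); have rP x : K x -> 0 < r x /\ P x (r x) := svalP (cid (H' x)).
have op (x : E) : K x -> open [set y : 'rV[R]_m.+1 | enorm (y - x) < r x / 2] by move=> _; exact: open_ball_enorm.
have [|D DK cov] := cK E K (fun x => [set y : 'rV[R]_m.+1 | enorm (y - x) < r x / 2]) op.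
 by move=> x Kx; exists x => //=; rewrite subrr enorm0 divr_gt0; case: (rP x Kx).
exists [seq (x, r x) | x <- finmap.enum_fset D]; split.
 by move=> _ /mapP[x xD ->]; apply: rP; have := DK x xD; rewrite inE.
move=> x /cov[y /= yD xy]; exists (y, r y) => //; by apply/mapP; exists y.
Qed.

Lemma contin_on_bounded (K : set E) (f : E -> R) : compact K -> contin_on K f ->
 exists C, forall x, K x -> `|f x| <= C.
move=> cK cf; have [|s [sP cov]] := @compact_balls K (fun x r => exists C, forall y, K y -> enorm (y - x) < r -> `|f y| <= C) cK.
 move=> x Kx; have [r r0 hr] := cf x Kx 1 ltr01; exists r => //; exists (`|f x| + 1) => y Ky yx.
 by have h := hr y Ky; have := ler_normD (f y - f x) (f x); rewrite subrK; lra.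
have : exists C, forall p, p \in s -> forall y, K y -> enorm (y - p.1) < p.2 -> `|f y| <= C.
 elim: s sP {cov} => [_|p s IH sP]; first by exists 0.
 have [C1 h1] := IH (fun q qs => sP q (ltac:(by rewrite in_cons qs orbT))).
 have [_ [C2 h2]] := sP p (mem_head _ _).
 exists (Num.max C1 C2) => q; rewrite in_cons => /orP[/eqP ->|qs] y b_y yq; rewrite le_max.
  by rewrite h2 ?orbT.
 by rewrite (h1 q).
move=> [C hC]; exists C => x bx; have [p ps xp] := cov x bx; apply: (hC p ps) => //.
have [p0 _] := sP p ps; rewrite (lt_trans xp) // half_lt //.
Qed.

End compact_balls.

(** * The outer unit normal *)

Section normal.
Context {R : realType} {d : nat}.
Local Notation E := 'rV[R]_d.+1.
Variables (Om : set E).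
Implicit Types (x y : E) (U : set E) (phi : E -> R).

Lemma ldf_at x y U phi : local_defining_function Om x U phi -> U y -> local_defining_function Om y U phi.
by move=> [[oU _] ? ? ? ?]. Qed.

Lemma ldf_in x U phi y : local_defining_function Om x U phi -> U y -> (Om y <-> phi y < 0).
move=> [_ _ _ h _]; split=> h2.
 by have : (Om `&` U) y by []; rewrite h => -[].
by have : ([set y | phi y < 0] `&` U) y by []; rewrite -h => -[].
Qed.

Lemma ldf_bd x U phi y : local_defining_function Om x U phi -> U y -> (boundary Om y <-> phi y = 0).
move=> [_ _ _ _ h]; split=> h2.
 by have : (boundary Om `&` U) y by []; rewrite h => -[].
by have : ([set y | phi y = 0] `&` U) y by []; rewrite -h => -[].
Qed.

(** A direction along which [phi] decreases enters [Om] for small times, and there [phi'] is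
    negative too, so [phi'] cannot increase to first order. *)
Lemma ldf_halfspace x U phi U' phi' v : boundary Om x -> local_defining_function Om x U phi ->
 local_defining_function Om x U' phi' -> dot (grad phi x) v < 0 -> dot (grad phi' x) v <= 0.
move=> bx l l' gv; rewrite leNgt; apply/negP => gv'.
have [[oU Ux] sp _ _ _] := l; have [[oU' Ux'] sp' _ _ _] := l'.
have nv : 0 < enorm v + 1 by rewrite ltr_wpDl // enorm_ge0.
have a0 : 0 < - dot (grad phi x) v / 2 / (enorm v + 1) by rewrite !divr_gt0 // oppr_gt0.
have b0 : 0 < dot (grad phi' x) v / 2 / (enorm v + 1) by rewrite !divr_gt0.
have [r r0 hr] := diff_fdiff (smooth_diff sp Ux) a0.
have [s s0 hs] := diff_fdiff (smooth_diff sp' Ux') b0.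
have [p p0 hp] := open_enorm oU Ux.
have /nbhs_enormP[p' p'0 hp'] := open_nbhs_nbhs (conj oU' Ux').
pose m := Num.min (Num.min r s) (Num.min p p'); have m0 : 0 < m by rewrite !lt_min r0 s0 p0.
pose t := m / (enorm v + 1); have t0 : 0 < t by rewrite divr_gt0.
have xtx : x + t *: v - x = t *: v by rewrite addrAC subrr add0r.
have tv : enorm (x + t *: v - x) < m.
 rewrite xtx enormZ gtr0_norm // /t mulrAC ltr_pdivrMr // ltr_pM2l //.
 by rewrite ltrDl.
move: (tv); rewrite !lt_min => /andP[/andP[h1 h2] /andP[h3 h4]].
have := hr _ h1; have := hs _ h2; have Uy := hp _ h3; have Uy' := hp' _ h4.
rewrite xtx !dotZr enormZ (gtr0_norm t0) ((ldf_bd l Ux).1 bx) ((ldf_bd l' Ux').1 bx) !subr0.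
set g := dot (grad phi x) v in gv a0 *; set g' := dot (grad phi' x) v in gv' b0 *.
have e1 : - g / 2 / (enorm v + 1) * (t * enorm v) <= t * (- g / 2).
 rewrite mulrCA ler_pM2l // mulrAC ler_pdivrMr // ler_wpM2l ?lerDl //.
 by rewrite divr_ge0 // oppr_ge0 ltW.
have e2 : g' / 2 / (enorm v + 1) * (t * enorm v) <= t * (g' / 2).
 rewrite mulrCA ler_pM2l // mulrAC ler_pdivrMr // ler_wpM2l ?lerDl //.
 by rewrite divr_ge0 // ltW.
move=> /ler_normlP[k1 k2] /ler_normlP[k3 k4].
have tg : t * g < 0 by rewrite pmulr_rlt0.
have tg' : 0 < t * g' by rewrite mulr_gt0.
have : phi (x + t *: v) < 0.
 apply: (@le_lt_trans _ _ (t * g + t * (- g / 2))); first by lra.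
 by rewrite -mulrDr pmulr_rlt0 //; lra.
move=> /(ldf_in l Uy) /(ldf_in l' Uy').
have : 0 < t * g' - t * (g' / 2) by rewrite -mulrBr mulr_gt0 //; lra.
lra.
Qed.

Lemma unit_grad U phi x : local_defining_function Om x U phi ->
 enorm ((enorm (grad phi x))^-1 *: grad phi x) = 1.
move=> [[_ Ux] _ h _ _]; have g0 : enorm (grad phi x) != 0 by rewrite enorm_eq0 h.
by rewrite enormZ ger0_norm ?invr_ge0 ?enorm_ge0 // mulVf.
Qed.

(** If the unit vectors [p] and [q] differed, the direction [q - p] would decrease the first
    defining function and increase the second. *)
Lemma normal_unique x U phi U' phi' : boundary Om x -> local_defining_function Om x U phi ->
 local_defining_function Om x U' phi' ->
 (enorm (grad phi x))^-1 *: grad phi x = (enorm (grad phi' x))^-1 *: grad phi' x.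
move=> bx l l'; set p := _ *: grad phi x; set q := _ *: grad phi' x.
have p1 : dot p p = 1 by rewrite -enorm_sqr (unit_grad l) expr1n.
have q1 : dot q q = 1 by rewrite -enorm_sqr (unit_grad l') expr1n.
have g0 : 0 < enorm (grad phi x) by rewrite enorm_gt0; case: l => [[_ Ux] _ h _ _]; exact: h.
have g0' : 0 < enorm (grad phi' x) by rewrite enorm_gt0; case: l' => [[_ Ux] _ h _ _]; exact: h.
have pq : dot p q >= 1.
 rewrite leNgt; apply/negP => pq; have : dot p (q - p) < 0 by rewrite dotDr dotNr p1 subr_lt0.
 rewrite dotZl pmulr_rlt0 ?invr_gt0 // => /(ldf_halfspace bx l l').
 rewrite -(pmulr_rle0 _ (_ : 0 < (enorm (grad phi' x))^-1)) ?invr_gt0 // -dotZl -/q.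
 by rewrite dotDr dotNr q1 (dotC q); lra.
apply/eqP; rewrite -subr_eq0 -enorm_eq0 -sqrf_eq0 enorm_sqr.
have h : dot (p - q) (p - q) = 2 - 2 * dot p q.
 by rewrite dotDl !dotDr !dotNl !dotNr p1 q1 (dotC q p); ring.
by rewrite eq_le dot_ge0 h andbT; lra.
Qed.

Lemma outer_normalE x U phi : boundary Om x -> local_defining_function Om x U phi ->
 outer_normal Om x = (enorm (grad phi x))^-1 *: grad phi x.
move=> bx l; rewrite /outer_normal; case: xgetP => [v _ [U' [phi' [l' ->]]]|h].
 exact: normal_unique l' l.
by exfalso; apply: (h ((enorm (grad phi x))^-1 *: grad phi x)); exists U, phi.
Qed.

Lemma smooth_gsq U phi : open U -> smooth U phi -> smooth U (fun x => dot (grad phi x) (grad phi x)).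
move=> oU sp k; apply: (@Ck_ext _ _ k U (fun x => \sum_(i < d.+1) partial i phi x * partial i phi x) _ oU).
 by move=> x _; apply: eq_bigr => i _; rewrite mxE.
by apply: (@Ck_sum _ _ k U _ _ (fun i x => partial i phi x * partial i phi x) oU) => i; apply: Ck_M => //; exact: smooth_partial.
Qed.

Lemma gnorm_continuous U phi x : open U -> smooth U phi -> U x -> {for x, continuous (fun y => enorm (grad phi y))}.
move=> oU sp Ux; apply: (@continuous_comp _ _ _ (fun y => dot (grad phi y) (grad phi y)) (@Num.sqrt R)).
 exact: smooth_for (smooth_gsq oU sp) Ux.
exact: sqrt_continuous.
Qed.

Lemma normal_contin (sm : smooth_boundary Om) i : contin_on (boundary Om) (fun x => outer_normal Om x ord0 i).
move=> x bx e e0; have [U [phi l]] := sm x bx; have [[oU Ux] sp gn _ _] := l.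
have cf : {for x, continuous (fun y => (enorm (grad phi y))^-1 * partial i phi y)}.
 have c1 : {for x, continuous (fun y => (enorm (grad phi y))^-1)}.
  by apply: continuousV; [rewrite enorm_eq0 gn|exact: gnorm_continuous sp Ux].
 exact: (continuousM c1 (smooth_for (smooth_partial i sp) Ux)).
have [r r0 hr] := (cont_enormP _ x).1 cf e e0.
have [s s0 hs] := open_enorm oU Ux.
exists (Num.min r s); first by rewrite lt_min r0.
move=> y b_y; rewrite lt_min => /andP[h1 h2]; rewrite distrC.
rewrite (outer_normalE bx l) (outer_normalE b_y (ldf_at l (hs _ h2))) !rowZ !mxE.
exact: hr.
Qed.

Lemma normal_unit (sm : smooth_boundary Om) x : boundary Om x -> enorm (outer_normal Om x) = 1.
by move=> bx; have [U [phi l]] := sm x bx; rewrite (outer_normalE bx l) (unit_grad l). Qed.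

End normal.

(** * Choice of small constants *)

Section small.
Context {R : realType}.

Lemma bernoulli_le (t : R) (m : nat) : 0 <= t <= 1 -> 1 - m%:R * t <= (1 - t) ^+ m.
move=> /andP[t0 t1]; elim: m => [|m IH]; first by rewrite mul0r subr0 expr0.
have h : 0 <= 1 - t by rewrite subr_ge0.
rewrite exprS; apply: le_trans (ler_wpM2l h IH); rewrite -natr1.
have : 0 <= m%:R * t * t by rewrite !mulr_ge0.
lra.
Qed.

(** The two products are the factors lost in the upper and lower collar estimates in a chart of
    distortion [e]; Bernoulli's inequality shows that a multiple of [z / (2 + z)], divided by the
    dimension, is small enough. *)
Lemma chart_distortion_small (z : R) (m : nat) : 0 < z -> exists e : R, [/\ 0 < e, e <= 2^-1,
 (1 - e)^-1 ^+ m.+1 * (1 + e) <= 1 + z & (1 - z) * ((1 - e)^-1 ^+ m * (1 + e) ^+ m.+1) <= 1 - e].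
move=> z0; have M0 : (0 : R) < m.+1%:R by rewrite ltr0n.
have M1 : (1 : R) <= m.+1%:R by rewrite ler1n.
have z2 : 0 < 2 + z by rewrite addr_gt0.
pose e := z / (2 + z) / (2 * m.+1%:R); have e0 : 0 < e by rewrite !divr_gt0 // mulr_gt0.
have ey : 2 * m.+1%:R * e = z / (2 + z) by rewrite /e mulrC divfK // gt_eqF // mulr_gt0.
have y1 : z / (2 + z) < 1 by rewrite ltr_pdivrMr //; lra.
have yz : z / (2 + z) * (2 + z) = z by rewrite divfK // gt_eqF.
have e2 : 2 * e < 1.
 apply: le_lt_trans y1; rewrite -ey -mulrA ler_pM2l // ler_pMl //.
set y := z / (2 + z) in ey y1 yz.
have y0 : 0 < y by rewrite divr_gt0.
have m1 : 1 - y / 2 <= (1 - e) ^+ m.+1.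
 have -> : y / 2 = m.+1%:R * e by rewrite -ey; field.
 by apply: bernoulli_le; apply/andP; split; lra.
have m2 : 1 - y <= (1 - 2 * e) ^+ m.+1.
 have -> : y = m.+1%:R * (2 * e) by rewrite -ey; ring.
 by apply: bernoulli_le; apply/andP; split; lra.
have q0 : 0 < 1 - e by lra.
have p0 : 0 < 1 + e by lra.
have Q0 : 0 < (1 - e) ^+ m.+1 by rewrite exprn_gt0.
have P0 : 0 < (1 + e) ^+ m.+1 by rewrite exprn_gt0.
have ey2 : 2 * e <= y by rewrite -ey -mulrA ler_pM2l // ler_pMl.
exists e; split=> //; first by rewrite -[2^-1]mul1r ler_pdivlMr //; lra.
 rewrite exprVn mulrC ler_pdivrMr //.
 have z1 : 0 <= 1 + z by lra.
 apply: le_trans (ler_wpM2l z1 m1).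
 have : y * (2 + z) = 2 * y + z * y by ring.
 lra.
have [z1|z1] := leP (1 - z) 0.
 apply: (@le_trans _ _ 0); last exact: ltW.
 apply: mulr_le0_ge0 => //; apply: mulr_ge0; apply: exprn_ge0; last exact: ltW.
 by rewrite invr_ge0 ltW.
rewrite exprVn mulrA mulrAC ler_pdivrMr ?exprn_gt0 // -exprS.
have yz2 : y <= z by have : 0 <= y * z by [rewrite mulr_ge0 // ltW]; have : y * (2 + z) = 2 * y + y * z by [ring]; lra.
apply: (@le_trans _ _ ((1 - 2 * e) ^+ m.+1 * (1 + e) ^+ m.+1)).
 by rewrite ler_wpM2r ?(ltW P0) //; lra.
rewrite -exprMn; apply: lerXn2r; rewrite ?nnegrE ?(ltW q0) //; first by rewrite mulr_ge0 //; lra.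
have : 0 <= e * e by rewrite mulr_ge0 // ltW.
lra.
Qed.

Lemma small_le (X P C : R) : (forall z, 0 < z -> z < 1 -> X <= P + z * C) -> 0 <= C -> X <= P.
move=> H C0; apply/ler_addgt0Pr => e e0; have C1 : 0 < C + 1 by rewrite ltr_wpDl.
pose z := Num.min 2^-1 (e / (C + 1)); have z0 : 0 < z by rewrite lt_min invr_gt0 ltr0n divr_gt0.
have z1 : z < 1 by rewrite gt_min invf_lt1 // ltr1n.
apply: le_trans (H z z0 z1) _; rewrite lerD2l.
have : z * (C + 1) <= e by rewrite -ler_pdivlMr // ge_min lexx orbT.
by rewrite mulrDr mulr1; lra.
Qed.

End small.

(** * Homogeneous functions and the integrand *)

Section homogeneous.
Context {R : realType} {m : nat}.
Local Notation E := 'rV[R]_m.+1.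
Implicit Types (g f : E -> R) (p q G : E).
Local Notation N0 := (~` [set (0 : E)]).

Lemma punctured_open : open N0.
rewrite openE => p p0; have p1 : p != 0 by apply/eqP => h.
apply/nbhs_enormP; exists (enorm p); first by rewrite enorm_gt0.
by move=> q qp q0; move: qp; rewrite q0 sub0r enormN ltxx.
Qed.

Lemma punctured p : p != 0 -> N0 p. Proof. by move=> /eqP. Qed.

Lemma fdiff_grad g p : differentiable g p -> fdiff g p (grad g p).
exact: diff_fdiff. Qed.

Lemma radial_derivative g p G c : fdiff g p G ->
 (forall s, 0 < s -> s < 1 -> g (p + s *: p) = g p + s * c) -> dot G p = c.
move=> dg hg; apply/eqP; rewrite -subr_eq0 -normr_eq0 eq_le normr_ge0 andbT.
apply/ler_addgt0Pr => e e0; rewrite add0r.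
have p1 : 0 < enorm p + 1 by rewrite ltr_wpDl // enorm_ge0.
have e1 : 0 < e / (enorm p + 1) by rewrite divr_gt0.
have [r r0 hr] := dg _ e1.
pose s := Num.min 2^-1 (r / (enorm p + 1)); have s0 : 0 < s by rewrite lt_min invr_gt0 ltr0n divr_gt0.
have s1 : s < 1 by rewrite gt_min invf_lt1 // ltr1n.
have sr : s * (enorm p + 1) <= r by rewrite -ler_pdivlMr // ge_min lexx orbT.
have pp : p + s *: p - p = s *: p by rewrite addrAC subrr add0r.
have := hr (p + s *: p); rewrite pp enormZ (gtr0_norm s0) hg // dotZr.
have -> : g p + s * c - g p - s * dot G p = s * (c - dot G p) by ring.
have lt_r : s * enorm p < r by lra.
move=> /(_ lt_r); rewrite normrM (gtr0_norm s0) mulrCA ler_pM2l // distrC => /le_trans; apply.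
by rewrite mulrAC ler_pdivrMr // ler_wpM2l ?(ltW e0) // lerDl.
Qed.

Definition homog1 g := forall t p, 0 < t -> g (t *: p) = t * g p.
Definition homog0 g := forall t p, 0 < t -> p != 0 -> g (t *: p) = g p.

Lemma homog1_0 g : homog1 g -> g 0 = 0.
by move=> hg; have := hg 2 0; rewrite scaler0; lra. Qed.

Lemma homog1_grad g t p : homog1 g -> 0 < t -> differentiable g p -> grad g (t *: p) = grad g p.
move=> hg t0 dg; have t1 : t != 0 by lra.
suff /fdiff_diff[_ h] : fdiff g (t *: p) (grad g p) by exact: h.
move=> e e0; have [r r0 hr] := fdiff_grad dg e0; exists (t * r); first by rewrite mulr_gt0.
move=> y yx; have [z yE] : exists z, y = t *: z by exists (t^-1 *: y); rewrite scalerA divff // scale1r.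
move: yx; rewrite yE -scalerBr enormZ (gtr0_norm t0) ltr_pM2l // => /hr.
rewrite !hg // dotZr -!mulrBr normrM (gtr0_norm t0) mulrCA ler_pM2l //.
Qed.

Lemma homog1_partial g j : homog1 g -> smooth N0 g -> homog0 (partial j g).
move=> hg sg t p t0 p0.
have := congr1 (fun v : E => v ord0 j) (homog1_grad hg t0 (smooth_diff sg (punctured p0))).
by rewrite !mxE.
Qed.

Lemma homog1_euler g p : homog1 g -> differentiable g p -> dot (grad g p) p = g p.
move=> hg dg; apply: (radial_derivative (fdiff_grad dg)) => s s0.
have -> : p + s *: p = (1 + s) *: p by rewrite scalerDl scale1r.
by rewrite hg ?addr_gt0 // mulrDl mul1r.
Qed.

Lemma homog0_euler g p : homog0 g -> p != 0 -> differentiable g p -> dot (grad g p) p = 0.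
move=> hg p0 dg; apply: (radial_derivative (fdiff_grad dg)) => s s0.
have -> : p + s *: p = (1 + s) *: p by rewrite scalerDl scale1r.
by rewrite hg ?addr_gt0 // mulr0 addr0.
Qed.

Lemma unit_dir p : p != 0 -> enorm ((enorm p)^-1 *: p) = 1.
move=> p0; rewrite enormZ ger0_norm ?invr_ge0 ?enorm_ge0 // mulVf // enorm_eq0 //.
Qed.

Lemma sphere_bounded g : (forall p, p != 0 -> {for p, continuous g}) ->
 exists2 C, 0 < C & forall p, enorm p = 1 -> `|g p| <= C.
move=> cg; pose S := [set p : E | eball 0 1 p /\ 1 <= enorm p].
have cS : compact S.
 apply: (subclosed_compact _ (@eball_compact R m 0 1)); last by move=> p [].
 apply: closed_level; first exact: eball_closed.
 by apply: cont_contin; exact: enorm_continuous.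
have [|C C0 hC] := @continuous_bounded_on R m S g cS.
 by move=> p [_ p1]; apply: cg; rewrite -enorm_gt0 (lt_le_trans ltr01).
by exists C => // p p1; apply: hC; rewrite /S /eball /= subr0 p1.
Qed.

Lemma homog0_bounded g : homog0 g -> (forall p, p != 0 -> {for p, continuous g}) ->
 exists2 C, 0 < C & forall p, p != 0 -> `|g p| <= C.
move=> hg cg; have [C C0 hC] := sphere_bounded cg; exists C => // p p0.
rewrite -(hg (enorm p)^-1 p) ?invr_gt0 ?enorm_gt0 //; exact: hC (unit_dir p0).
Qed.

Lemma homog1_bounded g : homog1 g -> (forall p, p != 0 -> {for p, continuous g}) ->
 exists2 C, 0 < C & forall p, `|g p| <= C * enorm p.
move=> hg cg; have [C C0 hC] := sphere_bounded cg; exists C => // p.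
have [->|p0] := eqVneq p 0; first by rewrite (homog1_0 hg) normr0 enorm0 mulr0.
have e0 : 0 < enorm p by rewrite enorm_gt0.
have := hC _ (unit_dir p0); rewrite hg ?invr_gt0 // normrM gtr0_norm ?invr_gt0 //.
by rewrite mulrC ler_pdivrMr.
Qed.

Lemma homog1_continuous g : homog1 g -> (forall p, p != 0 -> {for p, continuous g}) -> continuous g.
move=> hg cg p; have [->|p0] := eqVneq p 0; last exact: cg.
have [C C0 hC] := homog1_bounded hg cg.
apply/cont_enormP => e; exists (e / C); first by rewrite divr_gt0.
move=> y; rewrite subr0 (homog1_0 hg) sub0r normrN ltr_pdivlMr // mulrC.
exact: le_lt_trans.
Qed.

(** A one-homogeneous function is small near the origin, so truncation makes it vanish in a
    neighbourhood of the only point where it can fail to be smooth. *)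
Lemma trunc_homog1_smooth g k : homog1 g -> smooth N0 g -> smooth setT (trunc (rad k) \o g).
move=> hg sg l; have cg p : p != 0 -> {for p, continuous g} by move=> /punctured; exact: smooth_for.
have [C C0 hC] := homog1_bounded hg cg; have r0 : 0 < (rad k : R) := rad_gt0 k.
pose V := [set p : E | enorm (p - 0) < rad k / C].
have oV : open V by exact: open_ball_enorm.
apply: (@Ck_sub _ _ l (N0 `|` V)).
 move=> p; have [->|p0] := eqVneq p 0; last by left; exact: punctured.
 by right; rewrite /V /= subr0 enorm0 divr_gt0.
apply: Ck_union; first by apply: Ck_trunc => //; exact: punctured_open.
apply: (@Ck_ext _ _ l V (cst 0) _ oV); last exact: Ck_cst.
move=> p; rewrite /V /= subr0 ltr_pdivlMr // mulrC => pV; rewrite trunc0 //.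
exact: le_trans (ltW pV).
Qed.

End homogeneous.

Section elliptic.
Context {R : realType} {n : nat}.
Local Notation E := 'rV[R]_n.+1.
Variables (F : E -> R) (el : smooth_elliptic_integrand F).
Local Notation f := (homext F).
Local Notation N0 := (~` [set (0 : E)]).
Implicit Types (p q : E).

Lemma homext_homog1 : homog1 f.
move=> t p t0; rewrite /homext enormZ gtr0_norm // scalerA.
have -> : (t * enorm p)^-1 * t = (enorm p)^-1 by rewrite invfM mulrAC mulVf ?mul1r // gt_eqF.
lra.
Qed.

Lemma homextZ t p : 0 <= t -> f (t *: p) = t * f p.
rewrite le_eqVlt => /orP[/eqP <-|]; last exact: homext_homog1.
by rewrite scale0r mul0r (homog1_0 homext_homog1).
Qed.

Lemma homext_gt0 p : p != 0 -> 0 < f p.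
move=> p0; case: el => -[h _]; rewrite mulr_gt0 ?enorm_gt0 // h // unit_dir //.
Qed.

Lemma homext_smooth : smooth N0 f. Proof. by case: el. Qed.
Let sf := homext_smooth.

Definition halfsq p := f p ^+ 2 / 2.
(** The [j]-th component of the gradient of F²/2. At the origin the product is zero because [f] is,
    whatever value the derivative of [f] takes there. *)
Definition flow j p := f p * partial j f p.

Lemma homext_continuous : continuous f.
by apply: homog1_continuous; [exact: homext_homog1|move=> p /punctured; exact: smooth_for sf]. Qed.

(** Away from the origin this is the product rule; at the origin the square of a one-homogeneous
    function is bounded by a multiple of the squared norm, so its gradient is zero. *)
Lemma halfsq_grad q : grad halfsq q = f q *: grad f q.
have [->|q0] := eqVneq q 0.
 rewrite (homog1_0 homext_homog1) scale0r.
 have cf p : p != 0 -> {for p, continuous f} by move=> /punctured; exact: smooth_for.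
 have [C C0 hC] := homog1_bounded homext_homog1 cf.
 suff /fdiff_diff[] : fdiff halfsq 0 0 by [].
 move=> e; exists (e / C ^+ 2); first by rewrite divr_gt0 // exprn_gt0.
 move=> y; rewrite subr0 dot0l subr0 /halfsq (homog1_0 homext_homog1) expr0n mul0r subr0 => ye.
 rewrite ger0_norm ?divr_ge0 ?sqr_ge0 //.
 have h : f y ^+ 2 <= (C * enorm y) ^+ 2.
  by rewrite -[f y ^+ 2]real_normK ?num_real // lerXn2r ?nnegrE ?mulr_ge0 ?enorm_ge0 // ltW.
 have h2 : C ^+ 2 * enorm y <= e by rewrite mulrC -ler_pdivlMr ?exprn_gt0 // ltW.
 apply: le_trans (_ : f y ^+ 2 <= _); first by rewrite ler_pdivrMr // ler_peMr ?sqr_ge0 // ler1n.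
 apply: le_trans h _; rewrite exprMn mulrA; apply: ler_wpM2r h2.
 exact: enorm_ge0.
have df := smooth_diff sf (punctured q0).
have e1 : halfsq = cst 2^-1 \* (f \* f) by apply/funext => p; rewrite /= mulrC.
apply: row_ext => j; rewrite !mxE e1.
rewrite (@partialM _ _ (cst 2^-1) (f \* f) q j (differentiable_cst _ _) (differentiableM df df)).
by rewrite partial_cst partialM //=; field.
Qed.

Lemma anisotropic_gradE (Du : E -> E) x : anisotropic_grad F Du x = \row_j flow j (Du x).
by rewrite /anisotropic_grad halfsq_grad; apply: row_ext => j; rewrite !mxE. Qed.

Lemma partial_homog0 j : homog0 (partial j f). Proof. exact: homog1_partial homext_homog1 sf. Qed.

Lemma flow_homog1 j : homog1 (flow j).
move=> t p t0; rewrite /flow homext_homog1 // -mulrA.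
have [->|p0] := eqVneq p 0; first by rewrite (homog1_0 homext_homog1) !mul0r.
by rewrite partial_homog0.
Qed.

Lemma flow_smooth j : smooth N0 (flow j).
by move=> k; apply: Ck_M; [exact: punctured_open|exact: sf|exact: smooth_partial]. Qed.

Lemma flow_continuous j : continuous (flow j).
by apply: homog1_continuous; [exact: flow_homog1|move=> p /punctured; exact: smooth_for (flow_smooth j)]. Qed.

(** The case [t = 0] is included, so the factorisation of [X] on the boundary holds also at points
    where the gradient of the potential vanishes. *)
Lemma flow_ray t p j : 0 <= t -> p != 0 -> flow j (t *: p) = f (t *: p) * partial j f p.
rewrite /flow le_eqVlt => /orP[/eqP <-|t0] p0; last by rewrite partial_homog0.
by rewrite scale0r (homog1_0 homext_homog1) !mul0r.
Qed.

Lemma homext_euler p : p != 0 -> \sum_j partial j f p * p ord0 j = f p.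
move=> p0; rewrite -(homog1_euler homext_homog1 (smooth_diff sf (punctured p0))).
by apply: eq_bigr => j; rewrite mxE.
Qed.

(** Euler's relation for the zero-homogeneous [partial k f], after exchanging the two
    derivatives. *)
Lemma hess_radial p k : p != 0 -> \sum_i partial k (partial i f) p * p ord0 i = 0.
move=> p0; have := homog0_euler (partial_homog0 k) p0 (smooth_diff (smooth_partial k sf) (punctured p0)).
move=> h; apply: etrans h; apply: eq_bigr => i; rewrite mxE.
by rewrite (schwarz k i punctured_open (sf 2%N) (punctured p0)).
Qed.

Lemma flow_partial_bounded : exists2 C, 0 < C & forall i j p, p != 0 -> `|partial i (flow j) p| <= C.
have H (ij : 'I_n.+1 * 'I_n.+1) : {C : R | 0 < C & forall p, p != 0 -> `|partial ij.1 (flow ij.2) p| <= C}.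
 apply: cid2; apply: homog0_bounded; first exact: homog1_partial (flow_homog1 _) (flow_smooth _).
 by move=> p /punctured; apply: smooth_for; exact: smooth_partial (flow_smooth _).
exists (1 + \sum_ij s2val (H ij)) => [|i j p p0].
 by rewrite ltr_wpDr // sumr_ge0 // => ij _; exact: ltW (s2valP (H ij)).
apply: le_trans (s2valP' (H (i, j)) p p0) _.
rewrite (bigD1 (i, j)) //= addrCA lerDl addr_ge0 // sumr_ge0 // => ij _; exact: ltW (s2valP (H ij)).
Qed.

End elliptic.

(** * Square integrable functions and the quadratic form *)

Section square_integrable.
Context {R : realType} {d : nat}.
Local Notation E := 'rV[R]_d.+1.
Local Notation L := (@lebesgue_outer R d.+1).
Local Notation LT := (caratheodory_type L).
Local Notation mu := (@leb R d.+1).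
Variables (Om : set E) (oO : open Om) (bO : bounded_set Om).
Implicit Types (f g : E -> R).
Let mO := Om_measurable oO.

Lemma sqint_add f g : sqint Om f -> sqint Om g -> sqint Om (fun x => f x + g x).
by move=> [h1 h2] [h3 h4]; split; [exact: measurable_funD|exact: integrable_sqr_add]. Qed.

Lemma sqint_mulb f g (C : R) : sqint Om f -> measurable_fun (Om : set LT) g -> (forall x, Om x -> `|g x| <= C) ->
 sqint Om (fun x => f x * g x).
move=> [h1 h2] mg gC; split; first exact: measurable_funM.
exact: (integrable_sqr_mulb mO h2 mg gC).
Qed.

Lemma sqint1 : sqint Om (fun=> 1).
have cc : contin_on Om (fun=> 1 : R) by move=> e; exists 1 => //; rewrite subrr normr0.
split; first exact: cont_meas.
rewrite expr1n.
by apply: (@integrable_bounded R d Om _ 1 mO (bounded_fin bO) (cont_meas cc)) => x; rewrite normr1.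
Qed.

Lemma sqint_bounded g (C : R) : contin_on Om g -> (forall x, Om x -> `|g x| <= C) -> sqint Om g.
move=> cg gC; have -> : g = fun x => 1 * g x by apply/funext => x; rewrite mul1r.
by apply: sqint_mulb gC; [exact: sqint1|exact: cont_meas].
Qed.

Lemma sqint_sum (I : Type) (s : seq I) (G : I -> E -> R) : (forall k, sqint Om (G k)) ->
 sqint Om (fun x => \sum_(k <- s) G k x).
move=> H; elim: s => [|k s IH]; last by under eq_fun do rewrite big_cons; exact: sqint_add.
under eq_fun do rewrite big_nil; apply: (@sqint_bounded _ 0) => [|x _]; last by rewrite normr0.
by exists 1 => //; rewrite subrr normr0.
Qed.

Lemma sqint_smooth f a : sqint Om f -> smooth setT a -> sqint Om (fun x => f x * a x).
move=> sf sa; have [C _ hC] := smooth_bounded_Om bO sa; apply: sqint_mulb sf _ hC.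
by exact: smooth_measurable.
Qed.

Lemma sqint_itgM f g : sqint Om f -> sqint Om g -> Ritg mu Om (fun x => f x * g x).
by move=> [h1 h2] [h3 h4]; exact: itgM. Qed.

Lemma sqint_integrable f : sqint Om f -> Ritg mu Om f.
move=> sf; have := sqint_itgM sf sqint1.
by rewrite (_ : (fun x => f x * 1) = f) //; apply/funext => x; rewrite mulr1.
Qed.

Lemma wder_ext i f g g' : wder Om i f g -> (forall x, Om x -> g x = g' x) -> wder Om i f g'.
move=> [a1 a2 a3] gg; split=> //.
 apply: eq_integrable a2 => // x /set_mem Ox; by rewrite /= gg.
by move=> phi tp; rewrite a3 //; congr (- _); apply: eq_Rintegral => x /set_mem Ox; rewrite gg.
Qed.

Lemma wder_sqr i f g (C : R) : contin_on Om f -> (forall x, Om x -> `|f x| <= C) -> 0 <= C ->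
 wder Om i f g -> wder Om i (fun x => f x ^+ 2) (fun x => 2 * f x * g x).
move=> cf fC C0 wf; pose P (x : E) : 'rV[R]_1 := \row_j f x.
pose q (p : 'rV[R]_1) : R := p ord0 ord0; pose G := q \* q.
have sG : smooth setT G by move=> k; apply: Ck_M; [exact: openT|exact: Ck_coord|exact: Ck_coord].
have Pj (j : 'I_1) : (fun x => P x ord0 j) = f by apply/funext => x; rewrite mxE.
have := @wder_comp R d Om oO bO 0 P (fun=> g) i G C C0 sG.
have dq p : differentiable q p := (fdiff_diff (fdiff_coord p ord0)).1.
have dG p : partial ord0 G p = 2 * q p.
 by rewrite (@partialM _ _ q q p ord0 (dq p) (dq p)) partial_coord mulr1 mulrDl mul1r.
have -> : (fun x => \sum_(j < 1) g x * partial j G (P x)) = fun x => 2 * f x * g x.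
 by apply/funext => x; rewrite big_ord1 dG /q mxE mulrC.
have -> : G \o P = fun x => f x ^+ 2 by apply/funext => x; rewrite /G /q /= mxE.
apply=> [j|j|x j Ox]; rewrite ?Pj //; by rewrite mxE fC.
Qed.

End square_integrable.

Section quadratic_trace.
Context {R : comRingType} {m : nat}.
Implicit Types A B : 'M[R]_m.

Definition trace_form A B := \sum_i \sum_j (A i i * B j j - A j i * B i j).
Definition quad A := (\tr A) ^+ 2 - \tr (A *m A).

Lemma trace_formE A B : trace_form A B = \tr A * \tr B - \tr (A *m B).
rewrite /trace_form; under eq_bigr do rewrite sumrB -mulr_sumr.
rewrite sumrB -mulr_suml exchange_big; congr (_ - _); apply: eq_bigr => i.
by rewrite mxE.
Qed.

(** A difference of squares: [trace_form] is the symmetric bilinear form polarising [quad]. The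
    factor [A - B] will come from a field vanishing on the boundary, which is all that the null
    Lagrangian identity needs. *)
Lemma quad_sub A B : quad A - quad B = trace_form (A - B) (A + B).
rewrite trace_formE /quad.
have -> : \tr ((A - B) *m (A + B)) = \tr (A *m A) - \tr (B *m B).
 by rewrite mulmxDr !mulmxBl linearD !linearB /= [\tr (B *m A)]mxtrace_mulC addrA subrK.
ring.
Qed.

Lemma quadE A : quad A = \sum_i \sum_j (A i i * A j j - A i j * A j i).
rewrite /quad -trace_formE; apply: eq_bigr => i _; apply: eq_bigr => j.
by rewrite [A j i * _]mulrC.
Qed.

End quadratic_trace.

Section real_helpers.
Context {R : realType}.

Lemma flat_gt0 k (t : R) : 0 < t -> 0 < flat k t.
by move=> t0; rewrite /flat t0 mulr_gt0 ?expR_gt0 // exprn_gt0 // invr_gt0. Qed.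

Lemma flat_bounded k (t : R) : flat k t <= k.+2`!%:R.
have [t0|t0] := leP t 0; first by rewrite flat_le0.
have f1 : (1 : R) <= k.+2`!%:R by rewrite ler1n fact_gt0.
have [t1|t1] := leP t 1.
 apply: le_trans (ler_norm _) _; apply: le_trans (flat_quadratic k t) _.
 by rewrite ler_piMr // expr_le1 // ltW.
apply: le_trans f1; rewrite /flat t0; apply: mulr_ile1.
- by rewrite exprn_ge0 // invr_ge0 ltW.
- exact: expR_ge0.
- by rewrite exprn_ile1 ?invr_ge0 ?(ltW t0) // invf_le1 // ltW.
- by rewrite -expR0 ler_expR oppr_le0 invr_ge0 ltW.
Qed.

Lemma lipschitz_of_derive (h h' : R -> R) (C : R) a b : (forall t : R, is_derive t (1 : R) h (h' t)) ->
 (forall t, `|h' t| <= C) -> `|h b - h a| <= C * `|b - a|.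
move=> dh hC; have ch : continuous h.
 by move=> t; apply: differentiable_continuous; apply/derivable1_diffP.
have key a' b' : a' < b' -> `|h b' - h a'| <= C * `|b' - a'|.
 move=> ab; have [c _ ->] := @MVT R h h' a' b' ab (fun x _ => dh x) (continuous_subspaceT ch).
 by rewrite normrM ler_wpM2r.
by have [ab|ab|->] := ltgtP a b; [exact: key|rewrite distrC [`|b - a|]distrC; exact: key|rewrite !subrr normr0 mulr0].
Qed.

End real_helpers.

Section abstract_L2.
Context {disp} {T : measurableType disp} {R : realType} (mu : {measure set T -> \bar R}).
Variables (D : set T) (mD : measurable D).

Lemma L2_weak_cvg (g_ : nat -> T -> R) (b : T -> R) : (forall k, measurable_fun D (g_ k)) ->
 (forall k, Ritg mu D (fun x => g_ k x ^+ 2)) -> measurable_fun D b ->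
 Ritg mu D (fun x => b x ^+ 2) ->
 (fun k => \int[mu]_(x in D) (g_ k x ^+ 2)) @ \oo --> 0 ->
 (fun k => \int[mu]_(x in D) (g_ k x * b x)) @ \oo --> 0.
move=> mg ig mb ib /cvgrPdist_lt cg; apply/cvgrPdist_lt => e e0.
pose S := \int[mu]_(x in D) (b x ^+ 2); have S0 : 0 <= S by apply: Rintegral_ge0 => x _; exact: sqr_ge0.
have S1 : 0 < S + 1 by lra.
pose t := e / 2 / (S + 1); have t0 : 0 < t by rewrite !divr_gt0.
have : t * S <= e / 2 by rewrite mulrAC ler_pdivrMr // ler_wpM2l ?lerDl // divr_ge0 // ltW.
have te : 0 < t * (e / 2) by rewrite mulr_gt0 // divr_gt0.
have [N _ hN] := cg _ te; exists N => // k /hN; rewrite !sub0r !normrN => hk.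
under eq_Rintegral do rewrite mulrC.
apply: le_lt_trans (integral_young mD (_ : 0 < t) mb (mg k) ib (ig k)) _ => //.
rewrite -/S (splitr e) ler_ltD // mulrC ltr_pdivrMr // [e / 2 * t]mulrC.
exact: le_lt_trans (ler_norm _) hk.
Qed.

Lemma ae_imp (P Q : T -> Prop) : {ae mu, forall x, P x} -> (forall x, P x -> Q x) -> {ae mu, forall x, Q x}.
by move=> aP PQ; apply: filterS aP. Qed.

Lemma Rintegral_abs_ae (f : T -> R) : Ritg mu D f -> {ae mu, forall x, D x -> 0 <= f x} ->
 \int[mu]_(x in D) `|f x| = \int[mu]_(x in D) f x.
move=> iF f0; apply: (ae_eq_Rintegral mD (itg_meas (itg_norm iF)) (itg_meas iF)).
by apply: filterS f0 => x h Dx; rewrite ger0_norm // h.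
Qed.

Lemma EFin_Rintegral (f : T -> R) : Ritg mu D f ->
 (\int[mu]_(x in D) (f x)%:E = (\int[mu]_(x in D) f x)%R%:E)%E.
by move=> iF; rewrite fineK //; exact: (integrable_fin_num mD iF). Qed.

End abstract_L2.

(** * Slabs, reflections and straightening charts at the boundary *)

Section domain.
Context {R : realType} {d : nat}.
Local Notation E := 'rV[R]_d.+2.
Local Notation mu := (@leb R d.+2).
Local Notation L := (@lebesgue_outer R d.+2).
Local Notation LT := (caratheodory_type L).
Local Notation Ho := (@hausdorff_outer R d.+2 d.+1).
Local Notation HT := (caratheodory_type Ho).
Local Notation sigma := (@hausdorff R d.+2 d.+1).

Section slab.
Local Notation F := 'rV[R]_d.+1.

Definition slab (a b : R) (A : set F) : set E :=
 [set y : 'rV[R]_d.+2 | a <= y ord0 ord0 < b /\ A (rtail y)].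

Lemma vol_cons (a b : R) (l u : F) : vol (rcons0 a l) (rcons0 b u) = (b - a) * vol l u.
by rewrite volS !rcons0_head !rtail_cons. Qed.

Lemma slab_le (a b : R) (A : set F) : a < b -> (lebesgue_outer A < +oo)%E ->
 (lebesgue_outer (slab a b A) <= (b - a)%:E * lebesgue_outer A)%E.
move=> ab Afin; have ba : 0 < b - a by rewrite subr_gt0.
rewrite -(fineK (_ : lebesgue_outer A \is a fin_num)%E) ?ge0_fin_numE //; last exact: outer_measure_ge0.
apply/lee_addgt0Pr => e e0; have e1 : 0 < e / (b - a) by rewrite divr_gt0.
have [l [u [lu cov sumv]]] := leb_box_cover Afin e1.
apply: le_trans (@leb_le_cover _ _ _ (fun k => rcons0 a (l k)) (fun k => rcons0 b (u k)) _ _) _.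
- move=> k i; case: (unliftP ord0 i) => [j ->|->]; rewrite ?rcons0_lift ?rcons0_head //.
 exact: ltW.
- move=> y [y0 Ay]; have [k _ ck] := cov _ Ay; exists k => //.
 by rewrite -(rcons0_eta y); apply/box_rcons0; rewrite !rcons0_head !rtail_cons.
- under eq_eseriesr do rewrite vol_cons EFinM.
 rewrite nneseriesZl //; last by move=> k _; rewrite lee_fin vol_ge0.
 apply: le_trans (lee_wpmul2l _ sumv) _; first by rewrite lee_fin ltW.
 rewrite -[X in (_ * (X + _))%E](fineK (_ : lebesgue_outer A \is a fin_num)%E); last first.
  by rewrite ge0_fin_numE //; exact: outer_measure_ge0.
 rewrite -EFinD -!EFinM -EFinD lee_fin mulrDr lerD2l mulrCA divff ?mulr1 // gt_eqF //.
Qed.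

(** The base is enclosed in a box, over which the slab is again a box of known volume; the upper
    bound [slab_le] for the complement in that box then gives the lower bound for [A]. Measurability
    of [A] is what makes the base volumes add up. *)
Lemma slab_ge (a b r : R) (A : set F) : a < b -> measurable (A : set (caratheodory_type (@lebesgue_outer R d.+1))) ->
 (forall x, A x -> enorm x <= r) ->
 ((b - a)%:E * lebesgue_outer A <= lebesgue_outer (slab a b A))%E.
move=> ab mA Ar; have ba : 0 < b - a by rewrite subr_gt0.
pose q := `|r| + 1; have q0 : 0 < q by rewrite ltr_wpDl.
pose B := box (const_mx (- q)) (const_mx q) : set F.
have AB : A `<=` B.
 move=> x Ax i; rewrite !mxE; have := le_trans (coord_le_enorm x i) (le_trans (Ar x Ax) (ler_norm r)).
 rewrite ler_norml => /andP[h1 h2]; rewrite /q; apply/andP; split; lra.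
have qq i : (const_mx (- q) : F) ord0 i <= (const_mx q : F) ord0 i by rewrite !mxE; lra.
have LB : lebesgue_outer B = (vol (const_mx (- q) : F) (const_mx q))%:E by exact: leb_box.
have Bfin : (lebesgue_outer B < +oo)%E by rewrite LB ltry.
have Afin : (lebesgue_outer A < +oo)%E.
 exact: le_lt_trans (le_outer_measure (@lebesgue_outer R d.+1) _ _ AB) Bfin.
have BAfin : (lebesgue_outer (B `\` A) < +oo)%E.
 exact: le_lt_trans (le_outer_measure (@lebesgue_outer R d.+1) _ _ (@subDsetl _ B A)) Bfin.
have spl : (lebesgue_outer B = lebesgue_outer A + lebesgue_outer (B `\` A))%E.
 by have := mA B; rewrite (setIidr AB) setDE.
have sB : slab a b B = box (rcons0 a (const_mx (- q))) (rcons0 b (const_mx q)).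
 apply/seteqP; split=> y; rewrite -{1}(rcons0_eta y).
  by move=> [h1 h2]; rewrite -(rcons0_eta y); apply/box_rcons0; rewrite !rcons0_head !rtail_cons; rewrite rcons0_head rtail_cons in h1 h2.
 by move/box_rcons0; rewrite !rcons0_head !rtail_cons => -[h1 h2]; split.
have LsB : lebesgue_outer (slab a b B) = ((b - a)%:E * lebesgue_outer B)%E.
 rewrite sB leb_box ?vol_cons ?LB -?EFinM // => i.
 by case: (unliftP ord0 i) => [j ->|->]; rewrite ?rcons0_lift ?rcons0_head //; exact: ltW.
have sub : (lebesgue_outer (slab a b B) <= lebesgue_outer (slab a b A) + lebesgue_outer (slab a b (B `\` A)))%E.
 apply: le_trans (le_outer_measure (@lebesgue_outer R d.+2) _ (slab a b A `|` slab a b (B `\` A)) _) _.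
  by move=> y [h1 h2]; have [h|h] := pselect (A (rtail y)); [left|right].
 exact: outer_measureU2.
have := le_trans sub (leeD (lexx _) (slab_le ab BAfin)).
have Af : lebesgue_outer A \is a fin_num by rewrite ge0_fin_numE //; exact: outer_measure_ge0.
have Bf : lebesgue_outer (B `\` A) \is a fin_num by rewrite ge0_fin_numE //; exact: outer_measure_ge0.
by rewrite LsB spl -(fineK Af) -(fineK Bf) -EFinD -!EFinM mulrDr EFinD leeD2rE.
Qed.

End slab.

Section reflection.
Implicit Types (x y v : E).

(** Householder reflection, which is the identity when [v = 0]. With [v = nu - e0] it is an isometry
    taking the unit vector [nu] to the first basis vector, so no tangent basis has to be
    constructed. *)
Definition refl v x : E := x - (2 * dot x v / dot v v) *: v.

Lemma reflD v x y : refl v (x + y) = refl v x + refl v y.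
by rewrite /refl dotDl mulrDr mulrDl scalerDl opprD addrACA. Qed.

Lemma reflZ v c x : refl v (c *: x) = c *: refl v x.
by rewrite /refl dotZl scalerBr scalerA; congr (_ - _ *: _); rewrite !mulrA [2 * c]mulrC. Qed.

Lemma reflB v x y : refl v (x - y) = refl v x - refl v y.
by rewrite -scaleN1r reflD reflZ scaleN1r. Qed.

Lemma dot_refl v x y : dot (refl v x) (refl v y) = dot x y.
have [->|v0] := eqVneq v 0; first by rewrite /refl !scaler0 !subr0.
have vv : dot v v != 0 by rewrite -enorm_sqr expf_neq0 // enorm_eq0.
rewrite /refl !dotDl !dotDr !dotNl !dotNr !dotZl !dotZr (dotC v y).
by field.
Qed.

Lemma enorm_refl v x : enorm (refl v x) = enorm x.
by rewrite /enorm dot_refl. Qed.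

Definition e0 : E := delta_mx ord0 ord0.

Lemma dot_e0 x : dot x e0 = x ord0 ord0.
rewrite /dot (bigD1 ord0) //= big1 => [|j /negbTE ji]; last by rewrite !mxE ji andbF mulr0.
by rewrite !mxE !eqxx mulr1 addr0.
Qed.

Lemma refl_e0 nu : enorm nu = 1 -> refl (nu - e0) nu = e0.
move=> n1; have [v0|v0] := eqVneq (nu - e0) 0.
 by rewrite v0 /refl scaler0 subr0; apply/eqP; rewrite -subr_eq0 v0.
have vv : dot (nu - e0) (nu - e0) != 0 by rewrite -enorm_sqr expf_neq0 // enorm_eq0.
have nn : dot nu nu = 1 by rewrite -enorm_sqr n1 expr1n.
have ee : dot e0 e0 = 1 by rewrite dot_e0 !mxE !eqxx.
have h : 2 * dot nu (nu - e0) = dot (nu - e0) (nu - e0).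
 by rewrite dotDl !dotDr !dotNl !dotNr nn ee (dotC e0 nu); ring.
by rewrite /refl h divff // scale1r opprB addrC subrK.
Qed.

Lemma rtailB x y : rtail (x - y) = rtail x - rtail y.
by apply/rowP => i; rewrite !mxE. Qed.

Lemma dot_rtail x y : dot x y = x ord0 ord0 * y ord0 ord0 + dot (rtail x) (rtail y).
by rewrite /dot big_ord_recl; congr (_ + _); apply: eq_bigr => i _; rewrite !mxE.
Qed.

Lemma enorm_rtail_le x : enorm (rtail x) <= enorm x.
by rewrite /enorm ler_wsqrtr // dot_rtail lerDr -expr2 sqr_ge0.
Qed.

End reflection.

Section chart.
Local Notation F := 'rV[R]_d.+1.
Variables (Om : set E) (oO : open Om) (bO : bounded_set Om).
Variables (x0 : E) (U : set E) (phi : E -> R).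
Hypotheses (bx0 : boundary Om x0) (ldf : local_defining_function Om x0 U phi).
Implicit Types (x y z : E).

Let oU : open U. Proof. by case: ldf => [[]]. Qed.
Let Ux0 : U x0. Proof. by case: ldf => [[]]. Qed.
Let sphi : smooth U phi. Proof. by case: ldf. Qed.
Let inO x : U x -> (Om x <-> phi x < 0).
case: ldf => _ _ _ h; split=> h2.
 by have : (Om `&` U) x by []; rewrite h => -[].
by have : ([set y | phi y < 0] `&` U) x by []; rewrite -h => -[].
Qed.
Let onB x : U x -> (boundary Om x <-> phi x = 0).
case: ldf => _ _ _ _ h; split=> h2.
 by have : (boundary Om `&` U) x by []; rewrite h => -[].
by have : ([set y | phi y = 0] `&` U) x by []; rewrite -h => -[].
Qed.

Definition gnorm := enorm (grad phi x0).
Local Notation c := gnorm.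

Lemma gnorm_gt0 : 0 < c. Proof. by rewrite enorm_gt0; case: ldf => _ _ h _ _; exact: h. Qed.
Let c0 := gnorm_gt0.

Definition nu0 : E := c^-1 *: grad phi x0.

Lemma enorm_nu0 : enorm nu0 = 1.
by rewrite enormZ ger0_norm ?invr_ge0 ?enorm_ge0 // mulVf // gt_eqF. Qed.

Definition chart_ball (e r : R) := (forall y, enorm (y - x0) < r -> U y) /\
 forall x y, enorm (x - x0) < r -> enorm (y - x0) < r ->
  `|phi y - phi x - c * dot nu0 (y - x)| <= e * c * enorm (y - x).

Lemma chart_exists e : 0 < e -> exists2 r, 0 < r & chart_ball e r.
move=> e0; have ec0 : 0 < e * c by rewrite mulr_gt0.
have [r r0 hr] := strict_diff oU (sphi 1%N) Ux0 ec0.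
have [s s0 hs] := open_enorm oU Ux0.
exists (Num.min r s); first by rewrite lt_min r0.
split=> [y|x y]; rewrite !lt_min; first by move=> /andP[_]; exact: hs.
move=> /andP[xr _] /andP[yr _]; have := hr x y xr yr.
by rewrite dotZl mulrA divff ?mul1r // gt_eqF.
Qed.

Let v := nu0 - e0.
Definition bproj x : F := rtail (refl v (x - x0)).
(** The reflected coordinates, except that the normal one is replaced by [phi / c]. The boundary
    becomes flat, and normal lines keep their projection [bproj]. *)
Definition straighten x : E := rcons0 (phi x / c) (bproj x).

Lemma bproj_lip x y : enorm (bproj x - bproj y) <= enorm (x - y).
rewrite -rtailB (le_trans (enorm_rtail_le _)) // -reflB enorm_refl.
by rewrite opprB addrA subrK.
Qed.

Lemma bproj_line x t : bproj (x + t *: nu0) = bproj x.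
have -> : bproj (x + t *: nu0) = rtail (refl v (x - x0) + t *: e0).
 have e3 : x + t *: nu0 - x0 = (x - x0) + t *: nu0 by rewrite addrAC.
 by rewrite /bproj e3 reflD reflZ (refl_e0 enorm_nu0).
by apply/rowP => i; rewrite !mxE mulr0 addr0.
Qed.

Lemma bproj_bound x : enorm (bproj x) <= enorm (x - x0).
by rewrite (le_trans (enorm_rtail_le _)) // enorm_refl. Qed.

Variables (e r : R) (e_gt0 : 0 < e) (e_le : e <= 2^-1) (r_gt0 : 0 < r) (cb : chart_ball e r).

(** The increment of the chart differs from that of an isometry only by [t *: e0], where [t] is the
    first-order remainder of [phi / c], at most [e] times the distance. *)
Lemma straighten_bilip x y : enorm (x - x0) < r -> enorm (y - x0) < r ->
 (1 - e) * enorm (x - y) <= enorm (straighten x - straighten y) <= (1 + e) * enorm (x - y).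
move=> xr yr; pose t := (phi x - phi y) / c - dot nu0 (x - y).
have te : `|t| <= e * enorm (x - y).
 have := cb.2 _ _ yr xr; have -> : phi x - phi y - c * dot nu0 (x - y) = c * t.
  by rewrite /t mulrBr mulrCA divff ?mulr1 // gt_eqF.
 by rewrite normrM gtr0_norm // [e * c]mulrC -mulrA ler_pM2l.
have eq1 : straighten x - straighten y = refl v (x - y) + t *: e0.
 apply: row_ext => i; rewrite rowB rowD rowZ [e0 _ _]mxE /straighten.
 case: (unliftP ord0 i) => [j ->|->]; rewrite ?rcons0_lift ?rcons0_head.
  rewrite /= mulr0 addr0 /bproj; have -> : x - y = (x - x0) - (y - x0) by rewrite opprB addrA subrK.
  by rewrite (reflB v (x - x0) (y - x0)) rowB ![rtail _ _ _]mxE.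
 rewrite eqxx mulr1 -(dot_e0 (refl v _)) -(refl_e0 enorm_nu0) dot_refl (dotC (x - y)) /t.
 by rewrite mulrBl [RHS]addrC subrK.
have et : enorm (t *: (e0 : E)) = `|t|.
 rewrite enormZ -[RHS]mulr1; congr (_ * _); rewrite -(refl_e0 enorm_nu0) enorm_refl.
 exact: enorm_nu0.
rewrite eq1; apply/andP; split.
 have := ler_enormD (refl v (x - y) + t *: e0) (- (t *: e0)).
 by rewrite addrK enorm_refl enormN et; lra.
by apply: le_trans (ler_enormD _ _) _; rewrite enorm_refl et; lra.
Qed.

Lemma bproj_expand x y : enorm (x - x0) < r -> enorm (y - x0) < r -> phi x = phi y ->
 (1 - e) * enorm (x - y) <= enorm (bproj x - bproj y).
move=> xr yr xy; have /andP[h _] := straighten_bilip xr yr; apply: le_trans h _.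
have hd : (straighten x - straighten y) ord0 ord0 = 0.
 by rewrite rowB !rcons0_head xy subrr.
have tl : rtail (straighten x - straighten y) = bproj x - bproj y by rewrite rtailB !rtail_cons.
by rewrite /enorm dot_rtail hd tl mul0r add0r.
Qed.

(** Since [e <= 1/2], moving along the normal changes [phi / c] by at least half the distance
    travelled; an interval of length [2 * |s|] on each side therefore suffices for the intermediate
    value theorem. *)
Lemma shift_normal x s : enorm (x - x0) + 2 * `|s| < r ->
 exists2 t, `|t| <= 2 * `|s| & phi (x + t *: nu0) / c = phi x / c + s.
move=> xs; pose g (t : R) := phi (x + t *: nu0).
have inb t : `|t| <= 2 * `|s| -> enorm (x + t *: nu0 - x0) < r.
 move=> ts; rewrite addrAC (le_lt_trans (ler_enormD _ _)) // enormZ enorm_nu0 mulr1.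
 by rewrite (le_lt_trans _ xs) // lerD2l.
have xr : enorm (x - x0) < r by rewrite (le_lt_trans _ xs) // lerDl mulr_ge0.
have gt t : `|t| <= 2 * `|s| -> `|g t - phi x - c * t| <= e * c * `|t|.
 move=> ts; have := cb.2 _ _ xr (inb t ts).
 have -> : x + t *: nu0 - x = t *: nu0 by rewrite addrAC subrr add0r.
 rewrite dotZr.
 have -> : dot nu0 nu0 = 1 by rewrite -enorm_sqr enorm_nu0 expr1n.
 by rewrite mulr1 enormZ enorm_nu0 mulr1.
have s0 : 0 <= 2 * `|s| by rewrite mulr_ge0.
have cg : {within `[- (2 * `|s|), 2 * `|s|], continuous g}.
 apply: continuous_in_subspaceT => t; rewrite inE /= in_itv /= => /andP[t1 t2].
 have ts : `|t| <= 2 * `|s| by rewrite ler_norml t1.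
 have dt : differentiable phi (x + t *: nu0).
  by apply: (smooth_diff sphi); apply: cb.1; exact: inb.
 by exact: is_derive_continuous (is_derive_line dt).
have ns : `|- (2 * `|s|)| = 2 * `|s| by rewrite normrN ger0_norm.
have ps : `|2 * `|s| | = 2 * `|s| by rewrite ger0_norm.
have lo := gt (- (2 * `|s|)); rewrite ns lexx in lo; have {}lo := lo isT.
have hi := gt (2 * `|s|); rewrite ps lexx in hi; have {}hi := hi isT.
have cs : 0 <= c * `|s| by rewrite mulr_ge0 // ltW.
have ec : e * c * (2 * `|s|) <= c * `|s|.
 rewrite (_ : e * c * (2 * `|s|) = (2 * e) * (c * `|s|)); last by ring.
 rewrite ler_piMl; have := e_le; lra.
have s1 : c * s <= c * `|s| by rewrite ler_pM2l // ler_norm.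
have s2 : - (c * `|s|) <= c * s by rewrite -mulrN ler_pM2l // lerNl -normrN ler_norm.
rewrite ler_norml in lo; rewrite ler_norml in hi.
have mm : Num.min (g (- (2 * `|s|))) (g (2 * `|s|)) <= phi x + c * s <= Num.max (g (- (2 * `|s|))) (g (2 * `|s|)).
 apply/andP; split; first by rewrite ge_min; lra.
 by rewrite le_max; lra.
have [t] := @IVT R g (- (2 * `|s|)) (2 * `|s|) (phi x + c * s) (ge0_cp s0).2 cg mm.
rewrite in_itv /= => /andP[t1 t2] gts; exists t; first by rewrite ler_norml t1.
by rewrite -/(g t) gts mulrDl mulrAC divff ?mul1r // gt_eqF.
Qed.

Local Notation rho := (r / 8).
Let rho0 : 0 < rho. Proof. by rewrite divr_gt0. Qed.

Definition collar (p a b : R) : set E :=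
 [set x : 'rV[R]_d.+2 | [/\ Om x, enorm (x - x0) <= p & a < - phi x <= b]].
Definition fball (p : R) : set F := [set y : 'rV[R]_d.+1 | enorm y <= p].

Lemma fball_fin p : (lebesgue_outer (fball p) < +oo)%E.
exact: (@bounded_leb _ _ _ p). Qed.

Definition patchb (p : R) : set E := [set x : 'rV[R]_d.+2 | boundary Om x /\ enorm (x - x0) <= p].

Lemma contin_phi (p : R) : p < r -> contin_on (eball x0 p) phi.
move=> pr x xp s s0; have Ux : U x by apply: cb.1; exact: le_lt_trans pr.
have [q q0 hq] := (cont_enormP phi x).1 (smooth_for sphi Ux) s s0.
by exists q => // y _ /hq; rewrite distrC.
Qed.

Lemma collar_measurable p a b : p < r -> measurable (collar p a b : set LT).
move=> pr; have mB := eball_measurable.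
have mphi := cont_meas (contin_phi pr).
have -> : collar p a b = Om `&` (eball x0 p `&` phi @^-1` `[- b, - a[).
 apply/seteqP; split=> x; rewrite /= in_itv /=.
  by move=> [h1 h2 /andP[h3 h4]]; split=> //; apply/andP; lra.
 by move=> [h1 [h2 /andP[h3 h4]]]; split=> //; lra.
apply: measurableI; first exact: open_leb.
by apply: mphi => //.
Qed.

Lemma boundary_closed : closed (boundary Om).
by apply: closedI; [exact: closed_closure|apply: open_closedC; exact: open_interior]. Qed.

Lemma closed_haus_meas (K : set E) : closed K -> measurable (K : set HT).
move=> cK; rewrite -[K]setCK; apply: measurableC.
by apply: (@open_caratheodory R d.+1 Ho (@hausdorff_halfspace R d.+1 d.+1)); exact: closed_openC.
Qed.

Lemma patchb_closed p : closed (patchb p).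
by apply: closedI; [exact: boundary_closed|exact: eball_closed]. Qed.

Lemma patchb_measurable p : measurable (patchb p : set HT).
by apply: closed_haus_meas; exact: patchb_closed. Qed.

Let e1 : 0 < 1 - e. Proof. by have := e_le; lra. Qed.

Lemma straight_collar p a b : 2 * p < r -> 0 < p -> 0 <= a ->
 straighten @` collar p a b `<=` slab (- b / c) (- a / c) (fball p).
move=> pr p0 a0 _ [x [Ox xp /andP[h1 h2]] <-]; split.
 rewrite rcons0_head; rewrite ler_pM2r ?invr_gt0 // ltr_pM2r ?invr_gt0 //.
 lra.
by rewrite rtail_cons; exact: le_trans (bproj_bound x) xp.
Qed.

Let c00 : 0 <= c := ltW c0.
Let ei n : 0 <= (1 - e)^-1 ^+ n. Proof. by rewrite exprn_ge0 // invr_ge0 ltW. Qed.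
Let gap_ge0 a b : a < b -> 0 <= (b - a) / c. Proof. by move=> ab; rewrite divr_ge0 // subr_ge0 ltW. Qed.
Let gapE a b : (b - a) / c = - a / c - - b / c. Proof. by rewrite !mulNr opprK mulrBl addrC. Qed.
Let rr : rho < r. Proof. by rewrite half_lt. Qed.
Let r2 : 2 * rho < r. Proof. by rewrite frac_lt. Qed.

Lemma straight_expand (S : set E) : (forall x, S x -> enorm (x - x0) < r) ->
 (L S <= ((1 - e)^-1 ^+ d.+2)%:E * L (straighten @` S))%E.
move=> Sr; rewrite -!hausdorff_leb; apply: hausdorff_expand => // x y /Sr xr /Sr yr.
by case/andP: (straighten_bilip xr yr).
Qed.

Lemma collar_small p a b : 2 * p < r -> 0 < p -> 0 <= a -> a < b ->
 (L (collar p a b) <= (((1 - e)^-1 ^+ d.+2 * ((b - a) / c)))%:E * lebesgue_outer (fball p))%E.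
move=> pr p0 a0 ab; apply: le_trans (straight_expand _) _; first by move=> x [_ xp _]; lra.
rewrite (EFinM ((1 - e)^-1 ^+ d.+2)) -muleA lee_wpmul2l ?lee_fin //.
apply: le_trans (le_outer_measure L _ _ (straight_collar pr p0 a0)) _; rewrite gapE.
apply: slab_le; first by rewrite ltr_pM2r ?invr_gt0 // ltrN2.
exact: fball_fin.
Qed.

Lemma collar_fin p a b : 2 * p < r -> 0 < p -> 0 <= a -> a < b -> (L (collar p a b) < +oo)%E.
move=> pr p0 a0 ab; apply: le_lt_trans (collar_small pr p0 a0 ab) _.
by rewrite lte_mul_pinfty ?fball_fin // lee_fin mulr_ge0 // gap_ge0.
Qed.

Lemma restrict_leb_meas p a b (f : E -> R) : p < r -> contin_on (closure Om) f ->
 measurable_fun [set: LT] (f \_ (collar p a b)).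
move=> pr cf; apply: patch_measurable; first exact: collar_measurable.
by apply: cont_meas; apply: contin_on_sub cf => x [Ox _ _]; exact: subset_closure.
Qed.

Lemma restrict_haus_meas p (f : E -> R) : contin_on (closure Om) f ->
 measurable_fun [set: HT] (f \_ (patchb p)).
move=> cf; apply: patch_measurable; first exact: patchb_measurable.
apply: (@contin_on_measurable R d.+1 Ho _ _ (@hausdorff_halfspace R d.+1 d.+1)).
by apply: contin_on_sub cf => x [[]].
Qed.

Lemma patchb_fin p : p < r -> (Ho (patchb p) < +oo)%E.
move=> pr; apply: le_lt_trans (@hausdorff_expand R d.+1 d.+1 d.+1 bproj (patchb p) (1 - e) e1 _) _.
 move=> x y [bx xp] [b_y yp]; have xr : enorm (x - x0) < r by lra.
 have yr : enorm (y - x0) < r by lra.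
 by apply: bproj_expand => //; rewrite ((onB (cb.1 _ xr)).1 bx) ((onB (cb.1 _ yr)).1 b_y).
rewrite hausdorff_leb.
have : (lebesgue_outer (bproj @` patchb p) < +oo)%E.
 by apply: (@bounded_leb _ _ _ p) => _ [x [_ xp] <-]; exact: le_trans (bproj_bound x) xp.
by move=> h; rewrite lte_mul_pinfty // lee_fin exprn_ge0 // invr_ge0 ltW.
Qed.

Variables (H : E -> R) (C : R).
Hypotheses (cH : contin_on (closure Om) H) (H0 : forall x, 0 <= H x) (HC : forall x, H x <= C).
Hypothesis (Hsupp : forall x, rho < enorm (x - x0) -> H x = 0).

(** Continuity along normal lines in the one-sided form that sends a superlevel set of [H] into a
    superlevel set of [H + w]. *)
Definition nu_uniform w q := forall x t, `|t| <= q -> closure Om x -> closure Om (x + t *: nu0) ->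
 H x <= H (x + t *: nu0) + w.

Lemma collar_uniform w : 0 < w -> exists2 q, 0 < q & nu_uniform w q.
move=> w0; have [q q0 hq] := contin_on_uniform (closure_compact bO) cH w0.
exists (q / 2) => [|x t tq cx ct]; first by rewrite divr_gt0.
have := hq _ _ cx ct; rewrite addrAC subrr add0r enormZ enorm_nu0 mulr1.
have tq2 : `|t| < q by rewrite (le_lt_trans tq) // half_lt.
by move=> /(_ tq2); rewrite ltr_norml; lra.
Qed.

Lemma small_scale q b : 0 < q -> 0 < b ->
 exists2 q', 0 < q' & forall s, 0 < s -> s < q' -> 2 * (b * s) <= Num.min q rho * c.
move=> q0 b0; exists (Num.min q rho * c / (2 * b)) => [|s s0].
 by rewrite divr_gt0 ?mulr_gt0 // lt_min q0.
by rewrite ltr_pdivlMr ?mulr_gt0 // mulrC -mulrA => /ltW.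
Qed.

Lemma patch_level (A : set E) (f : E -> R) t : 0 < t -> [set x | t <= (f \_ A) x] = [set x | A x /\ t <= f x].
move=> t0; apply/seteqP; split=> x /=; rewrite /patch.
 by case: ifPn => [/set_mem Ax h|_]; [split|rewrite leNgt t0].
by move=> [Ax h]; rewrite mem_set.
Qed.

Let patch_bound A x : 0 <= (H \_ A) x <= C.
by rewrite /patch; case: ifP => _; rewrite ?H0 ?HC //= lexx (le_trans (H0 x) (HC x)). Qed.
Let patch_out A x : ~ A x -> (H \_ A) x = 0. Proof. by move=> nx; rewrite /patch memNset. Qed.
Let patch_ge0 w A x : 0 < w -> 0 <= ((fun x => H x + w) \_ A) x.
by move=> w0; rewrite /patch; case: ifP => // _; rewrite addr_ge0 // ltW. Qed.
Let cHw w : contin_on (closure Om) (fun x => H x + w).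
by apply: contin_onD => //; exact: contin_on_cst. Qed.

Lemma shift_near x s : enorm (x - x0) <= rho -> 2 * `|s| <= rho -> exists2 u, `|u| <= 2 * `|s| &
 phi (x + u *: nu0) / c = phi x / c + s /\ enorm (x + u *: nu0 - x0) <= 2 * rho.
move=> xp sr; have xr : enorm (x - x0) + 2 * `|s| < r by have := r_gt0; lra.
have [u ut up] := shift_normal xr; exists u => //; split=> //.
rewrite addrAC (le_trans (ler_enormD _ _)) // enormZ enorm_nu0; lra.
Qed.

(* The point of the boundary below [x] is reached along [nu0], where [H] varies by at most [w]. *)
Lemma collar_upper_step w q a b : 0 < w -> nu_uniform w q -> 0 <= a -> a < b ->
 2 * b <= Num.min q rho * c ->
 (\int[mu]_x ((H \_ (collar rho a b)) x)%:E <= ((1 - e)^-1 ^+ d.+2 * ((b - a) / c))%:E *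
   \int[sigma]_x (((fun x => H x + w) \_ (patchb (2 * rho))) x)%:E)%E.
move=> w0 hq a0 ab bm; apply: (@layer_le R _ LT _ HT mu sigma _ _ _ _ C
 (restrict_leb_meas a b rr cH) (restrict_haus_meas (2 * rho) (cHw w))
 (collar_measurable a b rr) (collar_fin r2 rho0 a0 ab) (patch_bound _) (@patch_out _)
 (fun x => patch_ge0 _ x w0) (mulr_ge0 (ei _) (gap_ge0 ab))) => t t0.
rewrite !patch_level //; set S := [set x | _]; set T := [set x | _].
have TT : (lebesgue_outer (bproj @` T) <= Ho T)%E.
 rewrite -hausdorff_leb; apply: le_trans (@hausdorff_lipschitz R d.+2 d.+1 d.+1 bproj T 1 ltr01 _) _.
  by move=> x y _ _; rewrite mul1r; exact: bproj_lip.
 by rewrite expr1n mul1e.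
have ST : straighten @` S `<=` slab (- b / c) (- a / c) (bproj @` T).
 move=> _ [x [[Ox xp /andP[h1 h2]] tx] <-]; split.
  rewrite rcons0_head ler_pM2r ?invr_gt0 // ltr_pM2r ?invr_gt0 //.
  by apply/andP; split; lra.
 have ph : `|- phi x / c| = - phi x / c.
  by rewrite ger0_norm // divr_ge0 // (le_trans a0 (ltW h1)).
 have : 2 * (- phi x / c) <= Num.min q rho by rewrite mulrA ler_pdivrMr //; lra.
 rewrite le_min => /andP[pq prr].
 have := @shift_near x (- phi x / c) xp; rewrite ph => /(_ prr)[u ut [up d2]].
 have /eqP : phi (x + u *: nu0) / c = 0 by rewrite up mulNr addrN.
 rewrite mulf_eq0 invr_eq0 (gt_eqF c0) orbF => /eqP phi0.
 have bu : boundary Om (x + u *: nu0).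
  by apply/onB => //; apply: cb.1; exact: le_lt_trans r2.
 exists (x + u *: nu0); last by rewrite bproj_line rtail_cons.
 split; first by split.
 apply: (le_trans tx); apply: hq; [exact: le_trans pq|exact: subset_closure|by case: bu].
rewrite -[X in (X <= _)%E]/(L S); apply: le_trans (straight_expand _) _.
 by move=> x [[_ xp _] _]; exact: le_lt_trans rr.
rewrite (EFinM ((1 - e)^-1 ^+ d.+2)) -muleA lee_wpmul2l ?lee_fin // gapE.
apply: le_trans (le_outer_measure L _ _ ST) (le_trans (slab_le _ _) _).
- by rewrite ltr_pM2r ?invr_gt0 // ltrN2.
- apply: (@bounded_leb _ _ _ (2 * rho)) => _ [x [[_ xp] _] <-]; exact: le_trans (bproj_bound x) xp.
- by rewrite lee_wpmul2l // lee_fin -gapE gap_ge0.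
Qed.

Lemma collar_upper w a b : 0 < w -> 0 <= a -> a < b -> exists2 q, 0 < q & forall s, 0 < s -> s < q ->
 (\int[mu]_x ((H \_ (collar rho (a * s) (b * s))) x)%:E <=
  ((1 - e)^-1 ^+ d.+2 * ((b - a) * s / c))%:E *
   \int[sigma]_x (((fun x => H x + w) \_ (patchb (2 * rho))) x)%:E)%E.
move=> w0 a0 ab; have [q q0 hq] := collar_uniform w0.
have [q' q'0 h] := small_scale q0 (le_lt_trans a0 ab); exists q' => // s s0 sq; rewrite mulrBl.
by apply: (collar_upper_step w0 hq _ _ (h s s0 sq)); rewrite ?ltr_pM2r // mulr_ge0 // ltW.
Qed.

(** Every point of the slab over the projected boundary level set is the image of a collar point,
    found by moving along the normal from the boundary. The base is the continuous image of a
    compact set, hence measurable, and [slab_ge] applies. *)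
Lemma collar_lower_step w q a b : 0 < w -> nu_uniform w q -> 0 <= a -> a < b ->
 2 * b <= Num.min q rho * c ->
 (\int[sigma]_x ((H \_ (patchb rho)) x)%:E <=
  ((1 - e)^-1 ^+ d.+1 * (1 + e) ^+ d.+2 * ((b - a) / c)^-1)%:E *
  \int[mu]_x (((fun x => H x + w) \_ (collar (2 * rho) a b)) x)%:E)%E.
move=> w0 hq a0 ab bm; have k0 : 0 < (b - a) / c by rewrite divr_gt0 // subr_gt0.
have kk : 0 <= (1 - e)^-1 ^+ d.+1 * (1 + e) ^+ d.+2 * ((b - a) / c)^-1.
 by rewrite mulr_ge0 ?invr_ge0 ?(ltW k0) // mulr_ge0 // exprn_ge0 // addr_ge0 // ltW.
apply: (@layer_le R _ HT _ LT sigma mu _ _ _ _ C (restrict_haus_meas rho cH)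
 (restrict_leb_meas a b r2 (cHw w)) (patchb_measurable rho) (patchb_fin rr) (patch_bound _)
 (@patch_out _) (fun x => patch_ge0 _ x w0) kk) => t t0.
rewrite !patch_level //; set S := [set x | _]; set T := [set x | _].
have Sr x : S x -> enorm (x - x0) < r by move=> [[_ xp] _]; exact: le_lt_trans rr.
have Tr x : T x -> enorm (x - x0) < r by move=> [[_ xp _] _]; exact: le_lt_trans r2.
have Sz x : S x -> phi x = 0 by move=> Sx; apply/onB; [exact: cb.1 (Sr x Sx)|case: Sx => -[]].
have ST : slab (- b / c) (- a / c) (bproj @` S) `<=` straighten @` T.
 move=> y [/andP[y1 y2] [x Sx py]]; have [[bx xp] tx] := Sx.
 set z := y ord0 ord0 in y1 y2.
 have z0 : z < 0 by rewrite (lt_le_trans y2) // mulNr oppr_le0 divr_ge0.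
 have : 2 * `|z| <= Num.min q rho.
  have : 2 * (b / c) <= Num.min q rho by rewrite mulrA ler_pdivrMr.
  by rewrite ltr0_norm //; rewrite mulNr in y1; lra.
 rewrite le_min => /andP[zq zr].
 have [u ut [up d2]] := shift_near xp zr; rewrite (Sz x Sx) mul0r add0r in up.
 have pu : phi (x + u *: nu0) = z * c by rewrite -up divfK // gt_eqF.
 have Ou : Om (x + u *: nu0).
  apply/inO; first by apply: cb.1; exact: le_lt_trans r2.
  by rewrite pu nmulr_rlt0.
 exists (x + u *: nu0).
  split; first split=> //.
   rewrite pu; move: y1 y2; rewrite ler_pdivrMr // ltr_pdivlMr //.
   by move=> h1 h2; apply/andP; split; lra.
  apply: (le_trans tx); apply: hq; [exact: le_trans zq|by case: bx|exact: subset_closure].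
 by rewrite /straighten up bproj_line py rcons0_eta.
have cS : compact S.
 apply: (@subclosed_compact _ _ (eball x0 rho)).
 - by apply: closed_level; [exact: patchb_closed|apply: contin_on_sub cH => x [[]]].
 - exact: eball_compact.
 - by move=> x [[_ xp] _].
have cA : compact (bproj @` S).
 apply: continuous_compact => //; apply: continuous_subspaceT.
 exact: rtail_lip_continuous bproj_lip.
have mA : measurable (bproj @` S : set (caratheodory_type (@lebesgue_outer R d.+1))).
 by exact: compact_leb_measurable.
have Ab (y : F) : (bproj @` S) y -> enorm y <= rho by move=> [x [[_ xp] _] <-]; exact: le_trans (bproj_bound x) xp.
have lo := slab_ge (_ : - b / c < - a / c) mA Ab.
have {}lo := lo ltac:(by rewrite ltr_pM2r ?invr_gt0 // ltrN2); rewrite -gapE in lo.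
have up : (L (straighten @` T) <= ((1 + e) ^+ d.+2)%:E * L T)%E.
 rewrite -!hausdorff_leb; apply: hausdorff_lipschitz; first by rewrite addr_gt0.
 by move=> x y /Tr xr /Tr yr; case/andP: (straighten_bilip xr yr).
rewrite -[X in (X <= _)%E]/(Ho S) -[X in (_ <= _ * X)%E]/(L T).
apply: le_trans (@hausdorff_expand R d.+1 d.+1 d.+1 bproj S (1 - e) e1 _) _.
 by move=> x y Sx Sy; apply: bproj_expand; [exact: Sr|exact: Sr|rewrite !Sz].
rewrite -mulrA EFinM -muleA lee_wpmul2l ?lee_fin //.
rewrite hausdorff_leb mulrC EFinM -muleA lee_pdivlMl //.
exact: le_trans lo (le_trans (le_outer_measure L _ _ ST) up).
Qed.

Lemma collar_lower w a b : 0 < w -> 0 <= a -> a < b -> exists2 q, 0 < q & forall s, 0 < s -> s < q ->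
 (\int[sigma]_x ((H \_ (patchb rho)) x)%:E <=
  ((1 - e)^-1 ^+ d.+1 * (1 + e) ^+ d.+2 * ((b - a) * s / c)^-1)%:E *
  \int[mu]_x (((fun x => H x + w) \_ (collar (2 * rho) (a * s) (b * s))) x)%:E)%E.
move=> w0 a0 ab; have [q q0 hq] := collar_uniform w0.
have [q' q'0 h] := small_scale q0 (le_lt_trans a0 ab); exists q' => // s s0 sq; rewrite mulrBl.
by apply: (collar_lower_step w0 hq _ _ (h s s0 sq)); rewrite ?ltr_pM2r // mulr_ge0 // ltW.
Qed.

Lemma collar_itg p a b (f : E -> R) (B : R) : 2 * p < r -> 0 < p -> 0 <= a -> a < b ->
 measurable_fun [set: LT] (f \_ (collar p a b)) -> (forall x, `|f x| <= B) ->
 Ritg mu setT (f \_ (collar p a b)).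
move=> pr p0 a0 ab; apply: restrict_integrable; first by apply: collar_measurable; lra.
exact: collar_fin.
Qed.

Lemma patchb_integrable p (f : E -> R) (B : R) : p < r ->
 measurable_fun [set: HT] (f \_ (patchb p)) -> (forall x, `|f x| <= B) ->
 Ritg sigma setT (f \_ (patchb p)).
by move=> pr; apply: restrict_integrable; [exact: patchb_measurable|exact: patchb_fin]. Qed.

End chart.

(** * Integrals over thin collars approach surface integrals *)

Section collar_limit.
Local Notation F := 'rV[R]_d.+1.
Variables (Om : set E) (oO : open Om) (bO : bounded_set Om).
Variables (x0 : E) (U : set E) (phi : E -> R).
Hypothesis (ldf : local_defining_function Om x0 U phi).
Variables (e r : R) (e_gt0 : 0 < e) (e_le : e <= 2^-1) (r_gt0 : 0 < r) (cb : chart_ball x0 U phi e r).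
Variables (H : E -> R) (C : R).
Hypotheses (cH : contin_on (closure Om) H) (H0 : forall x, 0 <= H x) (HC : forall x, H x <= C).
Hypothesis (Hsupp : forall x, r / 8 < enorm (x - x0) -> H x = 0).
Local Notation c := (gnorm x0 phi).
Local Notation rho := (r / 8).
Local Notation coll := (collar Om x0 phi).
Local Notation pat := (patchb Om x0).

Let c0 : 0 < c. Proof. exact: gnorm_gt0 ldf. Qed.
Let e1 : 0 < 1 - e. Proof. by have := e_le; lra. Qed.
Let rho0 : 0 < rho. Proof. by rewrite divr_gt0. Qed.
Let rr : rho < r. Proof. by rewrite half_lt. Qed.
Let r2 : 2 * rho < r.
by rewrite frac_lt. Qed.
Let r4 : 2 * (2 * rho) < r.
by rewrite mulrA mulrCA gtr_pMr // ltr_pdivrMr // mul1r -natrM ltr_nat. Qed.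
Let C0 : 0 <= C. Proof. exact: le_trans (HC 0). Qed.

Let HC' x : `|H x| <= C. Proof. by rewrite ger0_norm. Qed.
Let cHw w : contin_on (closure Om) (fun x => H x + w).
by apply: contin_onD => //; exact: contin_on_cst. Qed.
Let mesh_lt M l : (0 < M)%N -> l%:R / M%:R < l.+1%:R / M%:R :> R.
by move=> M0; rewrite ltr_pM2r ?invr_gt0 ?ltr0n // ltr_nat. Qed.
Let mesh_eq M l : l.+1%:R / M%:R - l%:R / M%:R = M%:R^-1 :> R.
by rewrite -mulrBl -natr1 addrAC subrr add0r mul1r. Qed.

(** The density produced by differentiating the cutoff at scale [s]: a mass of order one spread over
    a collar of thickness of order [s]. *)
Definition kint (s : R) (x : E) : R := s^-1 * kstep (- phi x / s) * H x.

Lemma kint_ge0 s x : 0 < s -> 0 <= kint s x.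
move=> s0; apply: mulr_ge0; last exact: H0.
by apply: mulr_ge0; [rewrite invr_ge0 ltW|exact: kstep_ge0].
Qed.

Lemma kint_patch s : 0 < s -> kint s \_ Om = kint s \_ (coll rho 0 s).
move=> s0; apply/funext => x; rewrite /patch.
have [xc|nc] := pselect (coll rho 0 s x); first by have [Ox _ _] := xc; rewrite !mem_set.
rewrite [in RHS](memNset nc); case: ifP => // /set_mem Ox.
have [xr|xr] := ltP rho (enorm (x - x0)); first by rewrite /kint Hsupp // mulr0.
rewrite /kint kstep_out ?mulr0 ?mul0r //.
have [h|h] := leP; [by left|right].
move: h; rewrite pmulr_lgt0 ?invr_gt0 // => h; rewrite ler_pdivlMr // mul1r.
by rewrite leNgt; apply/negP => h2; apply: nc; split=> //; rewrite h ltW.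
Qed.

Lemma kint_integrable s : 0 < s -> Ritg mu setT (kint s \_ Om).
move=> s0; rewrite kint_patch //; have [B B0 hB] := @kstep_bounded R.
apply: (collar_itg oO ldf e_le cb r2 rho0 (lexx 0) s0 _
 (_ : forall x, `|kint s x| <= s^-1 * B * C)).
 apply: patch_measurable; first exact: (collar_measurable oO ldf cb).
 apply: cont_meas; apply: contin_onM; last first.
  by apply: contin_on_sub cH => x [Ox _ _]; exact: subset_closure.
 apply: contin_on_sub (_ : contin_on (eball x0 rho) _); first by move=> x [_ xp _].
 have -> : (fun x => s^-1 * kstep (- phi x / s)) = (fun t => s^-1 * kstep (- t / s)) \o phi by [].
 apply: contin_on_comp1; first exact: (contin_phi ldf cb rr).
 move=> t; apply: cvgMr; apply: (@continuous_comp R R R (fun t : R => - t / s) kstep); last exact: kstep_continuous.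
 by apply: cvgMl; apply: cvgN.
move=> x; rewrite ger0_norm ?kint_ge0 // ler_pM //.
 by rewrite mulr_ge0 ?kstep_ge0 // invr_ge0 ltW.
by rewrite ler_wpM2l // invr_ge0 ltW.
Qed.

Lemma H_patch p : rho <= p -> H \_ (pat p) = H \_ (boundary Om).
move=> rp; apply/funext => x; rewrite /patch.
have [bx|nb] := pselect (boundary Om x); last by rewrite !memNset // => -[].
rewrite [in RHS](mem_set bx); case: ifPn => // /negP xn; rewrite Hsupp //.
by rewrite (le_lt_trans rp) // ltNge; apply/negP => h; apply: xn; rewrite mem_set.
Qed.

Let J0 := \int[sigma]_(x in boundary Om) H x.

Lemma surface_integrable : Ritg sigma setT (H \_ (boundary Om)).
rewrite -(H_patch (lexx rho)).
exact: (patchb_integrable ldf e_le cb rr (restrict_haus_meas x0 rho cH) HC').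
Qed.

Let HwC w x : 0 < w -> `|H x + w| <= C + w.
by move=> w0; rewrite ger0_norm ?lerD2r // addr_ge0 // ltW. Qed.

Lemma upper_real w a b : 0 < w -> 0 <= a -> a < b -> exists2 q, 0 < q & forall s, 0 < s -> s < q ->
 \int[mu]_x (H \_ (coll rho (a * s) (b * s))) x <=
  (1 - e)^-1 ^+ d.+2 * ((b - a) * s / c) * (J0 + w * fine (sigma (pat (2 * rho)))).
move=> w0 a0 ab.
have [q q0 hq] := collar_upper oO bO ldf e_le r_gt0 cb cH H0 HC w0 a0 ab.
exists q => // s s0 sq; have abs : a * s < b * s by rewrite ltr_pM2r.
have mw := restrict_haus_meas x0 (2 * rho) (cHw w).
have iw := patchb_integrable ldf e_le cb r2 mw (fun x => HwC x w0).
have iH := collar_itg oO ldf e_le cb r2 rho0 (mulr_ge0 a0 (ltW s0)) abs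
 (restrict_leb_meas oO ldf cb (a * s) (b * s) rr cH) HC'.
apply: le_trans (Rle_of_ele iH iw (hq s s0 sq)) _.
rewrite le_eqVlt; apply/orP; left; apply/eqP; congr (_ * _).
have mP := patchb_measurable Om x0 (2 * rho).
have fP : (sigma (pat (2 * rho)) < +oo)%E by exact: (patchb_fin ldf e_le cb r2).
have iI := itg_ind mP fP.
have -> : \int[sigma]_x ((fun x => H x + w) \_ (pat (2 * rho))) x =
  \int[sigma]_x ((H \_ (boundary Om)) x + w * \1_(pat (2 * rho)) x).
 apply: eq_Rintegral => x _; rewrite -(H_patch (_ : rho <= 2 * rho)); last by rewrite ler_pMl // ler1n.
 rewrite indicE /patch; case: ifP => _; first by rewrite mulr1.
 by rewrite mulr0 addr0.
rewrite RintegralD //; [|exact: surface_integrable|exact: itgZ].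
rewrite -Rintegral_mkcond RintegralZl //; congr (_ + _ * _).
by rewrite /Rintegral integral_indic // setIT.
Qed.

Lemma lower_real w a b : 0 < w -> 0 <= a -> a < b -> exists2 q, 0 < q & forall s, 0 < s -> s < q ->
 (b - a) * J0 / c <=
  (1 - e)^-1 ^+ d.+1 * (1 + e) ^+ d.+2 * (s^-1 * \int[mu]_x ((fun x => H x + w) \_ (coll (2 * rho) (a * s) (b * s))) x).
move=> w0 a0 ab.
have [q q0 hq] := collar_lower oO bO ldf e_gt0 e_le r_gt0 cb cH H0 HC w0 a0 ab.
exists q => // s s0 sq; have abs : a * s < b * s by rewrite ltr_pM2r.
have ba : 0 < b - a by rewrite subr_gt0.
have mw := restrict_leb_meas oO ldf cb (a * s) (b * s) r2 (cHw w).
have iw := collar_itg oO ldf e_le cb r4 (mulr_gt0 (ltr0Sn R 1) rho0) (mulr_ge0 a0 (ltW s0)) abs mw (fun x => HwC x w0).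
have iH : Ritg sigma setT (H \_ (pat rho)) by rewrite H_patch //; exact: surface_integrable.
have := Rle_of_ele iH iw (hq s s0 sq).
rewrite {1}(H_patch (lexx rho)) -Rintegral_mkcond -/J0 => h.
apply: le_trans (_ : (b - a) / c * J0 <= _); first by rewrite mulrAC.
apply: le_trans (ler_wpM2l _ h) _; first by rewrite divr_ge0 // ltW.
rewrite le_eqVlt; apply/orP; left; apply/eqP.
set I := \int[mu]_x _; set k := _ * (1 + e) ^+ _.
by field; rewrite !gt_eqF.
Qed.

Lemma finite_small (M : nat) (P : nat -> R -> Prop) :
 (forall l, exists2 q, 0 < q & forall s, 0 < s -> s < q -> P l s) ->
 exists2 q, 0 < q & forall s, 0 < s -> s < q -> forall l, (l < M)%N -> P l s.
move=> h; elim: M => [|M [q q0 hq]]; first by exists 1.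
have [q' q'0 hq'] := h M; exists (Num.min q q'); first by rewrite lt_min q0.
move=> s s0; rewrite lt_min => /andP[s1 s2] l; rewrite ltnS leq_eqVlt => /orP[/eqP ->|lM].
 exact: hq'.
exact: hq.
Qed.

Local Notation cell p M s l := (coll p (l%:R / M%:R * s) (l.+1%:R / M%:R * s)).

Lemma mesh_collar (M l : nat) p s x : (0 < M)%N -> 0 < s -> cell p M s l x ->
 l%:R / M%:R < - phi x / s <= l.+1%:R / M%:R.
by move=> M0 s0 [_ _ /andP[h1 h2]]; rewrite ltr_pdivlMr // ler_pdivrMr // h1. Qed.

(** On each cell of the mesh the profile is within [z] of its sample, and [upper_real] bounds the
    integral of [H] over the corresponding thin collar. The samples average to one, so the sum over
    cells has the factor [1 + z]. *)
Lemma collar_limit_upper z : 0 < z -> exists2 q, 0 < q & forall s, 0 < s -> s < q ->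
 \int[mu]_(x in Om) kint s x <= (1 - e)^-1 ^+ d.+2 / c * (J0 + z) * (1 + z).
move=> z0; have [M [xi [M0 sum1 hk]]] := kstep_mesh z0.
have Mr : (0 : R) < M%:R by rewrite ltr0n.
pose S := fine (sigma (pat (2 * rho))); have S0 : 0 <= S by exact: fine_ge0.
pose w := z / (S + 1); have S1 : 0 < S + 1 by rewrite ltr_wpDl.
have w0 : 0 < w by rewrite divr_gt0.
have wS : w * S <= z by rewrite /w mulrAC ler_pdivrMr // ler_wpM2l ?(ltW z0) // lerDl.
have [q q0 hq] := @finite_small M _ (fun l => upper_real w0 (divr_ge0 (ler0n R l) (ltW Mr)) (mesh_lt l M0)).
exists q => // s s0 sq; have {}hq := hq s s0 sq.
have is0 : 0 <= s^-1 by rewrite invr_ge0 ltW.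
have kz l : 0 <= kstep (xi l) + z by rewrite addr_ge0 ?kstep_ge0 // ltW.
have lt1 (l : nat) : l%:R / M%:R * s < l.+1%:R / M%:R * s by rewrite ltr_pM2r // mesh_lt.
have le0 (l : nat) : 0 <= l%:R / M%:R * s by rewrite mulr_ge0 ?divr_ge0 // ltW.
have iHl (l : nat) : Ritg mu setT (H \_ (cell rho M s l)).
 exact: (collar_itg oO ldf e_le cb r2 rho0 (le0 l) (lt1 l) (restrict_leb_meas oO ldf cb _ _ rr cH) HC').
pose T l x := s^-1 * (kstep (xi l) + z) * (H \_ (cell rho M s l)) x.
have iT (l : 'I_M) : Ritg mu setT (T l).
 exact: itgZ.
have [iS eS] := Rintegral_sum measurableT (index_enum 'I_M) iT.
have T0 (l : nat) x : 0 <= T l x.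
 by rewrite mulr_ge0 ?mulr_ge0 // /patch; case: ifP.
rewrite Rintegral_mkcond.
apply: (@le_trans _ _ (\int[mu]_x \sum_(l < M) (T l x))).
 apply: le_Rintegral => //; first exact: kint_integrable.
 move=> x _; rewrite kint_patch // [leLHS]/patch.
 have [xc|nc] := pselect (coll rho 0 s x); last by rewrite (memNset nc); apply: sumr_ge0 => l _; exact: T0.
 rewrite (mem_set xc); have [Ox xp /andP[p1 p2]] := xc.
 have t0 : 0 < - phi x / s by rewrite divr_gt0.
 have t1 : - phi x / s <= 1 by rewrite ler_pdivrMr // mul1r.
 have [l lM /andP[l1 l2]] := mesh_cell M0 t0 t1.
 rewrite (bigD1 (Ordinal lM)) //=; apply: ler_wpDr; first by apply: sumr_ge0 => j _; exact: T0.
 rewrite /T /patch mem_set; last first.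
  by split=> //; rewrite -ltr_pdivlMr // -ler_pdivrMr // l1.
 rewrite /kint ler_wpM2r // ler_wpM2l //.
 by have := hk l _ l1 l2 lM; rewrite ler_norml; lra.
rewrite eS.
apply: (@le_trans _ _ (\sum_(l < M) (s^-1 * (kstep (xi l) + z) * ((1 - e)^-1 ^+ d.+2 * (M%:R^-1 * s / c) * (J0 + z))))).
 apply: ler_sum => l; rewrite RintegralZl // ler_wpM2l ?mulr_ge0 //.
 apply: le_trans (hq l (ltn_ord l)) _.
 rewrite mesh_eq.
 rewrite ler_wpM2l ?lerD2l //.
 by rewrite mulr_ge0 ?exprn_ge0 ?invr_ge0 ?(ltW e1) // divr_ge0 ?(ltW c0) // mulr_ge0 // ltW.
rewrite le_eqVlt; apply/orP; left; apply/eqP.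
rewrite -mulr_suml -mulr_sumr.
have -> : \sum_(l < M) (kstep (xi l) + z) = M%:R * (1 + z).
 rewrite big_split sumr_const card_ord mulrDr mulr1 mulr_natl; congr (_ + _).
 rewrite -[RHS]mulr1 -[X in _ = _ * X]sum1 mulr_sumr; apply: eq_bigr => l.
 by rewrite mulrCA divff ?mulr1 // gt_eqF.
have b1 : M%:R != 0 :> R by rewrite gt_eqF.
have b2 : s != 0 by rewrite gt_eqF.
have b3 : c != 0 by rewrite gt_eqF.
by field; rewrite b3 b1.
Qed.

(** The same slicing in the opposite direction. The right-hand collars have doubled radius and carry
    [H + w], so the error must be bounded by the volume of the whole collar, which is of order
    [s]. *)
Lemma collar_limit_lower z : 0 < z -> exists2 q, 0 < q & forall s, 0 < s -> s < q ->
 J0 / c <= (1 - e)^-1 ^+ d.+1 * (1 + e) ^+ d.+2 * (\int[mu]_(x in Om) kint s x + z).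
move=> z0; have [B B0 hB] := @kstep_bounded R.
pose V := (1 - e)^-1 ^+ d.+2 * c^-1 * fine (lebesgue_outer (@fball (2 * rho))).
have V0 : 0 <= V.
 apply: mulr_ge0; last by apply: fine_ge0; exact: outer_measure_ge0.
 by apply: mulr_ge0; [apply: exprn_ge0|]; rewrite invr_ge0 ltW.
(* Replacing the profile by its samples and [H] by [H + w] changes the integrand by at most
   [w * (C + 1 + B)], on a collar of volume at most [s * V]; the choice of [w] makes this at most
   [z * s]. *)
pose D := (C + 1 + B) * (V + 1).
have D0 : 0 < D by rewrite mulr_gt0 ?ltr_wpDl // addr_ge0.
pose w := Num.min 1 (z / D); have w0 : 0 < w by rewrite lt_min ltr01 divr_gt0.
have wz : w * D <= z by rewrite -ler_pdivlMr // ge_min lexx orbT.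
have w1 : w <= 1 by rewrite ge_min lexx.
have [M [xi [M0 sum1 hk]]] := kstep_mesh w0.
have Mr : (0 : R) < M%:R by rewrite ltr0n.
have [q q0 hq] := @finite_small M _ (fun l => lower_real w0 (divr_ge0 (ler0n R l) (ltW Mr)) (mesh_lt l M0)).
exists q => // s s0 sq; have {}hq := hq s s0 sq.
have is0 : 0 <= s^-1 by rewrite invr_ge0 ltW.
have lt1 (l : nat) : l%:R / M%:R * s < l.+1%:R / M%:R * s by rewrite ltr_pM2r // mesh_lt.
have le0 (l : nat) : 0 <= l%:R / M%:R * s by rewrite mulr_ge0 ?divr_ge0 // ltW.
have rh2 : 0 < 2 * rho by rewrite mulr_gt0.
pose Hw x := H x + w; have Hw0 x : 0 <= Hw x by rewrite addr_ge0 // ltW.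
have iHl (l : nat) : Ritg mu setT (Hw \_ (cell (2 * rho) M s l)).
 exact: (collar_itg oO ldf e_le cb r4 rh2 (le0 l) (lt1 l)
  (restrict_leb_meas oO ldf cb _ _ r2 (cHw w)) (fun x => HwC x w0)).
pose T l x := kstep (xi l) * (Hw \_ (cell (2 * rho) M s l)) x.
have iT (l : 'I_M) : Ritg mu setT (T l).
 exact: itgZ.
have [iS eS] := Rintegral_sum measurableT (index_enum 'I_M) iT.
have mC := collar_measurable oO ldf cb 0 s r2.
have LC := collar_small ldf e_le cb r4 rh2 (lexx 0) s0.
have fC : (mu (coll (2 * rho) 0 s) < +oo)%E by exact: (collar_fin ldf e_le cb r4 rh2 (lexx 0) s0).
have LC2 : fine (mu (coll (2 * rho) 0 s)) <= s * V.
 rewrite -lee_fin fineK ?ge0_fin_numE //; apply: le_trans LC _.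
 rewrite -(fineK (_ : lebesgue_outer (@fball (2 * rho)) \is a fin_num)%E) ?ge0_fin_numE ?fball_fin //; last exact: outer_measure_ge0.
 rewrite -EFinM lee_fin subr0 le_eqVlt; apply/orP; left; apply/eqP; rewrite /V; set k := _ ^+ _; set f := fine _.
 by ring.
have iI := itg_ind mC fC.
have ik := kint_integrable s0.
have key : \int[mu]_x \sum_(l < M) (T l x) <=
  s * \int[mu]_(x in Om) kint s x + w * (C + 1 + B) * (s * V).
 apply: (@le_trans _ _ (\int[mu]_x (s * (kint s \_ Om) x + w * (C + 1 + B) * \1_(coll (2 * rho) 0 s) x))).
  apply: le_Rintegral => //; first by apply: itgD => //; exact: itgZ.
  move=> x _; have kO : 0 <= (kint s \_ Om) x by rewrite /patch; case: ifP => // _; exact: kint_ge0.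
  have [[l lM xl]|nl] := pselect (exists2 l : nat, (l < M)%N & cell (2 * rho) M s l x); last first.
   rewrite big1; last by move=> l _; rewrite /T /patch memNset ?mulr0 // => h; apply: nl; exists (l : nat).
   rewrite addr_ge0 ?mulr_ge0 ?(ltW s0) ?(ltW w0) ?indicE //.
   by rewrite !addr_ge0 // ltW.
  rewrite (bigD1 (Ordinal lM)) //= big1; last first.
   move=> j jl; rewrite /T /patch memNset ?mulr0 // => h.
   have := mesh_cell_uniq M0 (mesh_collar M0 s0 xl) (mesh_collar M0 s0 h).
   by move=> lj; move/eqP: jl; apply; apply: val_inj.
  have [Ox xp px] := xl; have xl2 := mesh_collar M0 s0 xl; have /andP[h1 h2] := xl2.
  have xc : coll (2 * rho) 0 s x.
   split=> //; move: px => /andP[p1 p2]; rewrite (le_lt_trans (le0 l) p1) (le_trans p2) //.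
   by rewrite ler_piMl ?(ltW s0) // ler_pdivrMr // mul1r ler_nat.
  rewrite addr0 indicE (mem_set xc) mulr1 /T [X in _ * X]/patch (mem_set xl) [X in _ <= _ * X + _]/patch (mem_set Ox).
  have -> : s * kint s x = kstep (- phi x / s) * H x.
   by rewrite /kint -mulrA mulVKf // gt_eqF.
  have := hk l _ h1 h2 lM; rewrite ler_norml => /andP[k1 k2].
  have kle : kstep (xi l) <= kstep (- phi x / s) + w by lra.
  apply: le_trans (ler_wpM2r (Hw0 x) kle) _; rewrite /Hw mulrDl !mulrDr.
  have a1 : kstep (- phi x / s) * w <= w * B by rewrite mulrC ler_wpM2l ?hB // ltW.
  have a2 : w * H x <= w * C by rewrite ler_wpM2l ?HC // ltW.
  have a3 : w * w <= w * 1 by rewrite ler_wpM2l // ltW.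
  by rewrite -addrA lerD2l addrC lerD // lerD.
 rewrite RintegralD //; try exact: itgZ.
 rewrite !RintegralZl // -Rintegral_mkcond lerD2l ler_wpM2l //.
  by rewrite mulr_ge0 ?(ltW w0) // !addr_ge0 // ltW.
 by rewrite /Rintegral integral_indic // setIT.
pose I l := \int[mu]_x (Hw \_ (cell (2 * rho) M s l)) x.
set k2 := _ * (1 + e) ^+ _; have k20 : 0 <= k2.
 by apply: mulr_ge0; apply: exprn_ge0; [rewrite invr_ge0 (ltW e1)|rewrite addr_ge0 // (ltW e_gt0)].
apply: (@le_trans _ _ (\sum_(l < M) kstep (xi l) * (k2 * (s^-1 * I l)))).
 have -> : J0 / c = \sum_(l < M) kstep (xi l) / M%:R * (J0 / c) by rewrite -mulr_suml sum1 mul1r.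
 apply: ler_sum => l _.
 have -> : kstep (xi l) / M%:R * (J0 / c) = kstep (xi l) * (M%:R^-1 * J0 / c) by rewrite !mulrA.
 apply: ler_wpM2l; first exact: kstep_ge0.
 apply: le_trans (hq l (ltn_ord l)).
 by rewrite mesh_eq.
have -> : \sum_(l < M) kstep (xi l) * (k2 * (s^-1 * I l)) =
 k2 * (s^-1 * \int[mu]_x \sum_(l < M) (T l x)).
 rewrite eS !mulr_sumr; apply: eq_bigr => l _; rewrite RintegralZl // mulrCA; congr (_ * _); rewrite mulrCA //.
rewrite ler_wpM2l // mulrC ler_pdivrMr // (le_trans key) // mulrDl mulrC lerD2l.
rewrite mulrCA [w * _ * V]mulrAC -mulrA mulrC ler_pM2r //; apply: le_trans wz.
have fin : w * (V * (C + 1 + B)) <= w * D.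
 rewrite /D (mulrC V (C + 1 + B)) (mulrA w (C + 1 + B) V) (mulrA w (C + 1 + B) (V + 1)).
 apply: ler_wpM2l; last by rewrite lerDl.
 by rewrite mulr_ge0 ?(ltW w0) // !addr_ge0 // ltW.
exact: fin.
Qed.

End collar_limit.

(** * The divergence theorem: globalisation *)

Section divergence.
Variables (Om : set E) (oO : open Om) (bO : bounded_set Om) (sm : smooth_boundary Om).
Implicit Types (x y : E).
Let mO := Om_measurable oO.

Lemma boundary_measurable : measurable (boundary Om : set HT).
by apply: closed_haus_meas; exact: boundary_closed. Qed.
Let mB := boundary_measurable.

Lemma boundary_compact : compact (boundary Om).
apply: (subclosed_compact _ (closure_compact bO)); last by move=> x [].
exact: boundary_closed.
Qed.

Lemma boundary_fin : (Ho (boundary Om) < +oo)%E.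
have [s [sP cov]] := @compact_balls R d.+1 (boundary Om) (fun x r => (Ho (patchb Om x r) < +oo)%E) boundary_compact
 (fun x bx => ltac:(
   have [U [phi l]] := sm bx; have h2 : (0 : R) < 2^-1 by [];
   have [r r0 cb] := chart_exists l h2; exists (r / 2); [by rewrite divr_gt0|];
   apply: (patchb_fin l (lexx _) cb); by rewrite half_lt)).
have sub : boundary Om `<=` \big[setU/set0]_(p <- s) patchb Om p.1 p.2.
 move=> x bx; have [p ps xp] := cov x bx; have [p0 _] := sP p ps.
 rewrite -bigcup_seq; exists p => //; split=> //; rewrite ltW // (lt_trans xp) //.
 by rewrite half_lt.
apply: le_lt_trans (le_outer_measure Ho _ _ sub) _.
apply: le_lt_trans (outer_bigsetU Ho s xpredT _) _.
rewrite big_seq; elim/big_ind : _ => // [a b a0 b0|p ps]; first by rewrite lte_add_pinfty.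
by case: (sP p ps).
Qed.

Lemma surface_bounded_itg (f : E -> R) : contin_on (boundary Om) f ->
 Ritg sigma (boundary Om) f.
move=> cf; have mf : measurable_fun (boundary Om : set HT) f.
 exact: (@contin_on_measurable R d.+1 Ho _ _ (@hausdorff_halfspace R d.+1 d.+1)).
have [C hC] := contin_on_bounded boundary_compact cf.
apply: measurable_bounded_integrable => //; first exact: boundary_fin.
exists C; split; first exact: num_real.
by move=> M CM x bx /=; exact: le_trans (hC x bx) (ltW CM).
Qed.

Variables (h : E -> R) (gh : 'I_d.+2 -> E -> R).
Hypotheses (ch : contin_on (closure Om) h) (wh : forall i, wder Om i h (gh i)).

Definition smoothV (W : 'I_d.+2 -> E -> R) := forall i, smooth setT (W i).
Implicit Types W : 'I_d.+2 -> E -> R.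

Definition divd W x : R := \sum_(i < d.+2) (gh i x * W i x + h x * partial i (W i) x).
Definition fluxd W x : R := h x * \sum_(i < d.+2) W i x * outer_normal Om x ord0 i.
Definition divI W : R := \int[mu]_(x in Om) divd W x.
Definition fluxI W : R := \int[sigma]_(x in boundary Om) fluxd W x.
Definition fluxA W : R := \int[sigma]_(x in boundary Om) `|fluxd W x|.

Lemma divd_int_i W i : smoothV W -> Ritg mu Om (fun x => gh i x * W i x + h x * partial i (W i) x).
move=> sW; have [a1 a2 _] := wh i.
apply: itgD => //; apply: smooth_itgM => //; exact: smooth_partial.
Qed.

Lemma divd_itg W : smoothV W -> Ritg mu Om (divd W).
by move=> sW; exact: (Rintegral_sum mO (index_enum 'I_d.+2) (fun i => divd_int_i i sW)).1. Qed.

Lemma contin_sum (I : Type) (s : seq I) (D : set E) (f : I -> E -> R) : (forall i, contin_on D (f i)) ->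
 contin_on D (fun x => \sum_(i <- s) f i x).
move=> cf; elim: s => [|i s IH]; first by under eq_fun do rewrite big_nil; exact: contin_on_cst.
by under eq_fun do rewrite big_cons; exact: contin_onD.
Qed.

Lemma fluxd_contin W : smoothV W -> contin_on (boundary Om) (fluxd W).
move=> sW; apply: contin_onM; first by apply: contin_on_sub ch => x [].
apply: contin_sum => i; apply: contin_onM; last exact: normal_contin.
by exact: smooth_contin_on.
Qed.

Lemma fluxd_integrable W : smoothV W -> Ritg sigma (boundary Om) (fluxd W).
by move=> sW; apply: surface_bounded_itg; exact: fluxd_contin. Qed.

Lemma divd_test W : (forall i, test_function Om (W i)) -> divI W = 0.
move=> tW; have sW : smoothV W by move=> i; case: (tW i).
rewrite /divI (Rintegral_sum mO (index_enum 'I_d.+2) (fun i => divd_int_i i sW)).2.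
apply: big1 => i _; have [a1 a2 a3] := wh i.
rewrite RintegralD //; [|exact: smooth_itgM|by apply: smooth_itgM => //; exact: smooth_partial].
by rewrite a3 // addrN.
Qed.

Lemma smooth_onem a : smooth setT a -> smooth setT (fun x => 1 - a x).
move=> sa k; apply: (@Ck_ext _ _ k setT (cst 1 \+ cst (-1) \* a) _ openT) => [x _|]; first by rewrite /= mulN1r.
by apply: Ck_D; [exact: openT|exact: Ck_cst|apply: Ck_M; [exact: openT|exact: Ck_cst|exact: sa]].
Qed.

Lemma divd_split W a : smoothV W -> smooth setT a ->
 divI W = divI (fun i x => W i x * a x) + divI (fun i x => W i x * (1 - a x)).
move=> sW sa; have sa1 : smooth setT (fun x => 1 - a x) by exact: smooth_onem.
have s1 : smoothV (fun i x => W i x * a x) by move=> i k; exact: (Ck_M openT (sW i k) (sa k)).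
have s2 : smoothV (fun i x => W i x * (1 - a x)) by move=> i k; exact: (Ck_M openT (sW i k) (sa1 k)).
rewrite /divI -RintegralD //; [|exact: divd_itg|exact: divd_itg].
apply: eq_Rintegral => x _; rewrite /divd -big_split /=; apply: eq_bigr => i _.
have dW := smooth_diff (sW i) (I : setT x).
rewrite (@partialM _ _ (W i) a x i dW (smooth_diff sa I)).
rewrite (@partialM _ _ (W i) (fun x => 1 - a x) x i dW (smooth_diff sa1 I)).
have -> : partial i (fun x => 1 - a x) x = - partial i a x.
 have := @partialD _ _ (fun x => 1 - a x) a x i (smooth_diff sa1 I) (smooth_diff sa I).
 rewrite (_ : (fun x => 1 - a x) \+ a = cst 1); last by apply/funext => y; rewrite /= subrK.
 by rewrite partial_cst => /esym/eqP; rewrite addr_eq0 => /eqP.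
set p := partial i (W i) x; set q := partial i a x.
ring.
Qed.

Lemma fluxd_split W a x : fluxd W x = fluxd (fun i x => W i x * a x) x + fluxd (fun i x => W i x * (1 - a x)) x.
rewrite /fluxd -mulrDr -big_split /=; congr (_ * _); apply: eq_bigr => i _; ring.
Qed.

Lemma fluxd_scale W a x : fluxd (fun i x => W i x * a x) x = a x * fluxd W x.
rewrite /fluxd mulrCA; congr (_ * _); rewrite mulr_sumr; apply: eq_bigr => i _; ring.
Qed.

Lemma divd_vanish W : smoothV W -> (forall x, closure Om x -> \forall y \near x, forall i, W i y = 0) ->
 divI W = 0 /\ forall x, closure Om x -> fluxd W x = 0.
move=> sW W0; split.
 rewrite /divI; under eq_Rintegral => x /set_mem Ox.
  rewrite (_ : divd W x = 0); first over.
  have H := W0 x (@subset_closure _ Om x Ox); apply: big1 => i _.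
  rewrite (nbhs_singleton H) mulr0 add0r (@partial_near _ _ _ (cst 0)) ?partial_cst ?mulr0 //.
  by apply: filterS H => y; exact.
 by rewrite Rintegral_cst // mul0r.
move=> x cx; rewrite /fluxd big1 ?mulr0 // => i _.
by rewrite (nbhs_singleton (W0 x cx)) mul0r.
Qed.

(** An inequality whose error is relative to the absolute flux. Both sides are additive when [W] is
    multiplied by a cutoff between 0 and 1 and by its complement, so errors do not accumulate with
    the number of balls. *)
Definition local_flux (z : R) x (r : R) := forall W, smoothV W -> (forall y i, r < enorm (y - x) -> W i y = 0) ->
 divI W <= fluxI W + z * fluxA W.

Definition bumpf x (r : R) : E -> R := step \o (fun y => 2 - (4 / r ^+ 2) * dot (y - x) (y - x)).

Lemma bumpf_smooth x r : smooth setT (bumpf x r).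
move=> k; apply: Ck_step; first exact: openT.
apply: (@Ck_ext _ _ k setT (cst 2 \+ cst (- (4 / r ^+ 2)) \* (fun y => dot (y - x) (y - x))) _ openT).
 by move=> y _ /=; rewrite mulNr.
apply: Ck_D; [exact: openT|exact: Ck_cst|apply: Ck_M; [exact: openT|exact: Ck_cst|]].
exact: (smooth_shift x (@smooth_dot R d.+1)).
Qed.

Lemma bumpf_in x r y : 0 < r -> enorm (y - x) < r / 2 -> bumpf x r y = 1.
move=> r0 yx; rewrite /bumpf /= step_ge1 // -enorm_sqr.
have : enorm (y - x) ^+ 2 <= (r / 2) ^+ 2 by rewrite lerXn2r ?nnegrE ?enorm_ge0 ?divr_ge0 ?(ltW r0) // ltW.
rewrite expr_div_n => hy; have r2 : 0 < r ^+ 2 by rewrite exprn_gt0.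
have : 4 / r ^+ 2 * enorm (y - x) ^+ 2 <= 4 / r ^+ 2 * (r ^+ 2 / 2 ^+ 2) by rewrite ler_wpM2l // divr_ge0 // ltW.
have -> : 4 / r ^+ 2 * (r ^+ 2 / 2 ^+ 2) = 1 by field; rewrite gt_eqF.
lra.
Qed.

Lemma bumpf_out x r y : 0 < r -> r < enorm (y - x) -> bumpf x r y = 0.
move=> r0 yx; rewrite /bumpf /= step_le0 // -enorm_sqr.
have : r ^+ 2 <= enorm (y - x) ^+ 2 by rewrite lerXn2r ?nnegrE ?enorm_ge0 ?(ltW r0) // ltW.
move=> hy; have r2 : 0 < r ^+ 2 by rewrite exprn_gt0.
have : 4 / r ^+ 2 * r ^+ 2 <= 4 / r ^+ 2 * enorm (y - x) ^+ 2 by rewrite ler_wpM2l // divr_ge0 // ltW.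
rewrite divfK ?gt_eqF //; lra.
Qed.

Lemma bumpf_itv x r y : 0 <= bumpf x r y <= 1. Proof. exact: step_itv. Qed.

(** Balls are peeled off one at a time: [W * bumpf] is handled by the local inequality, and
    [W * (1 - bumpf)] vanishes near the half ball. When no ball is left, the field vanishes near the
    whole closure. *)
Lemma flux_global (z : R) : 0 <= z -> (forall x, closure Om x -> exists2 r, 0 < r & local_flux z x r) ->
 forall W, smoothV W -> divI W <= fluxI W + z * fluxA W.
move=> z0 loc; have [s [sP cov]] := compact_balls (closure_compact bO) loc.
suff H : forall W, smoothV W -> (forall x, closure Om x -> (\forall y \near x, forall i, W i y = 0) \/
  exists2 p, p \in s & enorm (x - p.1) < p.2 / 2) -> divI W <= fluxI W + z * fluxA W.
 by move=> W sW; apply: H => // x /cov; right.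
elim: s sP {cov} => [_|[x r] s IH sP] W sW HW.
 have [|d0 f0] := divd_vanish sW; first by move=> y cy; have [//|[]] := HW y cy.
 rewrite d0 addr_ge0 //.
  rewrite /fluxI; under eq_Rintegral => y /set_mem [cy _] do rewrite f0 //.
  by rewrite Rintegral_cst // mul0r.
 by rewrite mulr_ge0 //; apply: Rintegral_ge0.
have [r0 lxr] := sP _ (mem_head _ _); rewrite /= in r0 lxr.
have sa := @bumpf_smooth x r; pose a := bumpf x r.
have sa1 : smooth setT (fun x => 1 - a x) by exact: smooth_onem.
have s1 : smoothV (fun i x => W i x * a x) by move=> i k; exact: (Ck_M openT (sW i k) (sa k)).
have s2 : smoothV (fun i x => W i x * (1 - a x)) by move=> i k; exact: (Ck_M openT (sW i k) (sa1 k)).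
have p1 : divI (fun i x => W i x * a x) <= fluxI (fun i x => W i x * a x) + z * fluxA (fun i x => W i x * a x).
 by apply: lxr => // y i yx; rewrite /a bumpf_out // mulr0.
have p2 : divI (fun i x => W i x * (1 - a x)) <= fluxI (fun i x => W i x * (1 - a x)) + z * fluxA (fun i x => W i x * (1 - a x)).
 apply: IH => //; first by move=> p ps; apply: sP; rewrite in_cons ps orbT.
 move=> y cy; have [H|[p]] := HW y cy.
  by left; apply: filterS H => u hu i; rewrite hu mul0r.
 rewrite in_cons => /orP[/eqP -> /= yx|ps yp]; last by right; exists p.
 left; apply/nbhs_enormP; exists (r / 2 - enorm (y - x)); first by rewrite subr_gt0.
 move=> u uy i; rewrite /a bumpf_in ?subrr ?mulr0 //.
 have := ler_enormD (u - y) (y - x); rewrite addrA subrK; lra.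
have f1 := fluxd_integrable s1; have f2 := fluxd_integrable s2.
have eF : fluxI W = fluxI (fun i x => W i x * a x) + fluxI (fun i x => W i x * (1 - a x)).
 by rewrite /fluxI -RintegralD //; apply: eq_Rintegral => y _; exact: fluxd_split.
have eA : fluxA W = fluxA (fun i x => W i x * a x) + fluxA (fun i x => W i x * (1 - a x)).
 rewrite /fluxA -RintegralD //; try exact: itg_norm.
 apply: eq_Rintegral => y _; rewrite !fluxd_scale.
 have := bumpf_itv x r y; rewrite -/(a y); move: (a y) (fluxd W y) => b w /andP[a0 a1].
 rewrite (normrM b) (normrM (1 - b)) (ger0_norm a0) (ger0_norm (_ : 0 <= 1 - b)) ?subr_ge0 //.
 by rewrite -mulrDl addrC subrK mul1r.
rewrite (divd_split sW sa) eF eA mulrDr addrACA; exact: lerD p1 p2.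
Qed.

End divergence.

(** * The divergence inequality near a point *)

Section local_divergence.
Variables (Om : set E) (oO : open Om) (bO : bounded_set Om) (sm : smooth_boundary Om).
Variables (h : E -> R) (gh : 'I_d.+2 -> E -> R).
Hypotheses (ch : contin_on (closure Om) h) (wh : forall i, wder Om i h (gh i)).
Implicit Types (x y : E) (W : 'I_d.+2 -> E -> R).
Let mO := Om_measurable oO.
Let mB : measurable (boundary Om : set HT) := boundary_measurable Om.

Lemma boundary_open : boundary Om = closure Om `\` Om.
by rewrite /boundary (interior_id _).1. Qed.

Lemma interior_flux z x : 0 <= z -> Om x -> exists2 r, 0 < r & local_flux Om h gh z x r.
move=> z0 Ox; have [r r0 hr] := open_enorm oO Ox.
exists (r / 2); first by rewrite divr_gt0.
have r2 : r / 2 < r by rewrite half_lt.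
move=> W sW W0; rewrite (divd_test oO bO wh); last first.
 move=> i; split; first exact: sW.
 exists (eball x (r / 2)); split; [exact: eball_compact|by move=> y yx; apply: hr; exact: le_lt_trans r2|].
 by move=> y /negP; rewrite -ltNge => yx; exact: W0.
have F0 y : boundary Om y -> fluxd Om h W y = 0.
 rewrite boundary_open => -[_ nO]; rewrite /fluxd big1 ?mulr0 // => i _.
 rewrite W0 ?mul0r // ltNge; apply/negP => yx; apply: nO; apply: hr; exact: le_lt_trans r2.
rewrite addr_ge0 //.
 rewrite /fluxI; under eq_Rintegral => y /set_mem b_y do rewrite F0 //.
 by rewrite Rintegral_cst // ?mul0r //; exact: boundary_measurable.
by rewrite mulr_ge0 //; apply: Rintegral_ge0.
Qed.

Section boundary_point.
Variables (x0 : E) (U : set E) (phi : E -> R).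
Hypothesis (ldf : local_defining_function Om x0 U phi).
Variables (e r : R) (e_gt0 : 0 < e) (e_le : e <= 2^-1) (r_gt0 : 0 < r) (cb : chart_ball x0 U phi e r).
Local Notation c := (gnorm x0 phi).
Local Notation rho := (r / 8).
Hypothesis gphi : forall y, enorm (y - x0) < r -> (1 - e) * c <= enorm (grad phi y) <= (1 + e) * c.
Variable W : 'I_d.+2 -> E -> R.
Hypotheses (sW : smoothV W) (W0 : forall y i, rho < enorm (y - x0) -> W i y = 0).

Let oU : open U. Proof. by case: ldf => -[]. Qed.
Let sphi : smooth U phi. Proof. by case: ldf. Qed.
Let rr : rho < r. Proof. by rewrite half_lt. Qed.
Let c0 : 0 < c. Proof. exact: gnorm_gt0 ldf. Qed.
Let e1 : 0 < 1 - e. Proof. by have := e_le; have := @mulfV R 2; lra. Qed.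

Definition cutoff (s : R) : E -> R := (fun u : R => step (2 * u - 1)) \o (fun y => - phi y / s).

Lemma cutoff_smooth s : smooth U (cutoff s).
move=> k; apply: (@Ck_ext _ _ k U (step \o (cst (-1) \+ cst (- (2 / s)) \* phi)) _ oU).
 by move=> y _; rewrite /cutoff /=; congr step; ring.
apply: Ck_step => //; apply: Ck_D => //; first exact: Ck_cst.
by apply: Ck_M => //; exact: Ck_cst.
Qed.

Lemma partial_cutoff s y i : U y -> partial i (cutoff s) y = - (s^-1 * kstep (- phi y / s) * partial i phi y).
move=> Uy; have dp := smooth_diff sphi Uy.
have e2 : (fun y => - phi y / s) = cst (- s^-1) \* phi by apply/funext => u; rewrite /= mulNr mulNr mulrC.
have dq : differentiable (cst (- s^-1) \* phi) y by exact: differentiableM.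
rewrite /cutoff (partial_comp1 i (is_derive_kstep _) (_ : differentiable (fun y => - phi y / s) y)).2; last by rewrite e2.
have -> : partial i (fun y => - phi y / s) y = - s^-1 * partial i phi y.
 by rewrite e2 partialM // partial_cst ?mul0r ?mulr0 ?addr0 ?add0r.
ring.
Qed.

Lemma W_near y i : rho < enorm (y - x0) -> \near y, W i y = cst 0 y.
move=> yx; apply/nbhs_enormP; exists (enorm (y - x0) - rho); first by rewrite subr_gt0.
move=> u uy /=; apply: W0; have := ler_enormD (y - u) (u - x0); rewrite addrA subrK -[y - u]opprB enormN; lra.
Qed.

(** On the support of the cutoff [- phi] is at least [s / 2], which keeps away from the boundary; on
    the other side [W] vanishes outside a small ball. Smoothness is glued from the chart domain and
    the region where [W] is zero. *)
Lemma cutoff_test s i : 0 < s -> test_function Om (fun y => W i y * cutoff s y).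
move=> s0; pose V := [set y | rho < enorm (y - x0)].
have oV : open V by exact: open_far_enorm.
split.
 move=> k; apply: (@Ck_sub _ _ k (U `|` V)).
  move=> y _; have [yx|yx] := ltP rho (enorm (y - x0)); [by right|left; apply: cb.1; exact: le_lt_trans rr].
 apply: Ck_union; first by apply: Ck_M => //; [apply: Ck_sub (sW i k) => //|exact: cutoff_smooth].
 by apply: (@Ck_ext _ _ k V (cst 0) _ oV) => [y yV|]; [rewrite W0 // mul0r|exact: Ck_cst].
exists [set y | eball x0 rho y /\ s / 2 <= - phi y]; split.
- apply: (subclosed_compact _ (@eball_compact R d.+1 x0 rho)); last by move=> y [].
 apply: closed_level; first exact: eball_closed.
 have -> : (fun y => - phi y) = (fun t => - t) \o phi by [].
 by apply: contin_on_comp1; [exact: (contin_phi ldf cb rr)|move=> t; exact: cvgN].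
- move=> y [yx sy]; have Uy : U y by apply: cb.1; exact: le_lt_trans rr.
 by apply: (ldf_in ldf Uy).2; have : 0 < s / 2 by [rewrite divr_gt0]; lra.
- move=> y nK; have [yx|yx] := ltP rho (enorm (y - x0)); first by rewrite W0 // mul0r.
 rewrite /cutoff /= step_le0 ?mulr0 // subr_le0 mulrA ler_pdivrMr // mul1r.
 rewrite leNgt; apply/negP => h2; apply: nK; split=> //.
 by rewrite ler_pdivrMr // mulrC ltW.
Qed.

Let H x := h x * \sum_i W i x * partial i phi x.

Lemma divd_cutoff s x : 0 < s -> Om x ->
 divd h gh (fun i y => W i y * cutoff s y) x = cutoff s x * divd h gh W x - kint phi H s x.
move=> s0 Ox; have [yx|yx] := ltP rho (enorm (x - x0)).
 have z i : partial i (fun y => W i y * cutoff s y) x = 0.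
  rewrite (@partial_near _ _ _ (cst 0)) ?partial_cst //.
  by apply: filterS (W_near i yx) => u /= ->; rewrite mul0r.
 have z2 i : partial i (W i) x = 0 by rewrite (partial_near _ (W_near i yx)) partial_cst.
 rewrite /divd big1; last by move=> i _; rewrite z W0 // mul0r !mulr0 addr0.
 rewrite big1; last by move=> i _; rewrite z2 W0 // !mulr0 addr0.
 by rewrite /kint /H big1 ?mulr0 ?subr0 // => i _; rewrite W0 // mul0r.
have Ux : U x by apply: cb.1; exact: le_lt_trans rr.
rewrite /divd /kint /H !mulr_sumr -sumrB; apply: eq_bigr => i _.
rewrite (@partialM _ _ (W i) (cutoff s) x i (smooth_diff (sW i) I) (smooth_diff (cutoff_smooth s) Ux)).
by rewrite partial_cutoff //; ring.
Qed.

(** Positive and negative parts of the density for [t] equal to 1 and -1, because the collar limits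
    concern nonnegative functions. The extension by zero makes the bounds hold everywhere. *)
Let Hs (t : R) := (fun x => Num.max (t * H x) 0) \_ (closure Om).
Local Notation Hp := (Hs 1).
Local Notation Hm := (Hs (-1)).

Let H_out x : rho < enorm (x - x0) -> H x = 0.
by move=> xx; rewrite /H big1 ?mulr0 // => i _; rewrite W0 // mul0r. Qed.

Lemma H_contin : contin_on (closure Om) H.
have -> : H = (fun x => \sum_i h x * (W i x * partial i phi x)) by apply/funext => x; rewrite /H mulr_sumr.
apply: contin_sum => i; apply: contin_onM => //.
move=> x _ z z0; have [yx|yx] := ltP rho (enorm (x - x0)).
 have /nbhs_enormP[q q0 hq] := W_near i yx.
 by exists q => // y _ /hq /= ->; rewrite W0 // !mul0r subr0 normr0.
have Ux : U x by apply: cb.1; exact: le_lt_trans rr.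
have cf := continuousM (smooth_for (sW i) (I : setT x)) (smooth_for (smooth_partial i sphi) Ux).
have [q q0 hq] := (cont_enormP _ x).1 cf z z0.
by exists q => // y _ /hq; rewrite distrC.
Qed.

Lemma contin_onN (f : E -> R) (D : set E) : contin_on D f -> contin_on D (fun x => - f x).
move=> cf; have -> : (fun x => - f x) = (fun t => - t) \o f by [].
by apply: contin_on_comp1 => // t; exact: cvgN.
Qed.

Lemma max0_contin (f : E -> R) (D : set E) : contin_on D f -> contin_on D (fun x => Num.max (f x) 0).
move=> cf; have -> : (fun x => Num.max (f x) 0) = (fun t => Num.max t 0) \o f by [].
apply: contin_on_comp1 => // t; apply: continuous_max; [exact: cvg_id|exact: cvg_cst].
Qed.

Lemma patch_contin (f : E -> R) (D : set E) : contin_on D f -> contin_on D (f \_ D).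
move=> cf x Dx z z0; have [q q0 hq] := cf x Dx z z0; exists q => // y Dy yx.
by rewrite /patch !mem_set //; exact: hq.
Qed.

Let cHs t : contin_on (closure Om) (Hs t).
by apply: patch_contin; apply: max0_contin; apply: contin_onM; [exact: contin_on_cst|exact: H_contin].
Qed.
Let Hs0 t x : 0 <= Hs t x. Proof. by rewrite /Hs /patch; case: ifP => // _; rewrite le_max lexx orbT. Qed.
Let Hs_out t x : rho < enorm (x - x0) -> Hs t x = 0.
by move=> /H_out h0; rewrite /Hs /patch; case: ifP => // _; rewrite h0 mulr0 maxxx. Qed.

Lemma HsE t x : closure Om x -> Hs t x = Num.max (t * H x) 0.
by move=> cx; rewrite /Hs /patch mem_set. Qed.

Lemma max_diff (t : R) : t = Num.max (1 * t) 0 - Num.max (-1 * t) 0.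
by rewrite mul1r mulN1r; case: (leP t 0) => t0; case: (leP (- t) 0) => t1; lra.
Qed.

Let HC t : exists C, forall x, Hs t x <= C.
have [C hC] := contin_on_bounded (closure_compact bO) (@cHs t); exists (Num.max C 0) => x.
have [cx|nx] := pselect (closure Om x); first by rewrite le_max (le_trans (ler_norm _) (hC x cx)).
by rewrite /Hs /patch memNset // le_max lexx orbT.
Qed.

Let Fs t := \int[sigma]_(x in boundary Om) Num.max (t * fluxd Om h W x) 0.
Local Notation Fp := (Fs 1).
Local Notation Fm := (Fs (-1)).
Let Fs0 t : 0 <= Fs t. Proof. by apply: Rintegral_ge0 => x _; rewrite le_max lexx orbT. Qed.

Lemma fluxd_H x : boundary Om x -> enorm (x - x0) < r -> H x = enorm (grad phi x) * fluxd Om h W x.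
move=> bx xx; have Ux := cb.1 _ xx; have l := ldf_at ldf Ux.
have g0 : enorm (grad phi x) != 0 by rewrite enorm_eq0; case: ldf => _ _ g _ _; exact: g.
rewrite /H /fluxd mulrCA; congr (_ * _); rewrite mulr_sumr; apply: eq_bigr => i _.
by rewrite (outer_normalE bx l) rowZ [grad phi x ord0 i]mxE [RHS]mulrCA mulVKf.
Qed.

Let iFs t : Ritg sigma (boundary Om) (fun x => Num.max (t * fluxd Om h W x) 0).
apply: surface_bounded_itg => //; apply: max0_contin; apply: contin_onM; first exact: contin_on_cst.
exact: fluxd_contin.
Qed.

(** On the boundary the density is the flux multiplied by the norm of the gradient of [phi], which
    is within the factors [1 - e] and [1 + e] of its value at the centre. *)
Lemma Hs_bounds t : (1 - e) * c * Fs t <= \int[sigma]_(x in boundary Om) Hs t x <= (1 + e) * c * Fs t.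
have iH : Ritg sigma (boundary Om) (Hs t).
 by apply: surface_bounded_itg => //; apply: contin_on_sub (@cHs t) => x [].
have pt x : boundary Om x -> (1 - e) * c * Num.max (t * fluxd Om h W x) 0 <= Hs t x <=
  (1 + e) * c * Num.max (t * fluxd Om h W x) 0.
 move=> bx; have [xx|xx] := ltP rho (enorm (x - x0)).
  rewrite Hs_out // /fluxd big1; last by move=> i _; rewrite W0 // mul0r.
  by rewrite !mulr0 maxxx !mulr0 lexx.
 have xr := le_lt_trans xx rr; have /andP[g1 g2] := gphi xr.
 rewrite HsE; last by case: bx.
 have -> : Num.max (t * H x) 0 = enorm (grad phi x) * Num.max (t * fluxd Om h W x) 0.
  by rewrite fluxd_H // maxr_pMr ?enorm_ge0 // mulr0 mulrCA.
 by rewrite !ler_wpM2r // le_max lexx orbT.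
rewrite -!RintegralZl //; apply/andP; split; apply: le_Rintegral => //; try exact: itgZ.
 by move=> x /pt/andP[].
by move=> x /pt/andP[].
Qed.

Lemma kint_split s x : Om x -> kint phi H s x = kint phi Hp s x - kint phi Hm s x.
move=> Ox; have cx := subset_closure Ox.
by rewrite /kint !HsE // {1}[H x]max_diff mulrBr.
Qed.

(** The cut-off field consists of test functions, so its divergence integrates to zero; the integral
    of [cutoff] times the divergence of [W] is therefore the collar integral of [H]. For small
    scales the former is close to [divI], and the latter is bounded by the upper collar limit of the
    positive part and the lower one of the negative part. *)
Lemma divI_le z : 0 < z -> z < 1 -> divI Om h gh W <=
 (1 - e)^-1 ^+ d.+2 * ((1 + e) * Fp + z / c) * (1 + z) -
 (((1 - e)^-1 ^+ d.+1 * (1 + e) ^+ d.+2)^-1 * ((1 - e) * Fm) - z) + z.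
move=> z0 z1; have [C1 hC1] := HC 1; have [C2 hC2] := HC (-1).
have [q1 q10 up] := collar_limit_upper oO bO ldf e_le r_gt0 cb (@cHs 1) (Hs0 1) hC1 (@Hs_out 1) z0.
have [q2 q20 lo] := collar_limit_lower oO bO ldf e_gt0 e_le r_gt0 cb (@cHs (-1)) (Hs0 (-1)) hC2 (@Hs_out (-1)) z0.
have ik t k : Ritg mu Om (kint phi (Hs t) (rad k)).
 have [C hC] := HC t; apply/(restrict_int _ mO).
 exact: (kint_integrable oO ldf e_le r_gt0 cb (@cHs t) (Hs0 t) hC (@Hs_out t) (rad_gt0 k)).
pose f (k : nat) x := divd h gh (fun i y => W i y * cutoff (rad k) y) x + (kint phi Hp (rad k) x - kint phi Hm (rad k) x).
have tk k i := cutoff_test i (@rad_gt0 R k).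
have id k : Ritg mu Om (divd h gh (fun i y => W i y * cutoff (rad k) y)).
 by apply: (divd_itg oO bO wh) => i; case: (tk k i).
have fE k x : Om x -> f k x = cutoff (rad k) x * divd h gh W x.
 by move=> Ox; rewrite /f -kint_split // divd_cutoff ?rad_gt0 // subrK.
have ifk k : Ritg mu Om (f k).
 apply: itgD => //; exact: itgB.
have If k : \int[mu]_(x in Om) f k x = \int[mu]_(x in Om) kint phi Hp (rad k) x - \int[mu]_(x in Om) kint phi Hm (rad k) x.
 have := divd_test oO bO wh (tk k); rewrite /divI => d0.
 rewrite RintegralD //; last exact: itgB.
 by rewrite d0 add0r RintegralB.
have iW := divd_itg oO bO wh sW.
have [] := @Rdominated _ _ _ mu Om mO f (divd h gh W) (fun x => `|divd h gh W x|).
- by move=> k; exact: itg_meas (ifk k).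
- move=> x Ox; have [xx|xx] := ltP rho (enorm (x - x0)).
  have -> : divd h gh W x = 0.
   rewrite /divd big1 // => i _; rewrite W0 // mulr0 add0r (partial_near _ (W_near i xx)) partial_cst mulr0 //.
  have -> : f^~ x = cst 0; last exact: cvg_cst.
  apply/funext => k; rewrite fE // /divd big1 ?mulr0 // => i _.
  by rewrite W0 // mulr0 add0r (partial_near _ (W_near i xx)) partial_cst mulr0.
 have Ux : U x by apply: cb.1; exact: le_lt_trans rr.
 have px : 0 < - phi x by rewrite oppr_gt0; apply: (ldf_in ldf Ux).1.
 have [N hN] := rad_small px; apply: cvg_near_cst; exists N => // k /= /hN kx.
 rewrite fE // /cutoff /= step_ge1 ?mul1r //.
 have : 1 <= - phi x / rad k by rewrite ler_pdivlMr ?rad_gt0 // mul1r ltW.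
 lra.
- exact: itg_norm iW.
- move=> k x Ox; rewrite fE // normrM ler_piMl // ger0_norm; first by case/andP: (step_itv (2 * (- phi x / rad k) - 1)).
 by case/andP: (step_itv (2 * (- phi x / rad k) - 1)).
move=> _ _ /cvgrPdist_lt /(_ z z0) [N _ hN].
have [N1 h1] := rad_small q10; have [N2 h2] := rad_small q20.
pose k := maxn N (maxn N1 N2).
have Nk : (N <= k)%N by rewrite leq_maxl.
have Nk1 : (N1 <= k)%N by rewrite (leq_trans (leq_maxl N1 N2)) // leq_maxr.
have Nk2 : (N2 <= k)%N by rewrite (leq_trans (leq_maxr N1 N2)) // leq_maxr.
have := hN k Nk; rewrite /= If ltr_norml => /andP[_]; rewrite -/(divI Om h gh W) => hd.
have := up _ (rad_gt0 k) (h1 k Nk1); have := lo _ (rad_gt0 k) (h2 k Nk2).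
set A := \int[mu]_(x in Om) kint phi Hp _ x in hd *; set B := \int[mu]_(x in Om) kint phi Hm _ x in hd *.
set a := (1 - e)^-1 ^+ d.+2; set b := (1 - e)^-1 ^+ d.+1 * _ => lo' up'.
have a0 : 0 < a by rewrite exprn_gt0 // invr_gt0.
have b0 : 0 < b by apply: mulr_gt0; apply: exprn_gt0; [rewrite invr_gt0|rewrite addr_gt0].
have l2 : b^-1 * ((1 - e) * Fm) - z <= B.
 rewrite lerBlDr mulrC ler_pdivrMr // (mulrC _ b); apply: le_trans lo'.
 by rewrite ler_pdivlMr // mulrAC; case/andP: (Hs_bounds (-1)).
have u2 : A <= a * ((1 + e) * Fp + z / c) * (1 + z).
 apply: le_trans up' _; rewrite ler_wpM2r ?addr_ge0 ?(ltW z0) // -mulrA ler_wpM2l ?(ltW a0) //.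
 rewrite mulrC ler_pdivrMr // mulrDl divfK ?gt_eqF // lerD2r mulrAC; by case/andP: (Hs_bounds 1).
lra.
Qed.

(** The error of the collar limits is first sent to zero in a fixed chart; only the chart distortion
    remains, and the two numerical conditions turn it into a relative error [z] on each part of the
    flux. *)
Lemma boundary_flux z : 0 < z -> (1 - e)^-1 ^+ d.+2 * (1 + e) <= 1 + z ->
 (1 - z) * ((1 - e)^-1 ^+ d.+1 * (1 + e) ^+ d.+2) <= 1 - e ->
 divI Om h gh W <= fluxI Om h W + z * fluxA Om h W.
move=> z0; set a := (1 - e)^-1 ^+ d.+2; set b := (1 - e)^-1 ^+ d.+1 * _ => ha hb.
have a0 : 0 < a by rewrite exprn_gt0 // invr_gt0.
have b0 : 0 < b by apply: mulr_gt0; apply: exprn_gt0; [rewrite invr_gt0|rewrite addr_gt0].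
have Fp0 := Fs0 1; have Fm0 := Fs0 (-1).
have eI : fluxI Om h W = Fp - Fm.
 by rewrite /fluxI -RintegralB //; apply: eq_Rintegral => x _; exact: max_diff.
have eA : fluxA Om h W = Fp + Fm.
 rewrite /fluxA -RintegralD //; apply: eq_Rintegral => x _; rewrite mul1r mulN1r; move: (fluxd _ _ _ _) => t.
 by case: (leP t 0) => t0; case: (leP (- t) 0) => t1; [rewrite ler0_norm|rewrite ler0_norm|rewrite ger0_norm|rewrite ger0_norm]; lra.
have k0 : 0 <= a * ((1 + e) * Fp) by rewrite mulr_ge0 ?(ltW a0) // mulr_ge0 // addr_ge0 // ltW.
have k1 : 0 <= a / c by rewrite divr_ge0 // ltW.
have step1 : divI Om h gh W <= a * ((1 + e) * Fp) - b^-1 * ((1 - e) * Fm).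
 apply: (@small_le _ _ _ (a * ((1 + e) * Fp) + 2 * (a / c) + 2)); last by rewrite !addr_ge0 // mulr_ge0.
 move=> t t0 t1; apply: le_trans (divI_le t0 t1) _; rewrite -/a -/b.
 have : t * (t * (a / c)) <= t * (1 * (a / c)) by rewrite ler_pM2l // ler_wpM2r // ltW.
 have -> : a * ((1 + e) * Fp + t / c) * (1 + t) = a * ((1 + e) * Fp) + t * (a * ((1 + e) * Fp)) + t * (a / c) + t * (t * (a / c)) by ring.
 lra.
apply: le_trans step1 _; rewrite eI eA.
have s1 : a * ((1 + e) * Fp) <= (1 + z) * Fp by rewrite mulrA ler_wpM2r.
have s2 : (1 - z) * Fm <= b^-1 * ((1 - e) * Fm).
 by rewrite mulrA ler_wpM2r // mulrC ler_pdivlMr.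
lra.
Qed.

End boundary_point.

Lemma local_flux_exists z x : 0 < z -> closure Om x -> exists2 r, 0 < r & local_flux Om h gh z x r.
move=> z0 cx; have [Ox|nO] := pselect (Om x); first by apply: interior_flux => //; exact: ltW.
have bx : boundary Om x by rewrite boundary_open.
have [U [phi l]] := sm bx; have [e [e0 e2 ha hb]] := chart_distortion_small d.+1 z0.
have [r1 r10 cb1] := chart_exists l e0; have c0 := gnorm_gt0 l.
have [[oU Ux] sp _ _ _] := l.
have [r2 r20 hr2] := enorm_grad_continuous (sp 1%N) Ux (mulr_gt0 e0 c0).
pose r := Num.min r1 r2; have r0 : 0 < r by rewrite lt_min r10.
have cb : chart_ball x U phi e r.
 split=> [y|y y']; rewrite !lt_min; first by move=> /andP[h1 _]; exact: cb1.1.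
 by move=> /andP[h1 _] /andP[h2 _]; exact: cb1.2.
exists (r / 8); first by rewrite divr_gt0.
move=> W sW W0; apply: (boundary_flux l e0 e2 r0 cb _ sW W0 z0 ha hb).
move=> y yx; have Uy := cb.1 _ yx; move: yx; rewrite lt_min => /andP[_ /hr2 /(_ Uy)] hg.
have g1 := ler_enormD (grad phi y - grad phi x) (grad phi x); rewrite subrK in g1.
have g2 := ler_enormD (grad phi x - grad phi y) (grad phi y); rewrite subrK -[grad phi x - _]opprB enormN in g2.
by rewrite !mulrDl mulNr mul1r; move: g1 g2 hg; rewrite -/(gnorm x phi) => g1 g2 hg; apply/andP; split; lra.
Qed.

(** Letting [z] tend to zero gives one inequality for all smooth fields, and the field [- W] gives
    the other. *)
Theorem divergence_theorem W : smoothV W -> divI Om h gh W = fluxI Om h W.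
have key W' : smoothV W' -> divI Om h gh W' <= fluxI Om h W'.
 move=> sW; apply: (@small_le _ _ _ (fluxA Om h W')); last by apply: Rintegral_ge0.
 by move=> z z0 _; apply: (flux_global oO bO sm ch wh (ltW z0)) => // x; exact: local_flux_exists.
move=> sW; apply/eqP; rewrite eq_le key //=; rewrite -lerN2.
have sN : smoothV (fun i x => - W i x).
 move=> i k; apply: (@Ck_ext _ _ k setT (cst (-1) \* W i) _ openT) => [x _|]; first by rewrite /= mulN1r.
 by apply: Ck_M; [exact: openT|exact: Ck_cst|exact: sW].
have e1 : divI Om h gh (fun i x => - W i x) = - divI Om h gh W.
 rewrite /divI -[RHS]mulN1r -RintegralZl //; last exact: divd_itg.
 apply: eq_Rintegral => x _; rewrite mulN1r /divd -sumrN; apply: eq_bigr => i _.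
 have -> : partial i (fun y => - W i y) x = - partial i (W i) x.
  have := @partialM _ _ (cst (-1)) (W i) x i (differentiable_cst _ _) (smooth_diff (sW i) (I : setT x)).
  by rewrite partial_cst ?mul0r ?mulr0 ?addr0 ?add0r mulN1r => <-; congr partial; apply/funext => y; rewrite /= mulN1r.
 by rewrite !mulrN opprD.
have e2 : fluxI Om h (fun i x => - W i x) = - fluxI Om h W.
 rewrite /fluxI -[RHS]mulN1r -RintegralZl //; last exact: fluxd_integrable.
 apply: eq_Rintegral => x _; rewrite mulN1r /fluxd -mulrN; congr (_ * _); rewrite -sumrN.
 by apply: eq_bigr => i _; rewrite mulNr.
by rewrite -e1 -e2; exact: key.
Qed.

End local_divergence.

(** * Smooth extension from a compact set *)

Section extension.
Implicit Types (x y : E) (U K : set E) (f g : E -> R).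

Lemma local_extension U g x : open U -> U x -> smooth U g -> exists2 r, 0 < r &
 exists g', smooth setT g' /\ forall y, enorm (y - x) <= r -> g' y = g y.
move=> oU Ux sg; have [r r0 hr] := open_enorm oU Ux.
have r2 : 0 < r / 2 by lra.
have rr : r / 2 < r by lra.
exists (r / 8); first by rewrite divr_gt0.
exists (fun y => bumpf x (r / 2) y * g y); split=> [k|y yx].
 have oV := @open_far_enorm R d.+1 x (r / 2); set V := [set y | _] in oV.
 apply: (@Ck_sub _ _ k (U `|` V)).
  by move=> y; have [yx|yx] := ltP (r / 2) (enorm (y - x)); [right|left; apply: hr; exact: le_lt_trans rr].
 apply: Ck_union; first by apply: Ck_M => //; apply: Ck_sub (bumpf_smooth x (r / 2) k).
 apply: (@Ck_ext _ _ k V (cst 0) _ oV) => [y yV|]; last exact: Ck_cst.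
 by rewrite bumpf_out // mul0r.
rewrite bumpf_in; lra.
Qed.

(** Local extensions are merged ball after ball by convex combinations with weight [bumpf]. Where
    both candidates agree with [f] on [K] so does any combination, hence earlier successes are never
    spoiled. *)
Lemma smooth_extension K f : compact K ->
 (forall x, K x -> exists U g, [/\ open U, U x, smooth U g & forall y, K y -> U y -> f y = g y]) ->
 exists g, smooth setT g /\ forall y, K y -> g y = f y.
move=> cK loc.
have [|s [sP cov]] := @compact_balls R d.+1 K (fun x r => exists g, smooth setT g /\ forall y, K y -> enorm (y - x) <= r -> g y = f y) cK.
 move=> x Kx; have [U [g [oU Ux sg fg]]] := loc x Kx.
 have [r r0 [g' [sg' hg']]] := local_extension oU Ux sg.
 have /nbhs_enormP[r' r'0 hr'] := open_nbhs_nbhs (conj oU Ux).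
 exists (Num.min r (r' / 2)); first by rewrite lt_min r0 divr_gt0.
 exists g'; split=> // y Ky; rewrite le_min => /andP[h1 h2]; rewrite hg' // fg //.
 by apply: hr'; apply: le_lt_trans h2 _; rewrite half_lt.
suff [g [sg hg]] : exists g, smooth setT g /\ forall y, K y -> (exists2 p, p \in s & enorm (y - p.1) < p.2 / 2) -> g y = f y.
 by exists g; split=> // y Ky; apply: hg => //; exact: cov.
elim: s sP {cov} => [_|[x r] s IH sP]; first by exists (cst 0); split=> [k|y _ []//]; exact: Ck_cst.
have [g' [sg' hg']] := IH (fun q qs => sP q (ltac:(by rewrite in_cons qs orbT))).
have [/= r0 [g [sg hg]]] := sP _ (mem_head _ _); pose a := bumpf x r.
have sa : smooth setT a by exact: bumpf_smooth.
exists (fun y => a y * g y + (1 - a y) * g' y); split=> [k|y Ky [p]].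
 apply: (@Ck_D _ _ k setT (a \* g) _ openT); first exact: Ck_M openT (sa k) (sg k).
 apply: (@Ck_M _ _ k setT (fun y => 1 - a y) _ openT); last exact: sg'.
 exact: (smooth_onem sa k).
rewrite in_cons => /orP[/eqP -> /= yx|ps yp].
 have yr : enorm (y - x) <= r by apply: le_trans (ltW yx) _; rewrite ler_pdivrMr // ler_pMr // ler1n.
 by rewrite /a bumpf_in // subrr mul0r addr0 mul1r hg.
rewrite hg'; [|by []|by exists p].
have [yr|yr] := leP (enorm (y - x)) r; first by rewrite hg //; ring.
by rewrite /a bumpf_out // mul0r add0r subr0 mul1r.
Qed.

End extension.

(** * Tangential Jacobians *)

Section tangent.
Variables (Om : set E) (x : E) (U : set E) (phi : E -> R).
Hypotheses (bx : boundary Om x) (ldf : local_defining_function Om x U phi).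
Local Notation nu := (outer_normal Om x).
Implicit Types (y t : E) (L : 'M[R]_d.+2) (X : E -> E).

Let oU : open U. Proof. by case: ldf => -[]. Qed.
Let Ux : U x. Proof. by case: ldf => -[]. Qed.
Let sphi : smooth U phi. Proof. by case: ldf. Qed.
Let c := enorm (grad phi x).
Let c0 : 0 < c. Proof. by rewrite enorm_gt0; case: ldf => _ _ h _ _; exact: h. Qed.
Let gE : grad phi x = c *: nu.
by rewrite (outer_normalE bx ldf) scalerA divff ?scale1r // gt_eqF. Qed.
Let nu1 : dot nu nu = 1.
by rewrite -enorm_sqr (outer_normalE bx ldf) (unit_grad ldf) expr1n. Qed.

Lemma phi_expand (e : R) : 0 < e -> exists2 r, 0 < r & forall y, enorm (y - x) < r -> U y /\
 `|phi y - c * dot nu (y - x)| <= e * enorm (y - x).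
move=> e0; have [r r0 hr] := diff_fdiff (smooth_diff sphi Ux) e0.
have [s s0 hs] := open_enorm oU Ux.
exists (Num.min r s); first by rewrite lt_min r0.
move=> y; rewrite lt_min => /andP[h1 h2]; split; first exact: hs.
by have := hr y h1; rewrite gE dotZl ((ldf_bd ldf Ux).1 bx) subr0.
Qed.

Lemma boundary_tangent (e : R) : 0 < e -> exists2 r, 0 < r & forall y, boundary Om y -> enorm (y - x) < r ->
 `|dot nu (y - x)| <= e * enorm (y - x).
move=> e0; have [r r0 hr] := phi_expand (mulr_gt0 c0 e0); exists r => // y b_y /hr[Uy].
rewrite ((ldf_bd ldf Uy).1 b_y) sub0r normrN normrM (gtr0_norm c0) -mulrA.
by rewrite ler_pM2l.
Qed.

(** Every tangent direction is realised by boundary points: near [x + a *: t] the defining function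
    changes sign along the normal within distance [e * a]. *)
Lemma boundary_approach t (e q : R) : dot nu t = 0 -> 0 < e -> 0 < q -> exists2 a : R, 0 < a &
 exists y, [/\ boundary Om y, enorm (y - x) < q & enorm (y - x - a *: t) <= e * a].
move=> nt e0 q0; have T0 : 0 < enorm t + e by rewrite ltr_wpDl // enorm_ge0.
have ce : 0 < c * e / 2 / (enorm t + e) by rewrite !divr_gt0 // mulr_gt0.
have [r r0 hr] := phi_expand ce.
pose a := Num.min r q / 2 / (enorm t + e).
have m0 : 0 < Num.min r q by rewrite lt_min r0.
have a0 : 0 < a by rewrite !divr_gt0.
have am : a * (enorm t + e) < Num.min r q by rewrite divfK ?gt_eqF // half_lt.
have nn : enorm nu = 1 by rewrite /enorm nu1 sqrtr1.
pose p s := x + a *: t + s *: nu.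
have px s : p s - x = a *: t + s *: nu by rewrite addrAC [x + _ - x]addrAC subrr add0r.
have pn s : `|s| <= e * a -> enorm (p s - x) <= a * (enorm t + e).
 move=> se; rewrite px; apply: le_trans (ler_enormD _ _) _; rewrite !enormZ nn (gtr0_norm a0).
 lra.
have pr s : `|s| <= e * a -> enorm (p s - x) < r.
 by move=> /pn h; apply: le_lt_trans h (lt_le_trans am _); rewrite ge_min lexx.
have pd s : dot nu (p s - x) = s by rewrite px dotDr !dotZr nt nu1 mulr0 add0r mulr1.
have est s : `|s| <= e * a -> `|phi (p s) - c * s| <= c * (e * a) / 2.
 move=> se; have [_] := hr _ (pr s se); rewrite pd => /le_trans; apply.
 apply: le_trans (ler_wpM2l (ltW ce) (pn s se)) _.
 by rewrite mulrCA divfK ?gt_eqF // le_eqVlt; apply/orP; left; apply/eqP; ring.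
have ea0 : 0 < e * a by rewrite mulr_gt0.
have cea : 0 < c * (e * a) by rewrite mulr_gt0.
have ab : - (e * a) <= e * a by lra.
have cf : {within `[- (e * a), e * a], continuous (phi \o p)}.
 apply: continuous_in_subspaceT => s; rewrite inE => sI.
 have se : `|s| <= e * a by rewrite ler_norml.
 have dp : differentiable phi (p s) by apply: smooth_diff sphi _; case: (hr _ (pr s se)).
 have [h _] := is_derive_line dp; apply: differentiable_continuous; apply/derivable1_diffP; exact: h.
have [|s sI ps] := @IVT R (phi \o p) (- (e * a)) (e * a) 0 ab cf.
 have h1 := est (- (e * a)); have h2 := est (e * a).
 move: h1 h2; rewrite normrN (gtr0_norm ea0) lexx => /(_ isT) + /(_ isT).
 rewrite !ler_norml => /andP[_ k1] /andP[k2 _].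
 apply/andP; split; [rewrite ge_min|rewrite le_max]; rewrite /=; lra.
have se : `|s| <= e * a by rewrite ler_norml.
exists a => //; exists (p s); split.
- have [Up _] := hr _ (pr s se); exact/(ldf_bd ldf Up).
- by apply: le_lt_trans (pn s se) (lt_le_trans am _); rewrite ge_min lexx orbT.
- by rewrite px addrAC subrr add0r enormZ nn mulr1.
Qed.

Lemma near_boundary (P : E -> Prop) : (\forall y \near within (boundary Om) (nbhs x), P y) <->
 exists2 r, 0 < r & forall y, boundary Om y -> enorm (y - x) < r -> P y.
split.
 by move=> /nbhs_enormP[r r0 hr]; exists r => // y b_y yx; exact: hr.
by move=> [r r0 hr]; apply/nbhs_enormP; exists r => // y yx b_y; exact: hr.
Qed.

Lemma mulmx_dot y L j : (y *m L) ord0 j = dot y (\row_i L i j).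
by rewrite mxE; apply: eq_bigr => i; rewrite mxE. Qed.

(** Two candidates agree on tangent directions, since these are approached along the boundary, and
    both annihilate the normal. Uniqueness identifies the value chosen by [xget] and compares
    Jacobians computed from different extensions. *)
Lemma tangential_jacobian_unique X L L' : is_tangential_jacobian Om X x L ->
 is_tangential_jacobian Om X x L' -> L = L'.
move=> [n1 j1] [n2 j2]; apply/matrixP => i j; apply/eqP; rewrite -subr_eq0.
pose D : E := \row_k (L k j - L' k j).
have nD : dot nu D = 0.
 have := congr1 (fun v : E => v ord0 j) (etrans n1 (esym n2)); rewrite !mulmx_dot => /eqP.
 rewrite -subr_eq0 => /eqP <-; rewrite -dotNr -dotDr; congr dot; apply: row_ext => k.
 by rewrite rowB !mxE.
have tD t : dot nu t = 0 -> dot t D = 0.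
 move=> nt; apply/eqP; rewrite -normr_eq0 eq_le normr_ge0 andbT.
 pose C := 2 * (enorm t + 1) + enorm D.
 apply: (@small_le _ _ _ C); last by rewrite /C addr_ge0 ?enorm_ge0 // mulr_ge0 // addr_ge0 // enorm_ge0.
 move=> e e0 e1; rewrite add0r.
 have /near_boundary[r1 r10 h1] := j1 e e0; have /near_boundary[r2 r20 h2] := j2 e e0.
 have q0 : 0 < Num.min r1 r2 by rewrite lt_min r10.
 have [a a0 [y [b_y yx ya]]] := boundary_approach nt e0 q0.
 move: yx; rewrite lt_min => /andP[yx1 yx2].
 have k1 := le_trans (coord_le_enorm _ j) (h1 y b_y yx1); have k2 := le_trans (coord_le_enorm _ j) (h2 y b_y yx2).
 have yD : `|dot (y - x) D| <= 2 * (e * enorm (y - x)).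
  have -> : dot (y - x) D = (X y - X x - (y - x) *m L') ord0 j - (X y - X x - (y - x) *m L) ord0 j.
   have -> : D = (\row_i L i j) - (\row_i L' i j) by apply: row_ext => k; rewrite !mxE.
   by rewrite dotDr dotNr !rowB !mulmx_dot; ring.
  by apply: le_trans (ler_normB _ _) _; lra.
 have yn : enorm (y - x) <= a * (enorm t + 1).
  have := ler_enormD (y - x - a *: t) (a *: t); rewrite subrK enormZ (gtr0_norm a0) => /le_trans; apply.
  have : e * a <= 1 * a by rewrite ler_pM2r // ltW.
  lra.
 have aD : `|a * dot t D| <= a * (e * C).
  have -> : a * dot t D = dot (y - x) D - dot (y - x - a *: t) D.
   by rewrite [dot (y - x - _) D]dotDl dotNl dotZl; ring.
  apply: le_trans (ler_normB _ _) _.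
  have := norm_dot_le (y - x - a *: t) D.
  have : enorm (y - x - a *: t) * enorm D <= e * a * enorm D by rewrite ler_wpM2r // enorm_ge0.
  have : e * enorm (y - x) <= e * (a * (enorm t + 1)) by rewrite ler_pM2l.
  have -> : a * (e * C) = 2 * (e * (a * (enorm t + 1))) + e * a * enorm D by rewrite /C; ring.
  lra.
 by move: aD; rewrite normrM (gtr0_norm a0) ler_pM2l.
have key v : dot v D = 0.
 have -> : v = dot nu v *: nu + (v - dot nu v *: nu) by rewrite addrC subrK.
 rewrite dotDl dotZl nD mulr0 add0r tD // dotDr dotNr dotZr nu1 mulr1 subrr //.
have := key (delta_mx ord0 i); rewrite /dot (bigD1 i) //= big1; last first.
 by move=> k ki; rewrite !mxE (negbTE ki) mul0r.
by rewrite !mxE !eqxx mul1r addr0 => ->.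
Qed.

(** For any differentiable extension [N] of the field, the full derivative with its normal part
    projected out. Dropping that part is harmless because increments along the boundary are
    tangential to first order. *)
Lemma tangential_jacobian_exists X (N : 'I_d.+2 -> E -> R) : (forall i, differentiable (N i) x) ->
 (exists2 r, 0 < r & forall y i, boundary Om y -> enorm (y - x) < r -> X y ord0 i = N i y) ->
 is_tangential_jacobian Om X x
  (\matrix_(j, i) (partial j (N i) x - nu ord0 j * dot nu (grad (N i) x))).
move=> dN [r0 r00 XN]; set L := \matrix_(j, i) _.
have LE y i : (y *m L) ord0 i = dot y (grad (N i) x) - dot nu y * dot nu (grad (N i) x).
 rewrite mulmx_dot /dot mulr_suml -sumrB; apply: eq_bigr => j _; rewrite !mxE.
 by rewrite mulrBr mulrA [y _ _ * nu _ _]mulrC.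
split; first by apply: row_ext => i; rewrite LE nu1 mul1r subrr mxE.
move=> e e0; apply/near_boundary.
pose B := 1 + \sum_i `|dot nu (grad (N i) x)|; have B0 : 0 < B by rewrite ltr_wpDr // sumr_ge0.
have m0 : (0 : R) < d.+2%:R by [].
pose e' := e / d.+2%:R / (2 * B); have e'0 : 0 < e' by rewrite !divr_gt0 // mulr_gt0.
have [r1 r10 h1] := boundary_tangent e'0.
have H i : exists2 r, 0 < r & forall y, enorm (y - x) < r -> `|N i y - N i x - dot (grad (N i) x) (y - x)| <= e' * enorm (y - x).
 exact: (diff_fdiff (dN i) e'0).
have [|r2 r20 h2] := finite_radius _ H; first by move=> i r s sr h y ys; apply: h; exact: lt_le_trans sr.
exists (Num.min r0 (Num.min r1 r2)); first by rewrite !lt_min r00 r10.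
move=> y b_y; rewrite !lt_min => /and3P[y0 y1 y2].
apply: le_trans (_ : d.+2%:R * (e / d.+2%:R * enorm (y - x)) <= _); last by rewrite mulrA [_ * (e / _)]mulrCA divff ?mulr1.
apply: enorm_le_coord => i.
rewrite !rowB LE (XN y i b_y y0) (XN x i bx) ?subrr ?enorm0 // opprB addrA addrAC.
apply: le_trans (ler_normD _ _) _; have k1 := h2 i y; rewrite dotC in k1.
have : `|dot nu (y - x) * dot nu (grad (N i) x)| <= e' * enorm (y - x) * (B - 1).
 rewrite normrM; apply: ler_pM => //; first exact: h1.
 by rewrite addrC addKr (bigD1 i) //= lerDl sumr_ge0.
have -> : e / d.+2%:R * enorm (y - x) = e' * enorm (y - x) + e' * enorm (y - x) * (B - 1) + e' * enorm (y - x) * B.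
 by rewrite /e'; field; rewrite gt_eqF //=.
have : 0 <= e' * enorm (y - x) * B.
 by apply: mulr_ge0; [apply: mulr_ge0; [exact: ltW|exact: enorm_ge0]|exact: ltW].
lra.
Qed.

Lemma tangential_divE X L : is_tangential_jacobian Om X x L -> tangential_div Om X x = \tr L.
move=> jL; rewrite /tangential_div; case: xgetP => [L' _ jL'|h]; last by case: (h L).
by rewrite (tangential_jacobian_unique jL jL').
Qed.

End tangent.

(** * The field ∇F(ν), its extension and the mean curvature *)

Section anisotropic_normal.
Variables (Om : set E) (oO : open Om) (bO : bounded_set Om) (sm : smooth_boundary Om).
Variables (F : E -> R) (el : smooth_elliptic_integrand F).
Local Notation f := (homext F).
Local Notation N0 := (~` [set (0 : E)]).
Implicit Types (x y : E) (g : E -> R) (N : 'I_d.+2 -> E -> R).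

Lemma ldf_grad_smooth U phi g x : local_defining_function Om x U phi -> smooth N0 g -> smooth U (g \o grad phi).
move=> [[oU _] sp gn _ _] sg k; apply: (@Ck_comp _ _ _ k U N0) => //; first by move=> y /gn/eqP.
move=> j; apply: (@Ck_ext _ _ k U (partial j phi) _ oU) => [y _|]; first by rewrite mxE.
exact: smooth_partial.
Qed.

Lemma normal_homog0 U phi g y : local_defining_function Om y U phi -> boundary Om y -> homog0 g ->
 g (outer_normal Om y) = g (grad phi y).
move=> l b_y hg; have g0 : grad phi y != 0 by case: l => [[_ Uy] _ h _ _]; exact: h.
by rewrite (outer_normalE b_y l) hg // invr_gt0 enorm_gt0.
Qed.

(** Since [g] ignores positive factors, the unnormalised gradient of a defining function may replace
    the normal, and [g \o grad phi] is a smooth local extension. *)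
Lemma normal_extension g : smooth N0 g -> homog0 g ->
 exists G, smooth setT G /\ forall y, boundary Om y -> G y = g (outer_normal Om y).
move=> sg hg; apply: smooth_extension; first exact: boundary_compact.
move=> x bx; have [U [phi l]] := sm bx; exists U, (g \o grad phi); have [[oU Ux] _ _ _ _] := l.
split=> //; first exact: (ldf_grad_smooth l sg).
by move=> y b_y Uy; rewrite (normal_homog0 (ldf_at l Uy) b_y hg).
Qed.

Definition transport N i x : R :=
 N i x * (\sum_j partial j (N j) x) - \sum_j N j x * partial j (N i) x.

Lemma transport_smooth N : (forall i, smooth setT (N i)) -> forall i, smooth setT (transport N i).
move=> sN i k; apply: (@Ck_ext _ _ k setT ((N i \* (fun x => \sum_j partial j (N j) x)) \+
 (cst (-1) \* (fun x => \sum_j N j x * partial j (N i) x))) _ openT) => [x _|]; first by rewrite /= mulN1r.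
apply: Ck_D; [exact: openT| |]; apply: Ck_M; try exact: openT.
- exact: sN.
- by apply: Ck_sum; [exact: openT|move=> j; exact: smooth_partial].
- exact: Ck_cst.
- apply: (@Ck_sum _ _ k setT _ _ (fun j x => N j x * partial j (N i) x)); first exact: openT.
 by move=> j; apply: Ck_M; [exact: openT|exact: sN|exact: smooth_partial].
Qed.

Lemma partial_sum (I : Type) (s : seq I) (G : I -> E -> R) i x : (forall j, differentiable (G j) x) ->
 differentiable (fun y => \sum_(j <- s) G j y) x /\
 partial i (fun y => \sum_(j <- s) G j y) x = \sum_(j <- s) partial i (G j) x.
move=> dG; elim: s => [|j s [IH1 IH2]].
 have -> : (fun y => \sum_(j <- [::]) G j y) = 0 by apply/funext => y; rewrite big_nil.
 by rewrite big_nil partial_cst.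
have -> : (fun y => \sum_(k <- j :: s) G k y) = G j \+ (fun y => \sum_(k <- s) G k y).
 by apply/funext => y; rewrite big_cons.
by rewrite big_cons partialD // IH2; split=> //; exact: differentiableD.
Qed.

(* The terms with second derivatives of [N] cancel by symmetry. *)
Lemma div_transport N x : (forall i, smooth setT (N i)) ->
 \sum_i partial i (transport N i) x =
 \sum_i \sum_j (partial i (N i) x * partial j (N j) x - partial i (N j) x * partial j (N i) x).
move=> sN; have dN i : differentiable (N i) x := smooth_diff (sN i) I.
have dP i j : differentiable (partial j (N i)) x := smooth_diff (smooth_partial j (sN i)) I.
have e1 i : partial i (transport N i) x =
  \sum_j (partial i (N i) x * partial j (N j) x - partial i (N j) x * partial j (N i) x) +
  \sum_j (N i x * partial i (partial j (N j)) x - N j x * partial j (partial i (N i)) x).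
 have [d1 p1] := partial_sum (index_enum 'I_d.+2) i (fun j => dP j j).
 have d2 j : differentiable (N j \* partial j (N i)) x by exact: differentiableM.
 have [d3 p3] := partial_sum (index_enum 'I_d.+2) i d2.
 have -> : transport N i = (N i \* (fun y => \sum_j partial j (N j) y)) \+
   (cst (-1) \* (fun y => \sum_j (N j \* partial j (N i)) y)).
  by apply/funext => y; rewrite /= mulN1r.
 rewrite partialD; [|exact: differentiableM|by apply: differentiableM].
 rewrite !partialM // p1 p3 partial_cst mulr0 addr0 mulN1r.
 rewrite !mulr_sumr !mulr_suml -!big_split -sumrN -big_split /=; apply: eq_bigr => j _.
 rewrite (@partialM _ _ (N j) (partial j (N i)) x i (dN j) (dP i j)) (schwarz i j openT (sN i 2%N) I).
 move: (partial i (partial j (N j)) x) (partial j (partial i (N i)) x) (partial j (N j) x) (partial i (N i) x)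
  (partial i (N j) x) (partial j (N i) x) (N i x) (N j x) => a b c e g h p q; ring.
rewrite (eq_bigr _ (fun i _ => e1 i)) big_split -[RHS]addr0; congr (_ + _).
under eq_bigr do rewrite sumrB.
by rewrite sumrB [X in _ - X]exchange_big subrr.
Qed.

(** The curvature is div N minus the normal part [k] of the derivative of [N]. What must be shown is
    that the vector with components Σ_i ∂_j N_i ν_i is the multiple [k] of ν; the second term of
    [transport] then contributes F(ν) [k]. *)
Lemma transport_normal N x : (forall i, smooth setT (N i)) ->
 (forall i y, boundary Om y -> N i y = partial i f (outer_normal Om y)) -> boundary Om x ->
 \sum_i transport N i x * outer_normal Om x ord0 i =
 f (outer_normal Om x) * anisotropic_mean_curvature F Om x.
move=> sN NE bx; have [U [phi l]] := sm bx; have [[oU Ux] sp gn _ _] := l.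
set nu := outer_normal Om x; set X := fun y => grad f (outer_normal Om y).
have dN i : differentiable (N i) x := smooth_diff (sN i) I.
have j1 : is_tangential_jacobian Om X x (\matrix_(j, i) (partial j (N i) x - nu ord0 j * dot nu (grad (N i) x))).
 by apply: (tangential_jacobian_exists bx l dN); exists 1 => // y i b_y _; rewrite mxE NE.
(* A second, local extension, through the gradient of a defining function. For it Σ_i ∂_j Q_i ν_i
   vanishes by homogeneity; equality of the tangential Jacobians transfers this to [N] up to a
   multiple of the normal. *)
pose Q i := partial i f \o grad phi.
have sQ i : smooth U (Q i) by apply: (ldf_grad_smooth l); exact: smooth_partial (homext_smooth el).
have dQ i := smooth_diff (sQ i) Ux.
have j2 : is_tangential_jacobian Om X x (\matrix_(j, i) (partial j (Q i) x - nu ord0 j * dot nu (grad (Q i) x))).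
 apply: (tangential_jacobian_exists bx l dQ); have [r r0 hr] := open_enorm oU Ux.
 exists r => // y i b_y /hr Uy; rewrite mxE /Q /=.
 exact: normal_homog0 (ldf_at l Uy) b_y (partial_homog0 el i).
have eL := tangential_jacobian_unique bx l j1 j2.
have g0 : grad phi x != 0 by exact: gn.
have nuE : nu = (enorm (grad phi x))^-1 *: grad phi x := outer_normalE bx l.
have Q0 j : \sum_i partial j (Q i) x * nu ord0 i = 0.
 have e1 i : partial j (Q i) x = \sum_k partial k (partial i f) (grad phi x) * partial j (partial k phi) x.
  have dg k : differentiable (fun y => grad phi y ord0 k) x.
   have -> : (fun y => grad phi y ord0 k) = partial k phi by apply/funext => y; rewrite mxE.
   exact: smooth_diff (smooth_partial k sp) Ux.
  have df := smooth_diff (smooth_partial i (homext_smooth el)) (punctured g0).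
  have [_ ->] := partial_comp j dg df; apply: eq_bigr => k _; congr (_ * partial j _ x).
  by apply/funext => y; rewrite mxE.
 under eq_bigr do rewrite e1 mulr_suml.
 rewrite exchange_big; apply: big1 => k _.
 transitivity (partial j (partial k phi) x * (enorm (grad phi x))^-1 * \sum_i partial k (partial i f) (grad phi x) * grad phi x ord0 i).
  rewrite mulr_sumr; apply: eq_bigr => i _; rewrite nuE rowZ.
  by move: (partial k _ _) (partial j _ x) (_^-1) (grad phi x ord0 i) => a b c e; ring.
 by rewrite (hess_radial el k g0) mulr0.
have Q1 : \sum_i dot nu (grad (Q i) x) * nu ord0 i = 0.
 under eq_bigr do rewrite mulr_suml.
 rewrite exchange_big; apply: big1 => j.
 transitivity (nu ord0 j * \sum_i partial j (Q i) x * nu ord0 i); last by rewrite Q0 mulr0.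
 by rewrite mulr_sumr; apply: eq_bigr => i; rewrite mxE mulrA.
pose k := \sum_i dot nu (grad (N i) x) * nu ord0 i.
have key j : \sum_i partial j (N i) x * nu ord0 i = nu ord0 j * k.
 have : \sum_i (partial j (N i) x - nu ord0 j * dot nu (grad (N i) x)) * nu ord0 i = 0.
  transitivity (\sum_i (partial j (Q i) x - nu ord0 j * dot nu (grad (Q i) x)) * nu ord0 i).
   by apply: eq_bigr => i; move/matrixP: eL => /(_ j i); rewrite !mxE => ->.
  under eq_bigr do rewrite mulrBl -mulrA.
  by rewrite sumrB Q0 -mulr_sumr Q1 mulr0 subrr.
 under eq_bigr do rewrite mulrBl -mulrA.
 by rewrite sumrB -mulr_sumr => /eqP; rewrite subr_eq0 => /eqP.
rewrite /anisotropic_mean_curvature (tangential_divE bx l j1) /mxtrace.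
have -> : \sum_i (\matrix_(j, i) (partial j (N i) x - nu ord0 j * dot nu (grad (N i) x))) i i = \sum_i partial i (N i) x - k.
 by rewrite -sumrB; apply: eq_bigr => i; rewrite mxE [dot _ _ * _]mulrC.
have n0 : nu != 0.
 by rewrite -enorm_gt0 (normal_unit sm bx).
have fE : \sum_j N j x * nu ord0 j = f nu.
 by rewrite -(homext_euler el n0); apply: eq_bigr => j; rewrite NE.
under eq_bigr do rewrite mulrBl mulrAC mulr_suml.
rewrite sumrB -mulr_suml fE exchange_big mulrBr; congr (_ - _).
rewrite -fE mulr_suml; apply: eq_bigr => j _.
by rewrite -mulrA -key mulr_sumr; apply: eq_bigr => i; rewrite mulrA.
Qed.

End anisotropic_normal.

(** * The identity for a field normal to the boundary *)

Section reilly.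
Variables (Om : set E) (oO : open Om) (bO : bounded_set Om) (sm : smooth_boundary Om).
Variables (F : E -> R) (el : smooth_elliptic_integrand F).
Local Notation f := (homext F).
Local Notation N0 := (~` [set (0 : E)]).
Variables (Du : E -> E) (D2 : 'I_d.+2 -> 'I_d.+2 -> E -> R).
Hypotheses (cDu : forall j, contin_on (closure Om) (fun x => Du x ord0 j))
 (wDu : forall i j, wder Om i (fun x => Du x ord0 j) (D2 i j)) (sD2 : forall i j, sqint Om (D2 i j))
 (normalDu : forall x, boundary Om x -> exists2 t, 0 <= t & Du x = t *: outer_normal Om x).
Implicit Types (x y : E) (i j l : 'I_d.+2).
Let mO := Om_measurable oO.
Let Oc : Om `<=` closure Om. Proof. exact: subset_closure. Qed.
Let cDuO j : contin_on Om (fun x => Du x ord0 j). Proof. exact: contin_on_sub (cDu j). Qed.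

Let X j x := flow F j (Du x).

Let cX j : contin_on (closure Om) (X j).
by apply: (@contin_on_comp R d.+1 d.+2 Du (flow F j)) => // x _; exact: flow_continuous. Qed.

Lemma closure_bound (g : E -> R) : contin_on (closure Om) g -> exists2 C, 0 <= C & forall x, closure Om x -> `|g x| <= C.
move=> cg; have [C hC] := contin_on_bounded (closure_compact bO) cg.
exists (Num.max C 0) => [|x cx]; first by rewrite le_max lexx orbT.
by rewrite le_max hC.
Qed.

Let S := [set x | Om x /\ Du x != 0].

Let oS : open S.
rewrite openE => x [Ox Dx]; have e0 : 0 < enorm (Du x) by rewrite enorm_gt0.
have [r r0 hr] := contin_on_row cDuO Ox e0; have [s s0 hs] := open_enorm oO Ox.
apply/nbhs_enormP; exists (Num.min r s); first by rewrite lt_min r0.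
move=> y; rewrite lt_min => /andP[yr ys]; have Oy := hs y ys; split=> //.
by apply: contraTneq (hr y Oy yr) => ->; rewrite sub0r enormN ltxx.
Qed.

(** The derivatives of the flow along [Du], set to zero where [Du] vanishes since the flow need not
    be differentiable there. The resulting [gX] is a formal chain rule, justified only after
    truncation. *)
Let kap l j := (fun x => partial l (flow F j) (Du x)) \_ S.

Lemma kap_measurable l j : measurable_fun (Om : set LT) (kap l j).
apply: measurable_funTS; apply: patch_measurable; first exact: open_leb.
apply: cont_meas; apply: (@contin_on_comp R d.+1 d.+2 Du (partial l (flow F j))) => [k|x [_ /punctured]].
 by apply: contin_on_sub (cDuO k) => x [].
by apply: smooth_for; exact: smooth_partial (flow_smooth el j).
Qed.

Let gX i j x := \sum_l D2 i l x * kap l j x.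

Lemma gX_sqint i j : sqint Om (gX i j).
have [C C0 hC] := flow_partial_bounded el.
apply: (sqint_sum oO bO) => l; apply: (sqint_mulb oO (C := C) (sD2 i l) (kap_measurable l j)).
move=> x _; rewrite /kap /patch; case: ifPn => [/set_mem[_ x0]|_]; first exact: hC.
by rewrite normr0 ltW.
Qed.

(** Truncation makes the outer function smooth, so [wder_comp] applies. Where [Du] vanishes both
    sides are zero, because the truncated flow is constant near the origin. *)
Lemma trunc_flow_wder k i j : wder Om i (trunc (rad k) \o X j) (fun x => dtrunc (rad k) (X j x) * gX i j x).
have H l : exists2 C, 0 <= C & forall x, closure Om x -> `|Du x ord0 l| <= C by exact: closure_bound.
pose B := \sum_l s2val (cid2 (H l)).
have B0 : 0 <= B by apply: sumr_ge0 => l _; exact: (s2valP (cid2 (H l))).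
have DB x l : Om x -> `|Du x ord0 l| <= B.
 move=> Ox; apply: le_trans (s2valP' (cid2 (H l)) x (Oc Ox)) _.
 by rewrite /B (bigD1 l) //= lerDl sumr_ge0 // => p _; exact: (s2valP (cid2 (H p))).
have sG := trunc_homog1_smooth k (flow_homog1 el j) (flow_smooth el j).
apply: (wder_ext oO (@wder_comp R d.+1 Om oO bO d.+1 Du (D2 i) i (trunc (rad k) \o flow F j) B B0 sG (wDu i) cDuO DB)).
move=> x Ox; rewrite mulr_sumr; apply: eq_bigr => l.
have [D0|D0] := eqVneq (Du x) 0.
 have X0 : X j x = 0 by rewrite /X D0 (homog1_0 (flow_homog1 el j)).
 have -> : dtrunc (rad k) (X j x) = 0 by rewrite X0 dtrunc0 ?rad_gt0 // normr0 ltW // rad_gt0.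
 rewrite mul0r D0 (@partial_near _ _ _ (cst 0)) ?partial_cst ?mulr0 //.
 have [r r0 hr] := (cont_enormP (flow F j) 0).1 (@flow_continuous _ _ _ el j 0) _ (rad_gt0 k).
 apply/nbhs_enormP; exists r => // y /hr; rewrite (homog1_0 (flow_homog1 el j)) sub0r normrN => /ltW h.
 by rewrite /= trunc0 // rad_gt0.
have df := smooth_diff (flow_smooth el j) (punctured D0).
have [_ ->] := partial_comp1 l (is_derive_trunc (rad k) (flow F j (Du x))) df.
by rewrite /kap /patch mem_set // mulrCA.
Qed.

Let DX i j x := (X j x != 0)%:R * gX i j x.

Lemma flow_wder i j : wder Om i (X j) (DX i j).
have [C C0 hC] := closure_bound (cX j); have cXO := contin_on_sub Oc (cX j).
apply: wder_trunc => // [||k]; last exact: trunc_flow_wder.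
 by apply: (sqint_integrable oO bO); apply: (sqint_bounded oO bO (C := C) cXO) => x /Oc; exact: hC.
exact: (sqint_integrable oO bO (gX_sqint i j)).
Qed.

Lemma DX_sqint i j : sqint Om (DX i j).
have [_ iD _] := flow_wder i j; have := itg_meas iD; split=> //.
have [_ iG] := gX_sqint i j; apply: (itg_le mO _ _ iG) => [|x _].
 by exact: measurable_funM.
rewrite exprMn normrM !normrX -[X in _ <= X]real_normK ?num_real // ler_piMl //.
by case: (_ != 0); rewrite ?normr1 ?normr0 ?expr0n.
Qed.

(** The weak Jacobian of the anisotropic gradient is produced rather than assumed, together with the
    integrability that later allows another Jacobian, equal almost everywhere, to be substituted. *)
Lemma reilly_identity : exists DX : 'I_d.+2 -> 'I_d.+2 -> E -> R,
 [/\ forall i j, wder Om i (fun x => flow F j (Du x)) (DX i j),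
  Ritg mu Om (fun x => quad (\matrix_(i, j) DX i j x)),
  Ritg sigma (boundary Om) (fun x => anisotropic_mean_curvature F Om x * f (Du x) ^+ 2 * f (outer_normal Om x)) &
  \int[mu]_(x in Om) quad (\matrix_(i, j) DX i j x) =
  \int[sigma]_(x in boundary Om) (anisotropic_mean_curvature F Om x * f (Du x) ^+ 2 * f (outer_normal Om x))].
have HN i := cid (normal_extension bO sm (smooth_partial i (homext_smooth el)) (partial_homog0 el i)).
pose N i := sval (HN i).
have sN i : smooth setT (N i) by case: (svalP (HN i)).
have NE i y : boundary Om y -> N i y = partial i f (outer_normal Om y) by case: (svalP (HN i)) => _; exact.
(* The vector ν/F(ν) has product one with ∇F(ν) by Euler's relation. Hence [w], linear in [X] with
   smooth coefficients and therefore weakly differentiable, takes the value F(Du) on the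
   boundary. *)
have Ha i : exists G, smooth setT G /\ forall y, boundary Om y -> G y = (fun p : E => p ord0 i / f p) (outer_normal Om y).
 apply: (@normal_extension Om bO sm (fun p : E => p ord0 i / f p)).
  move=> k; apply: Ck_M; [exact: punctured_open|exact: Ck_coord|apply: Ck_V; first exact: punctured_open].
   by move=> p /eqP p0; rewrite gt_eqF // (homext_gt0 el).
  exact: homext_smooth.
 move=> t p t0 p0; rewrite rowZ (homext_homog1 F) // invfM mulrACA divff ?mul1r // gt_eqF //.
pose a i := sval (cid (Ha i)).
have sa i : smooth setT (a i) by case: (svalP (cid (Ha i))).
have aE i y : boundary Om y -> a i y = outer_normal Om y ord0 i / f (outer_normal Om y) by case: (svalP (cid (Ha i))) => _; exact.
clearbody N a.
pose w x := \sum_j X j x * a j x.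
pose gw i x := \sum_j (X j x * partial i (a j) x + DX i j x * a j x).
have ww i : wder Om i w (gw i) by apply: wder_sum => // j; apply: wderM => //; exact: flow_wder.
have cw : contin_on (closure Om) w.
 apply: contin_sum => j; apply: contin_onM; first exact: cX.
 by exact: smooth_contin_on.
have [Cw Cw0 hCw] := closure_bound cw.
have cwO := contin_on_sub Oc cw; have hCwO x : Om x -> `|w x| <= Cw by move=> /Oc; exact: hCw.
have sw : sqint Om w by exact: (sqint_bounded oO bO cwO hCwO).
have sX j : sqint Om (X j).
 have [C C0 hC] := closure_bound (cX j).
 by apply: (sqint_bounded oO bO (C := C) (contin_on_sub Oc (cX j))) => x /Oc; exact: hC.
have sgw i : sqint Om (gw i).
 apply: (sqint_sum oO bO) => j.
 exact: (sqint_add oO (sqint_smooth oO bO (sX j) (smooth_partial i (sa j))) (sqint_smooth oO bO (DX_sqint i j) (sa j))).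
pose T i j x := w x * partial i (N j) x + gw i x * N j x.
have wT i j : wder Om i (fun x => w x * N j x) (T i j) by exact: wderM.
have sT i j : sqint Om (T i j).
 exact: (sqint_add oO (sqint_smooth oO bO sw (smooth_partial i (sN j))) (sqint_smooth oO bO (sgw i) (sN j))).
have wb x : boundary Om x -> w x = f (Du x) /\ forall j, X j x = w x * N j x.
 move=> bx; have [t t0 DuE] := normalDu bx.
 have n0 : outer_normal Om x != 0 by rewrite -enorm_gt0 (normal_unit sm bx).
 have XE j : X j x = f (Du x) * N j x by rewrite /X DuE flow_ray // NE.
 have wE : w x = f (Du x).
  transitivity (f (Du x) / f (outer_normal Om x) * \sum_j partial j f (outer_normal Om x) * outer_normal Om x ord0 j).
   by rewrite mulr_sumr; apply: eq_bigr => j _; rewrite XE NE // aE //; ring.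
  by rewrite (homext_euler el n0) divfK // gt_eqF // (homext_gt0 el).
 by split=> // j; rewrite wE.
(* The polarised form is applied to the difference [Z] and the sum [Y] of the two fields; only [Z]
   has to vanish on the boundary. *)
pose Z j x := X j x - w x * N j x; pose Y j x := X j x + w x * N j x.
have wN' i j : wder Om i (fun x => w x * N j x * cst (-1) x) (fun x => - T i j x).
 apply: (wder_ext oO (wderM oO bO (wT i j) (fun k => Ck_cst k setT (-1)))) => x _.
 by rewrite partial_cst mulr0 add0r mulrN1.
have wZ i j : wder Om i (Z j) (fun x => DX i j x + - T i j x).
 have -> : Z j = fun x => X j x + w x * N j x * (-1) x by apply/funext => x; rewrite /= mulrN1.
 by apply: wderD => //; exact: flow_wder.
have wY i j : wder Om i (Y j) (fun x => DX i j x + T i j x) by apply: wderD => //; exact: flow_wder.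
have sZ i j : sqint Om (fun x => DX i j x + - T i j x).
 apply: (sqint_add oO (DX_sqint i j)).
 have -> : (fun x => - T i j x) = fun x => T i j x * (-1) by apply/funext => x; rewrite mulrN1.
 exact: (sqint_smooth oO bO (sT i j) (fun k => Ck_cst k setT (-1))).
have sY i j : sqint Om (fun x => DX i j x + T i j x) by exact: (sqint_add oO (DX_sqint i j) (sT i j)).
have cZ j : contin_on (closure Om) (Z j).
 apply: contin_onD; first exact: cX.
 apply: contin_onN; apply: contin_onM => //; exact: smooth_contin_on.
have Z0 j x : closure Om x -> ~ Om x -> Z j x = 0.
 move=> cx nO; have bx : boundary Om x by rewrite (boundary_open oO).
 by rewrite /Z (wb x bx).2 subrr.
pose AX x : 'M[R]_d.+2 := \matrix_(i, j) DX i j x; pose AT x : 'M[R]_d.+2 := \matrix_(i, j) T i j x.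
have curl i j : \int[mu]_(x in Om) ((DX i i x + - T i i x) * (DX j j x + T j j x)) =
  \int[mu]_(x in Om) ((DX j i x + - T j i x) * (DX i j x + T i j x)).
 have [C C0 hC] := closure_bound (cZ i).
 exact: (@curl_vanishing R d.+1 Om oO bO (Z i) (Y j) (fun p x => DX p i x + - T p i x) (fun p x => DX p j x + T p j x) C i j
  (cZ i) (fun x Ox => hC x (Oc Ox)) C0 (Z0 i) (fun p => wZ p i) (fun p => sZ p i) (fun p => wY p j) (fun p => sY p j)).
have ip i j k l : Ritg mu Om (fun x => (DX i j x + - T i j x) * (DX k l x + T k l x)).
 exact: (sqint_itgM oO (sZ i j) (sY k l)).
have ipp i j : Ritg mu Om (fun x => (DX i i x + - T i i x) * (DX j j x + T j j x) - (DX j i x + - T j i x) * (DX i j x + T i j x)).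
 exact: itgB.
have [iD eD] : Ritg mu Om (fun x => quad (AX x) - quad (AT x)) /\
  \int[mu]_(x in Om) (quad (AX x) - quad (AT x)) = 0.
 have -> : (fun x => quad (AX x) - quad (AT x)) = fun x => \sum_i \sum_j ((DX i i x + - T i i x) * (DX j j x + T j j x) - (DX j i x + - T j i x) * (DX i j x + T i j x)).
  apply/funext => x; rewrite quad_sub; apply: eq_bigr => i _; apply: eq_bigr => j.
  by rewrite !mxE.
 have in1 i := Rintegral_sum mO (index_enum 'I_d.+2) (ipp i).
 have [h1 h2] := Rintegral_sum mO (index_enum 'I_d.+2) (fun i => (in1 i).1).
 split=> //; rewrite h2; apply: big1 => i _; rewrite (in1 i).2; apply: big1 => j.
 by rewrite RintegralB // curl subrr.
pose h x := w x ^+ 2; pose gh i x := 2 * w x * gw i x.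
have wh i : wder Om i h (gh i) by exact: (wder_sqr oO bO cwO hCwO Cw0 (ww i)).
have ch : contin_on (closure Om) h.
 by exact: contin_onM.
have sV := transport_smooth sN.
have QT x : quad (AT x) = divd h gh (transport N) x.
 have -> : divd h gh (transport N) x = 2 * w x * (\sum_i gw i x * transport N i x) + w x ^+ 2 * \sum_i partial i (transport N i) x.
  rewrite [2 * w x * _]mulr_sumr [w x ^+ 2 * _]mulr_sumr -big_split; apply: eq_bigr => i.
  by rewrite mulrA.
 rewrite div_transport // quadE.
 pose P i j := partial i (N j) x.
 (* In the expansion of [quad (AT x)] the terms quadratic in [gw] cancel. The terms linear in [gw]
    pair it with [transport], twice by symmetry in the indices, and the remaining ones are the
    divergence of [transport]. *)
 transitivity (\sum_i \sum_j (w x * (gw i x * (N i x * P j j - N j x * P j i))) + \sum_i \sum_j (w x * (gw j x * (N j x * P i i - N i x * P i j))) +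
   \sum_i \sum_j (w x ^+ 2 * (P i i * P j j - P i j * P j i))).
  rewrite -!big_split; apply: eq_bigr => i _; rewrite -!big_split /=; apply: eq_bigr => j _.
  rewrite !mxE /T -!/(P _ _); move: (P i i) (P j j) (P i j) (P j i) (w x) (gw i x) (gw j x) (N i x) (N j x).
  by move=> p1 p2 p3 p4 p5 p6 p7 p8 p9; ring.
 have e1 : \sum_i \sum_j (w x * (gw i x * (N i x * P j j - N j x * P j i))) = w x * \sum_i gw i x * transport N i x.
  by rewrite mulr_sumr; apply: eq_bigr => i; rewrite -mulr_sumr -mulr_sumr sumrB -mulr_sumr.
 rewrite [X in _ + X + _]exchange_big; congr (_ + _).
  lra.
 by rewrite mulr_sumr; apply: eq_bigr => i; rewrite mulr_sumr.
have iT : Ritg mu Om (fun x => quad (AT x)).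
 have -> : (fun x => quad (AT x)) = divd h gh (transport N) by apply/funext => x.
 exact: (divd_itg oO bO wh sV).
have flux x : boundary Om x -> fluxd Om h (transport N) x =
  anisotropic_mean_curvature F Om x * f (Du x) ^+ 2 * f (outer_normal Om x).
 move=> bx; rewrite /fluxd (transport_normal sm el sN NE bx) /h (wb x bx).1.
 lra.
have iF := fluxd_integrable bO sm ch sV.
exists DX; split; first exact: flow_wder.
- have := itgD mO iD iT.
 by rewrite (_ : (fun x => quad (AX x) - quad (AT x) + quad (AT x)) = fun x => quad (AX x)) //; apply/funext => x; rewrite subrK.
- apply: eq_integrable iF => //; first exact: boundary_measurable.
 by move=> x /set_mem bx; rewrite /= flux.
transitivity (\int[mu]_(x in Om) (quad (AX x) - quad (AT x) + quad (AT x))).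
 by apply: eq_Rintegral => x; rewrite subrK.
rewrite RintegralD // eD add0r.
transitivity (divI Om h gh (transport N)); first by apply: eq_Rintegral => x.
rewrite (divergence_theorem oO bO sm ch wh sV).
by apply: eq_Rintegral => x /set_mem; exact: flux.
Qed.

End reilly.

(** * The sign of the torsion potential *)

Section torsion_sign.
Variables (Om : set E) (oO : open Om) (bO : bounded_set Om).
Variables (u : E -> R) (Du : E -> E).
Hypotheses (cDu : forall j, contin_on (closure Om) (fun x => Du x ord0 j)) (h10 : sobolevH10 Om u Du).
Implicit Types (x y : E) (i j : 'I_d.+2).
Let mO := Om_measurable oO.
Let Oc : Om `<=` closure Om. Proof. exact: subset_closure. Qed.

Let su : sqint Om u. Proof. by case: h10 => -[]. Qed.
Let sDu i : sqint Om (fun x => Du x ord0 i). Proof. have [[_ h _] _] := h10; exact: (h i). Qed.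

Lemma test_sqint a : smooth setT a -> sqint Om a.
move=> sa; have [C _ hC] := smooth_bounded_Om bO sa.
by apply: (sqint_bounded oO bO _ hC); exact: smooth_contin_on.
Qed.

Lemma sqint_sub f g : sqint Om f -> sqint Om g -> sqint Om (fun x => f x - g x).
move=> sf sg; have -> : (fun x => f x - g x) = fun x => f x + g x * (-1) by apply/funext => x; rewrite mulrN1.
apply: (sqint_add oO sf); exact: (sqint_smooth oO bO sg (fun k => Ck_cst k setT (-1))).
Qed.

(** The integrand of the squared H¹ distance between a smooth function and a pair of a function with
    its weak gradient. *)
Definition gap (v : E -> R) (Dv : E -> E) (phi : E -> R) x : R := (phi x - v x) ^+ 2 + enorm (grad phi x - Dv x) ^+ 2.

Lemma gapE (v : E -> R) (Dv : E -> E) (phi : E -> R) x : gap v Dv phi x = (phi x - v x) ^+ 2 + \sum_i (partial i phi x - Dv x ord0 i) ^+ 2.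
by rewrite /gap enorm_sqr; congr (_ + _); apply: eq_bigr => i; rewrite rowB mxE. Qed.

Lemma gap_integrable (v : E -> R) (Dv : E -> E) (phi : E -> R) : sqint Om v -> (forall i, sqint Om (fun x => Dv x ord0 i)) -> smooth setT phi ->
 Ritg mu Om (gap v Dv phi).
move=> sv sDv sp; have -> : gap v Dv phi = fun x => (phi x - v x) ^+ 2 + \sum_i (partial i phi x - Dv x ord0 i) ^+ 2.
 by apply/funext => x; exact: gapE.
apply: (itgD mO); first by case: (sqint_sub (test_sqint sp) sv).
apply: (Rintegral_sum mO (index_enum 'I_d.+2) (fun i => _)).1.
by move=> i; case: (sqint_sub (test_sqint (smooth_partial i sp)) (sDv i)).
Qed.

Let phi := sval (cid h10.2).
Let tphi k : test_function Om (phi k). Proof. exact: (svalP (cid h10.2)).1. Qed.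
Let sphi k : smooth setT (phi k). Proof. by case: (tphi k). Qed.
Let rk k := \int[mu]_(x in Om) gap u Du (phi k) x.

Let rk_cvg : rk @ \oo --> 0.
apply: fine_cvg; exact: (svalP (cid h10.2)).2.
Qed.

Let gap_cvg (w : nat -> E -> R) (C : R) : (forall k, Ritg mu Om (w k)) ->
 (forall k x, Om x -> 0 <= w k x <= C * gap u Du (phi k) x) ->
 (fun k => \int[mu]_(x in Om) w k x) @ \oo --> 0.
move=> iw H; apply: (@squeeze_cvgr _ _ _ _ (fun=> 0) (fun k => C * rk k)).
- apply: nearW => k; apply/andP; split; first by apply: Rintegral_ge0 => x /(H k)/andP[].
 have ig := gap_integrable su sDu (sphi k).
 rewrite /rk -RintegralZl //; apply: le_Rintegral => //; first exact: itgZ.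
 by move=> x /(H k)/andP[].
- exact: cvg_cst.
- by rewrite -[X in _ --> X](mulr0 C); apply: cvgMr; exact: rk_cvg.
Qed.

Let gap_pair f (g_ : nat -> E -> R) (C : R) b : (forall k, sqint Om (g_ k)) -> sqint Om f ->
 (forall k x, Om x -> (g_ k x - f x) ^+ 2 <= C * gap u Du (phi k) x) -> sqint Om b ->
 (fun k => \int[mu]_(x in Om) (g_ k x * b x)) @ \oo --> \int[mu]_(x in Om) (f x * b x).
move=> sg sf H sb; have s1 k := sqint_sub (sg k) sf.
have gc : (fun k => \int[mu]_(x in Om) ((g_ k x - f x) ^+ 2)) @ \oo --> 0.
 by apply: (@gap_cvg _ C) => [k|k x Ox]; [case: (s1 k)|rewrite sqr_ge0 H].
have := @L2_weak_cvg _ _ _ mu Om mO (fun k x => g_ k x - f x) b (fun k => (s1 k).1) (fun k => (s1 k).2) sb.1 sb.2 gc.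
move=> /(cvgD (cvg_cst (\int[mu]_(x in Om) (f x * b x)))); rewrite addr0; apply: cvg_trans.
apply: near_eq_cvg; apply: nearW => k.
have := sqint_itgM oO sf sb.
transitivity (\int[mu]_(x in Om) (f x * b x) + \int[mu]_(x in Om) ((g_ k x - f x) * b x)); first by [].
rewrite -RintegralD //; last exact: (sqint_itgM oO (s1 k) sb).
by apply: eq_Rintegral => x; rewrite mulrBl addrC subrK.
Qed.

Let gap_u v Dv p x : (p x - v x) ^+ 2 <= gap v Dv p x.
by rewrite /gap lerDl sqr_ge0. Qed.

Let gap_Du v (Dv : E -> E) p i x : (partial i p x - Dv x ord0 i) ^+ 2 <= gap v Dv p x.
rewrite gapE; apply: ler_wpDl; first exact: sqr_ge0.
by rewrite (bigD1 i) //= lerDl sumr_ge0 // => j _; exact: sqr_ge0.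
Qed.

Lemma test_parts p a i : test_function Om p -> smooth setT a ->
 \int[mu]_(x in Om) (partial i p x * a x) = - \int[mu]_(x in Om) (p x * partial i a x).
move=> tp sa; have tpi := test_partial i tp; have sai := smooth_partial i sa.
have i1 : Ritg mu Om (fun x => partial i p x * a x).
 exact: (sqint_itgM oO (test_sqint tpi.1) (test_sqint sa)).
have i2 : Ritg mu Om (fun x => p x * partial i a x).
 exact: (sqint_itgM oO (test_sqint tp.1) (test_sqint sai)).
apply/eqP; rewrite -subr_eq0 opprK -RintegralD //; apply/eqP.
have := integral_partial i (bumpM (test_bump tp) sa).
have pE x : partial i (fun y => p y * a y) x = partial i p x * a x + p x * partial i a x.
 by rewrite (partialM i (smooth_diff tp.1 I) (smooth_diff sa I)) addrC mulrC.
have -> : partial i (fun y => p y * a y) = fun x => partial i p x * a x + p x * partial i a x by apply/funext.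
by rewrite -(Rintegral_supp (A := Om)) // => x nO; rewrite (test_outside tpi nO) (test_outside tp nO) !mul0r addr0.
Qed.

(** The smooth function [a] may be nonzero on the boundary: the approximating test functions vanish
    there, and both sides pass to the limit. *)
Lemma H10_parts a i : smooth setT a ->
 \int[mu]_(x in Om) (Du x ord0 i * a x) = - \int[mu]_(x in Om) (u x * partial i a x).
move=> sa; have sai := smooth_partial i sa.
have c1 := @gap_pair _ _ 1 _ (fun k => test_sqint (smooth_partial i (sphi k))) (sDu i)
 (fun k x _ => ltac:(rewrite mul1r; exact: gap_Du)) (test_sqint sa).
have c2 := @gap_pair _ _ 1 _ (fun k => test_sqint (sphi k)) su
 (fun k x _ => ltac:(rewrite mul1r; exact: gap_u)) (test_sqint sai).
have E1 : (fun k => \int[mu]_(x in Om) (partial i (phi k) x * a x)) = fun k => - \int[mu]_(x in Om) (phi k x * partial i a x).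
 by apply/funext => k; exact: test_parts.
rewrite E1 in c1.
exact: (cvg_unique (@norm_hausdorff _ _) c1 (cvgN c2)).
Qed.

Lemma H10_curl a i j : smooth setT a ->
 \int[mu]_(x in Om) (Du x ord0 i * partial j a x) = \int[mu]_(x in Om) (Du x ord0 j * partial i a x).
move=> sa; rewrite !H10_parts; try exact: smooth_partial.
have -> // : partial i (partial j a) = partial j (partial i a).
by apply/funext => x; exact: (schwarz i j openT (sa 2%N) I).
Qed.

(* [Theta (u)] has smaller energy than [u] unless [u <= 0]. *)
Let c0 : R := (4`!%:R)^-1.
Definition Theta (t : R) : R := t - c0 * flat 0 t.
Definition dTheta (t : R) : R := 1 - c0 * flat 2 t.

Let c00 : 0 < c0. Proof. by rewrite invr_gt0. Qed.

Lemma is_derive_Theta t : is_derive t (1 : R) Theta (dTheta t).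
have d1 := is_deriveZ c0 (is_derive_flat 0 t); rewrite mul0r subr0 in d1.
exact: (is_deriveB (is_derive_id t 1) d1).
Qed.

(** The constant [c0] is the inverse of the bound 4! on [flat 2], which keeps the derivative
    nonnegative. *)
Lemma dTheta_itv t : 0 <= dTheta t <= 1.
rewrite subr_ge0 lerBlDr lerDl mulr_ge0 ?(ltW c00) ?flat_ge0 //.
by rewrite mulrC ler_pdivrMr // mul1r flat_bounded.
Qed.

Lemma Theta_lip a b : `|Theta b - Theta a| <= `|b - a|.
rewrite -[leRHS]mul1r; apply: lipschitz_of_derive (is_derive_Theta) _ => t.
by have /andP[h1 h2] := dTheta_itv t; rewrite ger0_norm.
Qed.

Let Lp : R := 6`!%:R + 2 * 5`!%:R.
Lemma dTheta_lip a b : `|dTheta b - dTheta a| <= Lp * `|b - a|.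
have dd t : is_derive t (1 : R) dTheta (- (c0 * (flat 4 t - 2 * flat 3 t))).
 have d1 := is_deriveZ c0 (is_derive_flat 2 t).
 by apply: (is_derive_eq (is_deriveB (is_derive_cst (1 : R) t 1) d1)); rewrite sub0r.
apply: lipschitz_of_derive => t; rewrite normrN normrM (gtr0_norm c00).
have c1 : c0 <= 1 by rewrite invf_le1 // ler1n.
apply: le_trans (ler_wpM2r (normr_ge0 _) c1) _; rewrite mul1r.
apply: le_trans (ler_normB _ _) _; rewrite normrM !ger0_norm ?flat_ge0 //.
by apply: lerD; [exact: flat_bounded|rewrite ler_wpM2l // flat_bounded].
Qed.

Lemma Theta0 : Theta 0 = 0. Proof. by rewrite /Theta flat_le0 // mulr0 subr0. Qed.

Lemma Theta_smooth (p : E -> R) : smooth setT p -> smooth setT (Theta \o p).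
move=> sp k; apply: (@Ck_ext _ _ k setT (p \+ (cst (- c0) \* (flat 0 \o p))) _ openT) => [x _|].
 by rewrite /= mulNr.
apply: Ck_D; [exact: openT|exact: sp|apply: Ck_M; [exact: openT|exact: Ck_cst|]].
by apply: Ck_comp1; [exact: openT|exact: ck1_flat|exact: sp].
Qed.

Lemma partial_Theta (p : E -> R) x i : smooth setT p -> partial i (Theta \o p) x = dTheta (p x) * partial i p x.
by move=> sp; rewrite (partial_comp1 i (is_derive_Theta _) (smooth_diff sp I)).2. Qed.

Lemma Theta_test (p : E -> R) : test_function Om p -> test_function Om (Theta \o p).
move=> [sp [K [cK KO p0]]]; split; first exact: Theta_smooth.
by exists K; split=> // x /p0 /= ->; rewrite Theta0.
Qed.

Lemma Theta_continuous : continuous Theta.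
by move=> t; exact: is_derive_continuous (is_derive_Theta t). Qed.

Lemma dTheta_continuous : continuous dTheta.
move=> t; apply: cvgB; first exact: cvg_cst.
by apply: cvgMr; apply: (ck1_continuous (ck1_flat 0 2)).
Qed.

Let Tu x := Theta (u x).
Let DTu x : E := dTheta (u x) *: Du x.

Lemma sqint_comp_lip h f : continuous h -> (forall t, `|h t| <= `|t|) -> sqint Om f -> sqint Om (h \o f).
move=> ch hh [mf iF]; have : measurable_fun (Om : set LT) (h \o f).
 by apply: measurableT_comp mf; exact: continuous_measurable_fun.
split=> //; apply: (itg_le mO _ _ iF) => [|x _].
 by exact: measurable_funM.
by rewrite normrX -[X in _ <= X]real_normK ?num_real // lerXn2r //=.
Qed.

Let mdT : measurable_fun (Om : set LT) (fun x => dTheta (u x)).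
by apply: measurableT_comp su.1; apply: continuous_measurable_fun; exact: dTheta_continuous. Qed.

Let dT1 t : `|dTheta t| <= 1.
by have /andP[h1 h2] := dTheta_itv t; rewrite ger0_norm. Qed.

Let sTu : sqint Om Tu.
apply: sqint_comp_lip su; first exact: Theta_continuous.
by move=> t; have := Theta_lip 0 t; rewrite Theta0 !subr0.
Qed.

Let sDTu i : sqint Om (fun x => DTu x ord0 i).
have -> : (fun x => DTu x ord0 i) = fun x => Du x ord0 i * dTheta (u x) by apply/funext => x; rewrite rowZ mulrC.
exact: (sqint_mulb oO (sDu i) mdT (fun x _ => dT1 _)).
Qed.

Lemma Du_bounded : exists2 B, 0 <= B & forall x, Om x -> enorm (Du x) <= B.
have ce : contin_on (closure Om) (@enorm R d.+2 \o Du).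
 by apply: contin_on_comp => // x _; exact: enorm_continuous.
have [B B0 hB] := closure_bound bO ce; exists B => // x /Oc /hB.
by rewrite ger0_norm // enorm_ge0.
Qed.

(** The gradients differ by dTheta(p) times the old difference plus a change of dTheta times [Du].
    The second term is controlled by [p - u] because dTheta is Lipschitz and [Du] is bounded, being
    continuous up to the boundary. *)
Let gap_Theta : exists2 C, 0 <= C & forall k x, Om x -> gap Tu DTu (Theta \o phi k) x <= C * gap u Du (phi k) x.
have [B B0 hB] := Du_bounded; have Lp0 : 0 <= Lp by rewrite addr_ge0 // mulr_ge0.
exists (1 + 2 * (Lp * B) ^+ 2 + 2) => [|k x Ox]; first by rewrite !addr_ge0 // mulr_ge0 // sqr_ge0.
set p := phi k x; set G := grad (phi k) x - Du x.
have vE : grad (Theta \o phi k) x - DTu x = dTheta p *: G + (dTheta p - dTheta (u x)) *: Du x.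
 apply: row_ext => i; rewrite rowB rowD !rowZ mxE partial_Theta // rowB [grad _ _ _ _]mxE; ring.
have nv : enorm (grad (Theta \o phi k) x - DTu x) <= enorm G + Lp * B * `|p - u x|.
 rewrite vE; apply: le_trans (ler_enormD _ _) _; rewrite !enormZ; apply: lerD.
  by rewrite ler_piMl // enorm_ge0.
 have := ler_pM (normr_ge0 _) (enorm_ge0 _) (dTheta_lip (u x) p) (hB x Ox).
 lra.
have s1 : enorm (grad (Theta \o phi k) x - DTu x) ^+ 2 <= (enorm G + Lp * B * `|p - u x|) ^+ 2.
 by rewrite lerXn2r ?nnegrE ?enorm_ge0 // addr_ge0 ?enorm_ge0 // mulr_ge0 // mulr_ge0.
have s2 : (Theta p - Theta (u x)) ^+ 2 <= (p - u x) ^+ 2.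
 by rewrite -[X in X <= _]real_normK ?num_real // -[X in _ <= X]real_normK ?num_real // lerXn2r // Theta_lip.
have s3 : (enorm G + Lp * B * `|p - u x|) ^+ 2 <= 2 * enorm G ^+ 2 + 2 * (Lp * B) ^+ 2 * (p - u x) ^+ 2.
 rewrite -[(p - u x) ^+ 2]real_normK ?num_real //.
 have := sqr_ge0 (enorm G - Lp * B * `|p - u x|).
 move: (enorm G) (Lp * B) `|p - u x| => g' l' q'.
 have -> : 2 * l' ^+ 2 * q' ^+ 2 = 2 * (l' * q') ^+ 2 by ring.
 lra.
rewrite /gap -/p -/G /= -/p; have := sqr_ge0 (p - u x); have := sqr_ge0 (enorm G); have := sqr_ge0 (Lp * B).
move: s1 s2 s3; move: (enorm (_ - DTu x) ^+ 2) ((Theta p - _) ^+ 2) ((_ + _) ^+ 2) (enorm G ^+ 2) ((p - u x) ^+ 2) ((Lp * B) ^+ 2).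
move=> a1 a2 a3 g2 q2 l2 h2 h3 l0 g0 q0.
have : 0 <= l2 * g2 by rewrite mulr_ge0.
lra.
Qed.

Lemma Theta_H10 : sobolevH10 Om Tu DTu.
have [C C0 hC] := gap_Theta.
have iT k := gap_integrable sTu sDTu (Theta_smooth (sphi k)).
pose rT k := \int[mu]_(x in Om) gap Tu DTu (Theta \o phi k) x.
have rT0 : rT @ \oo --> 0.
 by apply: (@gap_cvg _ C iT) => k x Ox; rewrite hC // /gap addr_ge0 // sqr_ge0.
have loc g : sqint Om g -> loc_integrable Om g.
 move=> sg K cK KO; apply: (integrableS mO _ KO (sqint_integrable oO bO sg)).
 by apply: closed_leb; apply: compact_closed => //.
have st k : smooth setT (Theta \o phi k) := Theta_smooth (sphi k).
split; first split; [exact: sTu|exact: sDTu| |].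
 split; [exact: loc|exact: loc|move=> p tp].
 have c1 := gap_pair (fun k => test_sqint (st k)) sTu
  (fun k x Ox => le_trans (gap_u _ _ _ x) (hC k x Ox)) (test_sqint (smooth_partial i tp.1)).
 have c2 := gap_pair (fun k => test_sqint (smooth_partial i (st k))) (sDTu i)
  (fun k x Ox => le_trans (gap_Du _ _ _ i x) (hC k x Ox)) (test_sqint tp.1).
 have E1 : (fun k => \int[mu]_(x in Om) ((Theta \o phi k) x * partial i p x)) = fun k => - \int[mu]_(x in Om) (partial i (Theta \o phi k) x * p x).
  by apply/funext => k; rewrite (test_parts i (Theta_test (tphi k)) tp.1) opprK.
 rewrite E1 in c1.
exact: (cvg_unique (@norm_hausdorff _ _) c1 (cvgN c2)).
exists (fun k => Theta \o phi k); split=> [k|]; first exact: Theta_test.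
have : (fun k => (rT k)%:E) @ \oo --> (0 : R)%:E by apply: cvg_EFin; [exact: nearW|exact: rT0].
apply: cvg_trans; apply: near_eq_cvg; apply: nearW => k.
by rewrite (EFin_Rintegral mO (iT k)).
Qed.

Section energy.
Variables (F : E -> R) (el : smooth_elliptic_integrand F).
Local Notation f := (homext F).
Hypothesis min : forall v Dv, sobolevH10 Om v Dv -> (torsion_energy F Om u Du <= torsion_energy F Om v Dv)%E.

(** By homogeneity the composition multiplies the gradient term of the energy by the square of
    dTheta, at most one, and it also lowers [u]. Minimality forces the integral of [u - Theta u] to
    vanish, and this integrand is positive wherever [u] is. *)
Lemma torsion_le0 : {ae mu, forall x, Om x -> u x <= 0}.
have sf : sqint Om (f \o Du).
 have ce : contin_on (closure Om) (f \o Du).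
  by apply: contin_on_comp => // x _; exact: (homext_continuous el).
 have [B B0 hB] := closure_bound bO ce.
 by apply: (sqint_bounded oO bO (contin_on_sub Oc ce)) => x /Oc; exact: hB.
pose q x := 2^-1 * (f (Du x)) ^+ 2.
have iq : Ritg mu Om q by apply: itgZ => //; case: sf.
have iu := sqint_integrable oO bO su; have iTu := sqint_integrable oO bO sTu.
have id : Ritg mu Om (fun x => q x * dTheta (u x) ^+ 2).
 apply: (itgMb mO iq (C := 1)).
  by exact: measurable_funM.
 by move=> x; rewrite normrX exprn_ile1.
have := min Theta_H10; rewrite /torsion_energy.
have -> : (fun x => (f (Du x) ^+ 2 / 2 + u x)%:E) = EFin \o (fun x => q x + u x).
 by apply/funext => x /=; rewrite /q [2^-1 * _]mulrC.
have -> : (fun x => (f (DTu x) ^+ 2 / 2 + Tu x)%:E) = EFin \o (fun x => q x * dTheta (u x) ^+ 2 + Tu x).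
 apply/funext => x /=; have /andP[h0 _] := dTheta_itv (u x).
 rewrite /q homextZ //; congr (_ + _)%:E; rewrite exprMn; ring.
have i1 := itgD mO iq iu; have i2 := itgD mO id iTu.
rewrite (EFin_Rintegral mO i1) (EFin_Rintegral mO i2) lee_fin => h.
have i3 := itgB mO iu iTu.
have p0 x : 0 <= u x - Tu x by rewrite opprB addrC subrK mulr_ge0 ?(ltW c00) ?flat_ge0.
have z : \int[mu]_(x in Om) `|u x - Tu x| = 0.
 apply/eqP; rewrite eq_le; apply/andP; split; last exact: Rintegral_ge0.
 have i4 := itgB mO i1 i2.
 apply: (@le_trans _ _ (\int[mu]_(x in Om) (q x + u x - (q x * dTheta (u x) ^+ 2 + Tu x)))); last by rewrite RintegralB // subr_le0.
 apply: le_Rintegral => //; first exact: itg_norm.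
 move=> x _; rewrite ger0_norm //; have q0 : 0 <= q x by rewrite mulr_ge0 ?invr_ge0 // sqr_ge0.
 have h1 : q x * dTheta (u x) ^+ 2 <= q x.
  by rewrite ler_piMr // -[dTheta _ ^+ 2]real_normK ?num_real // exprn_ile1.
 lra.
have := Rintegral_abs_eq0 mO i3 z; apply: filterS => x h1 /h1.
move=> e0; rewrite leNgt; apply/negP => u0; move: e0.
rewrite opprB addrC subrK => /eqP; rewrite mulf_eq0 (gt_eqF c00) gt_eqF //.
exact: flat_gt0.
Qed.

End energy.

Lemma open_ae_witness (P : E -> Prop) V : {ae mu, forall x, Om x -> P x} -> open V -> V `<=` Om ->
 (exists y, V y) -> exists2 y, V y & P y.
move=> [N [mN N0 sub]] oV VO [y Vy]; apply: contrapT => nex.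
have VN : V `<=` N by move=> z Vz; apply: sub => h; apply: nex; exists z => //; apply: h; exact: VO.
have [r r0 hr] := open_enorm oV Vy.
have r2 : 0 < r / 2 by lra.
have EN : eball y (r / 2) `<=` N.
 by move=> z zy; apply: VN; apply: hr; apply: le_lt_trans zy _; rewrite half_lt.
have h : (L (eball y (r / 2)) <= L N)%E := le_outer_measure L _ _ EN.
have LN : L N = 0%E := N0.
move: h; rewrite LN leb_eball //.
rewrite lee_fin leNgt => /negP; rewrite mulr_gt0 ?exprn_gt0 //; exact: ball_volume_gt0.
Qed.

Lemma positive_integral (g : E -> R) V : Ritg mu Om g -> {ae mu, forall x, Om x -> 0 <= g x} ->
 open V -> V `<=` Om -> (exists y, V y) -> (forall y, V y -> 0 < g y) -> 0 < \int[mu]_(x in Om) g x.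
move=> ig g0 oV VO Vn gV.
have ea : \int[mu]_(x in Om) `|g x| = \int[mu]_(x in Om) g x.
 exact: (Rintegral_abs_ae mO ig g0).
rewrite lt_neqAle -{2}ea Rintegral_ge0 // andbT; apply/eqP => z.
have [y Vy y0] := open_ae_witness (Rintegral_abs_eq0 mO ig (etrans ea (esym z))) oV VO Vn.
by have := gV y Vy; rewrite y0 ltxx.
Qed.

(** * Caps at a boundary point and the direction of the gradient *)

Section cap.
Variables (x0 : E) (U : set E) (phi0 : E -> R).
Hypotheses (bx : boundary Om x0) (ldf : local_defining_function Om x0 U phi0).
Local Notation nu := (outer_normal Om x0).

(** Second-order Taylor expansion of a defining function, negative inside and zero at [x0]: the
    domain rises above its tangent plane at most quadratically. *)
Lemma exterior_quadratic : exists C r, [/\ 0 < r, 0 <= C & forall y, Om y -> enorm (y - x0) < r ->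
 dot nu (y - x0) <= C * enorm (y - x0) ^+ 2].
have [[oU Ux] sp gn _ _] := ldf; have g0 : 0 < enorm (grad phi0 x0) by rewrite enorm_gt0 gn.
have [r r0 [p [sp' pE]]] := local_extension oU Ux sp.
have /nbhs_enormP[r' r'0 hr'] := open_nbhs_nbhs (conj oU Ux).
pose g y := bumpf x0 1 y * p y.
have bg : bump_function g.
 apply: bumpM => //; split; first exact: bumpf_smooth.
 exists (enorm x0 + 1) => y yx; rewrite bumpf_out // ltNge; apply/negP => h.
 by have := ler_enormD (y - x0) x0; rewrite subrK; lra.
pose s := Num.min r (Num.min r' (1 / 2)); have s0 : 0 < s by rewrite !lt_min r0 r'0 divr_gt0.
have gE y : enorm (y - x0) < s -> g y = phi0 y /\ U y.
 rewrite !lt_min => /and3P[h1 h2 h3]; rewrite /g bumpf_in // mul1r pE ?(ltW h1); split=> //; exact: hr'.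
have [C C0 hC] := bump_quadratic bg.
have gg : grad g x0 = grad phi0 x0.
 apply: row_ext => i; rewrite !mxE; apply: partial_near; apply/nbhs_enormP; exists s => // y /gE[].
 by [].
exists (C / enorm (grad phi0 x0)), s; split=> //; first by rewrite divr_ge0 // ltW.
move=> y Oy ys; have := hC x0 (y - x0); rewrite addrCA subrr addr0 gg.
have [-> Uy] := gE y ys; have [-> _] := gE x0 (ltac:(by rewrite subrr enorm0)).
have f0 := (ldf_in ldf Uy).1 Oy; rewrite ((ldf_bd ldf Ux).1 bx) => /ler_normlP[h1 _].
by rewrite (outer_normalE bx ldf) dotZl mulrC ler_pdivrMr // mulrAC divfK; lra.
Qed.

(** For positive [K] and [delta] this is positive on an open ball centred on the outer side of [x0]
    that reaches slightly beyond [x0]. With [K] large, its part inside [Om] shrinks to [x0] as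
    [delta] decreases. *)
Definition capf (K delta : R) (y : E) : R := dot nu (y - x0) - K * dot (y - x0) (y - x0) + delta.
Definition capg (K : R) (y : E) : E := nu - (2 * K) *: (y - x0).

Lemma capf_fdiff K delta y : 0 <= K -> fdiff (capf K delta) y (capg K y).
move=> K0 e e0; have K1 : 0 < K + 1 by rewrite ltr_wpDl.
exists (e / (K + 1)); first by rewrite divr_gt0.
move=> z; rewrite ltr_pdivlMr // => zy.
have -> : capf K delta z - capf K delta y - dot (capg K y) (z - y) = - (K * enorm (z - y) ^+ 2).
 rewrite enorm_sqr /capf /capg (_ : z - x0 = (z - y) + (y - x0)); last by rewrite addrA subrK.
 move: (z - y) (y - x0) => w v.
 by rewrite !dotDl !dotDr dotNl dotZl (dotC w v); ring.
rewrite normrN ger0_norm; last by rewrite mulr_ge0 // sqr_ge0.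
rewrite mulrA ler_wpM2r ?enorm_ge0 //.
have := enorm_ge0 (z - y); lra.
Qed.

Lemma capf_smooth K delta : smooth setT (capf K delta).
pose b (v : E) := \sum_i nu ord0 i * v ord0 i + (- K * dot v v + delta).
have sb : smooth setT b.
 move=> k; apply: (@Ck_D _ _ k setT (fun v => \sum_i nu ord0 i * v ord0 i)); first exact: openT.
  apply: (@Ck_sum _ _ k setT _ _ (fun i (v : E) => nu ord0 i * v ord0 i)); first exact: openT.
  by move=> i; apply: (@Ck_M _ _ k setT (cst (nu ord0 i))); [exact: openT|exact: Ck_cst|exact: Ck_coord].
 apply: (@Ck_D _ _ k setT (cst (- K) \* (fun v => dot v v)) (cst delta) openT); last exact: Ck_cst.
 by apply: Ck_M; [exact: openT|exact: Ck_cst|exact: smooth_dot].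
move=> k; apply: (@Ck_ext _ _ k setT _ _ openT _ (smooth_shift x0 sb k)) => y.
by rewrite /b mulNr addrA.
Qed.

Lemma partial_capf K delta y j : 0 <= K -> partial j (capf K delta) y = capg K y ord0 j.
by move=> K0; have [_ <-] := fdiff_diff (capf_fdiff delta y K0); rewrite mxE. Qed.

Let n1 : dot nu nu = 1.
by rewrite -enorm_sqr (outer_normalE bx ldf) (unit_grad ldf) expr1n. Qed.

Lemma cap_small : exists2 K, 0 <= K & forall q, 0 < q -> exists2 delta, 0 < delta &
 forall y, Om y -> 0 < capf K delta y -> enorm (y - x0) < q.
have [C [r [r0 C0 hC]]] := exterior_quadratic.
(* Near [x0] the term [C + 1] beats the quadratic rise of the domain and leaves [p ^ 2 < delta]; the
   term [2 / r] excludes points at distance [r] or more, where only the linear bound on the normal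
   component is known. *)
pose K := C + 1 + 2 / r; have K0 : 0 <= K by rewrite !addr_ge0 // divr_ge0 // ltW.
exists K => // q q0; pose delta := Num.min r (q ^+ 2).
have d0 : 0 < delta by rewrite lt_min r0 exprn_gt0.
have dr : delta <= r by rewrite ge_min lexx.
have dq : delta <= q ^+ 2 by rewrite ge_min lexx orbT.
exists delta => // y Oy; rewrite /capf -enorm_sqr; have p0 := enorm_ge0 (y - x0).
have nd : dot nu (y - x0) <= enorm (y - x0).
 by have := dot_le_enorm nu (y - x0); rewrite {2}(outer_normalE bx ldf) (unit_grad ldf) mul1r.
set p := enorm (y - x0) in nd *; move: dq dr; move: delta {d0} => delta dq dr hp.
have [pr|pr] := ltP p r; last first.
 have : 2 * p <= K * p ^+ 2.
  rewrite mulrA ler_wpM2r //; have : 2 <= 2 / r * p by rewrite mulrAC ler_pdivlMr // ler_pM2l.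
  by rewrite /K; have : 0 <= (C + 1) * p by [rewrite mulr_ge0 // addr_ge0]; lra.
 lra.
have h1 := hC y Oy; rewrite -/p in h1.
have r1 : 0 <= 2 / r * p ^+ 2 by rewrite mulr_ge0 ?sqr_ge0 // divr_ge0 // ltW.
have : p ^+ 2 < q ^+ 2 by move: hp; rewrite /K; lra.
by rewrite ltr_pXn2r // nnegrE ltW.
Qed.

Lemma cap_open K delta : 0 < delta -> let V := [set y | Om y /\ 0 < capf K delta y] in
 [/\ open V, V `<=` Om & exists y, V y].
have cc := smooth_continuous (capf_smooth K delta).
have oC : open (capf K delta @^-1` [set t | 0 < t]).
 by apply: open_comp.
split; [exact: (openI oO oC)|by move=> y []|].
have [cx _] := bx; have [|y [Oy Vy]] := cx (capf K delta @^-1` [set t | 0 < t]); last by exists y.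
by apply: open_nbhs_nbhs; split=> //; rewrite /= /capf subrr dotC !dot0l mulr0 subr0 add0r.
Qed.

Lemma cap_test K delta j y : 0 <= K ->
 partial j (flat 0 \o capf K delta) y = flat 2 (capf K delta y) * capg K y ord0 j.
move=> K0; have [_ ->] := partial_comp1 j (is_derive_flat 0 (capf K delta y)) (smooth_diff (capf_smooth K delta) I).
by rewrite mul0r subr0 partial_capf.
Qed.

Let cap_test_smooth K delta : smooth setT (flat 0 \o capf K delta).
by move=> k; apply: Ck_comp1; [exact: openT|exact: ck1_flat|exact: capf_smooth]. Qed.

Let capg_contin K j : 0 <= K -> contin_on (closure Om) (fun y => capg K y ord0 j).
move=> K0; have -> : (fun y => capg K y ord0 j) = partial j (capf K 0) by apply/funext => y; rewrite partial_capf.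
apply: cont_contin; apply: smooth_continuous; apply: smooth_partial; exact: capf_smooth.
Qed.

Let capg0 K j : capg K x0 ord0 j = nu ord0 j.
by rewrite /capg subrr scaler0 subr0. Qed.

Let near_pos (b : E -> R) : contin_on (closure Om) b -> 0 < b x0 ->
 exists2 q, 0 < q & forall y, Om y -> enorm (y - x0) < q -> 0 < b y.
move=> cb b0; have [q q0 hq] := cb x0 bx.1 _ b0; exists q => // y Oy yx.
by have := hq y (Oc Oy) yx; move=> /ltr_normlP[h1 h2]; lra.
Qed.

(** A gradient in the H¹₀ sense is curl-free even against functions that do not vanish on the
    boundary. Tested with a function of the cap, whose gradient is nearly normal with a positive
    factor, a strict inequality at [x0] would give a positive integral. Exchanging the indices
    yields equality. *)
Lemma Du_tangential i j : Du x0 ord0 i * nu ord0 j <= Du x0 ord0 j * nu ord0 i.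
rewrite leNgt; apply/negP => lt; have [K K0 hK] := cap_small.
pose b y := Du y ord0 i * capg K y ord0 j - Du y ord0 j * capg K y ord0 i.
have cb : contin_on (closure Om) b.
 apply: contin_onD; first by apply: contin_onM => //; exact: capg_contin.
 by apply: contin_onN; apply: contin_onM => //; exact: capg_contin.
have [|q q0 hq] := near_pos cb; first by rewrite /b !capg0 subr_gt0.
have [delta d0 hd] := hK q q0; have [oV VO Vn] := cap_open K d0.
pose a := flat 0 \o capf K delta; have sa : smooth setT a := cap_test_smooth K delta.
have i1 := sqint_itgM oO (sDu i) (test_sqint (smooth_partial j sa)).
have i2 := sqint_itgM oO (sDu j) (test_sqint (smooth_partial i sa)).
have ig := itgB mO i1 i2.
have gE y : Du y ord0 i * partial j a y - Du y ord0 j * partial i a y = flat 2 (capf K delta y) * b y.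
 by rewrite !cap_test // /b; ring.
have z : \int[mu]_(y in Om) (Du y ord0 i * partial j a y - Du y ord0 j * partial i a y) = 0.
 transitivity (\int[mu]_(y in Om) (Du y ord0 i * partial j a y) - \int[mu]_(y in Om) (Du y ord0 j * partial i a y)).
  exact: (RintegralB mO i1 i2).
 by apply/eqP; rewrite subr_eq0; apply/eqP; exact: H10_curl.
suff : 0 < \int[mu]_(y in Om) (Du y ord0 i * partial j a y - Du y ord0 j * partial i a y) by rewrite z ltxx.
apply: (positive_integral ig _ oV VO Vn).
 apply: aeW => y Oy; rewrite gE; have [s0|s0] := leP (capf K delta y) 0; first by rewrite flat_le0 // mul0r.
 by rewrite mulr_ge0 ?flat_ge0 // ltW // hq // hd.
by move=> y [Oy s0]; rewrite gE mulr_gt0 ?flat_gt0 // hq // hd.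
Qed.

(** Integration by parts against the cap function turns the integral of [- Du] in the direction ν
    into that of [u] times a function positive on the cap. If [Du] pointed inwards at [x0] the
    former would be positive, while the latter is not since [u <= 0]. *)
Lemma Du_outward : {ae mu, forall x, Om x -> u x <= 0} -> 0 <= dot (Du x0) nu.
move=> u0; rewrite leNgt; apply/negP => lt; have [K K0 hK] := cap_small.
pose b y := \sum_j - nu ord0 j * Du y ord0 j; pose c y := \sum_j nu ord0 j * capg K y ord0 j.
have cst_contin (t : R) : contin_on (closure Om) (fun=> t) by move=> e; exists 1 => //; rewrite subrr normr0.
have cb : contin_on (closure Om) b by apply: contin_sum => j; apply: contin_onM.
have cc : contin_on (closure Om) c by apply: contin_sum => j; apply: contin_onM => //; exact: capg_contin.
have [|q1 q10 hq1] := near_pos cb.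
 rewrite /b; under eq_bigr do rewrite mulNr.
 by rewrite sumrN oppr_gt0; move: lt; rewrite dotC.
have [|q2 q20 hq2] := near_pos cc.
 by rewrite /c; under eq_bigr do rewrite capg0; rewrite -/(dot nu nu) n1.
have [|delta d0 hd] := hK (Num.min q1 q2); first by rewrite lt_min q10.
have [oV VO Vn] := cap_open K d0.
pose a := flat 0 \o capf K delta; have sa : smooth setT a := cap_test_smooth K delta.
have i1 j : Ritg mu Om (fun y => - nu ord0 j * (Du y ord0 j * a y)).
 by apply: (itgZ mO); exact: (sqint_itgM oO (sDu j) (test_sqint sa)).
have i2 j : Ritg mu Om (fun y => nu ord0 j * (u y * partial j a y)).
 by apply: (itgZ mO); exact: (sqint_itgM oO su (test_sqint (smooth_partial j sa))).
have [k1 e1] := Rintegral_sum mO (index_enum 'I_d.+2) i1.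
have [k2 e2] := Rintegral_sum mO (index_enum 'I_d.+2) i2.
have gE y : \sum_j - nu ord0 j * (Du y ord0 j * a y) = a y * b y.
 by rewrite mulr_sumr; apply: eq_bigr => j; rewrite mulrA mulrC.
have hE y : \sum_j nu ord0 j * (u y * partial j a y) = u y * (flat 2 (capf K delta y) * c y).
 rewrite !mulr_sumr; apply: eq_bigr => j _; rewrite /a cap_test //.
 lra.
have cap y : Om y -> 0 < capf K delta y -> 0 < b y /\ 0 < c y.
 by move=> Oy s0; have := hd y Oy s0; rewrite lt_min => /andP[h1 h2]; rewrite hq1 // hq2.
have h : 0 < \int[mu]_(y in Om) \sum_j - nu ord0 j * (Du y ord0 j * a y).
 apply: (positive_integral k1 _ oV VO Vn).
  apply: aeW => y Oy; rewrite gE; have [s0|s0] := leP (capf K delta y) 0; first by rewrite /a /= flat_le0 // mul0r.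
  by rewrite mulr_ge0 ?flat_ge0 // ltW; case: (cap y Oy s0).
 by move=> y [Oy s0]; rewrite gE mulr_gt0 ?flat_gt0; case: (cap y Oy s0).
have hle : \int[mu]_(y in Om) \sum_j nu ord0 j * (u y * partial j a y) <= 0.
 have k3 := itgZ mO (-1) k2.
 have ea : \int[mu]_(y in Om) `|-1 * \sum_j nu ord0 j * (u y * partial j a y)| = \int[mu]_(y in Om) (-1 * \sum_j nu ord0 j * (u y * partial j a y)).
  apply: (Rintegral_abs_ae mO k3); apply: (ae_imp u0) => y hu Oy; rewrite mulN1r oppr_ge0 hE.
  apply: mulr_le0_ge0; first exact: hu.
  have [s0|s0] := leP (capf K delta y) 0; first by rewrite flat_le0 // mul0r.
  by rewrite mulr_ge0 ?flat_ge0 // ltW; case: (cap y Oy s0).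
 have : 0 <= \int[mu]_(y in Om) (-1 * \sum_j nu ord0 j * (u y * partial j a y)) by rewrite -ea; apply: Rintegral_ge0.
 by rewrite RintegralZl // mulN1r oppr_ge0.
move: h hle; rewrite e1 e2 ltNge => /negP h hle; apply: h; apply: le_trans hle.
apply: ler_sum => j; rewrite !RintegralZl //.
- by rewrite (H10_parts j sa) mulrNN.
- exact: (sqint_itgM oO (sDu j) (test_sqint sa)).
- exact: (sqint_itgM oO su (test_sqint (smooth_partial j sa))).
Qed.

Lemma Du_normal : {ae mu, forall x, Om x -> u x <= 0} -> exists2 t, 0 <= t & Du x0 = t *: nu.
exists (dot (Du x0) nu); first exact: Du_outward.
have sym i j : Du x0 ord0 i * nu ord0 j = Du x0 ord0 j * nu ord0 i.
 by apply/eqP; rewrite eq_le !Du_tangential.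
apply: row_ext => i; rewrite rowZ -[LHS]mulr1 -n1 mulr_sumr mulr_suml; apply: eq_bigr => j.
by rewrite mulrA sym mulrAC.
Qed.

End cap.

End torsion_sign.

End domain.

(** * Passage to an arbitrary weak Jacobian *)

Section almost_everywhere.
Context {disp} {T : measurableType disp} {R : realType} (mu : {measure set T -> \bar R}).
Variables (D : set T) (mD : measurable D).

Lemma measurable_quad m (A : T -> 'M[R]_m) : (forall i j, measurable_fun D (fun x => A x i j)) ->
 measurable_fun D (fun x => quad (A x)).
move=> mA; under eq_fun do rewrite quadE.
apply: measurable_sum => i; apply: measurable_sum => j.
by apply: measurable_funB; exact: measurable_funM.
Qed.

Lemma ae_quad_integral m (A B : T -> 'M[R]_m) : (forall i j, measurable_fun D (fun x => A x i j)) ->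
 (forall i j, {ae mu, forall x, D x -> A x i j = B x i j}) -> Ritg mu D (fun x => quad (B x)) ->
 (\int[mu]_(x in D) (quad (A x))%:E = (\int[mu]_(x in D) quad (B x))%R%:E)%E.
move=> mA AB iB; rewrite -(EFin_Rintegral mD iB); apply: ae_eq_integral => //.
- by apply/measurable_EFinP; exact: measurable_quad.
- by apply/measurable_EFinP; exact: itg_meas iB.
have H : {ae mu, forall x, forall ij : 'I_m * 'I_m, D x -> A x ij.1 ij.2 = B x ij.1 ij.2}.
 apply: (@filter_forall _ _ (fun (ij : 'I_m * 'I_m) x => D x -> A x ij.1 ij.2 = B x ij.1 ij.2)).
 by move=> [i j]; exact: AB.
apply: filterS H => x h Dx /=; congr (quad _)%:E; apply/matrixP => i j; exact: (h (i, j)).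
Qed.

End almost_everywhere.

Section regularity.
Context {R : realType} {d : nat}.
Local Notation E := 'rV[R]_d.+1.
Local Notation L := (@lebesgue_outer R d.+1).
Local Notation LT := (caratheodory_type L).

Lemma holder_contin alpha (A : set E) (X : E -> E) j : 0 < alpha -> holder_on alpha A X ->
 contin_on A (fun x => X x ord0 j).
move=> a0 [C hC] x Ax e e0; have C1 : 0 < `|C| + 1 by rewrite ltr_wpDl.
pose s := e / (`|C| + 1); have s0 : 0 < s by rewrite divr_gt0.
exists (s `^ alpha^-1); first exact: powR_gt0.
move=> y Ay yx; rewrite -rowB.
apply: le_lt_trans (coord_le_enorm _ j) _; apply: le_lt_trans (hC y x Ay Ax) _.
have h : enorm (y - x) `^ alpha <= s.
 apply: le_trans (ge0_ler_powR (ltW a0) _ _ (ltW yx)) _; rewrite ?nnegrE ?enorm_ge0 ?powR_ge0 //.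
 by rewrite -powRrM mulVf ?gt_eqF // powRr1 // ltW.
apply: le_lt_trans (_ : `|C| * s < _).
 apply: le_trans (ler_wpM2r (powR_ge0 _ _) (ler_norm C)) _; exact: ler_wpM2l.
by rewrite /s mulrCA gtr_pMr // ltr_pdivrMr // mul1r ltrDl.
Qed.

(** Local integrability gives measurability on compact subsets only; countably many inner sets
    exhaust [Om]. *)
Lemma loc_integrable_measurable (Om : set E) (g : E -> R) : open Om -> bounded_set Om -> loc_integrable Om g ->
 measurable_fun (Om : set LT) g.
move=> oO bO lg.
have -> : Om = \bigcup_k inner Om (rad k).
 apply/seteqP; split=> x; last by move=> [k _]; apply: inner_sub; exact: rad_gt0.
 move=> Ox; have [r r0 hr] := open_enorm oO Ox.
 have [N hN] := rad_small r0; exists N => // z nz; apply: le_trans (ltW (hN N (leqnn N))) _.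
 by rewrite leNgt; apply/negP => h; apply: nz; apply: hr; rewrite enormB.
apply/measurable_fun_bigcup => k; first by apply: closed_leb; exact: inner_closed.
apply: itg_meas; apply: lg; first by apply: inner_compact => //; exact: rad_gt0.
by apply: inner_sub; exact: rad_gt0.
Qed.

End regularity.

Unset Implicit Arguments.

Theorem proposition3p3 (R : realType) (n : nat) (hn : (1 <= n)%N)
  (Om : set 'rV[R]_n.+1) (Om_open : open Om) (Om_bounded : bounded_set Om)
  (Om_smooth : smooth_boundary Om)
  (F : 'rV[R]_n.+1 -> R) (F_elliptic : smooth_elliptic_integrand F)
  (u : 'rV[R]_n.+1 -> R) (Du : 'rV[R]_n.+1 -> 'rV[R]_n.+1)
  (u_torsion : torsion_potential F Om u Du)
  (u_C1alpha : exists alpha : R,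
     0 < alpha < 1 /\ holder_on alpha (closure Om) Du)
  (u_H2 : sobolevH2 Om u Du)
  (M : 'rV[R]_n.+1 -> 'M[R]_n.+1)
  (M_jacobian : weak_jacobian Om (anisotropic_grad F Du) M) :
  (\int[leb n.+1]_(x in Om) ((\tr (M x)) ^+ 2 - \tr (M x *m M x))%:E
   = \int[hausdorff n.+1 n]_(x in boundary Om)
       (anisotropic_mean_curvature F Om x * homext F (Du x) ^+ 2
        * homext F (outer_normal Om x))%:E)%E.
Proof.
(* With [n = d + 1] the space has dimension [d + 2] and the charts project onto dimension [d + 1],
   which is positive as the theory of Lebesgue measure above requires. *)
case: n hn Om Om_open Om_bounded Om_smooth F F_elliptic u Du u_torsion u_C1alpha u_H2 M M_jacobian => [//|d] _.
move=> Om oO bO sm F el u Du [h10 min] [alpha [/andP[a0 _] hol]] [_ H2] M Mj.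
have cDu j : contin_on (closure Om) (fun x => Du x ord0 j) := holder_contin j a0 hol.
pose D2 j := sval (cid (H2 j)); have D2P j : sobolevH1 Om (fun x => Du x ord0 j) (D2 j) := svalP (cid (H2 j)).
have sD2 i j : sqint Om (fun x => D2 j x ord0 i) by have [_ h _] := D2P j; exact: (h i).
have wDu i j : wder Om i (fun x => Du x ord0 j) (fun x => D2 j x ord0 i).
  have [s1 _ h3] := D2P j; have [_ _ h] := h3 i; split=> //; apply: (sqint_integrable oO bO) => //.
have u0 := torsion_le0 oO bO cDu h10 el min.
have normalDu x : boundary Om x -> exists2 t, 0 <= t & Du x = t *: outer_normal Om x.
  by move=> bx; have [U [phi l]] := sm x bx; exact: (Du_normal oO bO cDu h10 bx l u0).
have [DX [wX iX iF e]] := reilly_identity oO bO sm el cDu wDu sD2 normalDu.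
have Mij i j : weak_partial Om i (fun x => flow F j (Du x)) (fun x => M x i j).
  have := Mj i j; rewrite (_ : (fun x => anisotropic_grad F Du x ord0 j) = fun x => flow F j (Du x)) //.
  by apply/funext => x; rewrite (anisotropic_gradE el) mxE.
(* The given Jacobian [M] is known only as a locally integrable weak derivative; uniqueness
   identifies it almost everywhere with the one constructed, and integrability of the quadratic form
   is inherited from there. *)
have AE i j : {ae @leb R d.+2, forall x, Om x -> M x i j = (\matrix_(k, l) DX k l x) i j}.
  by apply: (ae_imp (wder_ae oO bO (wX i j) (Mij i j))) => x h Ox; rewrite mxE h.
have mM i j : measurable_fun (Om : set (caratheodory_type (@lebesgue_outer R d.+2))) (fun x => M x i j).
  by have [_ h _] := Mij i j; exact: (loc_integrable_measurable oO bO h).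
rewrite (ae_quad_integral (Om_measurable oO) mM AE iX) e.
by rewrite (EFin_Rintegral (boundary_measurable Om) iF).
Qed.
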